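(* Let $n\ge2$ and let $u_0\in C^1_c(\overline{\mathbb{R}^n_+};\mathbb{R}^n)$ be a vector field with $\operatorname{div}u_0=0$ and $u_{0,n}|_{\Sigma}=0$. Then for every $i\in\{1,\dots,n\}$, $$\sum_{j=1}^n\int_{\mathbb{R}^n_+}G_{ij}(x,y,t)u_{0,j}(y)\,dy=\sum_{j=1}^n\int_{\mathbb{R}^n_+}\breve G_{ij}(x,y,t)u_{0,j}(y)\,dy=\sum_{j=1}^n\int_{\mathbb{R}^n_+}\widehat G_{ij}(x,y,t)u_{0,j}(y)\,dy$$ as continuous functions of $x\in\mathbb{R}^n_+$ and $t>0$, where $G_{ij}$ is the (unrestricted) Green tensor of the nonstationary Stokes system in $\mathbb{R}^n_+$, $$\breve G_{ij}(x,y,t)=\delta_{ij}\left[\Gamma(x-y,t)-\Gamma(x-y^*,t)\right]-4(1-\delta_{jn})\frac{\partial}{\partial x_j}\int_{\Sigma\times[0,x_n]}\frac{\partial}{\partial x_i}E(x-z)\,\Gamma(z-y^*,t)\,dz,$$ $$\widehat G_{ij}(x,y,t)=\delta_{ij}\left[\Gamma(x-y,t)-\Gamma(x-y^*,t)\right]-4\delta_{jn}C_i(x,y,t),$$ and $$C_i(x,y,t)=\int_0^{x_n}\int_\Sigma\partial_n\Gamma(x-y^*-z,t)\,\partial_iE(z)\,dz'\,dz_n.$$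
   Context: Notation. For $x\in\mathbb{R}^n$ write $x=(x',x_n)$, $x^*=(x',-x_n)$; $\mathbb{R}^n_+=\{x_n>0\}$, $\Sigma=\{x_n=0\}\cong\mathbb{R}^{n-1}$, and $\xi'\in\Sigma$ is identified with $(\xi',0)$. $\delta_{ij}$ is the Kronecker delta, $\epsilon_j=1-2\delta_{jn}$. For a function such as $E(x-y)$ or $\Gamma(x-y,t)$, $\partial_i$ denotes the derivative in the $i$-th spatial argument of the function. $\Gamma(x,t)=(4\pi t)^{-n/2}e^{-|x|^2/4t}$ for $t>0$ and $0$ for $t\le0$; $E$ is the fundamental solution of $-\Delta$ in $\mathbb{R}^n$: $E(x)=\frac1{n(n-2)|B_1|}|x|^{2-n}$ if $n\ge3$, $E(x)=-\frac1{2\pi}\log|x|$ if $n=2$. Oseen tensor: $S_{ij}(x,t)=\delta_{ij}\Gamma(x,t)+\Gamma_{ij}(x,t)$, $\Gamma_{ij}(x,t)=\partial_i\partial_j\int_{\mathbb{R}^n}\Gamma(x-z,t)E(z)\,dz$. Green tensor: for $x,y\in\mathbb{R}^n_+$, $t>0$, $$G_{ij}(x,y,t)=S_{ij}(x-y,t)-\epsilon_jS_{ij}(x-y^*,t)+W_{ij}(x,y,t),$$ $$W_{ij}(x,y,t)=-2\int_0^t\int_\Sigma\tilde K_{in}(x-\xi',t-s)S_{nj}(\xi'-y,s)\,d\xi'ds+4\int_\Sigma\partial_iE(x-\xi')S_{nj}(\xi'-y,t)\,d\xi',$$ $$\tilde K_{in}(x,t)=-2\delta_{in}\partial_n\Gamma(x,t)-4\,\partial_{x_n}\int_0^{x_n}\int_\Sigma\partial_n\Gamma(z,t)\,\partial_iE(x-z)\,dz'dz_n,$$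 and $G_{ij}=0$ for $t\le0$. *)

(* Defs.v *)
From HB Require Import structures.
From mathcomp Require Import all_boot all_order all_algebra.
From mathcomp Require Import all_classical all_reals all_analysis.

Set Implicit Arguments.
Unset Strict Implicit.
Unset Printing Implicit Defensive.

Import Order.TTheory GRing.Theory Num.Theory.
Import numFieldNormedType.Exports.

Local Open Scope classical_set_scope.
Local Open Scope ring_scope.

(* The product sigma-algebra on row vectors, as the library does for tuples. *)
Section measurable_rV.
Context {d} {T : measurableType d}.
Variable n : nat.

Definition rV_coord (i : 'I_n) (x : 'rV[T]_n) : T := x ord0 i.

Let rV_set0 : g_sigma_preimage rV_coord set0.
Proof. exact: sigma_algebra0. Qed.

Let rV_setC A : g_sigma_preimage rV_coord A -> g_sigma_preimage rV_coord (~` A).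
Proof. exact: sigma_algebraC. Qed.

Let rV_bigcup (F : (set 'rV[T]_n)^nat) :
  (forall i, g_sigma_preimage rV_coord (F i)) ->
  g_sigma_preimage rV_coord (\bigcup_i (F i)).
Proof. exact: sigma_algebra_bigcup. Qed.

HB.instance Definition _ := @isMeasurable.Build (measure_tuple_display d)
  'rV[T]_n (g_sigma_preimage rV_coord) rV_set0 rV_setC rV_bigcup.

End measurable_rV.


Lemma measurable_rV_coord d (T : measurableType d) n (i : 'I_n) :
  measurable_fun [set: 'rV[T]_n] (@rV_coord d T n i).
Proof.
move=> _ Y mY; rewrite setTI; apply: sub_sigma_algebra => /=.
rewrite -bigcup_seq/=; exists i => /=; first by rewrite mem_index_enum.
by exists Y => //; rewrite setTI.
Qed.

Lemma measurable_fun_rV d1 (T1 : measurableType d1) d (T : measurableType d) n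
    (f : T1 -> 'rV[T]_n) :
  (forall i, measurable_fun [set: T1] (fun x => f x ord0 i)) ->
  measurable_fun [set: T1] f.
Proof.
move=> mf _ A mA.
suff : image_set_system setT f measurable A by [].
move: A mA; apply: smallest_sub.
  exact/sigma_algebra_image/sigma_algebra_measurable.
rewrite -bigcup_seq => A [i /= _ [B mB <-]].
rewrite /image_set_system/= !setTI.
by have := mf i measurableT B mB; rewrite setTI.
Qed.

(* [rsnoc (xi, s)] is the point (xi, s) of R^n x R = R^(n+1). *)
Definition rsnoc (R : Type) n (p : 'rV[R]_n * R) : 'rV[R]_n.+1 :=
  \row_i (if unlift ord_max i is Some k then p.1 ord0 k else p.2).

Lemma rsnocK (R : Type) n :
  cancel (@rsnoc R n)
    (fun x => (\row_k x ord0 (lift ord_max k), x ord0 ord_max)).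
Proof.
move=> [x s]; congr pair; last by rewrite mxE unlift_none.
by apply/rowP => k; rewrite !mxE liftK.
Qed.

Section lebesgue_step.
Context {R : realType} {n : nat}.
Variable mu : {sigma_finite_measure set 'rV[R]_n -> \bar R}.

Let snoc (p : 'rV[R]_n * measurableTypeR R) : 'rV[R]_n.+1 := rsnoc p.

Let measurable_snoc : measurable_fun [set: 'rV[R]_n * measurableTypeR R] snoc.
Proof.
apply: measurable_fun_rV => i; rewrite /snoc /rsnoc.
under eq_fun do rewrite mxE.
case: (unlift ord_max i) => [k|]; last exact: measurable_snd.
apply: (measurableT_comp (measurable_rV_coord k)); exact: measurable_fst.
Qed.

Definition lebesgue_step : set 'rV[R]_n.+1 -> \bar R :=
  pushforward (mu \x @lebesgue_measure R)%E snoc.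

Let lebesgue_step0 : lebesgue_step set0 = 0%E.
Proof. exact: measure0. Qed.

Let lebesgue_step_ge0 A : (0 <= lebesgue_step A)%E.
Proof. exact: measure_ge0. Qed.

Let lebesgue_step_sigma_additive : semi_sigma_additive lebesgue_step.
Proof.
pose m : {measure set 'rV[R]_n.+1 -> \bar R} :=
  measure_function_pushforward__canonical__measure_function_Measure
    (mu \x @lebesgue_measure R)%E measurable_snoc.
exact: (@measure_semi_sigma_additive _ _ _ m).
Qed.

HB.instance Definition _ := isMeasure.Build _ _ _ lebesgue_step
  lebesgue_step0 lebesgue_step_ge0 lebesgue_step_sigma_additive.

Let lebesgue_step_sigma_finite : sigma_finite setT lebesgue_step.
Proof.
have /sigma_finiteP[F [TF ndF Foo]] := sigma_finiteT mu.
have /sigma_finiteP[G [TG ndG Goo]] := sigma_finiteT (@lebesgue_measure R).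
pose g (x : 'rV[R]_n.+1) : 'rV[R]_n * measurableTypeR R :=
  (\row_k x ord0 (lift ord_max k), x ord0 ord_max).
have mg : measurable_fun setT g.
  apply/measurable_fun_pairP; split; last exact: measurable_rV_coord.
  apply: measurable_fun_rV => i; rewrite /g /=.
  by under eq_fun do rewrite mxE; exact: measurable_rV_coord.
exists (fun k => g @^-1` (F k `*` G k)).
  apply/seteqP; split => // x _.
  have : [set: 'rV[R]_n] (g x).1 by [].
  have : [set: measurableTypeR R] (g x).2 by [].
  rewrite {1}TF {1}TG => -[j _ Gj] [i _ Fi]; exists (maxn i j) => //; split.
    by move: (g x).1 Fi; exact/subsetPset/ndF/leq_maxl.
  by move: (g x).2 Gj; exact/subsetPset/ndG/leq_maxr.
move=> k; have [mF Fk] := Foo k; have [mG Gk] := Goo k; split.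
  by rewrite -[X in measurable X]setTI; apply: mg => //; exact: measurableX.
rewrite /lebesgue_step /pushforward -comp_preimage.
rewrite (_ : g \o snoc = id) ?preimage_id; last first.
  by apply/funext => p; exact: rsnocK.
by rewrite product_measure1E// lte_mul_pinfty// ge0_fin_numE.
Qed.

HB.instance Definition _ := Measure_isSigmaFinite.Build _ _ _ lebesgue_step
  lebesgue_step_sigma_finite.

End lebesgue_step.

(* Lebesgue measure on R^n, built from R^0 (one point, of mass 1) through
   R^(n+1) = R^n x R. *)
Fixpoint lebesgue_rV (R : realType) (n : nat) :
    {sigma_finite_measure set 'rV[R]_n -> \bar R} :=
  match n with
  | 0 => dirac (0 : 'rV[R]_0)
  | n'.+1 => lebesgue_step (lebesgue_rV R n')
  end.

(* Throughout, the space dimension is n = d.+1 and x_n is the last coordinate,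
   so that Sigma = {x_n = 0} is identified with R^d. *)
Section stokes_half_space.
Context {R : realType} {d : nat}.
Local Notation Rn := 'rV[R]_d.+1.
Local Notation mu := (@lebesgue_measure R).
Local Notation mu_n := (lebesgue_rV R d.+1).
Local Notation mu_Sigma := (lebesgue_rV R d).
Local Notation n_ := (@ord_max d).
Implicit Types (x y z : Rn) (t s : R) (i j k : 'I_d.+1).

Definition height x : R := x ord0 n_.

Definition upper : set Rn := [set x | 0 < height x].

Definition closed_upper : set Rn := [set x | 0 <= height x].

Definition on_Sigma (xi : 'rV[R]_d) : Rn := rsnoc (xi, 0).

Definition star x : Rn := \row_i (if i == n_ then - x ord0 i else x ord0 i).

(* The norm that the library puts on 'rV is the sup norm. *)
Definition enorm x : R := Num.sqrt (\sum_i x ord0 i ^+ 2).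

Definition pd i (f : Rn -> R) x : R := 'D_(delta_mx ord0 i) f x.

Definition kron i j : R := (i == j)%:R.

Definition eps j : R := 1 - 2 * kron j n_.

Definition heat x t : R :=
  if 0 < t then
    (4 * pi * t) `^ (- (d.+1%:R / 2)) * expR (- (enorm x ^+ 2 / (4 * t)))
  else 0.

Definition unit_ball_volume : R := fine (mu_n [set x : Rn | enorm x < 1]).

(* Fundamental solution of -Laplace; meaningful for d.+1 >= 2 only. *)
Definition E x : R :=
  if d.+1 == 2%N then - (2 * pi)^-1 * ln (enorm x)
  else (d.+1%:R * (d.+1%:R - 2) * unit_ball_volume)^-1
       * enorm x `^ (2 - d.+1%:R).

Definition heat_E i j x t : R :=
  pd i (pd j (fun w => \int[mu_n]_z (heat (w - z) t * E z))) x.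

Definition oseen i j x t : R := kron i j * heat x t + heat_E i j x t.

Definition Ktilde i x t : R :=
  - 2 * kron i n_ * pd n_ (heat^~ t) x
  - 4 * pd n_ (fun w =>
      \int[mu]_(zn in `[0, height w]) \int[mu_Sigma]_z'
        (pd n_ (heat^~ t) (rsnoc (z', zn)) * pd i E (w - rsnoc (z', zn)))) x.

Definition W i j x y t : R :=
  - 2 * \int[mu]_(s in `[0, t]) \int[mu_Sigma]_xi
          (Ktilde i (x - on_Sigma xi) (t - s) * oseen n_ j (on_Sigma xi - y) s)
  + 4 * \int[mu_Sigma]_xi
          (pd i E (x - on_Sigma xi) * oseen n_ j (on_Sigma xi - y) t).

Definition green i j x y t : R :=
  if 0 < t then
    oseen i j (x - y) t - eps j * oseen i j (x - star y) t + W i j x y t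
  else 0.

Definition breve_green i j x y t : R :=
  kron i j * (heat (x - y) t - heat (x - star y) t)
  - 4 * (1 - kron j n_) * pd j (fun w =>
      \int[mu_n]_(z in [set z | 0 <= height z <= height w])
        (pd i (fun v => E (v - z)) w * heat (z - star y) t)) x.

Definition C_ i x y t : R :=
  \int[mu]_(zn in `[0, height x]) \int[mu_Sigma]_z'
    (pd n_ (heat^~ t) (x - star y - rsnoc (z', zn)) * pd i E (rsnoc (z', zn))).

Definition hat_green i j x y t : R :=
  kron i j * (heat (x - y) t - heat (x - star y) t)
  - 4 * kron j n_ * C_ i x y t.

(* C^1 up to the boundary: the first partial derivatives, which exist in the
   open half-space, extend continuously to the closed one. Only the values of u
   on the closed half-space matter. *)
Definition C1c_closed_upper (u : Rn -> Rn) : Prop :=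
  [/\ {within closed_upper, continuous u},
      forall j k,
        (forall x, upper x ->
           derivable (fun y => u y ord0 j) x (delta_mx ord0 k)) /\
        exists g : Rn -> R, {within closed_upper, continuous g} /\
          forall x, upper x -> pd k (fun y => u y ord0 j) x = g x
    & compact (closure [set x | closed_upper x /\ u x != 0])].

Definition divergence (u : Rn -> Rn) x : R :=
  \sum_j pd j (fun y => u y ord0 j) x.

Definition kernel := 'I_d.+1 -> 'I_d.+1 -> Rn -> Rn -> R -> R.

Definition kernel_integral (K : kernel) (u : Rn -> Rn) i x t : R :=
  \sum_j \int[mu_n]_(y in upper) (K i j x y t * u y ord0 j).

Definition kernel_integrable (K : kernel) (u : Rn -> Rn) i x t : Prop :=
  forall j, mu_n.-integrable upper (fun y => (K i j x y t * u y ord0 j)%:E).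

End stokes_half_space.

(* Main.v *)
Require Import Defs.
From mathcomp Require Import all_boot all_order all_algebra.
From mathcomp Require Import all_classical all_reals all_analysis.
From mathcomp Require Import measurable_realfun ring lra.

(* Neither the normalization nor the harmonicity of E matters: only
   d_i E = - c P_i with P_i z = z_i / |z|^n is used. For a fixed point (x, t)
   the field is moved by small translations to show that a solenoidal field
   which is tangential on Sigma is orthogonal, over the half-space, to
   y |-> (grad F)(x - y) and to y |-> eps_j (d_j F)(x - star y) for every smooth F
   of moderate growth. With F = d_i (Gamma conv E) this removes every nonlocal
   part of the Oseen tensor, also inside W after Fubini, where S_nj may then be
   replaced by delta_nj Gamma. With F = Gamma conv (1_{0 < z_n < x_n} P_i) it turns
   the kernel of breve G into that of hat G.
   It remains to evaluate W_in with Gamma in place of S_nn. The tangential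
   integral is the semigroup property; the time integral is the first-passage
   identity -2 int_0^t g'(a, t-s) g(b, s) ds = g(a+b, t) of the one-dimensional
   heat kernel g, and its derivative in a. The result is
   -2 delta_in Gamma(x - star y) - 4 C_i. *)

Set Implicit Arguments.
Unset Strict Implicit.
Unset Printing Implicit Defensive.

Import Order.TTheory GRing.Theory Num.Theory.
Import numFieldNormedType.Exports.

Local Open Scope classical_set_scope.
Local Open Scope ring_scope.

(** * Real-valued Lebesgue integrals *)

(** All three sums have the value a_1 - a_2 + 4 [cE] J: a_1 and a_2 are the integrals of u_i against
    Gamma(x - y) and Gamma(x - star y), and J is that of u_n against d_n (Gamma conv 1 P_i) at x -
    star y. Continuity is read off from this value. The obstacle is integrability: a real-valued
    integral is 0 when the extended one is infinite, so Fubini and linearity need explicit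
    majorants. Three defects shape them. First, E and its gradient are singular at the origin; the
    majorants are products of functions of one coordinate, so that integrals over R^n become line
    integrals. Second, on the tangential space R^d the decay |z|^(-d) just fails to be integrable;
    one weight [rhod] is kept from each of the two factors inside W, and [rho ^ 2] is integrable on
    the line. Third, second derivatives of the heat kernel have L^1 norm of order 1/t, not
    integrable in time; subtracting a value where the kernel concentrates, of E in the Oseen tensor
    and of [kt] in [Ktilde], leaves 1/sqrt s and 1/sqrt (t - s), whose product is integrable on (0,
    t). *)

Lemma aeS d (T : measurableType d) (R : realType) (m : {measure set T -> \bar R})
  (P Q : T -> Prop) : (forall x, P x -> Q x) ->
  {ae m, forall x, P x} -> {ae m, forall x, Q x}.
Proof. by move=> PQ; apply: filterS. Qed.

Section rintegral.
Context d (T : measurableType d) (R : realType) (m : {measure set T -> \bar R}).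
Implicit Types f g F : T -> R.

(** Integration domains are carried by indicator factors, so that integrability is always over the
    whole space; [Rint_restr] and [intg_restr] translate. *)
Definition intg f := m.-integrable [set: T] (EFin \o f).

Lemma intg_meas f : intg f -> measurable_fun [set: T] f.
Proof. by move=> /integrableP[/measurable_EFinP]. Qed.

Lemma intg_le_ae f F : measurable_fun [set: T] f -> intg F ->
  {ae m, forall x, `|f x| <= F x} -> intg f.
Proof.
move=> mf iF fF; apply/integrableP; split; first exact/measurable_EFinP.
have /integrableP[mF Foo] := iF.
apply: le_lt_trans Foo; apply: ae_ge0_le_integral => //=.
- by apply/measurable_EFinP; exact: measurableT_comp.
- by apply/measurable_EFinP; apply: measurableT_comp => //; exact/measurable_EFinP.
- apply: filterS fF => x fF _ /=; rewrite lee_fin (le_trans fF)//.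
  exact: ler_norm.
Qed.

Lemma intg_le f F : measurable_fun [set: T] f -> intg F ->
  (forall x, `|f x| <= F x) -> intg f.
Proof. by move=> mf iF fF; apply: (intg_le_ae mf iF); exact: aeW. Qed.

Lemma intgD f g : intg f -> intg g -> intg (fun x => f x + g x).
Proof. by move=> fi gi; exact: (integrableD measurableT fi gi). Qed.

Lemma intgB f g : intg f -> intg g -> intg (fun x => f x - g x).
Proof. by move=> fi gi; exact: (integrableB measurableT fi gi). Qed.

Lemma intgZ (c : R) f : intg f -> intg (fun x => c * f x).
Proof. by move=> fi; exact: (integrableZl measurableT c fi). Qed.

Lemma intgZr (c : R) f : intg f -> intg (fun x => f x * c).
Proof.
by move=> fi; rewrite (_ : (fun _ => _) = fun x => c * f x);
  [exact: intgZ | apply/funext => x; rewrite mulrC].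
Qed.

Lemma intg_norm f : intg f -> intg (fun x => `|f x|).
Proof. exact: integrable_norm. Qed.

Lemma intg_sum (I : Type) (s : seq I) (P : pred I) (f : I -> T -> R) :
  (forall i, P i -> intg (f i)) -> intg (fun x => \sum_(i <- s | P i) f i x).
Proof.
move=> fi; rewrite /intg (_ : _ \o _ = fun x => \sum_(i <- s | P i) (f i x)%:E)%E.
  by apply: integrable_sum.
by apply/funext => x /=; rewrite sumEFin.
Qed.

Lemma RintD f g : intg f -> intg g ->
  \int[m]_x (f x + g x) = \int[m]_x f x + \int[m]_x g x.
Proof. by move=> fi gi; rewrite RintegralD. Qed.

Lemma RintB f g : intg f -> intg g ->
  \int[m]_x (f x - g x) = \int[m]_x f x - \int[m]_x g x.
Proof. by move=> fi gi; rewrite RintegralB. Qed.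

Lemma RintZ (c : R) f : intg f -> \int[m]_x (c * f x) = c * \int[m]_x f x.
Proof. by move=> fi; rewrite RintegralZl. Qed.

Lemma RintZr (c : R) f : intg f -> \int[m]_x (f x * c) = \int[m]_x f x * c.
Proof. by move=> fi; rewrite RintegralZr. Qed.

Lemma Rint_sum (I : Type) (s : seq I) (P : pred I) (f : I -> T -> R) :
  (forall i, P i -> intg (f i)) ->
  \int[m]_x (\sum_(i <- s | P i) f i x) = \sum_(i <- s | P i) \int[m]_x f i x.
Proof.
move=> fi; elim: s => [|i s ih].
  rewrite big_nil (_ : (fun x => _) = fun=> 0); last first.
    by apply/funext => x; rewrite big_nil.
  by rewrite /Rintegral integral0.
rewrite big_cons; case: ifPn => Pi.
  rewrite -ih -RintD; [|exact: fi|exact: intg_sum].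
  by apply: eq_Rintegral => x _; rewrite big_cons Pi.
by rewrite -ih; apply: eq_Rintegral => x _; rewrite big_cons (negbTE Pi).
Qed.

Lemma Rint_le f g : intg f -> intg g -> (forall x, f x <= g x) ->
  \int[m]_x f x <= \int[m]_x g x.
Proof. by move=> fi gi fg; apply: le_Rintegral. Qed.

Lemma Rint_le_ae f g : intg f -> intg g -> {ae m, forall x, f x <= g x} ->
  \int[m]_x f x <= \int[m]_x g x.
Proof.
move=> fi gi fg; rewrite -subr_ge0 -RintB//.
have -> : \int[m]_x (g x - f x) = \int[m]_x `|g x - f x|.
  rewrite /Rintegral; congr fine; apply: ae_eq_integral => //.
  - by apply/measurable_EFinP/intg_meas/intgB.
  - by apply/measurable_EFinP/intg_meas/intg_norm/intgB.
  - by apply: filterS fg => x fgx _; rewrite ger0_norm// subr_ge0.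
exact: Rintegral_ge0.
Qed.

Lemma Rint_norm_le f F : intg f -> intg F -> (forall x, `|f x| <= F x) ->
  `|\int[m]_x f x| <= \int[m]_x F x.
Proof.
move=> fi Fi fF; apply: (le_trans (le_normr_Rintegral _ fi)) => //.
by apply: Rint_le => //; exact: intg_norm.
Qed.

Lemma eq_Rint_ae f g : measurable_fun [set: T] f -> measurable_fun [set: T] g ->
  {ae m, forall x, f x = g x} -> \int[m]_x f x = \int[m]_x g x.
Proof.
move=> mf mg fg; rewrite /Rintegral; congr fine; apply: ae_eq_integral => //.
- exact/measurable_EFinP.
- exact/measurable_EFinP.
- by apply: filterS fg => x -> _.
Qed.

Lemma Rint_restr (D : set T) f :
  \int[m]_(x in D) f x = \int[m]_x (\1_D x * f x).
Proof.
rewrite Rintegral_mkcond; apply: eq_Rintegral => x _.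
by rewrite patchE /indic; case: ifP; rewrite ?mul1r ?mul0r.
Qed.

Lemma intg_restr (D : set T) f : measurable D ->
  m.-integrable D (EFin \o f) <-> intg (fun x => \1_D x * f x).
Proof.
move=> mD; rewrite integrable_mkcond// /intg.
rewrite (_ : (EFin \o f) \_ D = EFin \o (fun x => \1_D x * f x))//.
apply/funext => x; rewrite patchE /indic /=.
by case: ifP; rewrite ?mul1r ?mul0r.
Qed.

Lemma EFin_Rint f : intg f -> (\int[m]_x f x)%:E = (\int[m]_x (f x)%:E)%E.
Proof. by move=> fi; rewrite /Rintegral fineK//; exact: integrable_fin_num. Qed.

Lemma intg0 : intg (fun=> 0).
Proof. exact: integrable0. Qed.

Lemma Rint_dct (f_ : nat -> T -> R) f F :
  (forall n, measurable_fun [set: T] (f_ n)) -> measurable_fun [set: T] f ->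
  {ae m, forall x, f_ ^~ x @ \oo --> f x} ->
  intg F -> {ae m, forall x n, `|f_ n x| <= F x} ->
  intg f /\ \int[m]_x f_ n x @[n --> \oo] --> \int[m]_x f x.
Proof.
move=> mf_ mf ff iF fF.
have [| | | |fi _ fcvg] := @dominated_convergence _ _ R m setT measurableT
  (fun n => EFin \o f_ n) (EFin \o f) (EFin \o F) _ _ _ iF _.
- by move=> n; exact/measurable_EFinP.
- exact/measurable_EFinP.
- by apply: filterS ff => x fx _; apply: cvg_EFin => //; exact: nearW.
- by apply: filterS fF => x fx n _ /=; rewrite lee_fin.
split => //; rewrite /Rintegral; apply: fine_cvg; rewrite fineK//.
exact: integrable_fin_num.
Qed.

End rintegral.

(** * Fubini for real-valued integrals *)

Section product.
Context d1 d2 (T1 : measurableType d1) (T2 : measurableType d2) (R : realType).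
Variable m1 : {sigma_finite_measure set T1 -> \bar R}.
Variable m2 : {sigma_finite_measure set T2 -> \bar R}.
Implicit Types f : T1 * T2 -> R.

(** The positive and the negative part have integrals measurable in [x] by Tonelli; [fine] is
    measurable too, whatever value it gives to infinite integrals. *)
Lemma measurable_Rint2 f : measurable_fun [set: T1 * T2] f ->
  measurable_fun [set: T1] (fun x => \int[m2]_y f (x, y)).
Proof.
move=> mf; apply: (measurableT_comp (fine_measurable measurableT)).
have mfE : measurable_fun setT (EFin \o f) by exact/measurable_EFinP.
rewrite (_ : (fun _ => _) = fubini_F m2 (EFin \o f)^\+%E \-
    fubini_F m2 (EFin \o f)^\-%E)%E; last first.
  apply/funext => x; rewrite integralE; congr (_ - _)%E;
  by apply: eq_integral => y _; rewrite ?funeposE ?funenegE.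
apply: emeasurable_funB.
- by apply: measurable_fun_fubini_tonelli_F => //; exact: measurable_funepos.
- by apply: measurable_fun_fubini_tonelli_F => //; exact: measurable_funeneg.
Qed.

Lemma measurable_Rint1 f : measurable_fun [set: T1 * T2] f ->
  measurable_fun [set: T2] (fun y => \int[m1]_x f (x, y)).
Proof.
move=> mf; apply: (measurableT_comp (fine_measurable measurableT)).
have mfE : measurable_fun setT (EFin \o f) by exact/measurable_EFinP.
rewrite (_ : (fun _ => _) = fubini_G m1 (EFin \o f)^\+%E \-
    fubini_G m1 (EFin \o f)^\-%E)%E; last first.
  apply/funext => y; rewrite integralE; congr (_ - _)%E;
  by apply: eq_integral => x _; rewrite ?funeposE ?funenegE.
apply: emeasurable_funB.
- by apply: measurable_fun_fubini_tonelli_G => //; exact: measurable_funepos.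
- by apply: measurable_fun_fubini_tonelli_G => //; exact: measurable_funeneg.
Qed.

(** The form in which Fubini is prepared: a real majorant [a] of the inner L^1 norms replaces the
    evaluation of an iterated extended integral. *)
Lemma intg_prod_ae f (a : T1 -> R) : measurable_fun [set: T1 * T2] f ->
  intg m1 a ->
  {ae m1, forall x, intg m2 (fun y => f (x, y)) /\
     \int[m2]_y `|f (x, y)| <= a x} ->
  intg (m1 \x m2)%E f.
Proof.
move=> mf ai fa; apply/integrable12ltyP; first exact/measurable_EFinP.
have /integrableP[ma aoo] := ai.
apply: le_lt_trans aoo; apply: ae_ge0_le_integral => //=.
- by move=> x _; exact: integral_ge0.
- apply: (@measurable_fun_fubini_tonelli_F _ _ _ _ _ _ (abse \o (EFin \o f))); last by move=> x; exact: abse_ge0.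
  by apply/measurableT_comp => //; exact/measurable_EFinP.
- by apply/measurable_EFinP; apply: measurableT_comp => //; exact/measurable_EFinP.
- apply: filterS fa => x [fx fax] _ /=.
  rewrite -(EFin_Rint (intg_norm fx)) lee_fin (le_trans fax)//.
  exact: ler_norm.
Qed.

Lemma intg_prod f (a : T1 -> R) : measurable_fun [set: T1 * T2] f ->
  intg m1 a -> (forall x, intg m2 (fun y => f (x, y))) ->
  (forall x, \int[m2]_y `|f (x, y)| <= a x) -> intg (m1 \x m2)%E f.
Proof. by move=> mf ai fi fa; apply: (intg_prod_ae mf ai); exact: aeW. Qed.

Lemma intg_mul (f : T1 -> R) (g : T2 -> R) : intg m1 f -> intg m2 g ->
  intg (m1 \x m2)%E (fun p => f p.1 * g p.2).
Proof.
move=> fi gi; apply: (@intg_prod _ (fun x => `|f x| * \int[m2]_y `|g y|)) => /=.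
- apply: measurable_funM.
  + exact: (measurableT_comp (intg_meas fi)).
  + exact: (measurableT_comp (intg_meas gi)).
- by apply: intgZr; exact: intg_norm.
- by move=> x; exact: intgZ.
- move=> x; rewrite -RintZ; last exact: intg_norm.
  by under eq_Rintegral do rewrite normrM.
Qed.

Section fubini.
Variable f : T1 * T2 -> R.
Hypothesis fi : intg (m1 \x m2)%E f.

Let ae1 : {ae m1, forall x, intg m2 (fun y => f (x, y))}.
Proof. exact: (ae_integrable1 fi). Qed.

Let ae2 : {ae m2, forall y, intg m1 (fun x => f (x, y))}.
Proof. exact: (ae_integrable2 fi). Qed.

Lemma ae_intg2 : {ae m2, forall y, intg m1 (fun x => f (x, y))}.
Proof. exact: ae2. Qed.

(** The real inner integral agrees with the extended one only where the section is integrable, that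
    is for almost every [x]; elsewhere [fine] may have turned an infinite value into 0. *)
Lemma intg_Rint2 : intg m1 (fun x => \int[m2]_y f (x, y)).
Proof.
have h := integrable_fubini_F fi; apply/integrableP; split.
  exact/measurable_EFinP/measurable_Rint2/intg_meas/fi.
have /integrableP[mh hoo] := h.
apply: le_lt_trans hoo; apply: ae_ge0_le_integral => //=.
- apply/measurable_EFinP; apply: measurableT_comp => //.
  exact/measurable_Rint2/intg_meas/fi.
- exact/measurableT_comp.
- by apply: filterS ae1 => x fx _; rewrite -abse_EFin (EFin_Rint fx).
Qed.

Lemma intg_Rint1 : intg m2 (fun y => \int[m1]_x f (x, y)).
Proof.
have mf : measurable_fun setT f := intg_meas fi.
apply/integrableP; split; first exact/measurable_EFinP/measurable_Rint1.
have := (integrable21ltyP m1 m2 (proj2 (measurable_EFinP _ _) mf)).1 fi.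
apply: le_lt_trans; apply: ae_ge0_le_integral => //=.
- apply/measurable_EFinP; apply: measurableT_comp => //.
  exact: measurable_Rint1.
- by move=> x _; exact: integral_ge0.
- apply: (@measurable_fun_fubini_tonelli_G _ _ _ _ _ _ (abse \o (EFin \o f))); last by move=> x; exact: abse_ge0.
  by apply/measurableT_comp => //; exact/measurable_EFinP.
- apply: filterS ae2 => y fy _; rewrite -abse_EFin (EFin_Rint fy).
  apply: le_abse_integral => //; have /integrableP[] := fy; by [].
Qed.

Lemma Rint_prod12 : \int[(m1 \x m2)%E]_z f z = \int[m1]_x \int[m2]_y f (x, y).
Proof.
rewrite [LHS]/Rintegral -(integral12_prod_meas1 fi) [RHS]/Rintegral.
congr fine; apply: ae_eq_integral => //.
- exact: measurable_fubini_F fi.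
- exact/measurable_EFinP/intg_meas/intg_Rint2.
- by apply: filterS ae1 => x fx _; rewrite (EFin_Rint fx).
Qed.

Lemma Rint_prod21 : \int[(m1 \x m2)%E]_z f z = \int[m2]_y \int[m1]_x f (x, y).
Proof.
rewrite [LHS]/Rintegral -(integral21_prod_meas1 fi) [RHS]/Rintegral.
congr fine; apply: ae_eq_integral => //.
- exact: measurable_fubini_G fi.
- exact/measurable_EFinP/intg_meas/intg_Rint1.
- by apply: filterS ae2 => x fx _; rewrite (EFin_Rint fx).
Qed.

Lemma Rint_swap : \int[m1]_x \int[m2]_y f (x, y) = \int[m2]_y \int[m1]_x f (x, y).
Proof. by rewrite -Rint_prod12 Rint_prod21. Qed.

End fubini.

End product.

(** * Invariance of Lebesgue measure under translations and reflections *)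

Section measure_preserving.
Context d (T : measurableType d) (R : realType) (m : {measure set T -> \bar R}).
Variable phi : T -> T.
Hypothesis mphi : measurable_fun setT phi.
Hypothesis phi_pres : forall f : T -> \bar R, measurable_fun setT f ->
  (forall x, 0 <= f x)%E -> (\int[m]_x f (phi x) = \int[m]_x f x)%E.

Lemma intg_preserving (f : T -> R) : intg m f -> intg m (fun x => f (phi x)).
Proof.
move=> fi; have mf := intg_meas fi; have /integrableP[_ foo] := fi.
apply/integrableP; split.
  by apply/measurable_EFinP; exact: (measurableT_comp mf mphi).
rewrite (phi_pres (f := fun x => `|f x|%:E))//.
by apply/measurable_EFinP; exact: measurableT_comp.
Qed.

(** Invariance for nonnegative functions is applied to the two parts of [f] separately, before
    [fine]. *)
Lemma Rint_preserving (f : T -> R) : measurable_fun setT f ->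
  \int[m]_x f (phi x) = \int[m]_x f x.
Proof.
move=> mf; have mfE : measurable_fun setT (EFin \o f) by exact/measurable_EFinP.
rewrite /Rintegral integralE [in RHS]integralE; congr fine; congr (_ - _)%E.
- rewrite -[RHS]phi_pres//; last exact: measurable_funepos.
  by apply: eq_integral => x _; rewrite !funeposE.
- rewrite -[RHS]phi_pres//; last exact: measurable_funeneg.
  by apply: eq_integral => x _; rewrite !funenegE.
Qed.

End measure_preserving.

Section lebesgue_affine.
Context {R : realType}.
Local Notation mu := (@lebesgue_measure R).

(** The sign is a parameter so that translations and reflections share their proofs. *)
Definition aff (e : bool) (c : R) (s : measurableTypeR R) : measurableTypeR R := c + (-1) ^+ e * s.

Lemma measurable_aff e c : measurable_fun [set: measurableTypeR R] (aff e c).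
Proof. by apply: measurable_funD => //; exact: measurable_funM. Qed.

Lemma lebesgue_aff e c (A : set (measurableTypeR R)) : measurable A ->
  mu (aff e c @^-1` A) = mu A.
Proof.
move=> mA; have mphi := measurable_aff e c.
pose m : {measure set (measurableTypeR R) -> \bar R} :=
  measure_function_pushforward__canonical__measure_function_Measure mu mphi.
rewrite -[LHS]/(m A); apply/esym; apply: lebesgue_measure_unique => // X.
move=> [[a b] _ <-] /=; rewrite /pushforward/=.
have [ab|ba] := ltP a b; last first.
  by rewrite set_itv_ge ?preimage_set0 ?measure0// bnd_simp -leNgt.
case: e mphi m => mphi m.
(* The reflection yields an interval closed on the left instead of the right; the length is the
   same. *)
- rewrite (_ : aff true c @^-1` _ = `[c - b, c - a[%classic); last first.
    apply/seteqP; split => x /=; rewrite /aff !in_itv/= expr1 mulN1r => /andP[? ?];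
    by apply/andP; split; lra.
  rewrite !lebesgue_measure_itv/= !lte_fin ab ifT; last lra.
  by rewrite -!EFinB; congr EFin; lra.
- rewrite (_ : aff false c @^-1` _ = `]a - c, b - c]%classic); last first.
    apply/seteqP; split => x /=; rewrite /aff !in_itv/= expr0 mul1r => /andP[? ?];
    by apply/andP; split; lra.
  rewrite !lebesgue_measure_itv/= !lte_fin ab ifT; last lra.
  by rewrite -!EFinB; congr EFin; lra.
Qed.

Lemma ge0_integral_aff e c (f : measurableTypeR R -> \bar R) :
  measurable_fun setT f -> (forall x, 0 <= f x)%E ->
  (\int[mu]_x f (aff e c x) = \int[mu]_x f x)%E.
Proof.
move=> mf f0; have mphi := measurable_aff e c.
pose m : {measure set (measurableTypeR R) -> \bar R} :=
  measure_function_pushforward__canonical__measure_function_Measure mu mphi.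
transitivity (\int[m]_x f x)%E; first by rewrite ge0_integral_pushforward.
by apply: eq_measure_integral => A mA _; exact: lebesgue_aff.
Qed.

Lemma intg_aff e c (f : R -> R) : intg mu f -> intg mu (fun s => f (aff e c s)).
Proof.
by apply: (intg_preserving (measurable_aff e c)) => g; exact: ge0_integral_aff.
Qed.

Lemma Rint_aff e c (f : R -> R) : measurable_fun [set: measurableTypeR R] f ->
  \int[mu]_s f (aff e c s) = \int[mu]_s f s.
Proof. by apply: Rint_preserving => g; exact: ge0_integral_aff. Qed.

End lebesgue_affine.

Section lebesgue_rV_theory.
Context {R : realType}.
Local Notation mu := (@lebesgue_measure R).

Lemma measurable_rsnoc n :
  measurable_fun [set: 'rV[R]_n * measurableTypeR R]
    (fun p => rsnoc p : 'rV[R]_n.+1).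
Proof.
apply: measurable_fun_rV => i; rewrite /rsnoc.
under eq_fun do rewrite mxE.
case: (unlift ord_max i) => [k|]; last exact: measurable_snd.
apply: (measurableT_comp (measurable_rV_coord k)); exact: measurable_fst.
Qed.

Definition tang n (x : 'rV[R]_n.+1) : 'rV[R]_n :=
  \row_k x ord0 (lift ord_max k).

Lemma rsnoc_tang n (x : 'rV[R]_n.+1) : rsnoc (tang x, height x) = x.
Proof.
apply/rowP => i; rewrite mxE; case: unliftP => [k|] -> //=.
by rewrite mxE.
Qed.

Lemma tang_rsnoc n (v : 'rV[R]_n) (s : R) : tang (rsnoc (v, s)) = v.
Proof. by apply/rowP => k; rewrite !mxE liftK. Qed.

Lemma height_rsnoc n (v : 'rV[R]_n) (s : R) : height (rsnoc (v, s)) = s.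
Proof. by rewrite /height mxE unlift_none. Qed.

(** By construction the measure in dimension [n + 1] is the image of the product measure under
    [rsnoc]; the auxiliary [m] presents this image as a pushforward, to which the change of
    variables applies. *)
Lemma ge0_integral_rsnoc n (f : 'rV[R]_n.+1 -> \bar R) :
  measurable_fun setT f -> (forall x, 0 <= f x)%E ->
  (\int[lebesgue_rV R n.+1]_x f x =
   \int[lebesgue_rV R n \x mu]_p f (rsnoc p))%E.
Proof.
move=> mf f0.
pose m : {measure set 'rV[R]_n.+1 -> \bar R} :=
  measure_function_pushforward__canonical__measure_function_Measure
    (lebesgue_rV R n \x mu)%E (@measurable_rsnoc n).
transitivity (\int[m]_x f x)%E; last first.
  by rewrite ge0_integral_pushforward//; exact: measurable_rsnoc.
exact: eq_measure_integral.
Qed.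

Lemma measurable_rsnoc_comp n d' (T : measurableType d') (f : 'rV[R]_n.+1 -> T) :
  measurable_fun setT f ->
  measurable_fun [set: 'rV[R]_n * measurableTypeR R] (fun p => f (rsnoc p)).
Proof. by move=> mf; apply: (measurableT_comp mf); exact: measurable_rsnoc. Qed.

Lemma intg_rsnoc n (f : 'rV[R]_n.+1 -> R) : measurable_fun setT f ->
  intg (lebesgue_rV R n.+1) f <->
  intg (lebesgue_rV R n \x mu)%E (fun p => f (rsnoc p)).
Proof.
move=> mf; have mfa : measurable_fun setT (fun x => (`|f x|%:E)%E).
  by apply/measurable_EFinP; exact: measurableT_comp.
split => /integrableP[_]; rewrite ?ge0_integral_rsnoc// => foo;
  apply/integrableP; split.
- by apply/measurable_EFinP; exact: measurable_rsnoc_comp.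
- exact: foo.
- exact/measurable_EFinP.
- by rewrite ge0_integral_rsnoc.
Qed.

Lemma Rint_rsnoc n (f : 'rV[R]_n.+1 -> R) : intg (lebesgue_rV R n.+1) f ->
  \int[lebesgue_rV R n.+1]_x f x =
  \int[(lebesgue_rV R n \x mu)%E]_p f (rsnoc p).
Proof.
move=> fi; have mf := intg_meas fi.
rewrite /Rintegral; congr fine.
pose m : {measure set 'rV[R]_n.+1 -> \bar R} :=
  measure_function_pushforward__canonical__measure_function_Measure
    (lebesgue_rV R n \x mu)%E (@measurable_rsnoc n).
transitivity (\int[m]_x (f x)%:E)%E; first exact: eq_measure_integral.
rewrite integral_pushforward//; first exact: measurable_rsnoc.
  exact/measurable_EFinP.
by have := (intg_rsnoc mf).1 fi; rewrite /intg preimage_setT.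
Qed.

Definition affv n (e : bool) (c x : 'rV[R]_n) : 'rV[R]_n := c + (-1) ^+ e *: x.

Lemma measurable_affv n e c : measurable_fun [set: 'rV[R]_n] (@affv n e c).
Proof.
apply: measurable_fun_rV => i.
under eq_fun => x do rewrite !mxE -/(aff e (c ord0 i) (rV_coord i x)).
exact: (measurableT_comp (measurable_aff e _)) (measurable_rV_coord i).
Qed.

Lemma affv_rsnoc n e (c : 'rV[R]_n.+1) v s :
  affv e c (rsnoc (v, s)) = rsnoc (affv e (tang c) v, aff e (height c) s).
Proof.
apply/rowP => i; rewrite !mxE; case: unliftP => [k|] -> //=.
by rewrite !mxE.
Qed.

(** Induction on the dimension, peeling off the last coordinate: the inner integral is treated by
    [ge0_integral_aff], the outer one by the induction hypothesis. *)
Lemma ge0_integral_affv n e (c : 'rV[R]_n) (f : 'rV[R]_n -> \bar R) :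
  measurable_fun setT f -> (forall x, 0 <= f x)%E ->
  (\int[lebesgue_rV R n]_x f (affv e c x) = \int[lebesgue_rV R n]_x f x)%E.
Proof.
elim: n c f => [|n ih] c f mf f0.
  by apply: eq_integral => x _; congr f; apply/rowP; case.
have mfs := measurable_rsnoc_comp mf.
rewrite !ge0_integral_rsnoc//; last first.
  exact: (measurableT_comp mf (measurable_affv e c)).
rewrite !fubini_tonelli1//; last first.
  apply: (@measurable_rsnoc_comp _ _ _ (fun x => f (affv e c x))).
  exact: (measurableT_comp mf (measurable_affv e c)).
rewrite /fubini_F.
transitivity (\int[lebesgue_rV R n]_x \int[mu]_y f (rsnoc (affv e (tang c) x, y)))%E.
  apply: eq_integral => v _.
  under eq_integral do rewrite affv_rsnoc.
  rewrite (@ge0_integral_aff _ e (height c) (fun s => f (rsnoc (affv e (tang c) v, s))))//.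
  exact: (measurableT_comp mfs (pair1_measurable _)).
rewrite (ih (tang c) (fun v => \int[mu]_y f (rsnoc (v, y)))%E)//.
- exact: (measurable_fun_fubini_tonelli_F _ mfs).
- by move=> v; exact: integral_ge0.
Qed.

Lemma intg_affv n e (c : 'rV[R]_n) (f : 'rV[R]_n -> R) :
  intg (lebesgue_rV R n) f -> intg (lebesgue_rV R n) (fun x => f (affv e c x)).
Proof.
by apply: (intg_preserving (measurable_affv e c)) => g; exact: ge0_integral_affv.
Qed.

Lemma Rint_affv n e (c : 'rV[R]_n) (f : 'rV[R]_n -> R) :
  measurable_fun setT f ->
  \int[lebesgue_rV R n]_x f (affv e c x) = \int[lebesgue_rV R n]_x f x.
Proof. by apply: Rint_preserving => g; exact: ge0_integral_affv. Qed.

Lemma Rint_sub n (c : 'rV[R]_n) (f : 'rV[R]_n -> R) : measurable_fun setT f ->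
  \int[lebesgue_rV R n]_x f (c - x) = \int[lebesgue_rV R n]_x f x.
Proof.
move=> mf; rewrite -(Rint_affv true c mf); apply: eq_Rintegral => x _.
by rewrite /affv expr1 scaleN1r.
Qed.

Lemma intg_sub n (c : 'rV[R]_n) (f : 'rV[R]_n -> R) :
  intg (lebesgue_rV R n) f -> intg (lebesgue_rV R n) (fun x => f (c - x)).
Proof.
move=> /(intg_affv true c); congr (intg _ _); apply/funext => x.
by rewrite /affv expr1 scaleN1r.
Qed.

Lemma Rint_shift n (c : 'rV[R]_n) (f : 'rV[R]_n -> R) : measurable_fun setT f ->
  \int[lebesgue_rV R n]_x f (x + c) = \int[lebesgue_rV R n]_x f x.
Proof.
move=> mf; rewrite -(Rint_affv false c mf); apply: eq_Rintegral => x _.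
by rewrite /affv expr0 scale1r addrC.
Qed.

Lemma intg_shift n (c : 'rV[R]_n) (f : 'rV[R]_n -> R) :
  intg (lebesgue_rV R n) f -> intg (lebesgue_rV R n) (fun x => f (x + c)).
Proof.
move=> /(intg_affv false c); congr (intg _ _); apply/funext => x.
by rewrite /affv expr0 scale1r addrC.
Qed.

Lemma Rint1_sub (c : R) (f : R -> R) : measurable_fun [set: measurableTypeR R] f ->
  \int[mu]_s f (c - s) = \int[mu]_s f s.
Proof.
move=> mf; rewrite -(Rint_aff true c mf); apply: eq_Rintegral => x _.
by rewrite /aff expr1 mulN1r.
Qed.

Lemma intg1_sub (c : R) (f : R -> R) : intg mu f -> intg mu (fun s => f (c - s)).
Proof.
move=> /(intg_aff true c); congr (intg _ _); apply/funext => x.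
by rewrite /aff expr1 mulN1r.
Qed.

End lebesgue_rV_theory.

Section measurable_real.
Context {R : realType}.

Lemma measurable_sqrtr : measurable_fun [set: R] (@Num.sqrt R).
Proof. by apply: continuous_measurable_fun; exact: sqrt_continuous. Qed.

(** The inverse is rewritten with the real power [powR], which is measurable; at 0 both expressions
    vanish, as [0^-1 = 0]. *)
Lemma measurable_invr : measurable_fun [set: R] (fun x : R => x^-1).
Proof.
rewrite (_ : (fun x => _) = fun x : R => x * ((x ^+ 2) `^ (-1))).
  apply: measurable_funM => //.
  apply: (measurableT_comp (measurable_powR (-1))).
  exact: measurable_funX.
apply/funext => x; rewrite powR_inv1 ?sqr_ge0//.
by have [->|x0] := eqVneq x 0; rewrite ?invr0 ?mul0r// expr2 invfM mulrA divff ?mul1r.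
Qed.

Lemma measurable_fun_inv d (T : measurableType d) (f : T -> R) :
  measurable_fun setT f -> measurable_fun setT (fun x => (f x)^-1).
Proof. by move=> mf; exact: (measurableT_comp measurable_invr). Qed.

Lemma measurable_fun_sqrt d (T : measurableType d) (f : T -> R) :
  measurable_fun setT f -> measurable_fun setT (fun x => Num.sqrt (f x)).
Proof. by move=> mf; exact: (measurableT_comp measurable_sqrtr). Qed.

Lemma measurable_indic_fun d (T : measurableType d) (D : set T) (f : T -> R) :
  measurable D -> measurable_fun setT f ->
  measurable_fun setT (fun x => \1_D x * f x).
Proof. by move=> mD mf; apply: measurable_funM => //; exact: measurable_indic. Qed.

End measurable_real.

Section continuous_rV.
Context {R : realType} {n : nat}.

(** The sigma-algebra on row vectors is generated by the coordinates, not by the open sets. A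
    continuous function is therefore shown measurable as a pointwise limit of functions of the
    rounded point on the grid of mesh [1 / (m + 1)], which take countably many values. *)
Definition grid (m : nat) (x : 'rV[R]_n) : 'rV[int]_n :=
  \row_k Num.floor (m.+1%:R * x ord0 k).

Definition of_grid (m : nat) (p : 'rV[int]_n) : 'rV[R]_n :=
  \row_k ((p ord0 k)%:~R / m.+1%:R).

Lemma measurable_grid_fiber m (p : 'rV[int]_n) :
  measurable [set x | grid m x = p].
Proof.
rewrite (_ : [set x | _] =
  \bigcap_(k in [set: 'I_n]) [set x : 'rV[R]_n |
    (p ord0 k)%:~R <= m.+1%:R * x ord0 k < (p ord0 k + 1)%:~R]); last first.
  apply/seteqP; split => [x /= <- k _|x /= h].
    by rewrite mxE; exact: floor_itv.
  by apply/rowP => k; rewrite mxE; apply: floor_def; exact: (h k I).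
apply: fin_bigcap_measurable => [|k _]; first exact: finite_finset.
pose g (x : 'rV[R]_n) := m.+1%:R * x ord0 k.
have mg : measurable_fun setT g.
  apply: measurable_funM => //. exact: (@measurable_rV_coord _ (measurableTypeR R) n k).
rewrite (_ : [set x | _] = g @^-1` `[(p ord0 k)%:~R, (p ord0 k + 1)%:~R[%classic).
  by rewrite -[X in measurable X]setTI; exact: mg.
by apply/seteqP; split => x /=; rewrite in_itv.
Qed.

Lemma measurable_grid_comp m (f : 'rV[int]_n -> R) :
  measurable_fun setT (fun x => f (grid m x)).
Proof.
move=> _ Y mY; rewrite setTI.
rewrite (_ : _ @^-1` _ = \bigcup_(p : 'rV[int]_n)
    (if f p \in Y then [set x | grid m x = p] else set0)); last first.
  apply/seteqP; split => [x Yx|x [p _]].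
    by exists (grid m x) => //; rewrite mem_set.
  by case: ifPn => [/set_mem Yp /= ->|_ []].
apply: countable_bigcupT_measurable => // p.
by case: ifP => _; [exact: measurable_grid_fiber|exact: measurable0].
Qed.

Lemma of_grid_close m (x : 'rV[R]_n) k :
  `|of_grid m (grid m x) ord0 k - x ord0 k| <= m.+1%:R^-1.
Proof.
rewrite !mxE; have /andP[h1 h2] := floor_itv (m.+1%:R * x ord0 k).
have m0 : 0 < m.+1%:R :> R by [].
set z := (Num.floor _)%:~R in h1 h2 *.
have -> : z / m.+1%:R - x ord0 k = (z - m.+1%:R * x ord0 k) / m.+1%:R.
  by rewrite mulrBl mulrAC divff ?mul1r// gt_eqF.
rewrite normrM [X in _ * X]gtr0_norm ?invr_gt0// ler_piMl ?invr_ge0//.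
rewrite ler0_norm ?subr_le0// opprB lerBlDr addrC.
by move: h2; rewrite intrD => /ltW.
Qed.

Lemma cvg_of_grid (x : 'rV[R]_n) : of_grid m (grid m x) @[m --> \oo] --> x.
Proof.
apply/cvgrPdist_le => e e0.
near=> m.
have me : (m.+1%:R : R)^-1 <= e.
  near: m; have := @near_infty_natSinv_lt R (PosNum e0).
  by apply: filterS => m /ltW.
rewrite /Num.norm/= mx_normrE; apply: bigmax_le => [|[i k] _]; first exact: ltW.
by rewrite ord1/= -normrN [X in `|X|](_ : _ = of_grid m (grid m x) ord0 k - x ord0 k)
  ?(le_trans (of_grid_close _ _ _))// !mxE opprB.
Unshelve. all: by end_near. Qed.

(** Since [f] is continuous only within [D], the rounded points must stay in [D]; rounding down
    preserves the closed half-space, to which this is applied. *)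
Lemma measurable_within_continuous (D : set 'rV[R]_n) (f : 'rV[R]_n -> R) :
  measurable D -> (forall m x, D x -> D (of_grid m (grid m x))) ->
  {within D, continuous f} -> measurable_fun setT (fun x => \1_D x * f x).
Proof.
move=> mD gD cf.
apply: (@measurable_fun_cvg _ _ _ _
  (fun m x => \1_D x * f (of_grid m (grid m x)))).
  move=> m; apply: measurable_indic_fun => //.
  exact: (@measurable_grid_comp m (fun p => f (of_grid m p))).
move=> x _; rewrite /indic; have [/set_mem Dx|_] := boolP (x \in D); last first.
  by under eq_fun do rewrite mul0r; rewrite mul0r; exact: cvg_cst.
under eq_fun do rewrite mul1r; rewrite mul1r.
move/subspace_continuousP/(_ x Dx): cf => cf.
apply: (cvg_comp (fun m => of_grid m (grid m x)) f _ cf).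
move=> B /cvg_of_grid [N _ hN].
by exists N => // m Nm /=; apply: (hN _ Nm); exact: gD.
Qed.

End continuous_rV.

(** * Integrals of products of one-variable functions, and null hyperplanes *)

Section products.
Context {R : realType}.
Local Notation mu := (@lebesgue_measure R).

(** This makes product majorants worthwhile: their integrals over R^n are products of line
    integrals. In dimension 0 the measure is a unit mass, matching the empty product. *)
Lemma intg_Rint_prodf n (f : 'I_n -> R -> R) :
  (forall k, intg mu (f k)) ->
  intg (lebesgue_rV R n) (fun x => \prod_k f k (x ord0 k)) /\
  \int[lebesgue_rV R n]_x \prod_k f k (x ord0 k) = \prod_k \int[mu]_s f k s.
Proof.
elim: n f => [|n ih] f fi.
  rewrite (_ : (fun x => _) = cst 1); last first.
    by apply/funext => x; rewrite big_ord0.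
  split.
    apply/integrableP; split; first exact/measurable_EFinP/measurable_cst.
    rewrite [X in (X < _)%E](_ : _ = (\int[\d_(0%R : 'rV[R]_0)]_x 1%:E)%E); last first.
      by apply: eq_integral => x _ /=; rewrite normr1.
    by rewrite integral_dirac//= diracT mul1e ltry.
  rewrite big_ord0 /Rintegral /= integral_dirac//=.
  by rewrite /indic in_setT mul1r.
pose f' (k : 'I_n) := f (lift ord_max k).
have [ii iE] := ih f' (fun k => fi _).
have rE (p : 'rV[R]_n * measurableTypeR R) : \prod_k f k (rsnoc p ord0 k) =
    (\prod_k f' k (p.1 ord0 k)) * f ord_max p.2.
  rewrite (bigD1_ord ord_max)//= mulrC; congr (_ * _).
    by apply: eq_bigr => k _; rewrite /f' mxE liftK.
  by rewrite mxE unlift_none.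
have mf : measurable_fun setT (fun x : 'rV[R]_n.+1 => \prod_k f k (x ord0 k)).
  apply: measurable_prod => k _.
  exact: (measurableT_comp (intg_meas (fi k)) (measurable_rV_coord k)).
have pi : intg (lebesgue_rV R n \x mu)%E
    (fun p => (\prod_k f' k (p.1 ord0 k)) * f ord_max p.2).
  exact: (intg_mul ii (fi ord_max)).
have fi' : intg (lebesgue_rV R n.+1) (fun x => \prod_k f k (x ord0 k)).
  by apply/intg_rsnoc => //; under eq_fun do rewrite rE.
split=> //; rewrite Rint_rsnoc//; under eq_Rintegral do rewrite rE.
rewrite (Rint_prod12 pi) (bigD1_ord ord_max)//= mulrC -iE -RintZr//.
by apply: eq_Rintegral => v _ /=; exact: (RintZ _ (fi ord_max)).
Qed.

Lemma intg_prodf n (f : 'I_n -> R -> R) : (forall k, intg mu (f k)) ->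
  intg (lebesgue_rV R n) (fun x => \prod_k f k (x ord0 k)).
Proof. by case/intg_Rint_prodf. Qed.

Lemma Rint_prodf n (f : 'I_n -> R -> R) : (forall k, intg mu (f k)) ->
  \int[lebesgue_rV R n]_x \prod_k f k (x ord0 k) = \prod_k \int[mu]_s f k s.
Proof. by case/intg_Rint_prodf. Qed.

Lemma Rint_prodf_le n (f : 'I_n -> R -> R) (C : 'I_n -> R) :
  (forall k, intg mu (f k)) -> (forall k s, 0 <= f k s) ->
  (forall k, \int[mu]_s f k s <= C k) ->
  \int[lebesgue_rV R n]_x \prod_k f k (x ord0 k) <= \prod_k C k.
Proof.
move=> fi f0 fC; rewrite Rint_prodf//; apply: ler_prod => k _.
by rewrite fC andbT; exact: Rintegral_ge0.
Qed.

Lemma ae_neq (c : R) : {ae mu, forall s, s != c}.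
Proof.
exists [set c]; split => //; first exact: lebesgue_measure_set1.
by move=> s /= /negP; rewrite negbK => /eqP.
Qed.

Lemma measurable_coord_eq n (k : 'I_n) (c : R) :
  measurable [set x : 'rV[R]_n | x ord0 k = c].
Proof.
rewrite (_ : [set x | _] = (@rV_coord _ (measurableTypeR R) n k) @^-1` [set c])//.
by rewrite -[X in measurable X]setTI; exact: measurable_rV_coord.
Qed.

Lemma lebesgue_rV_coord_eq n (k : 'I_n) (c : R) :
  lebesgue_rV R n [set x | x ord0 k = c] = 0%E.
Proof.
elim: n k => [[]//|n ih] k.
transitivity ((lebesgue_rV R n \x mu)%E
  ((fun p => rsnoc p) @^-1` [set x : 'rV[R]_n.+1 | x ord0 k = c])); first by [].
case: (unliftP ord_max k) => [j|] ->.
  rewrite (_ : _ @^-1` _ = [set v : 'rV[R]_n | v ord0 j = c] `*` [set: measurableTypeR R]).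
    rewrite product_measure1E//; last exact: measurable_coord_eq.
    by rewrite [X in (X * _)%E](_ : _ = 0%E) ?mul0e//; exact: ih.
  by apply/seteqP; split => -[v s] /=; rewrite mxE liftK => // -[].
rewrite (_ : _ @^-1` _ = [set: 'rV[R]_n] `*` [set c : measurableTypeR R]).
  rewrite product_measure1E//.
  by rewrite [X in (_ * X)%E](_ : _ = 0%E) ?mule0//; exact: lebesgue_measure_set1.
by apply/seteqP; split => -[v s] /=; rewrite mxE unlift_none => // -[].
Qed.

(** Discards the coordinate hyperplanes through [c], on which the product majorants of the singular
    kernels fail. *)
Lemma ae_coord_neq n (c : 'rV[R]_n) :
  {ae lebesgue_rV R n, forall x : 'rV[R]_n, forall k, x ord0 k != c ord0 k}.
Proof.
apply: (@filter_forall _ _ (fun k => [set x : 'rV[R]_n | x ord0 k != c ord0 k])) => k.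
exists [set x : 'rV[R]_n | x ord0 k = c ord0 k]; split.
- exact: measurable_coord_eq.
- exact: lebesgue_rV_coord_eq.
- by move=> x /= /negP; rewrite negbK => /eqP.
Qed.

End products.

(** * The one-dimensional heat kernel *)

Section ftc_open.
Context {R : realType}.
Local Notation mu := (@lebesgue_measure R).

(** An improper fundamental theorem: the classical one holds on each [[a m, b m]] and monotone
    convergence passes to the union. As [f] is nonnegative, the limit of the increments also yields
    integrability. *)
Lemma ge0_FTC_bigcup (f F : R -> R) (a b : nat -> R) (L : R) :
  (forall m, a m < b m) ->
  (forall m n, (m <= n)%N -> a n <= a m) -> (forall m n, (m <= n)%N -> b m <= b n) ->
  (forall m x, a m <= x <= b m -> is_derive x 1 F (f x)) ->
  (forall m x, a m <= x <= b m -> {for x, continuous f}) ->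
  (forall m x, a m <= x <= b m -> 0 <= f x) ->
  F (b m) - F (a m) @[m --> \oo] --> L ->
  let D : set (measurableTypeR R) := \bigcup_m `[a m, b m]%classic in
  intg mu (fun x => \1_D x * f x) /\ \int[mu]_x (\1_D x * f x) = L.
Proof.
move=> ab da ib dF cf f0 FL D.
have mF m : measurable_fun `[a m, b m]%classic f.
  apply: subspace_continuous_measurable_fun => //.
  apply: continuous_in_subspaceT => x /set_mem /=; rewrite in_itv/=; exact: cf.
have mD : measurable D by apply: bigcup_measurable.
have mDf : measurable_fun D f by apply/measurable_fun_bigcup.
have ftc m : (\int[mu]_(x in `[a m, b m]) (f x)%:E)%E = ((F (b m))%:E - (F (a m))%:E)%E.
  apply: continuous_FTC2 => //.
  - apply: continuous_in_subspaceT => x /set_mem /=; rewrite in_itv/=; exact: cf.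
  - have cF x : a m <= x <= b m -> {for x, continuous F}.
      move=> /dF xF; apply: differentiable_continuous; apply/derivable1_diffP.
      exact: ex_derive.
    split.
    + move=> x; rewrite in_itv/= => /andP[/ltW h1 /ltW h2].
      have := dF m x; rewrite h1 h2 => /(_ isT) xF; exact: ex_derive.
    + by apply: cvg_at_right_filter; apply: cF; rewrite lexx ltW.
    + by apply: cvg_at_left_filter; apply: cF; rewrite lexx ltW.
  - move=> x; rewrite in_itv/= => /andP[/ltW h1 /ltW h2].
    rewrite derive1E; have := dF m x; rewrite h1 h2 => /(_ isT) xF.
    exact: derive_val.
have intE : (\int[mu]_(x in D) (f x)%:E = L%:E)%E.
  have h : (\int[mu]_(x in `[a m, b m]) (f x)%:E)%E @[m --> \oo] -->
           (\int[mu]_(x in D) (f x)%:E)%E.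
    apply: ge0_nondecreasing_set_cvg_integral => //.
    - move=> m n mn; apply/subsetPset => x /=; rewrite !in_itv/= => /andP[h1 h2].
      by rewrite (le_trans (da _ _ mn) h1) (le_trans h2 (ib _ _ mn)).
    - by move=> m; apply/measurable_EFinP; exact: mF.
  rewrite -(cvg_lim (@ereal_hausdorff R) h)//; apply: (cvg_lim (@ereal_hausdorff R)) => //.
  under eq_fun do rewrite ftc -EFinB.
  by apply: cvg_EFin => //; exact: nearW.
have fDi : mu.-integrable D (EFin \o f).
  apply/integrableP; split; first exact/measurable_EFinP.
  rewrite (_ : (\int[mu]_(x in D) _)%E = (\int[mu]_(x in D) (f x)%:E)%E).
    by rewrite intE ltry.
  apply: eq_integral => x /set_mem [m _ /=]; rewrite in_itv/= => hx.
  by rewrite ger0_norm// (f0 m).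
have h := (intg_restr mu f mD).1 fDi. rewrite /intg in h; split. exact: h.
by rewrite -Rint_restr /Rintegral intE.
Qed.

End ftc_open.

Section gauss_kernel.
Context {R : realType}.
Local Notation mu := (@lebesgue_measure R).
Implicit Types r a b t s : R.

(** For [t <= 0] the square root is 0 and so is its inverse, hence [gk r t = 0]. *)
Definition gk r t : R := (Num.sqrt (4 * pi * t))^-1 * expR (- (r ^+ 2 / (4 * t))).
Definition gk1 r t : R := - (r / (2 * t)) * gk r t.
Definition gk2 r t : R := (r ^+ 2 / (4 * t ^+ 2) - (2 * t)^-1) * gk r t.

Lemma gk_ge0 r t : 0 <= gk r t.
Proof. by rewrite mulr_ge0 ?invr_ge0 ?sqrtr_ge0 ?expR_ge0. Qed.

Lemma gkN r t : gk (- r) t = gk r t.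
Proof. by rewrite /gk sqrrN. Qed.

Lemma measurable_gk d (T : measurableType d) (f h : T -> R) :
  measurable_fun setT f -> measurable_fun setT h ->
  measurable_fun setT (fun x => gk (f x) (h x)).
Proof.
move=> mf mh; apply: measurable_funM.
  by apply: measurable_fun_inv; apply: measurable_fun_sqrt; exact: measurable_funM.
apply: (measurableT_comp (@measurable_expR R)).
apply: measurableT_comp => //; apply: measurable_funM; first exact: measurable_funX.
by apply: measurable_fun_inv; exact: measurable_funM.
Qed.

Lemma gk_normal r t : 0 < t -> gk r t = normal_pdf 0 (Num.sqrt (2 * t)) r.
Proof.
move=> t0; have s0 : Num.sqrt (2 * t) != 0.
  by rewrite gt_eqF// sqrtr_gt0 mulr_gt0.
rewrite normal_pdfE//= /normal_peak /normal_fun /gk.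
rewrite sqr_sqrtr ?mulr_ge0// ?ltW// subr0; congr (_ * _).
  by congr (Num.sqrt _)^-1; rewrite -mulr_natr; ring.
by congr expR; rewrite mulNr; congr (- (_ * _^-1)); rewrite -mulr_natr; ring.
Qed.

Lemma intg_gk t : 0 < t -> intg mu (gk ^~ t).
Proof.
move=> t0; rewrite /intg (_ : _ \o _ = fun x => (normal_pdf 0 (Num.sqrt (2 * t)) x)%:E).
  exact: integrable_normal_pdf.
by apply/funext => x /=; rewrite gk_normal.
Qed.

Lemma Rint_gk t : 0 < t -> \int[mu]_r gk r t = 1.
Proof.
move=> t0; rewrite /Rintegral; under eq_integral do rewrite gk_normal//.
by rewrite integral_normal_pdf.
Qed.

Lemma intg_gk_sub a t : 0 < t -> intg mu (fun r => gk (a - r) t).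
Proof. by move=> /intg_gk; exact: intg1_sub. Qed.

Lemma Rint_gk_sub a t : 0 < t -> \int[mu]_r gk (a - r) t = 1.
Proof.
by move=> t0; rewrite (Rint1_sub a (intg_meas (intg_gk t0))) Rint_gk.
Qed.

Lemma is_derive_gk r t : is_derive r 1 (gk ^~ t) (gk1 r t).
Proof.
rewrite /gk1 /gk; apply: is_derive_eq; rewrite /GRing.scale /=.
have [->|t0] := eqVneq t 0; first by rewrite !mulr0 !invr0; ring.
by set q := (Num.sqrt _)^-1; field.
Qed.

Lemma is_derive_gk1 r t : is_derive r 1 (gk1 ^~ t) (gk2 r t).
Proof.
have h := is_derive_gk r t.
rewrite /gk1 /gk2; apply: is_derive_eq; rewrite /GRing.scale /= /gk1.
have [->|t0] := eqVneq t 0; first by rewrite !mulr0 expr0n/= mulr0 !invr0; ring.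
by set q := gk r t; field.
Qed.

(** The distance in units of the diffusion length [sqrt t]: a derivative of the kernel costs a
    factor [1 / sqrt t] and powers of [sg]. *)
Definition sg r t : R := 1 + `|r| / Num.sqrt t.

Lemma sg_ge1 r t : 1 <= sg r t.
Proof. by rewrite lerDl divr_ge0// sqrtr_ge0. Qed.

Lemma sg_gt0 r t : 0 < sg r t.
Proof. by rewrite (lt_le_trans _ (sg_ge1 _ _)). Qed.

(** [sqrt 2] is the ratio of the normalizing factors at times [t] and [2 t]; the exponential is the
    additive [2 N^2] spent when [N x] is absorbed by the Gaussian exponent. *)
Definition Kn (N : nat) : R := Num.sqrt 2 * expR (2 * N%:R ^+ 2).

Lemma Kn_gt0 N : 0 < Kn N.
Proof. by rewrite mulr_gt0 ?expR_gt0// sqrtr_gt0. Qed.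

(* [N x <= 2 N^2 + x^2 / 8] turns a polynomial factor into half of the Gaussian decay. *)
Lemma gk_sg N r t : 0 < t -> gk r t * sg r t ^+ N <= Kn N * gk r (2 * t).
Proof.
move=> t0; set x := `|r| / Num.sqrt t.
have x2 : r ^+ 2 = x ^+ 2 * t.
  by rewrite expr_div_n sqr_sqrtr ?ltW// mulfVK ?gt_eqF// real_normK ?num_real.
have st : Num.sqrt (4 * pi * (2 * t)) = Num.sqrt 2 * Num.sqrt (4 * pi * t) :> R.
  by rewrite -sqrtrM//; congr Num.sqrt; ring.
have s40 : 0 < Num.sqrt (4 * pi * t) :> R by rewrite sqrtr_gt0 !mulr_gt0// pi_gt0.
have s20 : 0 < Num.sqrt 2 :> R by rewrite sqrtr_gt0.
have -> : Kn N * gk r (2 * t) = (Num.sqrt (4 * pi * t))^-1 *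
    expR (2 * N%:R ^+ 2 + - (x ^+ 2 / 8)).
  rewrite /Kn /gk st expRD x2.
  have -> : x ^+ 2 * t / (4 * (2 * t)) = x ^+ 2 / 8 by field; rewrite gt_eqF.
  by field; rewrite !gt_eqF.
rewrite /gk -[leLHS]mulrA ler_pM2l ?invr_gt0//.
have -> : r ^+ 2 / (4 * t) = x ^+ 2 / 4 by rewrite x2; field; rewrite gt_eqF.
have sgN : sg r t ^+ N <= expR (N%:R * x).
  rewrite mulrC expRM_natr; apply: lerXn2r; rewrite ?nnegrE ?expR_ge0//.
    exact/ltW/sg_gt0.
  exact: expR_ge1Dx.
apply: (le_trans (ler_wpM2l (expR_ge0 _) sgN)); rewrite -expRD ler_expR.
have := sqr_ge0 (x - 4 * N%:R); lra.
Qed.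

Lemma gk1_sg r t : 0 < t -> `|gk1 r t| <= (Num.sqrt t)^-1 * (sg r t * gk r t).
Proof.
move=> t0; have st : 0 < Num.sqrt t by rewrite sqrtr_gt0.
rewrite normrM (ger0_norm (gk_ge0 _ _)) [leRHS]mulrA ler_wpM2r ?gk_ge0// normrN.
rewrite normrM normfV [`|2 * t|]gtr0_norm ?mulr_gt0//.
rewrite -[X in 2 * X](sqr_sqrtr (ltW t0)) /sg.
have x0 : 0 <= `|r| / Num.sqrt t by rewrite divr_ge0// ltW.
have -> : `|r| / (2 * Num.sqrt t ^+ 2) = (Num.sqrt t)^-1 * (`|r| / Num.sqrt t / 2).
  by field; rewrite gt_eqF.
by rewrite ler_pM2l ?invr_gt0//; lra.
Qed.

Lemma gk2_sg r t : 0 < t -> `|gk2 r t| <= t^-1 * (sg r t ^+ 2 * gk r t).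
Proof.
move=> t0; have st : 0 < Num.sqrt t by rewrite sqrtr_gt0.
rewrite normrM (ger0_norm (gk_ge0 _ _)) [leRHS]mulrA ler_wpM2r ?gk_ge0//.
set x := `|r| / Num.sqrt t.
have x0 : 0 <= x by rewrite divr_ge0// ltW.
have x2 : r ^+ 2 = x ^+ 2 * t.
  by rewrite expr_div_n sqr_sqrtr ?ltW// mulfVK ?gt_eqF// real_normK ?num_real.
have -> : r ^+ 2 / (4 * t ^+ 2) - (2 * t)^-1 = t^-1 * (x ^+ 2 / 4 - 2^-1).
  by rewrite x2; field; rewrite gt_eqF.
rewrite normrM gtr0_norm ?invr_gt0// ler_pM2l ?invr_gt0// /sg -/x.
by rewrite ler_norml; apply/andP; split; nra.
Qed.

Lemma gk_le r t : gk r t <= (Num.sqrt (4 * pi * t))^-1.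
Proof.
have [t0|t0] := ltP 0 t; last first.
  by rewrite /gk ler0_sqrtr ?invr0 ?mul0r// mulr_ge0_le0// mulr_ge0// pi_ge0.
rewrite /gk ler_piMr ?invr_ge0 ?sqrtr_ge0// -expR0 ler_expR oppr_le0.
by rewrite divr_ge0 ?sqr_ge0// mulr_ge0// ltW.
Qed.

Lemma gkM a b t s : gk a t * gk b s =
  (Num.sqrt (4 * pi * t) * Num.sqrt (4 * pi * s))^-1 *
  expR (- (a ^+ 2 / (4 * t)) - b ^+ 2 / (4 * s)).
Proof. by rewrite invfM expRD /gk; ring. Qed.

(** Completing the square in [r]: the product is [gk (a - b) (t + s)] times the Gaussian of centre
    [c] and time [w], which has integral 1. *)
Lemma gk_semigroup a b t s : 0 < t -> 0 < s ->
  \int[mu]_r (gk (a - r) t * gk (r - b) s) = gk (a - b) (t + s).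
Proof.
move=> t0 s0; have ts0 : 0 < t + s by rewrite addr_gt0.
pose c := (a * s + b * t) / (t + s); pose w := t * s / (t + s).
have w0 : 0 < w by rewrite divr_gt0// mulr_gt0.
have E r : gk (a - r) t * gk (r - b) s = gk (a - b) (t + s) * gk (c - r) w.
  have pi0 : 0 < 4 * pi :> R by rewrite mulr_gt0// pi_gt0.
  have sM (x y : R) : 0 < x -> 0 < y -> Num.sqrt (4 * pi * x) * Num.sqrt (4 * pi * y) =
      4 * pi * Num.sqrt (x * y).
    move=> x0 y0; rewrite -sqrtrM; last by rewrite mulr_ge0 ?ltW.
    rewrite (_ : 4 * pi * x * (4 * pi * y) = (4 * pi) ^+ 2 * (x * y)); last by ring.
    by rewrite sqrtrM ?sqr_ge0// sqrtr_sqr ger0_norm// mulr_ge0// pi_ge0.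
  rewrite !gkM !sM//; congr ((4 * pi * Num.sqrt _)^-1 * expR _).
    by rewrite /w [RHS]mulrC divfK// gt_eqF.
  by rewrite /w /c; field; rewrite !gt_eqF.
under eq_Rintegral do rewrite E.
by rewrite RintZ; [rewrite Rint_gk_sub// mulr1|exact: intg_gk_sub].
Qed.

End gauss_kernel.

(** * The first-passage identity *)

Section hitting.
Context {R : realType}.
Local Notation mu := (@lebesgue_measure R).
Implicit Types r a b t s : R.

(** The primitive of the first-passage integrand is a combination of two values of this function;
    its limits 0 and 1 give the boundary terms. *)
Definition gcdf t r : R := \int[mu]_(q in [set` `]-oo, r]]) gk q t.

Lemma continuous_gk t : continuous (gk ^~ t : R -> R).
Proof.
move=> r; apply: differentiable_continuous; apply/derivable1_diffP.
by have := is_derive_gk r t => h; exact: ex_derive.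
Qed.

Lemma is_derive_gcdf t r : 0 < t -> is_derive r 1 (gcdf t) (gk r t).
Proof.
move=> t0; have [||||df dE] := @continuous_FTC1 R (gk ^~ t) -oo%O r (r + 1).
- by rewrite ltrDl.
- exact: (integrableS measurableT _ _ (intg_gk t0)).
- by rewrite /Order.lt/=.
- exact: continuous_gk.
by apply: (DeriveDef df); rewrite -derive1E; exact: dE.
Qed.

Lemma gcdf_cvgy t (u : nat -> R) : 0 < t -> u m @[m --> \oo] --> +oo ->
  gcdf t (u m) @[m --> \oo] --> (1 : R).
Proof.
move=> t0 uy; rewrite -(Rint_gk t0) /gcdf; under eq_fun do rewrite Rint_restr.
apply: (proj2 (@Rint_dct _ _ R mu _ _ (gk ^~ t) _ _ _ (intg_gk t0) _)).
- move=> m; apply: measurable_indic_fun => //; exact: intg_meas (intg_gk t0).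
- exact: intg_meas (intg_gk t0).
- apply: aeW => q; apply: cvg_near_cst.
  move/cvgryPge: uy => /(_ q); apply: filterS => m qm.
  by rewrite /indic mem_set ?mul1r//= in_itv.
- apply: aeW => q m; rewrite /indic; case: (_ \in _).
    by rewrite mul1r ger0_norm// gk_ge0.
  by rewrite mul0r normr0 gk_ge0.
Qed.

Lemma gcdf_cvgNy t (u : nat -> R) : 0 < t -> u m @[m --> \oo] --> -oo ->
  gcdf t (u m) @[m --> \oo] --> (0 : R).
Proof.
move=> t0 uy.
have E0 : \int[mu]_r (0 : R) = 0 by rewrite /Rintegral integral0.
suff : gcdf t (u m) @[m --> \oo] --> \int[mu]_r (0 : R) by rewrite E0.
rewrite /gcdf; under eq_fun do rewrite Rint_restr.
apply: (proj2 (@Rint_dct _ _ R mu _ (fun=> 0) (gk ^~ t) _ _ _ (intg_gk t0) _)).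
- move=> m; apply: measurable_indic_fun => //; exact: intg_meas (intg_gk t0).
- exact: measurable_cst.
- apply: aeW => q; apply: cvg_near_cst.
  move/cvgrNyPlt: uy => /(_ q); apply: filterS => m qm.
  by rewrite /indic memNset ?mul0r//= in_itv/=; apply/negP; rewrite -ltNge.
- apply: aeW => q m; rewrite /indic; case: (_ \in _).
    by rewrite mul1r ger0_norm// gk_ge0.
  by rewrite mul0r normr0 gk_ge0.
Qed.

Lemma cvg_gk (T : Type) (G : set_system T) (FF : Filter G) (f h : T -> R) r t :
  0 < t -> f x @[x --> G] --> r -> h x @[x --> G] --> t ->
  gk (f x) (h x) @[x --> G] --> gk r t.
Proof.
move=> t0 fr ht; apply: cvgM.
  apply: cvgV; first by rewrite gt_eqF// sqrtr_gt0 !mulr_gt0// pi_gt0.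
  apply: (@continuous_cvg _ R R G _ (fun x => 4 * pi * h x) (@Num.sqrt R) (4 * pi * t)); first exact: sqrt_continuous.
  by apply: cvgM => //; exact: cvg_cst.
apply: (@continuous_cvg _ R R G _ (fun x => - (f x ^+ 2 / (4 * h x))) (@expR R) (- (r ^+ 2 / (4 * t)))); first exact: continuous_expR.
apply: cvgN; apply: cvgM; first by rewrite !expr2; exact: cvgM.
by apply: cvgV; [rewrite gt_eqF// mulr_gt0|apply: cvgM => //; exact: cvg_cst].
Qed.

Lemma cvg_gk1 (T : Type) (G : set_system T) (FF : Filter G) (f h : T -> R) r t :
  0 < t -> f x @[x --> G] --> r -> h x @[x --> G] --> t ->
  gk1 (f x) (h x) @[x --> G] --> gk1 r t.
Proof.
move=> t0 fr ht; apply: cvgM; last exact: cvg_gk.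
apply: cvgN; apply: cvgM => //; apply: cvgV; first by rewrite gt_eqF// mulr_gt0.
by apply: cvgM => //; exact: cvg_cst.
Qed.

Section identity.
Variables (a b t : R).
Hypotheses (a0 : 0 < a) (b0 : 0 < b) (t0 : 0 < t).

Let hit s := - 2 * gk1 a (t - s) * gk b s.
Let X (e : bool) s := (a * s + (-1) ^+ e * b * (t - s)) / Num.sqrt (s * (t - s)).
(* With [v = sqrt (s / (t - s))], completing the square both ways in the
   exponent gives the two Gaussians in [a v - b / v] and [a v + b / v]. *)
Let F s := gk (a + b) t * gcdf t (X true s) + gk (a - b) t * gcdf t (X false s).

Let dX e s : 0 < s < t ->
  is_derive s 1 (X e) ((a * s - (-1) ^+ e * b * (t - s)) * t / (2 * Num.sqrt (s * (t - s)) ^+ 3)).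
Proof.
move=> /andP[s0 st]; have ts0 : 0 < t - s by rewrite subr_gt0.
have w0 : 0 < s * (t - s) by rewrite mulr_gt0.
have sw0 : 0 < Num.sqrt (s * (t - s)) by rewrite sqrtr_gt0.
have dp : is_derive s 1 (fun s => s * (t - s)) (t - 2 * s).
  by apply: is_derive_eq; rewrite /GRing.scale/=; ring.
have dw : is_derive s 1 (fun s => Num.sqrt (s * (t - s)))
    ((2 * Num.sqrt (s * (t - s)))^-1 * (t - 2 * s)).
  exact: (@is_derive1_comp R Num.sqrt (fun s => s * (t - s)) s _ _ (is_derive1_sqrt w0) dp).
have dV := @is_deriveV R (fun s => Num.sqrt (s * (t - s))) s _ _ (lt0r_neq0 sw0) dw.
have dn : is_derive s 1 (fun s => a * s + (-1) ^+ e * b * (t - s)) (a - (-1) ^+ e * b).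
  by apply: is_derive_eq; rewrite /GRing.scale/=; ring.
apply: (is_derive_eq (is_deriveM dn dV)); rewrite /GRing.scale/=.
have sE := sqr_sqrtr (ltW w0); set w := Num.sqrt _ in sw0 sE *.
transitivity ((- (a * s + (-1) ^+ e * b * (t - s)) * (t - 2 * s)
    + 2 * w ^+ 2 * (a - (-1) ^+ e * b)) / (2 * w ^+ 3)).
  by field; rewrite gt_eqF.
by rewrite sE; congr (_ / _); ring.
Qed.

(** The signs in the two squares are opposite, so that the cross terms [2 a b] cancel for either
    [e]; the factor [sqrt (s (t - s)) / t] compares the normalizations. *)
Let gg e s : 0 < s < t -> gk (a + (-1) ^+ (~~ e) * b) t * gk (X e s) t =
  Num.sqrt (s * (t - s)) / t * (gk a (t - s) * gk b s).
Proof.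
move=> /andP[s0 st]; have ts0 : 0 < t - s by rewrite subr_gt0.
have w0 : 0 < s * (t - s) by rewrite mulr_gt0.
have sw0 : 0 < Num.sqrt (s * (t - s)) by rewrite sqrtr_gt0.
have pi0 : 0 < 4 * pi :> R by rewrite mulr_gt0// pi_gt0.
have e2 : ((-1) ^+ e : R) ^+ 2 = 1 by rewrite sqrr_sign.
have E1 : Num.sqrt (4 * pi * t) * Num.sqrt (4 * pi * t) = 4 * pi * t :> R.
  by rewrite -expr2 sqr_sqrtr// mulr_ge0 ?ltW.
have E2 : Num.sqrt (4 * pi * (t - s)) * Num.sqrt (4 * pi * s) =
    4 * pi * Num.sqrt (s * (t - s)).
  rewrite -sqrtrM; last by rewrite mulr_ge0// ltW.
  rewrite (_ : 4 * pi * (t - s) * (4 * pi * s) = (4 * pi) ^+ 2 * (s * (t - s))); last by ring.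
  by rewrite sqrtrM ?sqr_ge0// sqrtr_sqr ger0_norm// ltW.
rewrite !gkM E1 E2 mulrA; congr (_ * expR _).
  have pi1 : 0 < pi :> R := pi_gt0 R.
  move: (pi : R) pi1 => P P0.
  by field; rewrite (gt_eqF sw0) (gt_eqF t0) (gt_eqF P0).
rewrite /X expr_div_n sqr_sqrtr ?ltW// signrN.
have -> : (a + - (-1) ^+ e * b) ^+ 2 =
    a ^+ 2 - 2 * (-1) ^+ e * a * b + ((-1) ^+ e) ^+ 2 * b ^+ 2 by ring.
have -> : (a * s + (-1) ^+ e * b * (t - s)) ^+ 2 = (a * s) ^+ 2 +
    2 * (-1) ^+ e * a * b * s * (t - s) + ((-1) ^+ e) ^+ 2 * b ^+ 2 * (t - s) ^+ 2 by ring.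
rewrite e2 !mul1r.
by field; rewrite !gt_eqF.
Qed.

Let dF s : 0 < s < t -> is_derive s 1 F (hit s).
Proof.
move=> hs; have /andP[s0 st] := hs; have ts0 : 0 < t - s by rewrite subr_gt0.
have d1 := @is_derive1_comp R (gcdf t) (X true) s _ _ (is_derive_gcdf (X true s) t0) (dX true hs).
have d2 := @is_derive1_comp R (gcdf t) (X false) s _ _ (is_derive_gcdf (X false s) t0) (dX false hs).
have d3 := is_deriveZ (gk (a + b) t) d1.
have d4 := is_deriveZ (gk (a - b) t) d2.
apply: (is_derive_eq (is_deriveD d3 d4)); rewrite /GRing.scale/=.
have := gg true hs; have := gg false hs; rewrite /= expr0 expr1 mul1r mulN1r.
rewrite [X in _ -> _ -> X + _ = _]mulrA [X in _ -> _ -> _ + X = _]mulrA => -> ->; rewrite /hit /gk1.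
have w0 : 0 < s * (t - s) by rewrite mulr_gt0.
have sw0 : 0 < Num.sqrt (s * (t - s)) by rewrite sqrtr_gt0.
have sE := sqr_sqrtr (ltW w0); set w := Num.sqrt _ in sw0 sE *.
set A := gk a _; set B := gk b _.
(* The two derivatives carry the weights [a s + b (t - s)] and [a s - b (t - s)]; their sum [2 a s]
   no longer contains [b]. *)
transitivity (A * B * (2 * a * s) / (2 * w ^+ 2)).
  by field; rewrite !gt_eqF.
by rewrite sE; field; rewrite !gt_eqF.
Qed.

(** The ends cut off the fraction [1 / (M + 1)] of the interval with [M = m + 2], so that
    [s / (t - s)] equals [1 / M] or [M] and [X] is explicit there; the denominator [m + 3 > 2] keeps
    [am m < bm m]. *)
Let am m : R := t / m.+3%:R.
Let bm m : R := t - t / m.+3%:R.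

Let sqrt_scale (M : R) : 0 < M ->
  Num.sqrt ((t / (M + 1)) ^+ 2 * M) = t / (M + 1) * Num.sqrt M.
Proof.
move=> M0; rewrite sqrtrM ?sqr_ge0// sqrtr_sqr ger0_norm//.
by rewrite divr_ge0// ltW// ltr_wpDr.
Qed.

Let Xa e (M : R) : 0 < M ->
  X e (t / (M + 1)) = a / Num.sqrt M + (-1) ^+ e * b * Num.sqrt M.
Proof.
move=> M0; have sm : 0 < Num.sqrt M by rewrite sqrtr_gt0.
have M1 : 0 < M + 1 by rewrite ltr_wpDr.
have tE : t - t / (M + 1) = t / (M + 1) * M by field; rewrite gt_eqF.
rewrite /X tE (_ : t / (M + 1) * (t / (M + 1) * M) = (t / (M + 1)) ^+ 2 * M).
  rewrite sqrt_scale//; have := sqr_sqrtr (ltW M0).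
  move: (Num.sqrt M) sm => r r0 ME; rewrite -ME in M1 *.
  by field; rewrite (gt_eqF M1) (gt_eqF t0) (gt_eqF r0).
by rewrite expr2 mulrA.
Qed.

Let Xb e (M : R) : 0 < M ->
  X e (t - t / (M + 1)) = a * Num.sqrt M + (-1) ^+ e * b / Num.sqrt M.
Proof.
move=> M0; have sm : 0 < Num.sqrt M by rewrite sqrtr_gt0.
have M1 : 0 < M + 1 by rewrite ltr_wpDr.
have tE : t - t / (M + 1) = t / (M + 1) * M by field; rewrite gt_eqF.
rewrite /X subKr tE (_ : t / (M + 1) * M * (t / (M + 1)) = (t / (M + 1)) ^+ 2 * M).
  rewrite sqrt_scale//; have := sqr_sqrtr (ltW M0).
  move: (Num.sqrt M) sm => r r0 ME; rewrite -ME in M1 *.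
  by field; rewrite (gt_eqF M1) (gt_eqF t0) (gt_eqF r0).
by rewrite expr2 mulrAC.
Qed.

Let Xam e m : X e (am m) = a / Num.sqrt m.+2%:R + (-1) ^+ e * b * Num.sqrt m.+2%:R.
Proof. by rewrite /am -natr1 Xa. Qed.

Let Xbm e m : X e (bm m) = a * Num.sqrt m.+2%:R + (-1) ^+ e * b / Num.sqrt m.+2%:R.
Proof. by rewrite /bm -natr1 Xb. Qed.

Let sqrt_cvgy : (Num.sqrt m.+2%:R : R) @[m --> \oo] --> +oo.
Proof.
apply/cvgryPge => A; near=> m.
have [A0|A0] := ltP A 0; first by rewrite (le_trans (ltW A0))// sqrtr_ge0.
rewrite -(ger0_norm A0) -sqrtr_sqr ler_wsqrtr//.
have h : A ^+ 2 <= m%:R.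
  near: m; have := @cvgr_idn R => /cvgryPge; exact.
by rewrite (le_trans h)// ler_nat -addn2 leq_addr.
Unshelve. all: by end_near. Qed.

(* First passage: the heat flux through the origin, run for the remaining time. *)
Lemma hitting_identity :
  intg mu (fun s => \1_(`]0, t[%classic : set R) s * hit s) /\
  \int[mu]_s (\1_(`]0, t[%classic : set R) s * hit s) = gk (a + b) t.
Proof.
have mE m : m.+3%:R = m%:R + 3 :> R by rewrite -addn3 natrD.
have amE m : 0 < am m by rewrite divr_gt0.
have in0t m x : am m <= x <= bm m -> 0 < x < t.
  move=> /andP[h1 h2]; rewrite (lt_le_trans (amE m) h1)/= (le_lt_trans h2)//.
  by rewrite /bm ltrBlDr ltrDl; exact: (amE m).
have DE : \bigcup_m `[am m, bm m]%classic = `]0, t[%classic.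
  apply/seteqP; split => x /=.
    by case=> m _ /=; rewrite !in_itv/=; exact: in0t.
  rewrite in_itv/= => /andP[x0 xt].
  have tx0 : 0 < t - x by rewrite subr_gt0.
  pose e := Num.min x (t - x); have e0 : 0 < e by rewrite lt_min x0.
  have /cvgryPge/(_ (t / e)) [N _ hN] := @cvgr_idn R.
  exists N => //=; rewrite in_itv/=.
  have amx : am N <= e.
    rewrite /am ler_pdivrMr// mulrC -ler_pdivrMr// (le_trans (hN _ (leqnn _)))// ler_nat.
    by rewrite -addn3 leq_addr.
  move: amx; rewrite le_min => /andP[h1 h2]; by rewrite h1/= /bm -/(am N) lerBrDl -lerBrDr.
have := @ge0_FTC_bigcup R hit F am bm (gk (a + b) t).
rewrite DE; apply.
- move=> m; rewrite /am /bm ltrBrDr -mulrDl ltr_pdivrMr// mE.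
  by have := mulr_ge0 (ltW t0) (ler0n R m); move: t0; lra.
- move=> m n mn; rewrite /am ler_pM2l// lef_pV2 ?posrE// ler_nat.
  by rewrite !ltnS.
- move=> m n mn; rewrite /bm lerD2l lerN2 ler_pM2l// lef_pV2 ?posrE// ler_nat.
  by rewrite !ltnS.
- by move=> m x /in0t; exact: dF.
- move=> m x /in0t /andP[x0 xt]; rewrite /continuous_at /hit.
  have cx : s @[s --> x] --> x by [].
  apply: cvgM; last by apply: cvg_gk => //; exact: cvg_cst.
  apply: cvgM; first exact: cvg_cst.
  apply: cvg_gk1; [by rewrite subr_gt0|exact: cvg_cst|].
  by apply: cvgB => //; exact: cvg_cst.
- move=> m x /in0t /andP[x0 xt]; rewrite /hit mulr_ge0 ?gk_ge0// /gk1.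
  rewrite mulrA mulrNN mulr_ge0 ?gk_ge0// mulr_ge0// divr_ge0 ?ltW// mulr_gt0//.
  by rewrite subr_gt0.
- have sV : (Num.sqrt m.+2%:R : R)^-1 @[m --> \oo] --> (0 : R).
    apply/gtr0_cvgV0; last exact: sqrt_cvgy.
    by apply: nearW => m; rewrite sqrtr_gt0.
  have cy (c c' : R) : 0 < c -> c * Num.sqrt m.+2%:R + c' / Num.sqrt m.+2%:R @[m --> \oo] --> +oo.
    move=> c0; apply/cvgryPge => A.
    have /cvgryPge/(_ ((A + `|c'|) / c)) := sqrt_cvgy; apply: filterS => m.
    rewrite ler_pdivrMr// mulrC => h.
    have s1 : (Num.sqrt m.+2%:R : R)^-1 <= 1.
      rewrite invf_le1 ?sqrtr_gt0// -[leLHS]sqrtr1 ler_wsqrtr// ler1n//.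
    have : - `|c'| <= c' / Num.sqrt m.+2%:R; last lra.
    rewrite lerNl (le_trans (ler_norm _))// normrN normrM ler_piMr//.
    by rewrite ger0_norm// invr_ge0 sqrtr_ge0.
  have l1 : gcdf t (X true (bm m)) @[m --> \oo] --> (1 : R).
    by apply: gcdf_cvgy => //; under eq_fun do rewrite Xbm; exact: cy.
  have l2 : gcdf t (X false (bm m)) @[m --> \oo] --> (1 : R).
    by apply: gcdf_cvgy => //; under eq_fun do rewrite Xbm; exact: cy.
  have l3 : gcdf t (X false (am m)) @[m --> \oo] --> (1 : R).
    apply: gcdf_cvgy => //; under eq_fun do rewrite Xam expr0 mul1r addrC; exact: cy.
  have l4 : gcdf t (X true (am m)) @[m --> \oo] --> (0 : R).
    apply: gcdf_cvgNy => //; under eq_fun do rewrite Xam expr1 mulN1r.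
    apply/cvgNry; rewrite (_ : - _ = fun m => b * Num.sqrt m.+2%:R + (- a) / Num.sqrt m.+2%:R).
      exact: cy.
    by apply/funext => m; rewrite fctE; ring.
  (* At [s = t] both arguments tend to [+oo]; at [s = 0] the one with the minus sign tends to [-oo],
     the other to [+oo]. The two terms with [gk (a - b) t] cancel. *)
  rewrite [X in _ --> X](_ : _ = gk (a + b) t * 1 + gk (a - b) t * 1 -
     (gk (a + b) t * 0 + gk (a - b) t * 1)); last by ring.
  by apply: cvgB; apply: cvgD; apply: cvgM => //; exact: cvg_cst.
Qed.

End identity.
End hitting.

(** * One-dimensional weights and singularities *)

Section one_dimensional.
Context {R : realType}.
Local Notation mu := (@lebesgue_measure R).
Implicit Types r s t p : R.

Lemma intg_even (F : R -> R) : measurable_fun [set: measurableTypeR R] F ->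
  intg mu (fun r => \1_(`]0, +oo[%classic : set R) r * F r) ->
  intg mu (fun r => F `|r|).
Proof.
move=> mF Fi; have Fi' := intg1_sub 0 Fi.
apply: (intg_le_ae _ (intgD (intg_norm Fi) (intg_norm Fi'))).
  exact: (measurableT_comp mF).
apply: aeS (ae_neq (0 : R)) => r r0; rewrite sub0r /indic.
have [rp|rn] := ltP 0 r.
  rewrite [r \in _]mem_set ?mul1r ?(gtr0_norm rp)//=; last by rewrite in_itv/= rp.
  by rewrite lerDl.
have rp : 0 < - r by rewrite oppr_gt0 lt_neqAle r0.
rewrite [- r \in _]mem_set ?mul1r ?(ler0_norm rn)//=; last by rewrite in_itv/= rp.
by rewrite lerDr.
Qed.

(** The unit in which decay is counted: [rho ^ 2] is integrable on the line, [rho] itself is not. *)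
Definition rho r : R := (1 + `|r|)^-1.

Lemma rho_gt0 r : 0 < rho r.
Proof. by rewrite invr_gt0 ltr_wpDr. Qed.

Lemma rho_ge0 r : 0 <= rho r. Proof. exact/ltW/rho_gt0. Qed.

Lemma rho_le1 r : rho r <= 1.
Proof. by rewrite invf_le1 ?ltr_wpDr// lerDl. Qed.

(* Peetre's inequality. *)
Lemma rho_sub r s : rho (r - s) <= rho r * (1 + `|s|).
Proof.
rewrite /rho mulrC ler_pdivlMr ?ltr_wpDr// mulrC ler_pdivrMr ?ltr_wpDr//.
rewrite mulrDl mul1r mulrDr mulr1.
have := ler_normD (r - s) s; rewrite subrK => h.
have := mulr_ge0 (normr_ge0 s) (normr_ge0 (r - s)); lra.
Qed.

Lemma measurable_rho : measurable_fun [set: measurableTypeR R] rho.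
Proof.
by apply: measurable_fun_inv; apply: measurable_funD => //; exact: measurableT_comp.
Qed.

Lemma intg_rho2 : intg mu (fun r => rho r ^+ 2).
Proof.
pose F r : R := (1 + r)^-1 ^+ 2.
rewrite (_ : (fun r => _) = fun r => F `|r|)//; apply: intg_even.
  apply: measurable_funX; apply: measurable_fun_inv; exact: measurable_funD.
pose G r : R := - (1 + r)^-1.
pose am m : R := m.+1%:R^-1; pose bm m : R := m.+2%:R.
have in0 m x : am m <= x <= bm m -> 0 < x.
  by move=> /andP[h1 _]; rewrite (lt_le_trans _ h1)// invr_gt0.
have DE : \bigcup_m `[am m, bm m]%classic = `]0, +oo[%classic.
  apply/seteqP; split => x /=.
    by case=> m _ /=; rewrite !in_itv/= andbT; exact: in0.
  rewrite in_itv/= andbT => x0.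
  have /cvgryPge/(_ (Num.max x x^-1)) [N _ hN] := @cvgr_idn R.
  have := hN N (leqnn _); rewrite /= ge_max => /andP[h1 h2].
  exists N => //=; rewrite in_itv/= /am /bm; apply/andP; split.
    rewrite -[leRHS]invrK lef_pV2 ?posrE// ?invr_gt0//.
    by rewrite (le_trans h2)// ler_nat.
  by rewrite (le_trans h1)// ler_nat -addn2 leq_addr.
have := @ge0_FTC_bigcup R F G am bm 1.
rewrite DE => h; apply: (proj1 (h _ _ _ _ _ _ _)).
- move=> m; rewrite /am /bm (@le_lt_trans _ _ 1)//; last by rewrite ltr1n.
  by rewrite invf_le1// ler1n.
- by move=> m n mn; rewrite lef_pV2 ?posrE// ler_nat ltnS.
- by move=> m n mn; rewrite ler_nat !ltnS.
- move=> m x /in0 x0; have x1 : 1 + x != 0 by rewrite gt_eqF// ltr_wpDr// ltW.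
  have d1 : is_derive x 1 (fun x : R => 1 + x) 1.
    by apply: is_derive_eq; rewrite /GRing.scale /=; ring.
  apply: (is_derive_eq (is_deriveN (@is_deriveV R (fun x => 1 + x) x _ _ x1 d1))).
  by rewrite /GRing.scale/= mulr1 opprK /F exprVn.
- move=> m x /in0 x0; rewrite (_ : F = fun r => (1 + r)^-1 * (1 + r)^-1) /continuous_at; last first.
    by apply/funext => r; rewrite /F expr2.
  have x1 : 1 + x != 0 by rewrite gt_eqF// ltr_wpDr// ltW.
  by apply: cvgM; apply: cvgV => //; apply: cvgD; [exact: cvg_cst|exact: cvg_id|exact: cvg_cst|exact: cvg_id].
- by move=> m x _; rewrite sqr_ge0.
- have l0 (c : nat) : (m%:R + c.+1%:R : R)^-1 @[m --> \oo] --> (0 : R).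
    apply/gtr0_cvgV0; first by apply: nearW => m; rewrite ltr_wpDl.
    apply/cvgryPge => A; have /cvgryPge/(_ A) := @cvgr_idn R.
    by apply: filterS => m hm; rewrite (le_trans hm)// lerDl.
  rewrite [X in _ --> X](_ : _ = - 0 - - (1 + 0)^-1); last by rewrite oppr0 addr0 invr1; ring.
  apply: cvgB.
    apply: cvgN; rewrite (_ : (fun m => _) = fun m => (m%:R + 3%:R : R)^-1); first exact: (l0 2%N).
    by apply/funext => m; rewrite /bm nat1r -addn3 natrD.
  apply: cvgN; apply: cvgV; first by rewrite addr0 oner_neq0.
  apply: cvgD; first exact: cvg_cst.
  rewrite (_ : am = fun m => (m%:R + 1%:R : R)^-1); first exact: (l0 0%N).
  by apply/funext => m; rewrite /am natr1.
Qed.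

(** The share of a singularity that a single coordinate carries; the cut at 1 leaves decay to
    [rho]. *)
Definition hs p r : R := \1_(`]-1, 1[%classic : set R) r * `|r| `^ (- p).

Lemma hs_ge0 p r : 0 <= hs p r.
Proof. by rewrite mulr_ge0 ?powR_ge0// /indic; case: (_ \in _). Qed.

Lemma intg_hs p : 0 <= p < 1 -> intg mu (hs p).
Proof.
move=> /andP[p0 p1].
pose H r : R := \1_(`]0, 1[%classic : set R) r * expR (- p * ln r).
have mH : measurable_fun [set: measurableTypeR R] H.
  apply: measurable_indic_fun => //; apply: measurableT_comp => //.
  by apply: measurable_funM => //; exact: measurable_ln.
pose G r : R := (1 - p)^-1 * expR ((1 - p) * ln r).
(* Exponential end points make the logarithms in the primitive [G] explicit. *)
pose am m : R := expR (- m.+1%:R); pose bm m : R := expR (- m.+2%:R^-1).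
have in0 m x : am m <= x <= bm m -> 0 < x < 1.
  move=> /andP[h1 h2]; rewrite (lt_le_trans _ h1) ?expR_gt0//=.
  by rewrite (le_lt_trans h2)// -expR0 ltr_expR oppr_lt0 invr_gt0.
have DE : \bigcup_m `[am m, bm m]%classic = `]0, 1[%classic.
  apply/seteqP; split => x /=.
    by case=> m _ /=; rewrite !in_itv/=; exact: in0.
  rewrite in_itv/= => /andP[x0 x1].
  have y0 : 0 < - ln x by rewrite oppr_gt0 ln_lt0// x0.
  have /cvgryPge/(_ (Num.max (- ln x) (- ln x)^-1)) [N _ hN] := @cvgr_idn R.
  have := hN N (leqnn _); rewrite /= ge_max => /andP[h1 h2].
  exists N => //=; rewrite in_itv/= /am /bm -[x]lnK ?posrE// !ler_expR; apply/andP; split.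
    by rewrite lerNl (le_trans h1)// ler_nat.
  rewrite lerNr -[leRHS]invrK lef_pV2 ?posrE// ?invr_gt0//.
  by rewrite (le_trans h2)// ler_nat -addn2 leq_addr.
have q0 : 0 < 1 - p by rewrite subr_gt0.
have Hi : intg mu H.
  have := @ge0_FTC_bigcup R (fun r => expR (- p * ln r)) G am bm (1 - p)^-1.
  rewrite DE => h; apply: (proj1 (h _ _ _ _ _ _ _)).
  - move=> m; rewrite ltr_expR ltrN2 (@lt_le_trans _ _ 1) ?ler1n//.
    by rewrite invf_lt1// ltr1n.
  - by move=> m n mn; rewrite ler_expR lerN2 ler_nat ltnS.
  - by move=> m n mn; rewrite ler_expR lerN2 lef_pV2 ?posrE// ler_nat !ltnS.
  - move=> m x /in0/andP[x0 x1]; have dl := is_derive1_ln x0.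
    have d1 := is_deriveZ (1 - p) dl.
    have d2 := @is_derive1_comp R expR (fun x => (1 - p) * ln x) x _ _ (is_derive_expR _) d1.
    apply: (is_derive_eq (is_deriveZ (1 - p)^-1 d2)); rewrite /GRing.scale/=.
    have -> : (1 - p) * ln x = ln x + - p * ln x by ring.
    rewrite expRD lnK ?posrE//; field.
    by rewrite !gt_eqF//.
  - move=> m x /in0/andP[x0 x1].
    apply: (@continuous_cvg _ R R (nbhs x) _ (fun r => - p * ln r) (@expR R) (- p * ln x)).
      exact: continuous_expR.
    by apply: cvgM; [exact: cvg_cst|exact: continuous_ln].
  - by move=> m x _; rewrite expR_ge0.
  - have c1 : (1 - p) * - m.+2%:R^-1 @[m --> \oo] --> (1 - p) * - (0 : R).
      apply: cvgM; first exact: cvg_cst.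
      apply: cvgN; apply/gtr0_cvgV0; first by apply: nearW.
      apply/cvgryPge => A; have /cvgryPge/(_ A) := @cvgr_idn R.
      by apply: filterS => m hm; rewrite (le_trans hm)// ler_nat -addn2 leq_addr.
    have c2 : expR (- (1 - p)) * expR (- (1 - p)) ^+ m @[m --> \oo] -->
        expR (- (1 - p)) * (0 : R).
      apply: cvgM; first exact: cvg_cst.
      by apply: cvg_expr; rewrite ger0_norm ?expR_ge0// expR_lt1 oppr_lt0.
    have c3 : G (bm m) @[m --> \oo] --> (1 - p)^-1 * expR ((1 - p) * - (0 : R)).
      apply: cvgM; first exact: cvg_cst.
      rewrite (_ : (fun m => _) = fun m => expR ((1 - p) * - m.+2%:R^-1)).
        apply: (@continuous_cvg _ R R \oo _ _ (@expR R) _ _ c1).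
        exact: continuous_expR.
      by apply/funext => m; rewrite /bm expRK.
    have c4 : G (am m) @[m --> \oo] --> (1 - p)^-1 * (expR (- (1 - p)) * 0).
      apply: cvgM; first exact: cvg_cst.
      rewrite (_ : (fun m => _) = fun m => expR (- (1 - p)) * expR (- (1 - p)) ^+ m)//.
      apply/funext => m; rewrite /am expRK -exprS -expRM_natr; congr expR; ring.
    have := cvgB c3 c4; rewrite oppr0 !mulr0 expR0 mulr1 subr0; exact.
have H0 r : 0 <= H r by rewrite mulr_ge0 ?expR_ge0// /indic; case: (_ \in _).
have Hi2 : intg mu (fun r => H `|r|).
  apply: intg_even => //; apply: (intg_le _ Hi).
    by apply: measurable_indic_fun.
  move=> r; rewrite /indic; case: (_ \in _); rewrite ?mul1r ?mul0r ?normr0//.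
  by rewrite ger0_norm.
apply: (intg_le_ae _ Hi2).
  apply: measurable_indic_fun => //.
  by apply: (measurableT_comp (measurable_powR _)); apply: normr_measurable.
apply: aeS (ae_neq (0 : R)) => r r0; rewrite ger0_norm ?hs_ge0// /hs /H /indic.
rewrite /powR normr_eq0 (negbTE r0); have [/set_mem/= r1|] := boolP (r \in _); last first.
  by rewrite mul0r mulr_ge0 ?expR_ge0.
by rewrite [`|r| \in _]mem_set//= in_itv/= normr_gt0 r0/= ltr_norml; move: r1; rewrite in_itv.
Qed.

End one_dimensional.

(** * The Gaussian and convolutions with it *)

Section lines.
Context {R : realType} {n : nat}.
Implicit Types (x v : 'rV[R]_n) (f : 'rV[R]_n -> R) (i j k : 'I_n).

Definition ed i : 'rV[R]_n := delta_mx ord0 i.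

Lemma edE i k : ed i ord0 k = (k == i)%:R.
Proof. by rewrite mxE eqxx. Qed.

Lemma lineE i h x k : (h *: ed i + x) ord0 k = (k == i)%:R * h + x ord0 k.
Proof. by rewrite !mxE eqxx /= mulrC. Qed.

(** Turns derivatives along a coordinate vector into derivatives on the line, where the chain rule,
    the product rule and the mean value theorem are at hand. *)
Lemma is_derive_lineP i f x (l : R) :
  is_derive (0 : R) 1 (fun h : R => f (h *: ed i + x)) l <-> is_derive x (ed i) f l.
Proof.
have E : (fun h : R => h^-1 *: (((fun h : R => f (h *: ed i + x)) \o shift 0) (h *: 1) -
    f (0 *: ed i + x))) = (fun h : R => h^-1 *: ((f \o shift x) (h *: ed i) - f x)).
  apply/funext => h /=; rewrite addr0 scale0r add0r.
  by congr (_ *: (f (_ *: _ + _) - _)); rewrite /GRing.scale/= mulr1.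
split=> -[dl vl]; split.
- by rewrite /derivable -E.
- by rewrite -vl /derive E.
- by rewrite /derivable E.
- by rewrite -vl /derive E.
Qed.

Lemma is_derive_lineP_at i f x h (l : R) :
  is_derive (h *: ed i + x) (ed i) f l ->
  is_derive h 1 (fun h : R => f (h *: ed i + x)) l.
Proof.
move=> /is_derive_lineP dl.
have E : (fun r : R => f (r *: ed i + x)) =
    (fun r => f (r *: ed i + (h *: ed i + x))) \o (fun r => r - h).
  by apply/funext => r /=; rewrite addrA -scalerDl subrK.
rewrite E -[l]mulr1.
have d1 : is_derive h 1 (fun r => r - h) 1.
  by apply: is_derive_eq; rewrite /GRing.scale/=; ring.
apply: (@is_derive1_comp R (fun r => f (r *: ed i + (h *: ed i + x))) (fun r => r - h)).
by rewrite subrr.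
Qed.

End lines.

Section product_gauss.
Context {R : realType}.
Local Notation mu := (@lebesgue_measure R).

Section fixed_dimension.
Context {n : nat}.
Local Notation V := 'rV[R]_n.
Local Notation mun := (lebesgue_rV R n).
Implicit Types (v w x : V) (t s : R) (i j k : 'I_n).

(** The heat kernel in factorized form, so that every bound reduces to one coordinate; it agrees
    with [heat] at positive times by [heatE]. *)
Definition Gam v t : R := \prod_k gk (v ord0 k) t.
Definition Gam1 j v t : R := - (v ord0 j / (2 * t)) * Gam v t.
Definition Gam2 i j v t : R :=
  (v ord0 i * v ord0 j / (4 * t ^+ 2) - (i == j)%:R / (2 * t)) * Gam v t.

Lemma Gam_ge0 v t : 0 <= Gam v t.
Proof. by apply: prodr_ge0 => k _; exact: gk_ge0. Qed.

Lemma measurable_Gam d (T : measurableType d) (f : T -> V) (h : T -> R) :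
  (forall k, measurable_fun setT (fun y => f y ord0 k)) -> measurable_fun setT h ->
  measurable_fun setT (fun y => Gam (f y) (h y)).
Proof. by move=> mf mh; apply: measurable_prod => k _; exact: measurable_gk. Qed.

Lemma measurable_Gam1 j d (T : measurableType d) (f : T -> V) (h : T -> R) :
  (forall k, measurable_fun setT (fun y => f y ord0 k)) -> measurable_fun setT h ->
  measurable_fun setT (fun y => Gam1 j (f y) (h y)).
Proof.
move=> mf mh; apply: measurable_funM; last exact: measurable_Gam.
apply: measurableT_comp => //; apply: measurable_funM; first exact: mf.
by apply: measurable_fun_inv; exact: measurable_funM.
Qed.

Lemma measurable_Gam2 i j d (T : measurableType d) (f : T -> V) (h : T -> R) :
  (forall k, measurable_fun setT (fun y => f y ord0 k)) -> measurable_fun setT h ->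
  measurable_fun setT (fun y => Gam2 i j (f y) (h y)).
Proof.
move=> mf mh; apply: measurable_funM; last exact: measurable_Gam.
apply: measurable_funB.
  apply: measurable_funM; first exact: measurable_funM.
  by apply: measurable_fun_inv; apply: measurable_funM => //; exact: measurable_funX.
by apply: measurable_funM => //; apply: measurable_fun_inv; exact: measurable_funM.
Qed.

Lemma intg_Gam_Rint t : 0 < t -> intg mun (Gam ^~ t) /\ \int[mun]_z Gam z t = 1.
Proof.
move=> t0; have [ii iE] := intg_Rint_prodf (fun k : 'I_n => intg_gk t0).
split => //; rewrite iE (eq_bigr (fun=> 1)) ?big1// => k _; exact: Rint_gk.
Qed.

Lemma Gam_semigroup a b t s : 0 < t -> 0 < s ->
  \int[mun]_z (Gam (a - z) t * Gam (z - b) s) = Gam (a - b) (t + s).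
Proof.
move=> t0 s0.
have gi k : intg mu (fun r => gk (a ord0 k - r) t * gk (r - b ord0 k) s).
  apply: (intg_le _ (intgZr ((Num.sqrt (4 * pi * s))^-1) (intg_gk_sub (a ord0 k) t0))).
    apply: measurable_funM; apply: measurable_gk => //.
    - exact: measurable_funB.
    - exact: measurable_funB.
  move=> r; rewrite ger0_norm ?mulr_ge0 ?gk_ge0// ler_wpM2l ?gk_ge0//.
  exact: gk_le.
under eq_Rintegral => z _.
  rewrite -big_split/=.
  under eq_bigr do rewrite !mxE.
  over.
rewrite (Rint_prodf gi); apply: eq_bigr => k _.
by rewrite gk_semigroup// !mxE.
Qed.

Lemma is_derive_Gam j v t : is_derive v (ed j) (Gam ^~ t) (Gam1 j v t).
Proof.
apply/is_derive_lineP; pose c := \prod_(k | k != j) gk (v ord0 k) t.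
rewrite (_ : (fun h => _) = fun h => c * gk (h + v ord0 j) t); last first.
  apply/funext => h; rewrite /Gam (bigD1 j)//= lineE eqxx mul1r mulrC; congr (_ * _).
  by apply: eq_bigr => k /negbTE kj; rewrite lineE kj mul0r add0r.
have d1 : is_derive (0 : R) 1 (fun h => h + v ord0 j) 1.
  by apply: is_derive_eq; rewrite /GRing.scale/=; ring.
have d2 := @is_derive1_comp R (gk ^~ t) (fun h => h + v ord0 j) 0 _ _ (is_derive_gk _ t) d1.
apply: (is_derive_eq (is_deriveZ c d2)); rewrite /GRing.scale/= add0r mulr1 /gk1.
by rewrite /Gam1 /Gam (bigD1 j)//= mulrCA [c * _]mulrC.
Qed.

Lemma is_derive_Gam1 i j v t : is_derive v (ed i) (Gam1 j ^~ t) (Gam2 i j v t).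
Proof.
apply/is_derive_lineP.
have /is_derive_lineP dG := is_derive_Gam i v t.
have d1 : is_derive (0 : R) 1 (fun h => (h *: ed i + v) ord0 j / (2 * t))
    ((i == j)%:R / (2 * t)).
  rewrite (_ : (fun h => _) = fun h => (2 * t)^-1 * ((i == j)%:R * h + v ord0 j)).
    by apply: is_derive_eq; rewrite /GRing.scale/=; ring.
  by apply/funext => h; rewrite lineE eq_sym mulrC.
apply: (is_derive_eq (is_deriveM (is_deriveN d1) dG)).
have -> : (- (fun h : R => (h *: ed i + v) ord0 j / (2 * t))) 0 = - (v ord0 j / (2 * t)).
  by rewrite -[LHS]/(- ((0 *: ed i + v) ord0 j / (2 * t))) scale0r add0r.
rewrite scale0r add0r /GRing.scale/= /Gam2 /Gam1.
set q := Gam v t; set p := (_ == _)%:R.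
have [->|t0] := eqVneq t 0; first by rewrite !mulr0 expr0n/= mulr0 !invr0; ring.
by field.
Qed.

(** [Kn 6] pays for six powers of [sg]: three appear in the estimates, and three are traded for
    [rho ^ 3] through [1 <= (1 + sqrt t) * (sg r t * rho r)]. *)
Definition cM t : R := Kn 6 * (1 + Num.sqrt t) ^+ 3.

Lemma cM_gt0 t : 0 < cM t.
Proof. by rewrite mulr_gt0 ?Kn_gt0// exprn_gt0// ltr_wpDr// sqrtr_ge0. Qed.

Lemma cM_le s t : s <= t -> cM s <= cM t.
Proof.
move=> st; rewrite /cM ler_wpM2l ?(ltW (Kn_gt0 _))//.
by apply: lerXn2r; rewrite ?nnegrE ?addr_ge0 ?sqrtr_ge0// lerD2l ler_wsqrtr.
Qed.

Lemma sg_gk_rho r t : 0 < t -> sg r t ^+ 3 * gk r t <= cM t * (rho r ^+ 3 * gk r (2 * t)).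
Proof.
move=> t0; have st : 0 < Num.sqrt t by rewrite sqrtr_gt0.
have h : 1 <= (1 + Num.sqrt t) * (sg r t * rho r).
  rewrite /rho mulrA ler_pdivlMr ?ltr_wpDr// mul1r /sg.
  have x0 : 0 <= `|r| / Num.sqrt t by rewrite divr_ge0// ltW.
  have -> : (1 + Num.sqrt t) * (1 + `|r| / Num.sqrt t) =
    1 + Num.sqrt t + `|r| / Num.sqrt t + `|r| by field; rewrite gt_eqF.
  have := ltW st; lra.
have := gk_sg 6 r t0.
have h3 : 1 <= ((1 + Num.sqrt t) * (sg r t * rho r)) ^+ 3 by apply: exprn_ege1.
rewrite !exprMn in h3.
move=> g6.
have g0 := gk_ge0 r t; have s0 := sg_gt0 r t.
apply: (@le_trans _ _ (sg r t ^+ 3 * gk r t * ((1 + Num.sqrt t) ^+ 3 * (sg r t ^+ 3 * rho r ^+ 3)))).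
  by rewrite ler_peMr// mulr_ge0// exprn_ge0// ltW.
have -> : sg r t ^+ 3 * gk r t * ((1 + Num.sqrt t) ^+ 3 * (sg r t ^+ 3 * rho r ^+ 3)) =
   (1 + Num.sqrt t) ^+ 3 * rho r ^+ 3 * (gk r t * sg r t ^+ 6).
  by move: (gk r t) (sg r t) (rho r) (Num.sqrt t) => A B C D; ring.
have -> : cM t * (rho r ^+ 3 * gk r (2 * t)) =
   (1 + Num.sqrt t) ^+ 3 * rho r ^+ 3 * (Kn 6 * gk r (2 * t)).
  by rewrite /cM; move: (gk _ _) (Kn _) (rho r) (Num.sqrt t) => A B C D; ring.
by rewrite ler_wpM2l// mulr_ge0 ?exprn_ge0 ?rho_ge0// addr_ge0// sqrtr_ge0.
Qed.

(** Of the three powers in each coordinate, one absorbs linear growth of the function convolved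
    with, and two make the result integrable. *)
Definition wt v : R := \prod_k rho (v ord0 k) ^+ 3.

Lemma wt_gt0 v : 0 < wt v.
Proof. by apply: prodr_gt0 => k _; rewrite exprn_gt0// rho_gt0. Qed.

Lemma sg_Gam_wt v t : 0 < t ->
  (\prod_k sg (v ord0 k) t) ^+ 3 * Gam v t <= cM t ^+ n * (wt v * Gam v (2 * t)).
Proof.
move=> t0; rewrite -prodrXl /Gam /wt -!big_split/=.
rewrite -[n in cM t ^+ n]card_ord -prodr_const -big_split/=.
apply: ler_prod => k _; rewrite sg_gk_rho// andbT.
by rewrite mulr_ge0 ?gk_ge0// exprn_ge0// ltW// sg_gt0.
Qed.

Lemma sg_le_prod j v t : sg (v ord0 j) t <= \prod_k sg (v ord0 k) t.
Proof.
rewrite (bigD1 j)//= ler_peMr ?(ltW (sg_gt0 _ _))//.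
rewrite -[leLHS](@big1 _ 1 *%R _ (index_enum 'I_n) (fun k => k != j) (fun=> 1))//.
by apply: ler_prod => k _; rewrite ler01 sg_ge1.
Qed.

Lemma prod_sg_ge1 v t : 1 <= \prod_k sg (v ord0 k) t.
Proof.
rewrite -[leLHS](@big1 _ 1 *%R _ (index_enum 'I_n) predT (fun=> 1))//.
by apply: ler_prod => k _; rewrite ler01 sg_ge1.
Qed.

Lemma Gam1_bound j v t : 0 < t ->
  `|Gam1 j v t| <= (Num.sqrt t)^-1 * ((\prod_k sg (v ord0 k) t) ^+ 2 * Gam v t).
Proof.
move=> t0; have st : 0 < Num.sqrt t by rewrite sqrtr_gt0.
rewrite normrM (ger0_norm (Gam_ge0 _ _)) [leRHS]mulrA ler_wpM2r ?Gam_ge0// normrN.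
rewrite normrM normfV [`|2 * t|]gtr0_norm ?mulr_gt0//.
have P1 := prod_sg_ge1 v t; have Pj := sg_le_prod j v t.
set P := \prod_k _ in P1 Pj *.
have x0 : 0 <= `|v ord0 j| / Num.sqrt t by rewrite divr_ge0// ltW.
have -> : `|v ord0 j| / (2 * t) = (Num.sqrt t)^-1 * (`|v ord0 j| / Num.sqrt t / 2).
  by rewrite -[X in 2 * X](sqr_sqrtr (ltW t0)); field; rewrite gt_eqF.
rewrite ler_pM2l ?invr_gt0//; rewrite /sg in Pj; nra.
Qed.

Lemma Gam2_bound i j v t : 0 < t ->
  `|Gam2 i j v t| <= t^-1 * ((\prod_k sg (v ord0 k) t) ^+ 2 * Gam v t).
Proof.
move=> t0; have st : 0 < Num.sqrt t by rewrite sqrtr_gt0.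
rewrite normrM (ger0_norm (Gam_ge0 _ _)) [leRHS]mulrA ler_wpM2r ?Gam_ge0//.
have P1 := prod_sg_ge1 v t; have Pj := sg_le_prod j v t; have Pi := sg_le_prod i v t.
set P := \prod_k _ in P1 Pi Pj *.
have x0 k : 0 <= `|v ord0 k| / Num.sqrt t by rewrite divr_ge0// ltW.
have xi := x0 i; have xj := x0 j.
apply: (le_trans (ler_normB _ _)).
rewrite !normrM !normfV [`|4 * _|]gtr0_norm ?mulr_gt0 ?exprn_gt0//.
rewrite [`|2 * t|]gtr0_norm ?mulr_gt0// normr_nat.
have -> : `|v ord0 i| * `|v ord0 j| / (4 * t ^+ 2) =
    t^-1 * (`|v ord0 i| / Num.sqrt t * (`|v ord0 j| / Num.sqrt t) / 4).
  have := sqr_sqrtr (ltW t0); move: (Num.sqrt t) st => r r0 <-.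
  by field; rewrite gt_eqF.
have -> : (i == j)%:R / (2 * t) = t^-1 * ((i == j)%:R / 2) by field; rewrite gt_eqF.
rewrite -mulrDr ler_pM2l ?invr_gt0//; rewrite /sg in Pi Pj.
have : (i == j)%:R <= 1 :> R by rewrite lern1 leq_b1.
nra.
Qed.

Lemma Gam_wt v t : 0 < t -> Gam v t <= cM t ^+ n * (wt v * Gam v (2 * t)).
Proof.
move=> t0; apply: le_trans (sg_Gam_wt v t0).
by rewrite ler_peMl ?Gam_ge0// exprn_ege1// prod_sg_ge1.
Qed.

Lemma Gam1_wt j v t : 0 < t ->
  `|Gam1 j v t| <= (Num.sqrt t)^-1 * cM t ^+ n * (wt v * Gam v (2 * t)).
Proof.
move=> t0; apply: (le_trans (Gam1_bound j v t0)); rewrite -[leRHS]mulrA ler_wpM2l ?invr_ge0 ?sqrtr_ge0//.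
apply: le_trans (sg_Gam_wt v t0); rewrite ler_wpM2r ?Gam_ge0//.
by rewrite ler_weXn2l// prod_sg_ge1.
Qed.

Lemma Gam2_wt i j v t : 0 < t ->
  `|Gam2 i j v t| <= t^-1 * cM t ^+ n * (wt v * Gam v (2 * t)).
Proof.
move=> t0; apply: (le_trans (Gam2_bound i j v t0)).
rewrite -[leRHS]mulrA ler_wpM2l ?invr_ge0 ?(ltW t0)//.
apply: le_trans (sg_Gam_wt v t0); rewrite ler_wpM2r ?Gam_ge0//.
by rewrite ler_weXn2l// prod_sg_ge1.
Qed.

(* One factor [|v_k| <= sqrt t * sg] improves the [1/t] of the second
   derivatives to the time-integrable [1 / sqrt t]. *)
Lemma Gam2_wt_norm i j v t : 0 < t ->
  `|Gam2 i j v t| * (\sum_k `|v ord0 k|) <=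
  n%:R * (Num.sqrt t)^-1 * cM t ^+ n * (wt v * Gam v (2 * t)).
Proof.
move=> t0; have st : 0 < Num.sqrt t by rewrite sqrtr_gt0.
have P1 := prod_sg_ge1 v t; set P := \prod_k _ in P1.
have sumle : \sum_k `|v ord0 k| <= n%:R * (Num.sqrt t * P).
  have : \sum_k `|v ord0 k| <= \sum_(k < n) (Num.sqrt t * P).
    apply: ler_sum => k _; have := sg_le_prod k v t; rewrite -/P /sg => h.
    rewrite -ler_pdivrMl// mulrC; lra.
  by rewrite sumr_const card_ord mulr_natl.
apply: (@le_trans _ _ (t^-1 * (P ^+ 2 * Gam v t) * (n%:R * (Num.sqrt t * P)))).
  by apply: ler_pM => //; [exact: sumr_ge0|exact: Gam2_bound].
have -> : t^-1 * (P ^+ 2 * Gam v t) * (n%:R * (Num.sqrt t * P)) =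
    n%:R * (Num.sqrt t)^-1 * (P ^+ 3 * Gam v t).
  move: (Gam v t) (n%:R) => A N; rewrite -[X in X^-1](sqr_sqrtr (ltW t0)).
  by field; rewrite gt_eqF.
rewrite -[leRHS]mulrA ler_wpM2l ?mulr_ge0 ?invr_ge0 ?sqrtr_ge0//.
exact: sg_Gam_wt.
Qed.

Lemma Gam_le v t : 0 < t -> Gam v t <= (Num.sqrt (4 * pi * t))^-1 ^+ n.
Proof.
move=> t0; rewrite -[n in _ ^+ n]card_ord -prodr_const; apply: ler_prod => k _.
by rewrite gk_ge0 gk_le.
Qed.

End fixed_dimension.

Section last_coordinate.
Context {n : nat}.
Implicit Types (v : 'rV[R]_n) (s t : R).

Lemma prod_rsnoc (f : 'I_n.+1 -> R -> R) v s :
  \prod_k f k (rsnoc (v, s) ord0 k) =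
  (\prod_k f (lift ord_max k) (v ord0 k)) * f ord_max s.
Proof.
rewrite (bigD1_ord ord_max)//= mulrC; congr (_ * _).
  by apply: eq_bigr => k _; rewrite mxE liftK.
by rewrite mxE unlift_none.
Qed.

Lemma Gam_rsnoc v s t : Gam (rsnoc (v, s)) t = Gam v t * gk s t.
Proof. exact: (prod_rsnoc (fun=> gk ^~ t)). Qed.

End last_coordinate.
End product_gauss.

(** * Convolution with kernels dominated by a weight *)

Section convolution.
Context {R : realType} {n : nat}.
Local Notation mu := (@lebesgue_measure R).
Local Notation V := 'rV[R]_n.
Local Notation mun := (lebesgue_rV R n).
Implicit Types (v w x z : V) (f K : V -> R) (C : R).

Lemma measurable_rV_sub d (T : measurableType d) (f g : T -> V) :
  measurable_fun setT f -> measurable_fun setT g ->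
  measurable_fun setT (fun y => f y - g y).
Proof.
move=> mf mg; apply: measurable_fun_rV => k; under eq_fun do rewrite !mxE.
apply: measurable_funB.
- exact: (measurableT_comp (measurable_rV_coord k) mf).
- exact: (measurableT_comp (measurable_rV_coord k) mg).
Qed.

Lemma measurable_coordE (k : 'I_n) : measurable_fun [set: V] (fun z => z ord0 k).
Proof. exact: (measurable_rV_coord k). Qed.

Lemma measurable_rV_coord_comp d (T : measurableType d) (f : T -> V) k :
  measurable_fun setT f -> measurable_fun setT (fun y => f y ord0 k).
Proof. by move=> mf; exact: (measurableT_comp (measurable_rV_coord k)). Qed.

Lemma measurable_csub x : measurable_fun [set: V] (fun z => x - z).
Proof. by apply: measurable_rV_sub => //; exact: measurable_cst. Qed.

(** The reciprocal of [wt]: by Peetre's inequality, convolution with a kernel bounded by [wt] grows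
    at most like [pw]. *)
Definition pw x : R := \prod_k (1 + `|x ord0 k|) ^+ 3.

Lemma pw_gt0 x : 0 < pw x.
Proof. by apply: prodr_gt0 => k _; rewrite exprn_gt0// ltr_wpDr. Qed.

Lemma wt_sub x z : wt (x - z) <= pw x * wt z.
Proof.
rewrite /wt /pw -big_split/=; apply: ler_prod => k _.
rewrite exprn_ge0 ?rho_ge0//= -exprMn !mxE; apply: lerXn2r;
  rewrite ?nnegrE ?mulr_ge0 ?rho_ge0 ?addr_ge0//.
rewrite (_ : rho _ = rho (z ord0 k - x ord0 k)); last by rewrite /rho distrC.
by rewrite mulrC; exact: rho_sub.
Qed.

Lemma measurable_wt : measurable_fun setT (@wt R n).
Proof.
apply: measurable_prod => k _; apply: measurable_funX.
exact: (measurableT_comp measurable_rho (measurable_rV_coord k)).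
Qed.

Lemma intg_wt : intg mun (@wt R n).
Proof.
apply: (@intg_prodf _ _ (fun _ r => rho r ^+ 3)) => k.
apply: (intg_le _ intg_rho2); first by apply: measurable_funX; exact: measurable_rho.
move=> r; rewrite ger0_norm ?exprn_ge0 ?rho_ge0// exprS.
by rewrite ler_piMl ?exprn_ge0 ?rho_ge0 ?rho_le1.
Qed.

(** The weighted L^1 space on which convolution with a kernel bounded by a multiple of [wt] makes
    sense at every point. *)
Definition wclass f := measurable_fun setT f /\ intg mun (fun z => wt z * `|f z|).

Section kernel_bound.
Variables (K : V -> R) (C : R).
Hypotheses (mK : measurable_fun setT K) (KC : forall v, `|K v| <= C * wt v).

Let C0 : 0 <= C.
Proof.
have := le_trans (normr_ge0 _) (KC 0).
by rewrite pmulr_lge0// wt_gt0.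
Qed.

Lemma conv_dom f x z : `|K (x - z) * f z| <= C * pw x * (wt z * `|f z|).
Proof.
rewrite normrM mulrA ler_wpM2r// (le_trans (KC _))// -mulrA ler_wpM2l//.
exact: wt_sub.
Qed.

Lemma intg_conv f x : wclass f -> intg mun (fun z => K (x - z) * f z).
Proof.
move=> [mf fi]; apply: (intg_le _ (intgZ (C * pw x) fi)); last exact: conv_dom.
by apply: measurable_funM => //; exact: (measurableT_comp mK (measurable_csub x)).
Qed.

Lemma conv_le f x : wclass f ->
  `|\int[mun]_z (K (x - z) * f z)| <= C * pw x * \int[mun]_z (wt z * `|f z|).
Proof.
move=> fw; rewrite -RintZ; last exact: fw.2.
apply: Rint_norm_le; [exact: intg_conv|exact: intgZ fw.2|exact: conv_dom].
Qed.

End kernel_bound.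

Lemma is_derive_conv i K K' C f x :
  measurable_fun setT K -> measurable_fun setT K' ->
  (forall v, is_derive v (ed i) K (K' v)) ->
  (forall v, `|K v| <= C * wt v) -> (forall v, `|K' v| <= C * wt v) ->
  wclass f ->
  is_derive x (ed i) (fun w => \int[mun]_z (K (w - z) * f z))
    (\int[mun]_z (K' (x - z) * f z)).
Proof.
move=> mK mK' dK KC K'C fw; have [mf fi] := fw.
have C0 : 0 <= C.
  by have := le_trans (normr_ge0 _) (KC 0); rewrite pmulr_lge0// wt_gt0.
apply/is_derive_lineP.
pose F (h : R) z := K (h *: ed i + x - z) * f z.
have dF (h : R) z : is_derive h (1 : R) (fun h : R => F h z) (K' (h *: ed i + x - z) * f z).
  have d1 : is_derive h 1 (fun h : R => K (h *: ed i + (x - z))) (K' (h *: ed i + x - z)).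
    by rewrite -addrA; apply: is_derive_lineP_at; exact: dK.
  rewrite (_ : (fun h => F h z) = fun h : R => f z * K (h *: ed i + (x - z))); last first.
    by apply/funext => r; rewrite /F addrA mulrC.
  by apply: (is_derive_eq (is_deriveZ (f z) d1)); rewrite /GRing.scale/= mulrC.
have pE h z : partial1of2 F h z = K' (h *: ed i + x - z) * f z.
  by rewrite partial1of2E; have := dF h z => ?; exact: derive_val.
(* A bound of [C * pw] at all points [h *: ed i + x] with [|h| < 1], whence [2 + |x_k|] instead of
   [1 + |x_k|]. *)
pose A : R := C * \prod_k (2 + `|x ord0 k|) ^+ 3.
have KA h v : -1 < h < 1 -> C * pw (h *: ed i + x) <= A.
  move=> /andP[h1 h2]; rewrite ler_wpM2l//; apply: ler_prod => k _.
  rewrite exprn_ge0 ?addr_ge0//=; apply: lerXn2r; rewrite ?nnegrE ?addr_ge0//.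
  rewrite lineE; have := ler_normD ((k == i)%:R * h) (x ord0 k).
  have : `|(k == i)%:R * h| <= 1.
    by case: (k == i); rewrite ?mul1r ?mul0r ?normr0// ler_norml !ltW.
  lra.
have [dd dE] : derivable (fun h => \int[mun]_z F h z) 0 1 /\
    'D_1 (fun h => \int[mun]_z F h z) 0 = \int[mun]_z (K' (x - z) * f z).
  have I0 : (`]-1, 1[%classic : set R) 0 by rewrite /= in_itv/=; lra.
  have iF h : (`]-1, 1[%classic : set R) h -> intg mun (F h).
    by move=> _; exact: (intg_conv mK KC).
  have dd h z : (`]-1, 1[%classic : set R) h -> [set: V] z -> derivable (F ^~ z) h 1.
    by move=> _ _; have := dF h z => ?; exact: ex_derive.
  have G0 z : 0 <= A * (wt z * `|f z|).
    rewrite mulr_ge0 ?mulr_ge0 ?(ltW (wt_gt0 _))//.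
    by apply: prodr_ge0 => k _; rewrite exprn_ge0// addr_ge0.
  have Gu h z : (`]-1, 1[%classic : set R) h -> [set: V] z ->
      `|partial1of2 F h z| <= A * (wt z * `|f z|).
    rewrite /= in_itv/= => hh _; rewrite pE (le_trans (conv_dom K'C _ _ _))//.
    by rewrite ler_wpM2r ?KA// mulr_ge0// ltW// wt_gt0.
  have h := @cvg_differentiation_under_integral R _ _ mun F setT measurableT 0 (-1) 1 I0
    iF dd _ G0 (intgZ A fi) Gu.
  have E : \int[mun]_z (K' (x - z) * f z) = \int[mun]_z (partial1of2 F 0 z).
    by apply: eq_Rintegral => z _; rewrite pE scale0r add0r.
  have h' : h^-1 *: (((fun h => \int[mun]_z F h z) \o shift 0) (h *: 1) -
     \int[mun]_z F 0 z) @[h --> 0^'] --> \int[mun]_z (K' (x - z) * f z).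
    rewrite E; apply: cvg_trans h; apply: near_eq_cvg; apply: nearW => r /=.
    by rewrite /GRing.scale/= mulr1.
  split; first by apply/cvg_ex; eexists; exact: h'.
  exact: (cvg_lim _ h').
exact: (DeriveDef dd dE).
Qed.

End convolution.

(** * The fundamental solution, its gradient, and their increments *)

Section inverse_powers.
Context {R : realFieldType}.
Implicit Types x y r : R.

Lemma invX_sub_le m x y : 0 < x -> x <= y ->
  x^-1 ^+ m - y^-1 ^+ m <= m%:R * (y - x) * x^-1 ^+ m.+1.
Proof.
move=> x0 xy; have y0 : 0 < y := lt_le_trans x0 xy.
have yx : y^-1 <= x^-1 by rewrite lef_pV2.
have Yx : x^-1 - y^-1 <= (y - x) * x^-1 ^+ 2.
  have -> : x^-1 - y^-1 = (y - x) * (x^-1 * y^-1) by field; rewrite !gt_eqF.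
  by rewrite ler_wpM2l ?subr_ge0// expr2 ler_wpM2l// invr_ge0 ltW.
have X0 : 0 < x^-1 by rewrite invr_gt0. have Y0 : 0 < y^-1 by rewrite invr_gt0.
elim: m => [|m ih]; first by rewrite !expr0 subrr !mul0r.
have -> : x^-1 ^+ m.+1 - y^-1 ^+ m.+1 =
    x^-1 * (x^-1 ^+ m - y^-1 ^+ m) + y^-1 ^+ m * (x^-1 - y^-1) by rewrite !exprS; ring.
have -> : m.+1%:R * (y - x) * x^-1 ^+ m.+2 =
    x^-1 * (m%:R * (y - x) * x^-1 ^+ m.+1) + x^-1 ^+ m * ((y - x) * x^-1 ^+ 2).
  by rewrite -natr1 !exprS; ring.
apply: lerD; first by rewrite ler_pM2l.
apply: ler_pM => //; rewrite ?subr_ge0 ?exprn_ge0 ?(ltW Y0)//.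
by apply: lerXn2r; rewrite ?nnegrE ?(ltW Y0) ?(ltW X0).
Qed.

Lemma invX_lip m x y : 0 < x -> 0 < y ->
  `|x^-1 ^+ m - y^-1 ^+ m| <= m%:R * `|x - y| * (x^-1 ^+ m.+1 + y^-1 ^+ m.+1).
Proof.
wlog xy : x y / x <= y => [H x0 y0|x0 y0].
  have [xy|/ltW yx] := leP x y; first exact: H.
  by rewrite distrC (distrC x) [X in _ * X]addrC; exact: H.
have h := invX_sub_le m x0 xy.
have yx : y^-1 ^+ m <= x^-1 ^+ m.
  by apply: lerXn2r; rewrite ?nnegrE ?invr_ge0 ?(ltW x0) ?(ltW y0)// lef_pV2.
rewrite ger0_norm ?subr_ge0//; rewrite distrC ger0_norm ?subr_ge0//.
apply: (le_trans h); rewrite ler_wpM2l ?mulr_ge0 ?subr_ge0// lerDl.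
by rewrite exprn_ge0// invr_ge0 ltW.
Qed.

End inverse_powers.

Section fundamental_solution.
Context {R : realType} {d : nat}.
Local Notation mu := (@lebesgue_measure R).
Local Notation Rn := 'rV[R]_d.+1.
Local Notation mun := (lebesgue_rV R d.+1).
Implicit Types (x z v w a b : Rn) (i j k : 'I_d.+1).

Lemma enorm_ge0 x : 0 <= enorm x. Proof. exact: sqrtr_ge0. Qed.

Lemma enorm_sqr x : enorm x ^+ 2 = \sum_k x ord0 k ^+ 2.
Proof. by rewrite sqr_sqrtr// sumr_ge0// => k _; exact: sqr_ge0. Qed.

Lemma coord_le_enorm x k : `|x ord0 k| <= enorm x.
Proof.
rewrite -sqrtr_sqr ler_wsqrtr// (bigD1 k)//= lerDl.
by apply: sumr_ge0 => j _; exact: sqr_ge0.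
Qed.

Lemma enorm_gt0 x k : x ord0 k != 0 -> 0 < enorm x.
Proof. by move=> xk; rewrite (lt_le_trans _ (coord_le_enorm x k))// normr_gt0. Qed.

(** After multiplication by [enorm a + enorm b] the left side is a difference of sums of squares,
    and the estimate is made coordinate by coordinate. *)
Lemma enorm_lip a b : `|enorm a - enorm b| <= \sum_k `|a ord0 k - b ord0 k|.
Proof.
have [ab0|] := eqVneq (enorm a + enorm b) 0.
  have -> : enorm a = 0 by apply/eqP; have := enorm_ge0 a; have := enorm_ge0 b; lra.
  have -> : enorm b = 0 by apply/eqP; have := enorm_ge0 a; have := enorm_ge0 b; lra.
  by rewrite subrr normr0 sumr_ge0.
move=> ab; have ab0 : 0 < enorm a + enorm b by rewrite lt_neqAle eq_sym ab addr_ge0 ?enorm_ge0.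
rewrite -(ler_pM2r ab0) -{1}(ger0_norm (ltW ab0)) -normrM -subr_sqr !enorm_sqr.
rewrite -sumrB mulr_suml (le_trans (ler_norm_sum _ _ _))//; apply: ler_sum => k _.
rewrite subr_sqr normrM ler_wpM2l// (le_trans (ler_normD _ _))//.
by rewrite lerD// coord_le_enorm.
Qed.

Lemma is_derive_enorm i z : 0 < enorm z ->
  is_derive z (ed i) (enorm : Rn -> R) (z ord0 i / enorm z).
Proof.
move=> z0; apply/is_derive_lineP.
have E h : enorm (h *: ed i + z) = Num.sqrt (h ^+ 2 + 2 * h * z ord0 i + enorm z ^+ 2).
  rewrite /enorm sqr_sqrtr; last by apply: sumr_ge0 => k _; exact: sqr_ge0.
  congr Num.sqrt; rewrite (bigD1 i)//= [in RHS](bigD1 i)//= lineE eqxx mul1r addrA.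
  congr (_ + _); first by ring.
  by apply: eq_bigr => k /negbTE ki; rewrite lineE ki mul0r add0r.
rewrite (_ : (fun h => _) = Num.sqrt \o (fun h => h ^+ 2 + 2 * h * z ord0 i + enorm z ^+ 2)).
  have d1 : is_derive (0 : R) 1 (fun h => h ^+ 2 + 2 * h * z ord0 i + enorm z ^+ 2) (2 * z ord0 i).
    by apply: is_derive_eq; rewrite /GRing.scale/=; ring.
  have q0 : 0 < (0 : R) ^+ 2 + 2 * 0 * z ord0 i + enorm z ^+ 2.
    by rewrite expr0n/= mulr0 mul0r !add0r exprn_gt0.
  apply: (is_derive_eq (@is_derive1_comp R Num.sqrt (fun h => h ^+ 2 + 2 * h * z ord0 i + enorm z ^+ 2) 0 _ _ (is_derive1_sqrt q0) d1)).
  rewrite expr0n/= mulr0 mul0r !add0r sqrtr_sqr ger0_norm ?ltW//.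
  by field; rewrite gt_eqF.
by apply/funext => h; rewrite E.
Qed.

Lemma measurable_enorm : measurable_fun setT (enorm : Rn -> R).
Proof.
apply: measurable_fun_sqrt; apply: measurable_sum => k.
by apply: measurable_funX; exact: measurable_coordE.
Qed.

Definition nrmd z : R := (enorm z)^-1 ^+ d.

Definition Pk i z : R := z ord0 i * (enorm z)^-1 ^+ d.+1.

Definition cE : R := if d.+1 == 2%N then (2 * pi)^-1
  else (d.+1%:R - 2) * (d.+1%:R * (d.+1%:R - 2) * @unit_ball_volume R d)^-1.

Lemma nrmd_ge0 z : 0 <= nrmd z.
Proof. by rewrite exprn_ge0// invr_ge0 enorm_ge0. Qed.

Lemma measurable_nrmd : measurable_fun setT nrmd.
Proof. by apply: measurable_funX; apply: measurable_fun_inv; exact: measurable_enorm. Qed.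

Lemma measurable_Pk i : measurable_fun setT (Pk i).
Proof.
apply: measurable_funM; first exact: measurable_coordE.
by apply: measurable_funX; apply: measurable_fun_inv; exact: measurable_enorm.
Qed.

Lemma Pk_le i z : `|Pk i z| <= nrmd z.
Proof.
rewrite normrM [X in _ * X]ger0_norm ?exprn_ge0 ?invr_ge0 ?enorm_ge0//.
rewrite exprS mulrA ler_piMl ?exprn_ge0 ?invr_ge0 ?enorm_ge0//.
have [->|z0] := eqVneq (enorm z) 0; first by rewrite invr0 mulr0.
have e0 : 0 < enorm z by rewrite lt_neqAle eq_sym z0 enorm_ge0.
by rewrite ler_pdivrMr// mul1r coord_le_enorm.
Qed.

Lemma EE z : (1 <= d)%N -> 0 < enorm z -> E z =
  if d.+1 == 2%N then - (2 * pi)^-1 * ln (enorm z)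
  else (d.+1%:R * (d.+1%:R - 2) * @unit_ball_volume R d)^-1 * (enorm z)^-1 ^+ d.-1.
Proof.
move=> d1 z0; rewrite /E; case: ifPn => // d2; congr (_ * _).
have -> : 2 - d.+1%:R = - d.-1%:R :> R.
  by case: d d1 d2 {z z0} => // e _ _; rewrite /= -!natr1; ring.
by rewrite powRN powR_mulrn ?enorm_ge0// exprVn.
Qed.

Lemma pd_E i z : (1 <= d)%N -> 0 < enorm z -> pd i E z = - cE * Pk i z.
Proof.
move=> d1 z0; suff h : is_derive z (ed i) E (- cE * Pk i z) by exact: derive_val.
have dn := is_derive_enorm i z0; have /is_derive_lineP dn' := dn.
apply/is_derive_lineP.
have z0' : 0 < enorm (0 *: ed i + z) by rewrite scale0r add0r.
(* The radial profile with an integer exponent; [E] coincides with it off the origin, hence near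
   [z]. *)
pose F (r : R) : R := if d.+1 == 2%N then - (2 * pi)^-1 * ln r
  else (d.+1%:R * (d.+1%:R - 2) * @unit_ball_volume R d)^-1 * r^-1 ^+ d.-1.
apply: (@near_eq_is_derive R R R (F \o (fun h : R => enorm (h *: ed i + z)))).
  have cn : {for (0 : R), continuous (fun h : R => enorm (h *: ed i + z))}.
    by case: dn' => dd _; exact: (differentiable_continuous ((derivable1_diffP _ _).1 dd)).
  have hn : \forall h \near (0 : R), 0 < enorm (h *: ed i + z) by exact: (cvgr_gt _ cn _ z0').
  near=> h; have h0 : 0 < enorm (h *: ed i + z) by near: h.
  by rewrite /= EE.
set r := enorm z in z0 dn dn' *.
have dF : is_derive r 1 F (- cE * r^-1 ^+ d).
  rewrite /F /cE; case: ifPn => [/eqP d2|d2].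
    apply: (is_derive_eq (is_deriveZ (- (2 * pi)^-1) (is_derive1_ln z0))).
    by case: d2 => ->; rewrite expr1.
  set c := (_ * _ * _)^-1.
  have dV : is_derive r 1 (fun r : R => r^-1) (- r ^- 2 *: 1).
    by apply: (@is_deriveV R id r); rewrite gt_eqF.
  have dX := is_deriveX d.-1 dV.
  have -> : (fun r : R => c * r^-1 ^+ d.-1) = c \*: ((fun r : R => r^-1) ^+ d.-1).
    by apply/funext => u; rewrite /= exprfctE.
  apply: (is_derive_eq (is_deriveZ c dX)); rewrite /GRing.scale/= mulr1.
  case: d d1 d2 {dX} c => [//|[|e]] // _ _ c.
  have -> : e.+3%:R - 2 = e.+1%:R :> R by rewrite -!natr1; ring.
  rewrite /= -exprVn !exprS; move: (r^-1 ^+ e) (e.+1%:R) => A B; ring.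
rewrite -[r]/(enorm z) -{1}[z]add0r -{1}(scale0r (ed i)) in dF.
have := @is_derive1_comp R F (fun h : R => enorm (h *: ed i + z)) 0 _ _ dF dn'.
rewrite /Pk -/r => h; apply: (is_derive_eq h).
by rewrite exprS; move: (cE) (r^-1 ^+ d) => A B; field; rewrite gt_eqF.
Unshelve. all: by end_near. Qed.

(** As [E] is radial, only the segment between the two norms matters, and it avoids the singularity
    even if the segment from [a] to [b] does not. The derivative of the profile is largest at the
    smaller norm; taking both ends avoids distinguishing which one that is. *)
Lemma E_lip a b : (1 <= d)%N -> 0 < enorm a -> 0 < enorm b ->
  `|E a - E b| <= `|cE| * (\sum_k `|a ord0 k - b ord0 k|) * (nrmd a + nrmd b).
Proof.
move=> d1 a0 b0; rewrite !EE// /cE /nrmd.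
have lip := enorm_lip a b.
set x := enorm a in a0 lip *; set y := enorm b in b0 lip *.
have xy0 : 0 <= x^-1 ^+ d + y^-1 ^+ d by rewrite addr_ge0// exprn_ge0// invr_ge0 ltW.
case: ifPn => [/eqP[d2]|d2].
  have dd (u : R) : u ^+ d = u by rewrite d2 expr1.
  rewrite -mulrBr normrM normrN -mulrA ler_wpM2l// !dd.
  apply: (@le_trans _ _ (`|x - y| * (x^-1 + y^-1))); last first.
    by rewrite ler_wpM2r// addr_ge0// invr_ge0 ltW.
  have lnle (u v : R) : 0 < u -> 0 < v -> ln u - ln v <= `|u - v| * v^-1.
    move=> u0 v0; rewrite -ln_div ?posrE//.
    have -> : u / v = 1 + (u - v) / v by field; rewrite gt_eqF.
    apply: (le_trans (le_ln1Dx _)); last by rewrite ler_wpM2r ?invr_ge0 ?(ltW v0)// ler_norm.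
    have -> : (u - v) / v = u / v - 1 by field; rewrite gt_eqF.
    by rewrite ltrBrDl subrr divr_gt0.
  have h1 := lnle x y a0 b0; have h2 := lnle y x b0 a0; rewrite distrC in h2.
  have X0 : 0 <= `|x - y| / x by rewrite divr_ge0// ltW.
  have Y0 : 0 <= `|x - y| / y by rewrite divr_ge0// ltW.
  by rewrite ler_norml mulrDr; apply/andP; split; lra.
rewrite -mulrBr normrM normrM; set c := (_ * _ * _)^-1.
have E2 : d.+1%:R - 2 = d.-1%:R :> R by case: d d1 d2 {c xy0} => // e _ _; rewrite /= -!natr1; ring.
rewrite E2 normr_nat.
apply: (@le_trans _ _ (`|c| * (d.-1%:R * `|x - y| * (x^-1 ^+ d + y^-1 ^+ d)))).
  rewrite ler_wpM2l//; have := invX_lip d.-1 a0 b0.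
  by rewrite prednK.
have -> : d.-1%:R * `|c| * (\sum_k `|a ord0 k - b ord0 k|) * (x^-1 ^+ d + y^-1 ^+ d) =
  `|c| * (d.-1%:R * (\sum_k `|a ord0 k - b ord0 k|) * (x^-1 ^+ d + y^-1 ^+ d)) by ring.
by rewrite ler_wpM2l// ler_wpM2r// ler_wpM2l.
Qed.

(** [Pk i] is not radial, so the coordinate and the inverse power are varied in turn. With [a] the
    point of smaller norm, [|a_i| <= enorm a] absorbs one of the [d + 2] inverse powers produced by
    [invX_sub_le]. *)
Lemma Pk_lip i a b : 0 < enorm a -> 0 < enorm b ->
  `|Pk i a - Pk i b| <= d.+2%:R * (\sum_k `|a ord0 k - b ord0 k|) *
     ((enorm a)^-1 ^+ d.+1 + (enorm b)^-1 ^+ d.+1).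
Proof.
wlog ab : a b / enorm a <= enorm b.
  move=> H a0 b0; have [ab|/ltW ba] := leP (enorm a) (enorm b); first exact: H.
  rewrite distrC (eq_bigr (fun k => `|b ord0 k - a ord0 k|)).
    by rewrite [X in _ * X]addrC; exact: H.
  by move=> k _; rewrite distrC.
move=> a0 b0; rewrite distrC /Pk.
have lip := enorm_lip a b; have ai := coord_le_enorm a i.
have h := invX_sub_le d.+1 a0 ab.
have yx : (enorm b)^-1 ^+ d.+1 <= (enorm a)^-1 ^+ d.+1.
  by apply: lerXn2r; rewrite ?nnegrE ?invr_ge0 ?enorm_ge0// lef_pV2 ?posrE.
set x := enorm a in a0 ab lip ai h yx *; set y := enorm b in b0 ab lip h yx *.
set S := \sum_k _ in lip *.
have Si : `|b ord0 i - a ord0 i| <= S.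
  by rewrite /S (bigD1 i)//= distrC lerDl sumr_ge0.
have -> : b ord0 i * y^-1 ^+ d.+1 - a ord0 i * x^-1 ^+ d.+1 =
  (b ord0 i - a ord0 i) * y^-1 ^+ d.+1 - a ord0 i * (x^-1 ^+ d.+1 - y^-1 ^+ d.+1) by ring.
apply: (le_trans (ler_normB _ _)); rewrite !normrM.
have Y0 : 0 <= y^-1 ^+ d.+1 by rewrite exprn_ge0// invr_ge0 ltW.
have X0 : 0 <= x^-1 ^+ d.+1 by rewrite exprn_ge0// invr_ge0 ltW.
have S0 : 0 <= S by rewrite sumr_ge0.
rewrite (ger0_norm Y0) [X in _ + _ * X]ger0_norm ?subr_ge0//.
have yxS : y - x <= S by apply: le_trans lip; rewrite distrC ler_norm.
apply: (@le_trans _ _ (S * y^-1 ^+ d.+1 + x * (d.+1%:R * S * x^-1 ^+ d.+2))).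
  apply: lerD; first by rewrite ler_wpM2r.
  apply: ler_pM => //; first by rewrite subr_ge0.
  apply: (le_trans h); rewrite ler_wpM2r ?ler_wpM2l//.
  by rewrite exprn_ge0// invr_ge0 ltW.
have -> : x * (d.+1%:R * S * x^-1 ^+ d.+2) = d.+1%:R * S * x^-1 ^+ d.+1.
  by rewrite [x^-1 ^+ d.+2]exprS; move: (x^-1 ^+ d.+1) => A; field; rewrite gt_eqF.
rewrite -[d.+2%:R]natr1 mulrDl mul1r mulrDl.
have := mulr_ge0 S0 X0; have := mulr_ge0 S0 Y0.
have : 0 <= d.+1%:R * S * y^-1 ^+ d.+1 by rewrite !mulr_ge0.
rewrite !mulrDr; lra.
Qed.

End fundamental_solution.

Lemma add1_sum_le_prod (R : realDomainType) (I : Type) (r : seq I) (f : I -> R) :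
  (forall i, 0 <= f i) -> 1 + \sum_(i <- r) f i <= \prod_(i <- r) (1 + f i).
Proof.
move=> f0; elim: r => [|i r ih]; first by rewrite !big_nil addr0.
rewrite !big_cons; apply: (@le_trans _ _ ((1 + f i) * (1 + \sum_(j <- r) f j))).
  have := mulr_ge0 (f0 i) (@sumr_ge0 _ _ r xpredT f (fun j _ => f0 j)); lra.
by rewrite ler_wpM2l// addr_ge0.
Qed.

(** * The heat kernel acting on functions with a singularity at the origin *)

Section heat_product.
Context {R : realType} {d : nat}.
Local Notation mu := (@lebesgue_measure R).
Local Notation Rn := 'rV[R]_d.+1.
Local Notation mun := (lebesgue_rV R d.+1).
Implicit Types (x z v w p : Rn) (i j k : 'I_d.+1) (t s : R).

Lemma heatE x t : 0 < t -> heat x t = Gam x t.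
Proof.
move=> t0; rewrite /heat t0 enorm_sqr /Gam /gk big_split/= -expR_sum.
have pt0 : 0 < 4 * pi * t :> R by rewrite !mulr_gt0// pi_gt0.
rewrite prodr_const card_ord; congr (_ * expR _); last first.
  by rewrite sumrN mulr_suml.
rewrite powRN exprVn -powR12_sqrt ?(ltW pt0)// -powR_mulrn ?powR_ge0//.
by rewrite -powRrM [2^-1 * _]mulrC.
Qed.

Lemma pd_heat j x t : 0 < t -> pd j (heat^~ t) x = Gam1 j x t.
Proof.
move=> t0; rewrite /pd (_ : heat^~ t = fun w => Gam w t); last first.
  by apply/funext => w; exact: heatE.
by have := is_derive_Gam j x t => ?; exact: derive_val.
Qed.

Lemma Gam_bounds t : 0 < t -> exists C : R, forall v : Rn,
  [/\ `|Gam v t| <= C * wt v, forall j, `|Gam1 j v t| <= C * wt v &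
      forall i j, `|Gam2 i j v t| <= C * wt v].
Proof.
move=> t0; have t20 : 0 < 2 * t by rewrite mulr_gt0.
pose c : R := (Num.sqrt (4 * pi * (2 * t)))^-1 ^+ d.+1.
have c0 : 0 <= c by rewrite exprn_ge0// invr_ge0 sqrtr_ge0.
have cM0 : 0 <= cM t ^+ d.+1 by rewrite exprn_ge0// ltW// cM_gt0.
exists ((1 + (Num.sqrt t)^-1 + t^-1) * cM t ^+ d.+1 * c) => v.
have wG : cM t ^+ d.+1 * (wt v * Gam v (2 * t)) <= cM t ^+ d.+1 * c * wt v.
  by rewrite -mulrA ler_wpM2l// mulrC ler_wpM2r ?(ltW (wt_gt0 _))// Gam_le.
have W0 : 0 <= cM t ^+ d.+1 * c * wt v by rewrite !mulr_ge0// ltW// wt_gt0.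
have s0 : 0 <= (Num.sqrt t)^-1 by rewrite invr_ge0 sqrtr_ge0.
have i0 : 0 <= t^-1 by rewrite invr_ge0 ltW.
have E : (1 + (Num.sqrt t)^-1 + t^-1) * cM t ^+ d.+1 * c * wt v =
  (1 + (Num.sqrt t)^-1 + t^-1) * (cM t ^+ d.+1 * c * wt v) by rewrite !mulrA.
split=> [|j|i j]; rewrite E.
- rewrite ger0_norm ?Gam_ge0// (le_trans (Gam_wt v t0))// (le_trans wG)//.
  by rewrite ler_peMl// -addrA lerDl addr_ge0.
- rewrite (le_trans (Gam1_wt j v t0))// -mulrA (le_trans (ler_wpM2l s0 wG))//.
  by rewrite ler_wpM2r//; lra.
- rewrite (le_trans (Gam2_wt i j v t0))// -mulrA (le_trans (ler_wpM2l i0 wG))//.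
  by rewrite ler_wpM2r//; lra.
Qed.

Lemma measurable_Gamt t : measurable_fun [set: Rn] (Gam ^~ t).
Proof. by apply: measurable_Gam => // k; exact: measurable_coordE. Qed.

Lemma measurable_Gam1t j t : measurable_fun [set: Rn] (Gam1 j ^~ t).
Proof. by apply: measurable_Gam1 => // k; exact: measurable_coordE. Qed.

Lemma measurable_Gam2t i j t : measurable_fun [set: Rn] (Gam2 i j ^~ t).
Proof. by apply: measurable_Gam2 => // k; exact: measurable_coordE. Qed.

Definition hconv (f : Rn -> R) t w := \int[mun]_z (Gam (w - z) t * f z).
Definition hconv1 j (f : Rn -> R) t w := \int[mun]_z (Gam1 j (w - z) t * f z).
Definition hconv2 i j (f : Rn -> R) t w := \int[mun]_z (Gam2 i j (w - z) t * f z).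

Lemma is_derive_hconv j f t x : 0 < t -> wclass f ->
  is_derive x (ed j) (hconv f t) (hconv1 j f t x).
Proof.
move=> t0 fw; have [C hC] := Gam_bounds t0.
apply: (@is_derive_conv R _ j (Gam ^~ t) (Gam1 j ^~ t) C) => //.
- exact: measurable_Gamt.
- exact: measurable_Gam1t.
- by move=> v; exact: is_derive_Gam.
- by move=> v; have [] := hC v.
- by move=> v; have [] := hC v.
Qed.

Lemma is_derive_hconv1 i j f t x : 0 < t -> wclass f ->
  is_derive x (ed i) (hconv1 j f t) (hconv2 i j f t x).
Proof.
move=> t0 fw; have [C hC] := Gam_bounds t0.
apply: (@is_derive_conv R _ i (Gam1 j ^~ t) (Gam2 i j ^~ t) C) => //.
- exact: measurable_Gam1t.
- exact: measurable_Gam2t.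
- by move=> v; exact: is_derive_Gam1.
- by move=> v; have [] := hC v.
- by move=> v; have [] := hC v.
Qed.

Lemma pd_hconv j f t x : 0 < t -> wclass f -> pd j (hconv f t) x = hconv1 j f t x.
Proof. by move=> t0 fw; have := is_derive_hconv j x t0 fw => ?; exact: derive_val. Qed.

Lemma pd_hconv1 i j f t x : 0 < t -> wclass f -> pd i (hconv1 j f t) x = hconv2 i j f t x.
Proof. by move=> t0 fw; have := is_derive_hconv1 i j x t0 fw => ?; exact: derive_val. Qed.

Lemma wclass1 : wclass (fun _ : Rn => 1 : R).
Proof.
split; first exact: measurable_cst.
rewrite (_ : (fun z => _) = @wt R d.+1); first exact: intg_wt.
by apply/funext => z; rewrite normr1 mulr1.
Qed.

(** By translation invariance the convolution of [Gam1 j] with the constant 1 is constant, so that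
    its derivative vanishes. *)
Lemma Rint_Gam2 i j t : 0 < t -> \int[mun]_z Gam2 i j z t = 0.
Proof.
move=> t0; have mG1 : measurable_fun setT (Gam1 j ^~ t : Rn -> R) by exact: measurable_Gam1t.
have mG2 : measurable_fun setT (Gam2 i j ^~ t : Rn -> R) by exact: measurable_Gam2t.
have := is_derive_hconv1 i j 0 t0 wclass1.
rewrite (_ : hconv1 _ _ _ = cst (\int[mun]_z Gam1 j z t)); last first.
  apply/funext => w; rewrite /hconv1 /=; under eq_Rintegral do rewrite mulr1.
  by rewrite (Rint_sub w mG1).
move=> h; have h2 : is_derive (0 : Rn) (ed i) (cst (\int[mun]_z Gam1 j z t)) 0.
  exact: is_derive_cst.
have : hconv2 i j (fun=> 1) t 0 = 0.
  by rewrite -(@derive_val _ _ _ _ _ _ _ h) -[RHS](@derive_val _ _ _ _ _ _ _ h2).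
rewrite /hconv2; under eq_Rintegral do rewrite mulr1.
by rewrite (Rint_sub 0 mG2).
Qed.

Definition alpha : R := d%:R / d.+1%:R.
Definition qn (r : R) := 1 + hs alpha r.
(** The [d] powers of decay of [nrmd] go to the [d] tangential coordinates; the last coordinate only
    carries its share of the singularity. *)
Definition qf k (r : R) := if k == ord_max then qn r else rho r * qn r.

Lemma alpha01 : 0 <= alpha < 1.
Proof. by rewrite divr_ge0//= ltr_pdivrMr// mul1r ltr_nat. Qed.

Lemma qn_ge1 r : 1 <= qn r.
Proof. by rewrite lerDl hs_ge0. Qed.

Lemma qn_ge0 r : 0 <= qn r.
Proof. exact: le_trans (qn_ge1 r). Qed.

Lemma qf_ge0 k r : 0 <= qf k r.
Proof. by rewrite /qf; case: ifP; rewrite ?mulr_ge0 ?qn_ge0 ?rho_ge0. Qed.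

Lemma measurable_qf k : measurable_fun [set: measurableTypeR R] (qf k).
Proof.
have mq : measurable_fun [set: measurableTypeR R] qn.
  by apply: measurable_funD => //; exact: intg_meas (intg_hs alpha01).
rewrite /qf; case: (k == _) => //.
by apply: measurable_funM => //; exact: measurable_rho.
Qed.

Lemma hs_ge r e : 0 < e -> e < 1 -> r != 0 -> `|r| <= e -> e `^ (- alpha) <= hs alpha r.
Proof.
move=> e0 e1 r0 re; rewrite /hs /indic mem_set ?mul1r; last first.
  by rewrite /= in_itv/= -ltr_norml (le_lt_trans re).
have r0' : 0 < `|r| by rewrite normr_gt0.
rewrite !powRN lef_pV2 ?posrE ?powR_gt0//.
by apply: ge0_ler_powR => //; rewrite ?nnegrE ?(ltW e0)//; have /andP[] := alpha01.
Qed.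

(* Spreading the exponent [d] evenly over the [d + 1] coordinates keeps each
   one-dimensional singularity integrable, as [d / (d + 1) < 1]. *)
Lemma nrmd_le_qf v : (forall k, v ord0 k != 0) ->
  nrmd v <= 2 ^+ d * \prod_k qf k (v ord0 k).
Proof.
move=> v0; have e0 : 0 < enorm v := enorm_gt0 (v0 ord_max).
rewrite (bigD1_ord ord_max)//= {1}/qf eqxx.
have qfl (k : 'I_d) : qf (lift ord_max k) (v ord0 (lift ord_max k)) =
    rho (v ord0 (lift ord_max k)) * qn (v ord0 (lift ord_max k)).
  by rewrite /qf eq_sym (negbTE (neq_lift _ _)).
under eq_bigr do rewrite qfl.
have hV k : (1 + `|v ord0 k|)^-1 = rho (v ord0 k) by [].
have ve k := coord_le_enorm v k.
(* Outside the unit ball the decay factors suffice, by [1 + |v_k| <= 2 |v|]; inside, each coordinate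
   takes the power [alpha] of the singularity and [1 + |v_k| <= 2]. Both cases cost the factor
   [2 ^+ d]. *)
have [e1|e1] := ltP (enorm v) 1; last first.
  apply: (@le_trans _ _ (2 ^+ d * (1 * \prod_(k < d) (2 * enorm v)^-1))).
    rewrite prodr_const card_ord mul1r -exprMn /nrmd invfM mulrA divff ?mul1r//.
  rewrite ler_pM2l ?exprn_gt0//; apply: ler_pM => //; rewrite ?qn_ge1//.
    by apply: prodr_ge0 => k _; rewrite invr_ge0 mulr_ge0// ltW.
  apply: ler_prod => k _; rewrite invr_ge0 mulr_ge0 ?(ltW e0)//=.
  apply: (@le_trans _ _ (rho (v ord0 (lift ord_max k)))).
    rewrite lef_pV2 ?posrE ?mulr_gt0 ?ltr_wpDr//.
    by have := ve (lift ord_max k); lra.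
  by rewrite ler_peMr ?rho_ge0 ?qn_ge1.
pose P : R := enorm v `^ (- alpha).
have P0 : 0 < P by rewrite powR_gt0.
have -> : nrmd v = P ^+ d.+1.
  rewrite -powR_mulrn ?(ltW P0)// /P -powRrM /alpha mulNr divfK ?pnatr_eq0//.
  by rewrite powRN powR_mulrn ?enorm_ge0// /nrmd exprVn.
have hP k : P <= hs alpha (v ord0 k) by apply: hs_ge.
apply: (@le_trans _ _ (2 ^+ d * (P * \prod_(k < d) (2^-1 * P)))).
  rewrite prodr_const card_ord exprMn exprVn mulrCA [2 ^+ d * _]mulrA.
  by rewrite divff ?mul1r ?expf_neq0// exprS.
rewrite ler_pM2l ?exprn_gt0//; apply: ler_pM.
- exact: ltW.
- by apply: prodr_ge0 => k _; rewrite mulr_ge0// ltW.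
- by rewrite /qn (le_trans (hP ord_max))// lerDr.
- apply: ler_prod => k _; rewrite mulr_ge0 ?(ltW P0)//=; apply: ler_pM => //.
  + exact: ltW.
  + rewrite lef_pV2 ?posrE ?ltr_wpDr//.
    by have := ve (lift ord_max k); lra.
  + by rewrite /qn (le_trans (hP (lift ord_max k)))// lerDr.
Qed.

Lemma ae_nrmd_le p : {ae mun, forall z : Rn,
  nrmd (p - z) <= 2 ^+ d * \prod_k qf k (p ord0 k - z ord0 k)}.
Proof.
apply: aeS (ae_coord_neq p) => z zp.
have := @nrmd_le_qf (p - z); under eq_bigr do rewrite !mxE.
by apply=> k; rewrite !mxE subr_eq0 eq_sym.
Qed.

Lemma intg_wt2_nrmd :
  intg mun (fun z => (\prod_k rho (z ord0 k) ^+ 2) * nrmd z).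
Proof.
have qi k : intg mu (fun r => rho r ^+ 2 * qf k r).
  apply: (intg_le _ (intgD intg_rho2 (intg_hs alpha01))).
    apply: measurable_funM; last exact: measurable_qf.
    by apply: measurable_funX; exact: measurable_rho.
  move=> r; have r0 := rho_ge0 r; have r1 := rho_le1 r; have h0 := hs_ge0 alpha r.
  rewrite ger0_norm ?mulr_ge0 ?exprn_ge0 ?qf_ge0//.
  apply: (@le_trans _ _ (rho r ^+ 2 * qn r)).
    rewrite ler_wpM2l ?exprn_ge0// /qf; case: ifP => // _.
    by rewrite ler_piMl// qn_ge0.
  by rewrite /qn mulrDr mulr1 lerD2l ler_piMl// exprn_ile1.
apply: (intg_le_ae _ (intgZ (2 ^+ d) (intg_prodf qi))).
  apply: measurable_funM; last exact: measurable_nrmd.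
  apply: measurable_prod => k _; apply: measurable_funX.
  exact: (measurableT_comp measurable_rho (measurable_rV_coord k)).
apply: aeS (ae_coord_neq 0) => z z0.
have P0 : 0 <= \prod_k rho (z ord0 k) ^+ 2 by apply: prodr_ge0 => k _; rewrite exprn_ge0 ?rho_ge0.
rewrite ger0_norm ?mulr_ge0 ?nrmd_ge0// [X in 2 ^+ d * X]big_split /= [leRHS]mulrCA ler_wpM2l//.
by apply: nrmd_le_qf => k; have := z0 k; rewrite mxE.
Qed.

(** One power of [rho] per coordinate absorbs the linear factor; the two that remain are integrable,
    also against [nrmd]. The class thus contains [E] and the truncations of [Pk i]. *)
Lemma wclass_le (f : Rn -> R) (C : R) : 0 <= C -> measurable_fun setT f ->
  (forall z, 0 < enorm z -> `|f z| <= C * (1 + \sum_k `|z ord0 k|) * (1 + nrmd z)) ->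
  wclass f.
Proof.
move=> C0 mf fC; split=> //.
have i2 : intg mun (fun z => \prod_k rho (z ord0 k) ^+ 2).
  by apply: (@intg_prodf _ _ (fun _ r => rho r ^+ 2)) => k; exact: intg_rho2.
apply: (intg_le_ae _ (intgZ C (intgD i2 intg_wt2_nrmd))).
  by apply: measurable_funM; [exact: measurable_wt|exact: measurableT_comp].
apply: aeS (ae_coord_neq 0) => z z0.
have e0 : 0 < enorm z by apply: (@enorm_gt0 _ _ _ ord_max); have := z0 ord_max; rewrite mxE.
rewrite ger0_norm ?mulr_ge0 ?(ltW (wt_gt0 _))//.
apply: (le_trans (ler_wpM2l (ltW (wt_gt0 _)) (fC _ e0))).
set w2 := \prod_k rho (z ord0 k) ^+ 2.
have w20 : 0 <= w2 by apply: prodr_ge0 => k _; rewrite exprn_ge0 ?rho_ge0.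
suff h : wt z * (1 + \sum_k `|z ord0 k|) <= w2.
  have -> : wt z * (C * (1 + \sum_k `|z ord0 k|) * (1 + nrmd z)) =
    C * (wt z * (1 + \sum_k `|z ord0 k|) * (1 + nrmd z)) by ring.
  rewrite ler_wpM2l// -[X in _ <= X + _]mulr1 -mulrDr ler_wpM2r//.
  by rewrite addr_ge0 ?nrmd_ge0.
have -> : w2 = wt z * \prod_k (1 + `|z ord0 k|).
  rewrite /w2 /wt -big_split/=; apply: eq_bigr => k _.
  rewrite [rho _ ^+ 3]exprSr -mulrA [rho _ * _]mulVf ?mulr1//.
by rewrite ler_wpM2l ?(ltW (wt_gt0 _))//; exact: add1_sum_le_prod.
Qed.

End heat_product.

(** * Estimates for the nonlocal part of the Oseen tensor *)

Section oseen_bound.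
Context {R : realType} {d : nat}.
Hypothesis d1 : (1 <= d)%N.
Local Notation mu := (@lebesgue_measure R).
Local Notation Rn := 'rV[R]_d.+1.
Local Notation mun := (lebesgue_rV R d.+1).
Implicit Types (x y z v w p : Rn) (i j k : 'I_d.+1) (t s M : R).

Definition rhod n (v : 'rV[R]_n) : R := \prod_k rho (v ord0 k).

Lemma rhod_ge0 n (v : 'rV[R]_n) : 0 <= rhod v.
Proof. by apply: prodr_ge0 => k _; exact: rho_ge0. Qed.

Lemma rhod_le1 n (v : 'rV[R]_n) : rhod v <= 1.
Proof.
rewrite -[leRHS](@big1 _ 1 *%R _ (index_enum 'I_n) xpredT (fun=> 1))//.
by apply: ler_prod => k _; rewrite rho_ge0 rho_le1.
Qed.

Lemma rhod_sub n (v u : 'rV[R]_n) :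
  rhod (v - u) <= rhod v * \prod_k (1 + `|u ord0 k|).
Proof.
rewrite /rhod -big_split/=; apply: ler_prod => k _.
by rewrite rho_ge0/= !mxE rho_sub.
Qed.

Lemma measurable_rhod n : measurable_fun setT (@rhod n).
Proof.
apply: measurable_prod => k _.
exact: (measurableT_comp measurable_rho (measurable_rV_coord k)).
Qed.

Definition seg M (r : R) : R := \1_(`[- M, M]%classic : set R) r.
(** The support of the field is enclosed in a cube rather than a ball because the indicator of a
    cube factorizes. *)
Definition cube M y : R := \prod_k seg M (y ord0 k).

Lemma seg_ge0 M r : 0 <= seg M r.
Proof. by rewrite /seg /indic; case: (_ \in _). Qed.

Lemma cube_ge0 M y : 0 <= cube M y.
Proof. by apply: prodr_ge0 => k _; exact: seg_ge0. Qed.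

Lemma seg_cases M r : (seg M r = 0) \/ (seg M r = 1 /\ `|r| <= M).
Proof.
rewrite /seg /indic; have [/set_mem/=|_] := boolP (r \in _); last by left.
by rewrite in_itv/= -ler_norml => h; right.
Qed.

Lemma cube1 M y : (forall k, `|y ord0 k| <= M) -> cube M y = 1.
Proof.
move=> yM; rewrite /cube big1// => k _; rewrite /seg /indic mem_set//=.
by rewrite in_itv/= -ler_norml.
Qed.

Lemma measurable_seg M : measurable_fun [set: measurableTypeR R] (seg M).
Proof. exact: measurable_indic. Qed.

Lemma measurable_cube M : measurable_fun setT (cube M).
Proof.
apply: measurable_prod => k _.
exact: (measurableT_comp (measurable_seg M) (measurable_rV_coord k)).
Qed.

Lemma intg_seg M : 0 <= M -> intg mu (seg M) /\ \int[mu]_r seg M r = 2 * M.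
Proof.
move=> M0; split; first exact: integrable_indic_itv.
have E : mu (`[- M, M]%classic : set R) = (2 * M)%:E.
  rewrite lebesgue_measure_itv/= lte_fin; have [MM|MM] := ltP (- M) M.
    by rewrite -EFinB; congr EFin; ring.
  by congr EFin; lra.
by rewrite /Rintegral /seg integral_indic// setIT [X in fine X]E.
Qed.

Lemma intg_cube M : 0 <= M -> intg mun (cube M).
Proof. by move=> M0; apply: (@intg_prodf _ _ (fun=> seg M)) => k; have [] := intg_seg M0. Qed.

Let H0 : R := \int[mu]_r hs (@alpha R d) r.

Let H00 : 0 <= H0.
Proof. by apply: Rintegral_ge0 => r _; exact: hs_ge0. Qed.

Let hi := intg_hs (@alpha01 R d).

(** [1 + M] is the price of Peetre's inequality for a shift by at most [M]; [2 * M + H0] bounds the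
    integral of [qn] over a segment of length [2 * M]. *)
Definition cq M : R := (1 + M) * (2 * M + H0).

Lemma cq_ge0 M : 0 <= M -> 0 <= cq M.
Proof. by move=> M0; rewrite mulr_ge0// addr_ge0// mulr_ge0. Qed.

Lemma seg_qf M k r : 0 <= M ->
  intg mu (fun s => seg M s * qf k (r - s)) /\
  \int[mu]_s (seg M s * qf k (r - s)) <= cq M * (if k == ord_max then 1 else rho r).
Proof.
move=> M0; set c : R := if _ then _ else _.
have c0 : 0 <= c by rewrite /c; case: ifP; rewrite ?rho_ge0.
have [si sE] := intg_seg M0.
have Fi : intg mu (fun s => c * (1 + M) * (seg M s + hs (@alpha R d) (r - s))).
  by apply: intgZ; apply: intgD => //; exact: intg1_sub.
have le s : seg M s * qf k (r - s) <= c * (1 + M) * (seg M s + hs (@alpha R d) (r - s)).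
  have [->|[-> sM]] := seg_cases M s.
    by rewrite mul0r add0r !mulr_ge0 ?hs_ge0// addr_ge0.
  rewrite mul1r -/(qn _) /c /qf; case: ifP => _.
    by rewrite mul1r ler_peMl ?qn_ge0// lerDl.
  rewrite ler_wpM2r ?qn_ge0// (le_trans (rho_sub _ _))//.
  by rewrite ler_wpM2l ?rho_ge0// lerD2l.
have mf : measurable_fun [set: measurableTypeR R] (fun s => seg M s * qf k (r - s)).
  apply: measurable_funM; first exact: measurable_seg.
  apply: (measurableT_comp (measurable_qf k)); exact: measurable_funB.
have f0 s : 0 <= seg M s * qf k (r - s) by rewrite mulr_ge0 ?seg_ge0 ?qf_ge0.
have ii : intg mu (fun s => seg M s * qf k (r - s)).
  by apply: (intg_le mf Fi) => s; rewrite ger0_norm.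
split=> //; apply: (le_trans (Rint_le ii Fi le)).
rewrite RintZ ?RintD//; try exact: intg1_sub; last first.
  by apply: intgD => //; exact: intg1_sub.
by rewrite sE (Rint1_sub r (intg_meas hi)) -/H0 /cq -[leLHS]mulrA [leLHS]mulrC.
Qed.

Lemma prod_last (c : R) (f : 'I_d.+1 -> R) : \prod_k (c * (if k == ord_max then 1 else f k)) =
  c ^+ d.+1 * \prod_(k < d) f (lift ord_max k).
Proof.
rewrite big_split/= prodr_const card_ord (bigD1_ord ord_max)//= eqxx mul1r.
congr (_ * _); apply: eq_bigr => k _.
by rewrite eq_sym (negbTE (neq_lift _ _)).
Qed.

Lemma rhod_tang p : rhod (tang p) = \prod_(k < d) rho (p ord0 (lift ord_max k)).
Proof. by apply: eq_bigr => k _; rewrite mxE. Qed.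

(** Averaging the singular kernel over the support of the field removes the singularity and retains
    the tangential decay in [p]. *)
Lemma cube_nrmd M p : 0 <= M ->
  intg mun (fun y => cube M y * nrmd (p - y)) /\
  \int[mun]_y (cube M y * nrmd (p - y)) <= 2 ^+ d * cq M ^+ d.+1 * rhod (tang p).
Proof.
move=> M0; have qi k := (seg_qf k (p ord0 k) M0).1.
have Fi := intg_prodf qi.
have mf : measurable_fun setT (fun y => cube M y * nrmd (p - y)).
  apply: measurable_funM; first exact: measurable_cube.
  exact: (measurableT_comp measurable_nrmd (measurable_csub p)).
have le : {ae mun, forall y, cube M y * nrmd (p - y) <=
    2 ^+ d * \prod_k (seg M (y ord0 k) * qf k (p ord0 k - y ord0 k))}.
  apply: aeS (ae_nrmd_le p) => y h.
  rewrite [X in _ <= _ * X]big_split/= [leRHS]mulrCA ler_wpM2l//; exact: cube_ge0.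
have f0 y : 0 <= cube M y * nrmd (p - y) by rewrite mulr_ge0 ?cube_ge0 ?nrmd_ge0.
have ii : intg mun (fun y => cube M y * nrmd (p - y)).
  by apply: (intg_le_ae mf (intgZ (2 ^+ d) Fi)); apply: aeS le => y; rewrite ger0_norm.
split=> //; apply: (le_trans (Rint_le_ae ii (intgZ (2 ^+ d) Fi) le)).
rewrite RintZ// -mulrA ler_wpM2l ?exprn_ge0//.
rewrite rhod_tang -(prod_last _ (fun k => rho (p ord0 k))).
apply: (@Rint_prodf_le _ _ (fun k s => seg M s * qf k (p ord0 k - s))) => //.
- by move=> k s; rewrite mulr_ge0 ?seg_ge0 ?qf_ge0.
- by move=> k; have [] := seg_qf k (p ord0 k) M0.
Qed.

Lemma measurable_E : measurable_fun setT (E : Rn -> R).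
Proof.
have [d2|d2] := boolP (d.+1 == 2%N).
  rewrite (_ : E = fun z => - (2 * pi)^-1 * ln (enorm z)).
    apply: measurable_funM => //.
    exact: (measurableT_comp (@measurable_ln R) measurable_enorm).
  by apply/funext => z; rewrite /E d2.
rewrite (_ : E = fun z => (d.+1%:R * (d.+1%:R - 2) * @unit_ball_volume R d)^-1
     * enorm z `^ (2 - d.+1%:R)).
  apply: measurable_funM => //.
  exact: (measurableT_comp (measurable_powR _) measurable_enorm).
by apply/funext => z; rewrite /E (negbTE d2).
Qed.

(** Comparison with the value at a fixed unit vector [b] through [E_lip] treats the logarithm and
    the power at once. *)
Lemma wclass_E : wclass (E : Rn -> R).
Proof.
pose b : Rn := ed ord_max.
have b0 : 0 < enorm b by apply: (@enorm_gt0 _ _ _ ord_max); rewrite edE eqxx oner_neq0.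
pose B : R := \sum_k `|b ord0 k|.
have B0 : 0 <= B by apply: sumr_ge0.
have N0 := nrmd_ge0 b.
apply: (@wclass_le _ _ _ (`|E b| + `|@cE R d| * ((1 + B) * (1 + nrmd b)))).
- by rewrite addr_ge0// mulr_ge0// mulr_ge0// addr_ge0.
- exact: measurable_E.
move=> z z0; have h := E_lip d1 z0 b0.
have S0 : 0 <= \sum_k `|z ord0 k| by apply: sumr_ge0.
have Sb : \sum_k `|z ord0 k - b ord0 k| <= \sum_k `|z ord0 k| + B.
  by rewrite /B -big_split/=; apply: ler_sum => k _; exact: ler_normB.
have Nz := nrmd_ge0 z.
have -> : E z = (E z - E b) + E b by rewrite subrK.
apply: (le_trans (ler_normD _ _)); apply: (le_trans (lerD h (lexx _))).
set S := \sum_k `|z ord0 k| in S0 Sb *; set c := `|cE|.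
have c0 : 0 <= c by exact: normr_ge0.
have E0 : 0 <= `|E b| by [].
rewrite [leLHS]addrC.
have -> : (`|E b| + c * ((1 + B) * (1 + nrmd b))) * (1 + S) * (1 + nrmd z) =
  `|E b| * ((1 + S) * (1 + nrmd z)) +
  c * (((1 + B) * (1 + S)) * ((1 + nrmd b) * (1 + nrmd z))) by ring.
apply: lerD; first by rewrite ler_peMr//; have := mulr_ge0 S0 Nz; lra.
rewrite -[leLHS]mulrA ler_wpM2l//.
apply: ler_pM; rewrite ?sumr_ge0 ?addr_ge0//.
  by apply: (le_trans Sb); have := mulr_ge0 B0 S0; lra.
by have := mulr_ge0 Nz N0; lra.
Qed.

(** Both derivatives fall on the Gaussian, which is licit because [E] lies in [wclass]. *)
Lemma heat_E_hconv i j x t : 0 < t -> heat_E i j x t = hconv2 i j E t x.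
Proof.
move=> t0; rewrite /heat_E -(pd_hconv1 i j x t0 wclass_E).
congr (pd i _ x); apply/funext => v; rewrite -(pd_hconv j v t0 wclass_E).
congr (pd j _ v); apply/funext => w; rewrite /hconv.
by apply: eq_Rintegral => z _; rewrite heatE.
Qed.

Lemma ae_enorm_gt0 v : {ae mun, forall z : Rn, 0 < enorm (v - z)}.
Proof.
apply: aeS (ae_coord_neq v) => z h; apply: (@enorm_gt0 _ _ _ ord_max).
by rewrite !mxE subr_eq0 eq_sym.
Qed.

Definition cS t : R := `|@cE R d| * (d.+1%:R * cM t ^+ d.+1).

(* The second derivatives of the heat kernel have mean zero, so only increments
   of [E] matter: this costs [1 / sqrt s] instead of [1 / s]. *)
Lemma heat_E_le i j v s : 0 < s -> 0 < enorm v ->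
  intg mun (fun z => wt z * Gam z (2 * s) * (nrmd (v - z) + nrmd v)) ->
  `|heat_E i j v s| <= cS s * (Num.sqrt s)^-1 *
    \int[mun]_z (wt z * Gam z (2 * s) * (nrmd (v - z) + nrmd v)).
Proof.
move=> s0 v0 gi; rewrite heat_E_hconv// /hconv2.
have mG2 : measurable_fun setT (Gam2 i j ^~ s : Rn -> R) by exact: measurable_Gam2t.
have mEv : measurable_fun setT (fun z => E (v - z)).
  exact: (measurableT_comp measurable_E (measurable_csub v)).
have mf : measurable_fun setT (fun z => Gam2 i j z s * E (v - z)).
  exact: measurable_funM.
have [C hC] := @Gam_bounds R d s s0.
have fi0 : intg mun (fun z => Gam2 i j (v - z) s * E z).
  by apply: (@intg_conv _ _ (Gam2 i j ^~ s) C mG2) wclass_E => u; have [] := hC u.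
have fi : intg mun (fun z => Gam2 i j z s * E (v - z)).
  have := intg_sub v fi0; congr (intg _ _); apply/funext => z.
  by rewrite subKr.
have gi0 : intg mun (fun z => Gam2 i j z s).
  by apply: (intg_le mG2 (intgZ C intg_wt)) => u; have [] := hC u.
have -> : \int[mun]_z (Gam2 i j (v - z) s * E z) =
    \int[mun]_z (Gam2 i j z s * (E (v - z) - E v)).
  have -> : \int[mun]_z (Gam2 i j z s * (E (v - z) - E v)) = \int[mun]_z (Gam2 i j z s * E (v - z)).
    under eq_Rintegral do rewrite mulrBr.
    rewrite (RintB fi (intgZr (E v) gi0)) (RintZr (E v) gi0).
    by rewrite (Rint_Gam2 i j s0) mul0r subr0.
  rewrite -(Rint_sub v mf); apply: eq_Rintegral => z _.
  by rewrite subKr.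
rewrite -(RintZ _ gi); set F := fun z => _ * (wt z * _ * _).
have Fi : intg mun F by exact: intgZ.
have ffi : intg mun (fun z => Gam2 i j z s * (E (v - z) - E v)).
  rewrite (_ : (fun z => _) = fun z => Gam2 i j z s * E (v - z) - Gam2 i j z s * E v).
    by apply: intgB => //; exact: intgZr.
  by apply/funext => z; rewrite mulrBr.
apply: (le_trans (le_normr_Rintegral measurableT ffi)).
apply: Rint_le_ae => //; first exact: intg_norm.
apply: aeS (ae_enorm_gt0 v) => z vz.
rewrite /F normrM; have := E_lip d1 vz v0.
have -> : \sum_k `|(v - z) ord0 k - v ord0 k| = \sum_k `|z ord0 k|.
  by apply: eq_bigr => k _; rewrite !mxE addrC addKr normrN.
move=> h; apply: (le_trans (ler_wpM2l (normr_ge0 _) h)).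
have h2 := Gam2_wt_norm i j z s0.
have n0 : 0 <= nrmd (v - z) + nrmd v by rewrite addr_ge0 ?nrmd_ge0.
rewrite /cS.
have -> : `|Gam2 i j z s| * (`|@cE R d| * (\sum_k `|z ord0 k|) * (nrmd (v - z) + nrmd v)) =
  `|@cE R d| * (nrmd (v - z) + nrmd v) * (`|Gam2 i j z s| * (\sum_k `|z ord0 k|)).
  by move: (nrmd _ + _) (Gam2 _ _ _ _) (\sum_k _) (`|@cE R d|) => A B S c; ring.
apply: (le_trans (ler_wpM2l _ h2)); first by rewrite mulr_ge0.
rewrite le_eqVlt; apply/orP; left; apply/eqP.
by move: (nrmd _ + _) (Gam z _) (wt z) (`|@cE R d|) (cM s) (Num.sqrt s)^-1 => A B S c e f; ring.
Qed.

End oseen_bound.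

Section oseen_integral.
Context {R : realType} {d : nat}.
Hypothesis d1 : (1 <= d)%N.
Local Notation mu := (@lebesgue_measure R).
Local Notation Rn := 'rV[R]_d.+1.
Local Notation mun := (lebesgue_rV R d.+1).
Implicit Types (x y z v w p : Rn) (i j k : 'I_d.+1) (t s M : R).

Lemma measurable_hconv2 i j (f : Rn -> R) : measurable_fun setT f ->
  measurable_fun [set: Rn * measurableTypeR R] (fun q => hconv2 i j f q.2 q.1).
Proof.
move=> mf.
have mF : measurable_fun setT (fun p : (Rn * measurableTypeR R) * Rn =>
    Gam2 i j (p.1.1 - p.2) p.1.2 * f p.2).
  apply: measurable_funM; last exact: (measurableT_comp mf).
  apply: measurable_Gam2.
    move=> k; apply: measurable_rV_coord_comp; apply: measurable_rV_sub => //.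
    exact: (measurableT_comp measurable_fst measurable_fst).
  exact: (measurableT_comp measurable_snd measurable_fst).
have h := measurable_Rint2 mun mF.
exact: h.
Qed.

Lemma measurable_hconv2_sub i j s p : measurable_fun setT (fun y => hconv2 i j E s (p - y)).
Proof.
have mm : measurable_fun setT (fun y => (p - y, s) : Rn * measurableTypeR R).
  by apply/measurable_fun_pairP; split; [exact: measurable_csub|exact: measurable_cst].
exact: (measurableT_comp (measurable_hconv2 i j measurable_E) mm).
Qed.

Lemma wt_rhod_tang p z : wt z * rhod (tang (p - z)) <= rhod (tang p).
Proof.
have -> : tang (p - z) = tang p - tang z by apply/rowP => k; rewrite !mxE.
apply: (le_trans (ler_wpM2l (ltW (wt_gt0 _)) (rhod_sub _ _))).
rewrite mulrCA ler_piMr ?rhod_ge0//.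
rewrite /wt (bigD1_ord ord_max)//= -mulrA -big_split/=.
have h0 : 0 <= rho (z ord0 ord_max) ^+ 3 by rewrite exprn_ge0 ?rho_ge0.
have h1 : rho (z ord0 ord_max) ^+ 3 <= 1 by rewrite exprn_ile1 ?rho_ge0 ?rho_le1.
apply: mulr_ile1 => //.
  by apply: prodr_ge0 => k _; rewrite mulr_ge0 ?exprn_ge0 ?rho_ge0// addr_ge0.
rewrite -[leRHS](@big1 _ 1 *%R _ (index_enum 'I_d) xpredT (fun=> 1))//.
apply: ler_prod => k _; rewrite mulr_ge0 ?exprn_ge0 ?rho_ge0 ?addr_ge0//=.
rewrite mxE exprSr -mulrA [rho _ * (1 + _)]mulVf ?mulr1 ?exprn_ile1 ?rho_ge0 ?rho_le1//.
Qed.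

Definition cI M t : R := cS (d := d) t * (2 * (2 ^+ d * cq (d := d) M ^+ d.+1)).

(** The majorant for Fubini inside [W]: averaged over the support of the field, the nonlocal part
    has a time singularity [1 / sqrt s] and one power of decay in each tangential coordinate of [p].
    Integrating over the cube first turns [nrmd] into [rhod], and the factor [wt z] undoes the shift
    of the centre by [z]. *)
Lemma cube_heat_E i j p M s T : 0 <= M -> 0 < s -> s <= T ->
  intg mun (fun y => cube M y * hconv2 i j E s (p - y)) /\
  \int[mun]_y (cube M y * `|hconv2 i j E s (p - y)|) <=
    cI M T * (Num.sqrt s)^-1 * rhod (tang p).
Proof.
move=> M0 s0 sT; pose c1 : R := 2 ^+ d * cq (d := d) M ^+ d.+1.
have c10 : 0 <= c1 by rewrite mulr_ge0 ?exprn_ge0 ?cq_ge0.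
have s20 : 0 < 2 * s by rewrite mulr_gt0.
pose w z := wt z * Gam z (2 * s).
have w0 z : 0 <= w z by rewrite mulr_ge0 ?Gam_ge0 ?(ltW (wt_gt0 _)).
have mw : measurable_fun setT w.
  by apply: measurable_funM; [exact: measurable_wt|exact: measurable_Gamt].
pose G (q : Rn * Rn) := w q.1 * (cube M q.2 * (nrmd (p - q.2 - q.1) + nrmd (p - q.2))).
have G0 q : 0 <= G q by rewrite mulr_ge0// mulr_ge0 ?cube_ge0// addr_ge0 ?nrmd_ge0.
have inner z : intg mun (fun y => cube M y * (nrmd (p - y - z) + nrmd (p - y))) /\
   \int[mun]_y (cube M y * (nrmd (p - y - z) + nrmd (p - y))) <=
     c1 * rhod (tang (p - z)) + c1 * rhod (tang p).
  have [i1 b1] := cube_nrmd (p - z) M0; have [i2 b2] := cube_nrmd p M0.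
  have E : (fun y => cube M y * (nrmd (p - y - z) + nrmd (p - y))) =
     fun y => cube M y * nrmd (p - z - y) + cube M y * nrmd (p - y).
    by apply/funext => y; rewrite mulrDr addrAC.
  by rewrite E; split; [exact: intgD|rewrite RintD//; exact: lerD].
have mG : measurable_fun setT G.
  apply: measurable_funM; first exact: (measurableT_comp mw).
  apply: measurable_funM; first exact: (measurableT_comp (measurable_cube M)).
  apply: measurable_funD; apply: (measurableT_comp (@measurable_nrmd R d)).
    exact: (measurable_rV_sub (measurableT_comp (measurable_csub p) measurable_snd) measurable_fst).
  exact: (measurableT_comp (measurable_csub p) measurable_snd).
have Gle z : \int[mun]_y `|G (z, y)| <= 2 * c1 * rhod (tang p) * Gam z (2 * s).
  have [ii ib] := inner z.
  have -> : \int[mun]_y `|G (z, y)| = \int[mun]_y (w z * (cube M y * (nrmd (p - y - z) + nrmd (p - y)))).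
    by apply: eq_Rintegral => y _; rewrite ger0_norm.
  rewrite (RintZ _ ii); apply: (le_trans (ler_wpM2l (w0 _) ib)).
  have := wt_rhod_tang p z; have g0 := Gam_ge0 z (2 * s).
  have r0 := rhod_ge0 (tang p).
  have w1 : wt z <= 1.
    rewrite /wt -[leRHS](@big1 _ 1 *%R _ (index_enum 'I_d.+1) xpredT (fun=> 1))//.
    by apply: ler_prod => k _; rewrite exprn_ge0 ?exprn_ile1 ?rho_ge0 ?rho_le1.
  move=> h.
  have -> : w z * (c1 * rhod (tang (p - z)) + c1 * rhod (tang p)) =
    c1 * Gam z (2 * s) * (wt z * rhod (tang (p - z)) + wt z * rhod (tang p)).
    by rewrite /w; move: (Gam z _) (wt z) (rhod _) (rhod _) => A B S e; ring.
  have -> : 2 * c1 * rhod (tang p) * Gam z (2 * s) = c1 * Gam z (2 * s) * (rhod (tang p) + rhod (tang p)).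
    by move: (Gam z _) (rhod _) => A B; ring.
  apply: ler_wpM2l; first by rewrite mulr_ge0.
  by apply: lerD => //; rewrite ler_piMl.
have [gi gE] := @intg_Gam_Rint R d.+1 _ s20.
have Gi : intg (mun \x mun)%E G.
  apply: (intg_prod mG (intgZ (2 * c1 * rhod (tang p)) gi)) => // z.
  exact: (intgZ (w z) (inner z).1).
pose H y := \int[mun]_z G (z, y).
have Hi : intg mun H := intg_Rint1 Gi.
have HE : \int[mun]_y H y <= 2 * c1 * rhod (tang p).
  have -> : 2 * c1 * rhod (tang p) = \int[mun]_z (2 * c1 * rhod (tang p) * Gam z (2 * s)).
    by rewrite (RintZ _ gi) gE mulr1.
  rewrite /H -(Rint_swap Gi).
  apply: (Rint_le (intg_Rint2 Gi) (intgZ _ gi)) => z /=.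
  apply: (le_trans _ (Gle z)); apply: Rint_le => [||y]; last exact: ler_norm.
  - exact: (intgZ (w z) (inner z).1).
  - exact: (intg_norm (intgZ (w z) (inner z).1)).
have s1 : 0 <= (Num.sqrt s)^-1 by rewrite invr_ge0 sqrtr_ge0.
have cS0 t : 0 <= cS (d := d) t.
  by rewrite /cS !mulr_ge0// exprn_ge0// ltW// cM_gt0.
have H0 y : 0 <= H y by apply: Rintegral_ge0 => z _.
have ae : {ae mun, forall y, cube M y * `|hconv2 i j E s (p - y)| <=
    cS (d := d) s * (Num.sqrt s)^-1 * H y}.
  (* The pointwise bound [heat_E_le] asks for a nonzero argument and for integrability in [z]; both
     hold for almost every [y], the latter by Fubini. *)
  have := ae_intg2 Gi; have := ae_enorm_gt0 p; apply: filterS2 => y py iy.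
  have [->|c0] := eqVneq (cube M y) 0.
    by rewrite mul0r; apply: mulr_ge0 => //; exact: mulr_ge0.
  have iy' : intg mun (fun z => w z * (nrmd (p - y - z) + nrmd (p - y))).
    have := intgZ (cube M y)^-1 iy; congr (intg _ _); apply/funext => z.
    by rewrite /G/=; field.
  have := heat_E_le d1 i j s0 py iy'; rewrite heat_E_hconv// => h.
  apply: (le_trans (ler_wpM2l (cube_ge0 _ _) h)).
  rewrite mulrCA; apply: ler_wpM2l; first exact: mulr_ge0.
  have -> : H y = cube M y * \int[mun]_z (w z * (nrmd (p - y - z) + nrmd (p - y))).
    by rewrite -(RintZ _ iy'); apply: eq_Rintegral => z _; rewrite /G/= mulrCA.
  exact: lexx.
have mh := measurable_hconv2_sub i j s p.
have mf : measurable_fun setT (fun y => cube M y * hconv2 i j E s (p - y)).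
  by apply: measurable_funM => //; exact: measurable_cube.
have nE y : `|cube M y * hconv2 i j E s (p - y)| = cube M y * `|hconv2 i j E s (p - y)|.
  by rewrite normrM ger0_norm ?cube_ge0.
have ii : intg mun (fun y => cube M y * hconv2 i j E s (p - y)).
  apply: (intg_le_ae mf (intgZ (cS (d := d) s * (Num.sqrt s)^-1) Hi)).
  by apply: aeS ae => y; rewrite nE.
split=> //; have := intg_norm ii; under eq_fun do rewrite nE; move=> iin.
apply: (le_trans (Rint_le_ae iin (intgZ _ Hi) ae)); rewrite (RintZ _ Hi).
apply: (@le_trans _ _ (cS (d := d) s * (Num.sqrt s)^-1 * (2 * c1 * rhod (tang p)))).
  by rewrite ler_wpM2l// mulr_ge0.
rewrite /cI -/c1.
have -> : cS (d := d) s * (Num.sqrt s)^-1 * (2 * c1 * rhod (tang p)) =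
  cS (d := d) s * ((Num.sqrt s)^-1 * (2 * c1 * rhod (tang p))) by rewrite [RHS]mulrA.
have -> : cS (d := d) T * (2 * c1) * (Num.sqrt s)^-1 * rhod (tang p) =
  cS (d := d) T * ((Num.sqrt s)^-1 * (2 * c1 * rhod (tang p))).
  by move: (cS _) (rhod _) ((Num.sqrt s)^-1) => A B S; ring.
have r0 := rhod_ge0 (tang p).
apply: ler_wpM2r; first by do 3! [apply: mulr_ge0 => //].
rewrite /cS; apply: ler_wpM2l => //; apply: ler_wpM2l => //.
by apply: lerXn2r; rewrite ?nnegrE ?(ltW (cM_gt0 _)) ?cM_le.
Qed.

End oseen_integral.

(** * Solenoidal fields are orthogonal to gradients *)

Section solenoidal_field.
Context {R : realType} {d : nat}.
Local Notation mu := (@lebesgue_measure R).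
Local Notation Rn := 'rV[R]_d.+1.
Local Notation mun := (lebesgue_rV R d.+1).
Implicit Types (x y z p : Rn) (i j k : 'I_d.+1) (t s M N : R).

Lemma measurable_upper : measurable (upper : set Rn).
Proof.
have := @measurable_rV_coord _ (measurableTypeR R) d.+1 ord_max measurableT _ (measurable_itv `]0, +oo[).
by rewrite setTI; congr measurable; apply/seteqP; split=> x /=; rewrite in_itv/= andbT.
Qed.

Lemma measurable_closed_upper : measurable (closed_upper : set Rn).
Proof.
have := @measurable_rV_coord _ (measurableTypeR R) d.+1 ord_max measurableT _ (measurable_itv `[0, +oo[).
by rewrite setTI; congr measurable; apply/seteqP; split=> x /=; rewrite in_itv/= andbT.
Qed.

Lemma indic_upper y : \1_upper y = (0 < height y)%R%:R :> R.
Proof.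
rewrite /indic; have [h|/negP h] := boolP (0 < height y); first by rewrite mem_set.
by rewrite memNset.
Qed.

Lemma measurable_upper_cont (g : Rn -> R) : {within closed_upper, continuous g} ->
  measurable_fun setT (fun y => \1_upper y * g y).
Proof.
move=> cg; rewrite (_ : (fun y => _) = fun y => \1_upper y * (\1_closed_upper y * g y)).
  apply: measurable_indic_fun; first exact: measurable_upper.
  apply: measurable_within_continuous => //; first exact: measurable_closed_upper.
  move=> m x; rewrite /closed_upper/= /height !mxE => x0.
  by rewrite divr_ge0// ler0z floor_ge0 mulr_ge0.
apply/funext => y; rewrite indic_upper; have [h|h] := ltP 0 (height y); last by rewrite !mul0r.
by rewrite !mul1r /indic mem_set ?mul1r//=; exact: ltW.
Qed.

Definition box N : set Rn := [set y | closed_upper y /\ forall k, `|y ord0 k| <= N].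

Lemma compact_box N : compact (box N).
Proof.
pose A k : set R := if k == ord_max then `[0, N]%classic else `[- N, N]%classic.
rewrite (_ : box N = [set v | forall k, A k (v ord0 k)]).
  by apply: rV_compact => k; rewrite /A; case: ifP => _; exact: segment_compact.
apply/seteqP; split=> [y [y0 yN] k|y yA].
  rewrite /A; case: ifPn => [/eqP ->|_] /=; rewrite in_itv/=.
    by rewrite y0/= (le_trans (ler_norm _)).
  by rewrite -ler_norml.
split=> [|k]; first by have := yA ord_max; rewrite /A eqxx /= in_itv/= => /andP[].
have := yA k; rewrite /A; case: ifPn => _ /=; rewrite in_itv/=; last by rewrite -ler_norml.
by move=> /andP[h1 h2]; rewrite ger0_norm.
Qed.

Lemma box_bounded N (g : Rn -> R) : {within closed_upper, continuous g} ->
  exists2 B, 0 <= B & forall y, box N y -> `|g y| <= B.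
Proof.
move=> cg; have cg' : {within box N, continuous g}.
  by apply: continuous_subspaceW cg => y [].
have /compact_bounded/pinfty_ex_gt0[B B0 hB] := continuous_compact cg' (@compact_box N).
by exists B; [exact: ltW|move=> y yN; apply: hB; exists y].
Qed.

Lemma cube_cases M y : (cube M y = 0 /\ exists k, M < `|y ord0 k|) \/
  (cube M y = 1 /\ forall k, `|y ord0 k| <= M).
Proof.
have [/forallP h|] := boolP [forall k, `|y ord0 k| <= M]; first by right; rewrite cube1.
rewrite negb_forall => /existsP[k]; rewrite -ltNge => yk; left; split; last by exists k.
rewrite /cube (bigD1_ord k)//=; have [->|[_]] := seg_cases M (y ord0 k); first by rewrite mul0r.
by rewrite leNgt yk.
Qed.

Lemma line_continuous j y : continuous (fun r : R => r *: ed j + y).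
Proof.
move=> r; have h0 : x @[x --> r] --> r by exact: cvg_id.
have h : (fun r : R => r *: ed j) x @[x --> r] --> r *: ed j by exact: (cvgZr_tmp h0).
by have h3 : y @[x --> r] --> y; [exact: cvg_cst|exact: (cvgD h h3)].
Qed.

Lemma line_within j y (a b : R) (g : Rn -> R) : {within closed_upper, continuous g} ->
  (forall r, a <= r <= b -> closed_upper (r *: ed j + y)) ->
  {within `[a, b], continuous (fun r => g (r *: ed j + y))}.
Proof.
move=> /subspace_continuousP cg ab; apply/subspace_continuousP => r /= rab.
have cl : {for r, continuous (fun r : R => r *: ed j + y)}.
  exact: line_continuous.
have rc : closed_upper (r *: ed j + y) by apply: ab; rewrite in_itv/= in rab.
apply: cvg_comp (cg _ rc) => B hB.
have h : \forall q \near r, closed_upper (q *: ed j + y) -> B (q *: ed j + y) := cl _ hB.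
have : \forall q \near r, q \in `[a, b] -> B (q *: ed j + y).
  by apply: filterS h => q hq qab; apply: hq; apply: ab; rewrite in_itv/= in qab.
exact.
Qed.

Definition extu (u : Rn -> Rn) j y : R := \1_upper y * u y ord0 j.

(* What the translation argument uses about the extension by zero of a
   solenoidal field: it is Lipschitz in the j-th direction for its j-th
   component, and its divergence vanishes off the boundary. *)
Definition solenoidal (v w : 'I_d.+1 -> Rn -> R) (B M : R) :=
  [/\ 0 <= B, 0 <= M & [/\ forall j, measurable_fun setT (v j),
    forall j, measurable_fun setT (w j),
    forall j y, `|v j y| <= B * cube M y,
    forall j y h, `|h| <= 1 -> `|v j (h *: ed j + y) - v j y| <= B * `|h| * cube M y &
    (forall j y, height y != 0 -> is_derive y (ed j) (v j) (w j y)) /\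
    forall y, \sum_j w j y = 0]].

Section field.
Variable u : Rn -> Rn.
Hypotheses (u_C1c : C1c_closed_upper u)
  (u_div : forall x, upper x -> divergence u x = 0)
  (u_Sigma : forall x, height x = 0 -> height (u x) = 0).

Let ucont j : {within closed_upper, continuous (fun y => u y ord0 j)}.
Proof.
have [/subspace_continuousP cu _ _] := u_C1c; apply/subspace_continuousP => x xc.
apply: (@cvg_comp _ _ _ u (fun v : Rn => v ord0 j) _ _ _ (cu x xc)).
exact: coord_continuous.
Qed.

Let usupp : exists2 M, 0 <= M & forall y, upper y -> forall k, M < `|y ord0 k| -> u y = 0.
Proof.
have [_ _ /compact_bounded/pinfty_ex_gt0[M M0 hM]] := u_C1c.
exists M; first exact: ltW; move=> y yu k yk; apply/eqP; apply: contraLR yk => uy.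
rewrite -leNgt; have /hM/= : closure [set x | closed_upper x /\ u x != 0] y.
  by apply: subset_closure; split=> //; exact: ltW.
apply: le_trans; rewrite {2}/Num.norm/= mx_normrE.
by apply: (le_trans _ (le_bigmax _ _ (ord0, k))).
Qed.

Let ugrad : exists g : 'I_d.+1 -> Rn -> R,
  (forall j, {within closed_upper, continuous (g j)}) /\
  forall j x, upper x -> is_derive x (ed j) (fun y => u y ord0 j) (g j x) /\
    pd j (fun y => u y ord0 j) x = g j x.
Proof.
have [_ hu _] := u_C1c.
have /choice[g hg] : forall j, exists g : Rn -> R, {within closed_upper, continuous g} /\
          forall x, upper x -> pd j (fun y => u y ord0 j) x = g x.
  by move=> j; have [_] := hu j j.
exists g; split=> [j|j x xu]; first by have [] := hg j.
have e := (hg j).2 x xu; split=> //; rewrite -e; apply: derivableP.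
by have [h _] := hu j j; exact: h.
Qed.

Lemma solenoidal_extu : exists w B M, solenoidal (extu u) w B M.
Proof.
have [M M0 uM] := usupp; have [g [gc gd]] := ugrad.
(* With the support in the cube of size [M], size [M + 1] contains every point from which a step
   [|h| <= 1] can reach it, and [M + 2] the ends of such steps. *)
have hB j : exists2 B, 0 <= B & forall y, box (M + 2) y -> `|g j y| <= B /\ `|u y ord0 j| <= B.
  have [B1 B10 h1] := box_bounded (M + 2) (gc j).
  have [B2 B20 h2] := box_bounded (M + 2) (@ucont j).
  exists (B1 + B2); first exact: addr_ge0.
  move=> y yb; split; first by rewrite (le_trans (h1 _ yb))// lerDl.
  by rewrite (le_trans (h2 _ yb))// lerDr.
have /choice[Bj hBj] : forall j, exists B, 0 <= B /\
    forall y, box (M + 2) y -> `|g j y| <= B /\ `|u y ord0 j| <= B.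
  by move=> j; have [B B0 h] := hB j; exists B.
pose B := \sum_j Bj j.
have BB j : Bj j <= B.
  by rewrite /B (bigD1_ord j)//= lerDl; apply: sumr_ge0 => k _; have [] := hBj (lift j k).
have B0 : 0 <= B by apply: sumr_ge0 => k _; have [] := hBj k.
have gB j y : box (M + 2) y -> `|g j y| <= B.
  by move=> yb; have [_ h] := hBj j; rewrite (le_trans (h y yb).1).
have uB j y : box (M + 2) y -> `|u y ord0 j| <= B.
  by move=> yb; have [_ h] := hBj j; rewrite (le_trans (h y yb).2).
have v0 j y : (exists k, M < `|y ord0 k|) -> extu u j y = 0.
  move=> [k yk]; rewrite /extu indic_upper; have [yu|yu] := ltP 0 (height y); last by rewrite mul0r.
  by rewrite (uM y yu k yk) mxE mulr0.
have lip0 j y (a b : R) : a <= b ->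
    (forall r, a <= r <= b -> box (M + 2) (r *: ed j + y)) ->
    (forall r, a < r < b -> upper (r *: ed j + y)) ->
    `|u (b *: ed j + y) ord0 j - u (a *: ed j + y) ord0 j| <= B * `|b - a|.
  move=> ab rb ru; have dd r : r \in `]a, b[ ->
      is_derive r 1 (fun r : R => u (r *: ed j + y) ord0 j) (g j (r *: ed j + y)).
    rewrite in_itv/= => rab; apply: (@is_derive_lineP_at _ _ j (fun y => u y ord0 j)).
    by have [] := gd j _ (ru r rab).
  have cc : {within `[a, b], continuous (fun r : R => u (r *: ed j + y) ord0 j)}.
    by apply: (@line_within j y a b (fun y => u y ord0 j)) => // r rab; have [] := rb r rab.
  have [c] := MVT_segment ab dd cc; rewrite in_itv/= => cab ->.
  by rewrite normrM ler_wpM2r// gB//; exact: rb.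
have lip j y (a b : R) :
    (forall r, (a <= r <= b) || (b <= r <= a) -> box (M + 2) (r *: ed j + y)) ->
    (forall r, (a < r < b) || (b < r < a) -> upper (r *: ed j + y)) ->
    `|u (b *: ed j + y) ord0 j - u (a *: ed j + y) ord0 j| <= B * `|b - a|.
  move=> h1 h2; have [ab|/ltW ba] := leP a b.
    by apply: lip0 => // r rab; [apply: h1|apply: h2]; rewrite rab.
  by rewrite distrC (distrC b); apply: lip0 => // r rab; [apply: h1|apply: h2]; rewrite rab orbT.
have hline j y r : height (r *: ed j + y) = (ord_max == j)%:R * r + height y.
  by rewrite /height lineE.
exists (fun j y => \1_upper y * g j y), B, (M + 1); split; [by []|exact: addr_ge0|split].
- by move=> j; exact: measurable_upper_cont.
- by move=> j; exact: measurable_upper_cont.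
- move=> j y; have [[-> [k yk]]|[-> yM]] := cube_cases (M + 1) y.
    by rewrite v0 ?normr0 ?mulr0//; exists k; lra.
  rewrite /extu indic_upper mulr1; have [yu|yu] := ltP 0 (height y); last by rewrite mul0r normr0.
  rewrite mul1r uB//; split=> [|k]; first exact: ltW.
  by have := yM k; lra.
- move=> j y h h1; have [[-> [k yk]]|[-> yM]] := cube_cases (M + 1) y.
    rewrite mulr0 !v0 ?subr0 ?normr0//; exists k; first by lra.
    rewrite lineE; have := lerB_normD (y ord0 k) ((k == j)%:R * h); rewrite [y ord0 k + _]addrC.
    have : `|(k == j)%:R * h| <= 1 by case: (k == j); rewrite ?mul1r ?mul0r ?normr0.
    by set c := _ * h; move: (`|c|) => e e1 e2; lra.
  rewrite mulr1; have bx r : `|r| <= 1 -> 0 <= height (r *: ed j + y) -> box (M + 2) (r *: ed j + y).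
    move=> r1 r0; split=> // k; rewrite lineE.
    have := ler_normD ((k == j)%:R * r) (y ord0 k); have := yM k.
    have : `|(k == j)%:R * r| <= 1 by case: (k == j); rewrite ?mul1r ?mul0r ?normr0.
    by set c := _ * r; move: (`|c|) => e e1 e2; lra.
  (* A tangential step keeps the height and stays on one side of [Sigma], so the jump of a
     tangential component across [Sigma] is not met. *)
  have [jn|jn] := eqVneq ord_max j; last first.
    have he r : height (r *: ed j + y) = height y by rewrite hline (negbTE jn) mul0r add0r.
    rewrite /extu !indic_upper he; have [yu|yu] := ltP 0 (height y); last by rewrite !mul0r subrr normr0 mulr_ge0.
    rewrite !mul1r -[y in X in _ - X]add0r -[0 in X in _ - X](scale0r (ed j)).
    rewrite -[h in leRHS]subr0; apply: lip => r rh; last by rewrite /upper/= he.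
    apply: bx; last by rewrite he ltW.
    by move: h1; rewrite !ler_norml; case/orP: rh => /andP[]; lra.
  have he r : height (r *: ed j + y) = r + height y by rewrite hline jn eqxx mul1r.
  (* For the normal component, extension by zero means evaluating [u] at the nearest point of the
     closed half-space in the normal direction: below [Sigma] that point lies on [Sigma], where the
     component vanishes. The projection is 1-Lipschitz, so the constant [B] is kept. *)
  have E r : extu u j (r *: ed j + y) = u (Num.max r (- height y) *: ed j + y) ord0 j.
    rewrite /extu indic_upper he; have [rp|rp] := ltP 0 (r + height y).
      by rewrite mul1r max_l//; lra.
    rewrite mul0r max_r; last by lra.
    have := u_Sigma (x := - height y *: ed j + y); rewrite he addNr -jn => /(_ erefl).
    by rewrite /height => ->.
  have -> : extu u j y = extu u j (0 *: ed j + y) by rewrite scale0r add0r.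
  rewrite !E; apply: (@le_trans _ _ (B * `|Num.max h (- height y) - Num.max 0 (- height y)|)).
    apply: lip => r; last first.
      by rewrite /upper/= he !gt_max !lt_max => /orP[] /andP[]; lra.
    have yn := yM ord_max; rewrite -/(height y) ler_norml in yn.
    have hp : - height y <= Num.max h (- height y) by rewrite le_max lexx orbT.
    have zp : - height y <= Num.max 0 (- height y) by rewrite le_max lexx orbT.
    move=> rh; have r0 : - height y <= r by case/orP: rh => /andP[]; lra.
    split; first by rewrite /closed_upper/= he; lra.
    move=> k; rewrite lineE; have [->|kj] := eqVneq k j; last first.
      by rewrite mul0r add0r; have := yM k; lra.
    rewrite mul1r -jn -/(height y) ger0_norm; last by lra.
    have hq : Num.max h (- height y) <= Num.max 1 (- height y).
      by rewrite ge_max !le_max lexx orbT andbT; move: h1; rewrite ler_norml; lra.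
    have zq : Num.max 0 (- height y) <= Num.max 1 (- height y).
      by rewrite ge_max !le_max lexx orbT andbT; lra.
    have rq : r <= Num.max 1 (- height y) by case/orP: rh => /andP[]; lra.
    by move: rq; rewrite le_max; case/orP; lra.
  rewrite ler_wpM2l// -[h in leRHS]subr0.
  case: (leP h (- height y)) => c1; case: (leP 0 (- height y)) => c2;
    rewrite ?subrr ?normr0 ?normr_ge0//.
    by rewrite !ler0_norm; lra.
  by rewrite !ger0_norm; lra.
split=> [j y y0|y]; last first.
  rewrite -mulr_sumr indic_upper; have [yu|yu] := ltP 0 (height y); last by rewrite mul0r.
  rewrite mul1r -[RHS](u_div yu); apply: eq_bigr => j _.
  by have [] := gd j y yu.
apply/is_derive_lineP.
have hc : {for (0 : R), continuous (fun r : R => height (r *: ed j + y))}.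
  apply: (@continuous_comp _ _ _ (fun r : R => r *: ed j + y) height).
    exact: line_continuous.
  exact: coord_continuous.
have h0E : height (0 *: ed j + y) = height y by rewrite scale0r add0r.
rewrite indic_upper; have [yu|yu] := ltP 0 (height y).
  have hn : \forall r \near (0 : R), 0 < height (r *: ed j + y).
    by apply: (cvgr_gt _ hc); rewrite h0E.
  rewrite mul1r; apply: (@near_eq_is_derive R R R (fun r : R => u (r *: ed j + y) ord0 j)).
    near=> r; have rr : 0 < height (r *: ed j + y) by near: r.
    by rewrite /extu indic_upper rr mul1r.
  have [h _] := gd j y yu.
  by apply/(@is_derive_lineP _ _ j (fun y => u y ord0 j)).
have yu' : height y < 0 by rewrite lt_neqAle y0.
have hn : \forall r \near (0 : R), height (r *: ed j + y) < 0.
  by apply: (cvgr_lt _ hc); rewrite h0E.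
rewrite mul0r; apply: (@near_eq_is_derive R R R (cst (0 : R))).
near=> r; have rr : height (r *: ed j + y) < 0 by near: r.
by rewrite /extu indic_upper ltNge (ltW rr) mul0r.
Unshelve. all: by end_near. Qed.

End field.
End solenoidal_field.

(** * Integration by parts through translations *)

Section translation.
Context {R : realType} {d : nat}.
Local Notation mu := (@lebesgue_measure R).
Local Notation Rn := 'rV[R]_d.+1.
Local Notation mun := (lebesgue_rV R d.+1).
Implicit Types (x y z p : Rn) (i j k : 'I_d.+1) (t s M N : R).

Lemma is_derive_seq (f : Rn -> R) x v (l : R) (h : nat -> R) :
  is_derive x v f l -> (forall m, h m != 0) -> h m @[m --> \oo] --> (0 : R) ->
  (h m)^-1 * (f (h m *: v + x) - f x) @[m --> \oo] --> l.
Proof.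
move=> [dl <-] h0 hc.
pose q (r : R) : R := r^-1 *: ((f \o shift x) (r *: v) - f x).
apply: (@cvg_comp _ _ _ h q _ (0 : R)^' _ _ dl) => A [e e0 hA].
have /cvgrPdist_lt/(_ e e0) := hc; apply: filterS => m hm.
by apply: hA => //; rewrite /= distrC subr0 in hm *; rewrite distrC subr0.
Qed.

Lemma pw_line M y j (h : R) : 0 <= M -> `|h| <= 1 -> cube M y * pw (h *: ed j + y) <=
  cube M y * (M + 2) ^+ (3 * d.+1).
Proof.
move=> M0 h1; have [[-> _]|[-> yM]] := cube_cases M y; first by rewrite !mul0r.
rewrite !mul1r /pw exprM -[d.+1 in leRHS]card_ord -prodr_const; apply: ler_prod => k _.
rewrite exprn_ge0 ?addr_ge0//=; apply: lerXn2r; rewrite ?nnegrE ?addr_ge0//.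
rewrite lineE; have := ler_normD ((k == j)%:R * h) (y ord0 k); have := yM k.
have : `|(k == j)%:R * h| <= 1 by case: (k == j); rewrite ?mul1r ?mul0r ?normr0.
by set c := _ * h; move: (`|c|) => e e1 e2; lra.
Qed.

Lemma line_quotient (f : Rn -> R) (f' : Rn -> R) j y (h : R) :
  (forall x, is_derive x (ed j) f (f' x)) -> 0 < h ->
  exists2 r, 0 <= r <= h & h^-1 * (f (h *: ed j + y) - f y) = f' (r *: ed j + y).
Proof.
move=> df h0.
have dd (r : R) : is_derive r (1 : R) (fun r : R => f (r *: ed j + y)) (f' (r *: ed j + y)).
  exact: is_derive_lineP_at.
have [|c] := @MVT_segment R (fun r => f (r *: ed j + y)) (fun r => f' (r *: ed j + y)) 0 h (ltW h0).
  apply: continuous_subspaceT => r; have [d1 _] := dd r.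
  exact: (differentiable_continuous ((derivable1_diffP _ _).1 d1)).
rewrite in_itv/= scale0r add0r subr0 => ch ->.
by exists c => //; rewrite mulrC mulfK// gt_eqF.
Qed.

(** Translation invariance moves a difference quotient from [F] to [v j], and dominated convergence
    passes to the limit on both sides. No boundary term appears, since the quotients of [v j] in
    direction [j] are bounded and converge off the null set [Sigma]; summed over [j], the limit
    contains the divergence. *)
Lemma solenoidal_Rint (v w : 'I_d.+1 -> Rn -> R) (B M C : R)
    (F : Rn -> R) (F' : 'I_d.+1 -> Rn -> R) :
  solenoidal v w B M -> measurable_fun setT F -> (forall j, measurable_fun setT (F' j)) ->
  (forall j y, is_derive y (ed j) F (F' j y)) ->
  (forall y, `|F y| <= C * pw y) -> (forall j y, `|F' j y| <= C * pw y) ->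
  (forall j, intg mun (fun y => F' j y * v j y)) /\
  \sum_j \int[mun]_y (F' j y * v j y) = 0.
Proof.
move=> [B0 M0 [mv mw vB vlip [vw w0]]] mF mF' dF FC F'C.
have C0 : 0 <= C.
  by have := le_trans (normr_ge0 _) (FC 0); rewrite pmulr_lge0// pw_gt0.
pose h (m : nat) : R := m.+1%:R^-1.
have h_gt0 m : 0 < h m by rewrite invr_gt0.
have h_le1 m : h m <= 1 by rewrite invf_le1// ler1n.
have h_cvg : h m @[m --> \oo] --> (0 : R) by exact: cvg_harmonic.
have ci := @intg_cube R d M M0.
pose D : R := C * (M + 2) ^+ (3 * d.+1) * B.
have Fcube j y (r : R) (G : Rn -> R) : (forall y, `|G y| <= C * pw y) -> `|r| <= 1 ->
    cube M y * `|G (r *: ed j + y)| <= cube M y * (C * (M + 2) ^+ (3 * d.+1)).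
  move=> GC r1; apply: (le_trans (ler_wpM2l (cube_ge0 _ _) (GC _))).
  by rewrite mulrCA [leRHS]mulrCA ler_wpM2l// pw_line.
have mline j (r : R) : measurable_fun setT (fun y : Rn => r *: ed j + y).
  apply: measurable_fun_rV => k; under eq_fun do rewrite lineE.
  by apply: measurable_funD => //; exact: measurable_coordE.
have key j : intg mun (fun y => F' j y * v j y) /\ intg mun (fun y => F y * w j y) /\
    \int[mun]_y (F' j y * v j y) = - \int[mun]_y (F y * w j y).
  pose f_ m y := (h m)^-1 * (F (h m *: ed j + y) - F y) * v j y.
  pose g_ m y := F y * ((h m)^-1 * (v j (- h m *: ed j + y) - v j y)).
  have mf_ m : measurable_fun setT (f_ m).
    apply: measurable_funM => //; apply: measurable_funM => //.
    by apply: measurable_funB => //; exact: (measurableT_comp mF (mline j _)).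
  have mg_ m : measurable_fun setT (g_ m).
    apply: measurable_funM => //; apply: measurable_funM => //.
    by apply: measurable_funB => //; exact: (measurableT_comp (mv j) (mline j _)).
  have bf m y : `|f_ m y| <= D * cube M y.
    rewrite /f_ normrM; have [r /andP[r0 rh] ->] := line_quotient y (dF j) (h_gt0 m).
    apply: (le_trans (ler_wpM2l (normr_ge0 _) (vB j y))).
    have r1 : `|r| <= 1 by rewrite ger0_norm// (le_trans rh).
    have := ler_wpM2l B0 (Fcube j y r (F' j) (F'C j) r1); rewrite /D.
    by move: (`|F' j _|) (cube M y) (_ ^+ _) => a b c e; lra.
  have bg m y : `|g_ m y| <= D * cube M y.
    have vl : `|(h m)^-1 * (v j (- h m *: ed j + y) - v j y)| <= B * cube M y.
      rewrite normrM gtr0_norm ?invr_gt0// ler_pdivrMl//.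
      have := vlip j y (- h m); rewrite normrN [`|h m|]gtr0_norm// => /(_ (h_le1 m)).
      by rewrite mulrCA mulrA.
    rewrite /g_ normrM; apply: (le_trans (ler_wpM2l (normr_ge0 _) vl)).
    have := ler_wpM2l B0 (Fcube j y 0 F FC _); rewrite scale0r add0r normr0 /D => /(_ ler01).
    by move: (`|F y|) (cube M y) (_ ^+ _) => a b c e; lra.
  have Di : intg mun (fun y => D * cube M y) by exact: intgZ.
  have a1 : {ae mun, forall y, f_ ^~ y @ \oo --> F' j y * v j y}.
    apply: aeW => y; apply: cvgMr_tmp.
    by apply: is_derive_seq => // m; rewrite gt_eqF.
  have b1 : {ae mun, forall y, forall m, `|f_ m y| <= D * cube M y}.
    by apply: aeW => y m; exact: bf.
  have [i1 c1] := Rint_dct mf_ (measurable_funM (mF' j) (mv j)) a1 Di b1.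
  have a2 : {ae mun, forall y, g_ ^~ y @ \oo --> -1 * (F y * w j y)}.
    apply: aeS (ae_coord_neq (0 : Rn)) => y /(_ ord_max); rewrite mxE => y0.
    rewrite mulN1r -mulrN; apply: cvgMl_tmp.
    rewrite (_ : (fun m => _) = fun m => - ((- h m)^-1 * (v j (- h m *: ed j + y) - v j y))).
      apply: cvgN; apply: is_derive_seq; [exact: vw|by move=> m; rewrite oppr_eq0 gt_eqF|].
      by rewrite -oppr0; exact: cvgN.
    by apply/funext => m; rewrite invrN mulNr opprK.
  have b2 : {ae mun, forall y, forall m, `|g_ m y| <= D * cube M y}.
    by apply: aeW => y m; exact: bg.
  have mFw : measurable_fun setT (fun y => -1 * (F y * w j y)).
    by apply: measurable_funM => //; exact: measurable_funM.
  have [i2 c2] := Rint_dct mg_ mFw a2 Di b2.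
  have fg m : \int[mun]_y f_ m y = \int[mun]_y g_ m y.
    have vi : intg mun (fun y => F y * v j y).
      apply: (intg_le (measurable_funM mF (mv j)) Di) => y.
      rewrite normrM; apply: (le_trans (ler_wpM2l (normr_ge0 _) (vB j y))).
      have := ler_wpM2l B0 (Fcube j y 0 F FC _); rewrite scale0r add0r normr0 /D => /(_ ler01).
      by move: (`|F y|) (cube M y) (_ ^+ _) => a b c e; lra.
    have si : intg mun (fun y => F (h m *: ed j + y) * v j y).
      apply: (intg_le _ Di) => [|y].
        by apply: measurable_funM => //; exact: (measurableT_comp mF (mline j _)).
      rewrite normrM; apply: (le_trans (ler_wpM2l (normr_ge0 _) (vB j y))).
      have hm1 : `|h m| <= 1 by rewrite gtr0_norm.
      have := ler_wpM2l B0 (Fcube j y (h m) F FC hm1); rewrite /D.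
      by move: (`|F _|) (cube M y) (_ ^+ _) => a b c e; lra.
    have sE : (fun y => F (h m *: ed j + y) * v j y) =
        fun y => (fun y => F y * v j (- h m *: ed j + y)) (y + h m *: ed j).
      by apply/funext => y /=; rewrite [y + _]addrC addrA -scalerDl addNr scale0r add0r.
    have mvs : measurable_fun setT (fun y => F y * v j (- h m *: ed j + y)).
      by apply: measurable_funM => //; exact: (measurableT_comp (mv j) (mline j _)).
    have si' : intg mun (fun y => F y * v j (- h m *: ed j + y)).
      have := intg_shift (- h m *: ed j) si; congr (intg _ _); apply/funext => y.
      by rewrite [y + _]addrC addrA -scalerDl addrN scale0r add0r.
    have fE : f_ m = fun y => (h m)^-1 * (F (h m *: ed j + y) * v j y - F y * v j y).
      by apply/funext => y; rewrite /f_; ring.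
    have gE : g_ m = fun y => (h m)^-1 * (F y * v j (- h m *: ed j + y) - F y * v j y).
      by apply/funext => y; rewrite /g_; ring.
    rewrite fE gE (RintZ _ (intgB si vi)) (RintZ _ (intgB si' vi)).
    by rewrite (RintB si vi) (RintB si' vi) [in LHS]sE (Rint_shift _ mvs).
  have i3 : intg mun (fun y => F y * w j y).
    have := intgZ (-1) i2; congr (intg _ _); apply/funext => y; by rewrite mulrA mulrNN mulr1 mul1r.
  split=> //; split=> //.
  have e : (fun m => \int[mun]_y f_ m y) = fun m => \int[mun]_y g_ m y.
    by apply/funext => m; exact: fg.
  rewrite -mulN1r -(RintZ _ i3); rewrite e in c1.
  exact: (cvg_unique _ c1 c2).
split=> [j|]; first by have [] := key j.
have -> : \sum_j \int[mun]_y (F' j y * v j y) = - \sum_j \int[mun]_y (F y * w j y).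
  by rewrite -sumrN; apply: eq_bigr => j _; have [_ []] := key j.
rewrite -Rint_sum; last by move=> j; have [_ []] := key j.
rewrite (_ : (fun y => _) = fun=> 0).
  by rewrite Rintegral_cst// mul0r oppr0.
by apply/funext => y; rewrite -mulr_sumr w0 mulr0.
Qed.

End translation.

Section divergence.
Context {R : realType} {d : nat}.
Local Notation mu := (@lebesgue_measure R).
Local Notation Rn := 'rV[R]_d.+1.
Local Notation mun := (lebesgue_rV R d.+1).
Implicit Types (x y z p : Rn) (i j k : 'I_d.+1) (t s : R).

Lemma starE y k : star y ord0 k = eps k * y ord0 k.
Proof. by rewrite mxE /eps /kron; case: eqP => _; rewrite /=; ring. Qed.

Lemma is_derive_affine (f : Rn -> R) j p c l (q : Rn -> Rn) y :
  is_derive p (ed j) f l -> (forall h : R, q (h *: ed j + y) = (c * h) *: ed j + p) ->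
  is_derive y (ed j) (f \o q) (c * l).
Proof.
move=> /is_derive_lineP df qE; apply/is_derive_lineP.
rewrite (_ : (fun h => _) = (fun h : R => f (h *: ed j + p)) \o (fun h : R => c * h)); last first.
  by apply/funext => h /=; rewrite qE.
have d0 : is_derive (c * (0 : R)) (1 : R) (fun h : R => f (h *: ed j + p)) l by rewrite mulr0.
have dc : is_derive (0 : R) (1 : R) (fun h : R => c * h) c.
  have h := @is_deriveZ R R R id c 0 1 1 (is_derive_id _ _).
  by apply: (is_derive_eq h); rewrite /GRing.scale/= mulr1.
by apply: (is_derive_eq (@is_derive1_comp R _ _ _ _ _ d0 dc)); rewrite mulrC.
Qed.

Lemma pw_sub x y : pw (x - y) <= pw x * pw y.
Proof.
rewrite /pw -big_split/=; apply: ler_prod => k _; rewrite exprn_ge0 ?addr_ge0//= -exprMn.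
apply: lerXn2r; rewrite ?nnegrE ?mulr_ge0 ?addr_ge0// !mxE.
have := ler_normB (x ord0 k) (y ord0 k); have := mulr_ge0 (normr_ge0 (x ord0 k)) (normr_ge0 (y ord0 k)).
by move: (`|_ - _|) (`|x _ _|) (`|y _ _|) => a b c; lra.
Qed.

Lemma pw_star y : pw (star y) = pw y.
Proof.
by apply: eq_bigr => k _; rewrite mxE; case: ifP => _; rewrite ?normrN.
Qed.

Lemma measurable_star : measurable_fun setT (star : Rn -> Rn).
Proof.
apply: measurable_fun_rV => k; under eq_fun do rewrite starE.
by apply: measurable_funM => //; exact: measurable_coordE.
Qed.

Section solenoidal_conv.
Variables (v w : 'I_d.+1 -> Rn -> R) (B M : R).
Hypothesis vs : solenoidal v w B M.

Section growth.
Variables (G : Rn -> R) (G' : 'I_d.+1 -> Rn -> R) (C : R).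
Hypotheses (mG : measurable_fun setT G) (mG' : forall j, measurable_fun setT (G' j))
  (dG : forall j y, is_derive y (ed j) G (G' j y))
  (GC : forall y, `|G y| <= C * pw y) (G'C : forall j y, `|G' j y| <= C * pw y).

Let C0 : 0 <= C.
Proof. by have := le_trans (normr_ge0 _) (GC 0); rewrite pmulr_lge0// pw_gt0. Qed.

Lemma div_sub x : (forall j, intg mun (fun y => G' j (x - y) * v j y)) /\
  \sum_j \int[mun]_y (G' j (x - y) * v j y) = 0.
Proof.
have dF j y : is_derive y (ed j) (G \o (fun y => x - y)) (-1 * G' j (x - y)).
  apply: (is_derive_affine (dG j (x - y))) => h.
  by rewrite opprD mulN1r scaleNr addrCA.
have bnd (g : Rn -> R) y : (forall y, `|g y| <= C * pw y) -> `|g (x - y)| <= C * pw x * pw y.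
  by move=> gC; rewrite (le_trans (gC _))// -mulrA ler_wpM2l// pw_sub.
have [||||ii ss] := @solenoidal_Rint R d v w B M (C * pw x) (G \o (fun y => x - y))
    (fun j y => -1 * G' j (x - y)) vs.
- exact: (measurableT_comp mG (measurable_csub x)).
- move=> j; apply: measurable_funM => //; exact: (measurableT_comp (mG' j) (measurable_csub x)).
- by move=> y; exact: bnd.
- by move=> j y; rewrite mulN1r normrN; exact: bnd.
have ii' j : intg mun (fun y => G' j (x - y) * v j y).
  have := intgZ (-1) (ii j); congr (intg _ _); apply/funext => y.
  by rewrite mulrA mulrA mulrNN !mul1r.
split=> //; apply: oppr_inj; rewrite oppr0 -[RHS]ss -sumrN; apply: eq_bigr => j _.
by rewrite -[LHS]mulN1r -(RintZ _ (ii' j)); apply: eq_Rintegral => y _; rewrite mulrA.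
Qed.

(** By the chain rule, [y |-> G (x - star y)] has [j]-th derivative [- eps j * G' j (x - star y)],
    which is where the signs come from. *)
Lemma div_star x : (forall j, intg mun (fun y => G' j (x - star y) * v j y)) /\
  \sum_j eps j * \int[mun]_y (G' j (x - star y) * v j y) = 0.
Proof.
have e2 j : eps j * eps j = 1 :> R by rewrite /eps /kron; case: eqP => _; rewrite /=; ring.
have e1 j : `|eps j| = 1 :> R.
  by have := e2 j; rewrite -expr2 => /eqP; rewrite sqrf_eq1 => /orP[] /eqP ->; rewrite ?normrN normr1.
have dF j y : is_derive y (ed j) (G \o (fun y => x - star y)) (- eps j * G' j (x - star y)).
  apply: (is_derive_affine (dG j (x - star y))) => h.
  apply/rowP => k; rewrite lineE.
  have sE u : (x - star u) ord0 k = x ord0 k - eps k * u ord0 k.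
    by rewrite mxE [(- star u) _ _]mxE starE.
  rewrite !sE lineE; move: (x ord0 k) (y ord0 k) => a b.
  have [->|_] := eqVneq k j; move: (eps _); last by move=> e; rewrite !mul0r !add0r.
  by move=> e; rewrite !mul1r; ring.
have bnd (g : Rn -> R) y : (forall y, `|g y| <= C * pw y) -> `|g (x - star y)| <= C * pw x * pw y.
  by move=> gC; rewrite (le_trans (gC _))// -mulrA ler_wpM2l// -(pw_star y) pw_sub.
have ms : measurable_fun setT (fun y => x - star y).
  exact: (measurableT_comp (measurable_csub x) measurable_star).
have [||||ii ss] := @solenoidal_Rint R d v w B M (C * pw x) (G \o (fun y => x - star y))
    (fun j y => - eps j * G' j (x - star y)) vs.
- exact: (measurableT_comp mG ms).
- move=> j; apply: measurable_funM => //; exact: (measurableT_comp (mG' j) ms).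
- by move=> y; exact: bnd.
- by move=> j y; rewrite normrM normrN e1 mul1r; exact: bnd.
have ii' j : intg mun (fun y => G' j (x - star y) * v j y).
  have := intgZ (- eps j) (ii j); congr (intg _ _); apply/funext => y.
  by rewrite mulrA mulrA mulrNN e2 mul1r.
split=> //; apply: oppr_inj; rewrite oppr0 -[RHS]ss -sumrN; apply: eq_bigr => j _.
by rewrite -[LHS]mulNr -(RintZ _ (ii' j)); apply: eq_Rintegral => y _; rewrite mulrA.
Qed.

End growth.

Lemma measurable_hconv0 (f : Rn -> R) t : measurable_fun setT f -> measurable_fun setT (hconv f t).
Proof.
move=> mf; have mF : measurable_fun setT (fun p : Rn * Rn => Gam (p.1 - p.2) t * f p.2).
  apply: measurable_funM; last exact: (measurableT_comp mf).
  by apply: (measurableT_comp (measurable_Gamt t)); exact: measurable_rV_sub.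
by have h := measurable_Rint2 mun mF; exact: h.
Qed.

Lemma measurable_hconv1 j (f : Rn -> R) t : measurable_fun setT f -> measurable_fun setT (hconv1 j f t).
Proof.
move=> mf; have mF : measurable_fun setT (fun p : Rn * Rn => Gam1 j (p.1 - p.2) t * f p.2).
  apply: measurable_funM; last exact: (measurableT_comp mf).
  by apply: (measurableT_comp (measurable_Gam1t j t)); exact: measurable_rV_sub.
by have h := measurable_Rint2 mun mF; exact: h.
Qed.

Lemma measurable_hconv2t i j (f : Rn -> R) t : measurable_fun setT f -> measurable_fun setT (hconv2 i j f t).
Proof.
move=> mf; have mF : measurable_fun setT (fun p : Rn * Rn => Gam2 i j (p.1 - p.2) t * f p.2).
  apply: measurable_funM; last exact: (measurableT_comp mf).
  by apply: (measurableT_comp (measurable_Gam2t i j t)); exact: measurable_rV_sub.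
by have h := measurable_Rint2 mun mF; exact: h.
Qed.

Lemma hconv_bounds (f : Rn -> R) t : 0 < t -> wclass f -> exists C : R, forall y,
  [/\ `|hconv f t y| <= C * pw y, forall j, `|hconv1 j f t y| <= C * pw y &
   forall i j, `|hconv2 i j f t y| <= C * pw y].
Proof.
move=> t0 fw; have [C hC] := @Gam_bounds R d t t0.
exists (C * \int[mun]_z (wt z * `|f z|)) => y.
rewrite -[C * _ * _]mulrA [_ * pw y]mulrC [C * _]mulrA; split=> [|j|i j].
- apply: (@conv_le R d.+1 (Gam ^~ t) C) => //; first exact: measurable_Gamt.
  by move=> u; have [] := hC u.
- apply: (@conv_le R d.+1 (Gam1 j ^~ t) C) => //; first exact: measurable_Gam1t.
  by move=> u; have [_ h _] := hC u; exact: h.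
- apply: (@conv_le R d.+1 (Gam2 i j ^~ t) C) => //; first exact: measurable_Gam2t.
  by move=> u; have [_ _ h] := hC u; exact: h.
Qed.

(** Applied to the truncated [Pk i], this trades the tangential components in [breve_green] for the
    normal one in [hat_green]. *)
Lemma div_hconv_star (f : Rn -> R) t x : 0 < t -> wclass f ->
  (forall j, intg mun (fun y => hconv1 j f t (x - star y) * v j y)) /\
  \sum_j eps j * \int[mun]_y (hconv1 j f t (x - star y) * v j y) = 0.
Proof.
move=> t0 fw; have [C hC] := hconv_bounds t0 fw; have [mf _] := fw.
apply: (@div_star (hconv f t) (fun j => hconv1 j f t) C).
- exact: measurable_hconv0.
- by move=> j; exact: measurable_hconv1.
- by move=> j y; exact: is_derive_hconv.
- by move=> y; have [] := hC y.
- by move=> j y; have [_ h _] := hC y; exact: h.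
Qed.

Lemma Gam2C i j p t : Gam2 i j p t = Gam2 j i p t.
Proof. by rewrite /Gam2 [p ord0 i * _]mulrC eq_sym. Qed.

Lemma hconv2C i j (f : Rn -> R) t p : hconv2 i j f t p = hconv2 j i f t p.
Proof. by rewrite /hconv2; apply: eq_Rintegral => z _; rewrite Gam2C. Qed.

(** Applied to [E]: row [i] of the nonlocal part of the Oseen tensor is the gradient of the smooth
    function [hconv1 i E t]. *)
Lemma div_hconv2_sub i (f : Rn -> R) t x : 0 < t -> wclass f ->
  (forall j, intg mun (fun y => hconv2 i j f t (x - y) * v j y)) /\
  \sum_j \int[mun]_y (hconv2 i j f t (x - y) * v j y) = 0.
Proof.
move=> t0 fw; have [C hC] := hconv_bounds t0 fw; have [mf _] := fw.
apply: (@div_sub (hconv1 i f t) (fun j => hconv2 i j f t) C).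
- exact: measurable_hconv1.
- by move=> j; exact: measurable_hconv2t.
- by move=> j y; rewrite hconv2C; exact: is_derive_hconv1.
- by move=> y; have [_ h _] := hC y; exact: h.
- by move=> j y; have [_ _ h] := hC y; exact: h.
Qed.

Lemma div_hconv2_star i (f : Rn -> R) t x : 0 < t -> wclass f ->
  (forall j, intg mun (fun y => hconv2 i j f t (x - star y) * v j y)) /\
  \sum_j eps j * \int[mun]_y (hconv2 i j f t (x - star y) * v j y) = 0.
Proof.
move=> t0 fw; have [C hC] := hconv_bounds t0 fw; have [mf _] := fw.
apply: (@div_star (hconv1 i f t) (fun j => hconv2 i j f t) C).
- exact: measurable_hconv1.
- by move=> j; exact: measurable_hconv2t.
- by move=> j y; rewrite hconv2C; exact: is_derive_hconv1.
- by move=> y; have [_ h _] := hC y; exact: h.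
- by move=> j y; have [_ _ h] := hC y; exact: h.
Qed.

End solenoidal_conv.
End divergence.

(** * The boundary potential *)

Section tangential_kernel.
Context {R : realType} {d : nat}.
Local Notation mu := (@lebesgue_measure R).
Local Notation Rn := 'rV[R]_d.+1.
Local Notation V := 'rV[R]_d.
Local Notation mud := (lebesgue_rV R d).
Implicit Types (v w z y : V) (i j k : 'I_d.+1) (t s T q a : R).

Lemma enorm_inv_rho z q a (k : 'I_d) : 0 < a -> a <= `|q| ->
  (enorm (rsnoc (z, q)))^-1 <= (1 + a^-1) * rho (z ord0 k).
Proof.
move=> a0 aq; set e := enorm _.
have q_e : `|q| <= e.
  by have := coord_le_enorm (rsnoc (z, q)) ord_max; rewrite mxE unlift_none.
have z_e : `|z ord0 k| <= e.
  by have := coord_le_enorm (rsnoc (z, q)) (lift ord_max k); rewrite mxE liftK.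
have e0 : 0 < e by rewrite (lt_le_trans a0)// (le_trans aq).
rewrite -[leLHS]mul1r ler_pdivrMr// /rho.
rewrite mulrAC ler_pdivlMr ?ltr_wpDr// mul1r mulrDl mul1r [leLHS]addrC lerD//.
by rewrite -[leLHS](mulVf (lt0r_neq0 a0)) ler_wpM2l ?invr_ge0 ?(ltW a0)// (le_trans aq).
Qed.

Lemma enorm_inv_le z q a : 0 < a -> a <= `|q| -> (enorm (rsnoc (z, q)))^-1 <= 1 + a^-1.
Proof.
move=> a0 aq; set e := enorm _.
have q_e : `|q| <= e.
  by have := coord_le_enorm (rsnoc (z, q)) ord_max; rewrite mxE unlift_none.
apply: (@le_trans _ _ a^-1); last by rewrite lerDr.
by rewrite lef_pV2 ?posrE// ?(le_trans aq)// (lt_le_trans a0)// (le_trans aq).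
Qed.

Lemma rsnoc_enorm_gt0 z q : q != 0 -> 0 < enorm (rsnoc (z, q)).
Proof. by move=> q0; apply: (@enorm_gt0 _ _ _ ord_max); rewrite mxE unlift_none. Qed.

Lemma nrmd_rhod z q a : 0 < a -> a <= `|q| ->
  nrmd (rsnoc (z, q)) <= (1 + a^-1) ^+ d * rhod z.
Proof.
move=> a0 aq.
have prodE (r : R) : r ^+ d = \prod_(k < d) r by rewrite prodr_const card_ord.
rewrite /nrmd /rhod !prodE -big_split/=; apply: ler_prod => k _.
by rewrite invr_ge0 enorm_ge0 enorm_inv_rho.
Qed.

(** The factor [wt] is split off the Gaussian at the price of doubling its time, and pays for
    Peetre's inequality. Convolution thus preserves the decay [rhod], uniformly for [s <= T]. *)
Lemma intg_conv_rhod n (f : 'rV[R]_n -> R) (A : R) s T (v : 'rV[R]_n) :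
  measurable_fun setT f -> (forall z : 'rV[R]_n, `|f z| <= A * rhod z) -> 0 < s -> s <= T ->
  intg (lebesgue_rV R n) (fun z : 'rV[R]_n => Gam (v - z) s * f z) /\
  \int[lebesgue_rV R n]_z `|Gam (v - z) s * f z| <= A * cM T ^+ n * rhod v.
Proof.
move=> mf fA s0 sT; have s20 : 0 < 2 * s by rewrite mulr_gt0.
have A0 : 0 <= A.
  have := le_trans (normr_ge0 _) (fA 0); rewrite pmulr_lge0//.
  by apply: prodr_gt0 => k _; exact: rho_gt0.
have [gi gE] := @intg_Gam_Rint R n _ s20.
have mG : measurable_fun setT (fun z : 'rV[R]_n => Gam z (2 * s)).
  by apply: measurable_Gam => // k; exact: measurable_coordE.
have dom (z : 'rV[R]_n) : `|Gam (v - z) s * f z| <= A * cM T ^+ n * rhod v * Gam (v - z) (2 * s).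
  rewrite normrM ger0_norm ?Gam_ge0//.
  apply: (le_trans (ler_wpM2l (Gam_ge0 _ _) (fA z))).
  have h := Gam_wt (v - z) s0.
  have hw : wt (v - z) * rhod z <= rhod v.
    have e : z = v - (v - z) by rewrite subKr.
    rewrite [in rhod z]e; apply: (le_trans (ler_wpM2l (ltW (wt_gt0 _)) (rhod_sub _ _))).
    rewrite mulrCA ler_piMr ?rhod_ge0// /wt -big_split/=.
    rewrite -[leRHS](@big1 _ 1 *%R _ (index_enum 'I_n) xpredT (fun=> 1))//.
    apply: ler_prod => k _; rewrite mulr_ge0 ?exprn_ge0 ?rho_ge0 ?addr_ge0//=.
    by rewrite exprSr -mulrA [rho _ * (1 + _)]mulVf ?mulr1 ?exprn_ile1 ?rho_ge0 ?rho_le1// gt_eqF// ltr_wpDr.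
  have cT : cM s ^+ n <= cM T ^+ n.
    by apply: lerXn2r; rewrite ?nnegrE ?(ltW (cM_gt0 _)) ?cM_le.
  have r0 := rhod_ge0 z; have g0 := Gam_ge0 (v - z) (2 * s).
  have c0 : 0 <= cM s ^+ n by rewrite exprn_ge0 ?(ltW (cM_gt0 _)).
  rewrite mulrCA -[leRHS]mulrA -[leRHS]mulrA; apply: ler_wpM2l => //.
  apply: (le_trans (ler_wpM2r r0 h)).
  have -> : cM s ^+ n * (wt (v - z) * Gam (v - z) (2 * s)) * rhod z =
    cM s ^+ n * ((wt (v - z) * rhod z) * Gam (v - z) (2 * s)).
    by move: (wt _) (Gam _ _) (rhod z) (_ ^+ n) => a b c e; ring.
  apply: ler_pM => //; last by apply: ler_wpM2r.
  by do 2! [apply: mulr_ge0 => //]; exact: ltW (wt_gt0 _).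
have Di : intg (lebesgue_rV R n) (fun z : 'rV[R]_n => A * cM T ^+ n * rhod v * Gam (v - z) (2 * s)).
  by apply: intgZ; exact: (intg_sub v gi).
have ii : intg (lebesgue_rV R n) (fun z : 'rV[R]_n => Gam (v - z) s * f z).
  apply: (intg_le _ Di) => //; apply: measurable_funM => //.
  by apply: measurable_Gam => // k; apply: measurable_rV_coord_comp; exact: measurable_csub.
split=> //; apply: (le_trans (Rint_le (intg_norm ii) Di dom)).
by rewrite (RintZ _ (intg_sub v gi)) (Rint_sub v mG) gE mulr1.
Qed.

Lemma conv_rhod_le n (f : 'rV[R]_n -> R) (A : R) s T (v : 'rV[R]_n) :
  measurable_fun setT f -> (forall z : 'rV[R]_n, `|f z| <= A * rhod z) -> 0 < s -> s <= T ->
  `|\int[lebesgue_rV R n]_z (Gam (v - z) s * f z)| <= A * cM T ^+ n * rhod v.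
Proof.
move=> mf fA s0 sT; have [ii ib] := intg_conv_rhod v mf fA s0 sT.
by rewrite (le_trans _ ib)//; exact: (le_normr_Rintegral measurableT ii).
Qed.

(** The slice of [Pk i] at height [q], smoothed by the tangential heat semigroup. *)
Definition kt i v q s : R := \int[mud]_z (Gam (v - z) s * Pk i (rsnoc (z, q))).

Lemma measurable_rsnoc2 q : measurable_fun [set: V] (fun z => rsnoc (z, q) : Rn).
Proof.
have h : measurable_fun [set: V] (fun z => (z, q) : V * measurableTypeR R).
  by apply/measurable_fun_pairP; split; [exact: measurable_id|exact: measurable_cst].
exact: (measurableT_comp (@measurable_rsnoc R d) h).
Qed.

Lemma measurable_Pk_rsnoc i q : measurable_fun [set: V] (fun z => Pk i (rsnoc (z, q)) : R).
Proof. exact: (measurableT_comp (measurable_Pk i) (measurable_rsnoc2 q)). Qed.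

Lemma Pk_rhod i z q a : 0 < a -> a <= `|q| ->
  `|Pk i (rsnoc (z, q))| <= (1 + a^-1) ^+ d * rhod z.
Proof. by move=> a0 aq; rewrite (le_trans (Pk_le _ _))// nrmd_rhod. Qed.

Lemma intg_kt i v q s : q != 0 -> 0 < s ->
  intg mud (fun z => Gam (v - z) s * Pk i (rsnoc (z, q))).
Proof.
move=> q0 s0; have qp : 0 < `|q| by rewrite normr_gt0.
have h := intg_conv_rhod v (measurable_Pk_rsnoc i q) _ s0 (lexx s).
by have [] := h _ (fun z => Pk_rhod i z qp (lexx _)).
Qed.

Lemma kt_rhod i v q s a T : 0 < a -> a <= `|q| -> 0 < s -> s <= T ->
  `|kt i v q s| <= (1 + a^-1) ^+ d * cM T ^+ d * rhod v.
Proof.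
move=> a0 aq s0 sT; apply: conv_rhod_le => //; first exact: measurable_Pk_rsnoc.
by move=> z; exact: Pk_rhod.
Qed.

Lemma Pk_rsnoc_lip i z q q' a : 0 < a -> a <= q -> a <= q' ->
  `|Pk i (rsnoc (z, q)) - Pk i (rsnoc (z, q'))| <=
     2 * d.+2%:R * (1 + a^-1) ^+ d.+1 * `|q - q'| * rhod z.
Proof.
move=> a0 aq aq'; have q0 : 0 < q by exact: lt_le_trans aq.
have q0' : 0 < q' by exact: lt_le_trans aq'.
have nq : a <= `|q| by rewrite ger0_norm// ltW.
have nq' : a <= `|q'| by rewrite ger0_norm// ltW.
have := Pk_lip i (rsnoc_enorm_gt0 z (lt0r_neq0 q0)) (rsnoc_enorm_gt0 z (lt0r_neq0 q0')).
have -> : \sum_k `|rsnoc (z, q) ord0 k - rsnoc (z, q') ord0 k| = `|q - q'|.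
  rewrite (bigD1_ord ord_max)//= big1 ?addr0 => [|k _]; last first.
    by rewrite !mxE liftK subrr normr0.
  by rewrite !mxE unlift_none.
move=> /le_trans; apply.
have b (r : R) : a <= `|r| -> (enorm (rsnoc (z, r)))^-1 ^+ d.+1 <= (1 + a^-1) ^+ d.+1 * rhod z.
  move=> ar; rewrite !exprS -[leRHS]mulrA; apply: ler_pM; last exact: nrmd_rhod.
  - by rewrite invr_ge0 enorm_ge0.
  - by rewrite exprn_ge0// invr_ge0 enorm_ge0.
  - exact: enorm_inv_le.
have := lerD (b q nq) (b q' nq').
have c0 : 0 <= d.+2%:R * `|q - q'| by rewrite mulr_ge0.
move=> /(ler_wpM2l c0) /le_trans; apply; rewrite le_eqVlt; apply/orP; left; apply/eqP.
by move: (rhod z) (_ ^+ d.+1) (`|q - q'|) (d.+2%:R) => e f g h; ring.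
Qed.

Lemma kt_lip i v q q' s a T : 0 < a -> a <= q -> a <= q' -> 0 < s -> s <= T ->
  `|kt i v q s - kt i v q' s| <=
    2 * d.+2%:R * (1 + a^-1) ^+ d.+1 * cM T ^+ d * `|q - q'| * rhod v.
Proof.
move=> a0 aq aq' s0 sT; have q0 : 0 < q by exact: lt_le_trans aq.
have q0' : 0 < q' by exact: lt_le_trans aq'.
rewrite /kt -(RintB (intg_kt i v (lt0r_neq0 q0) s0) (intg_kt i v (lt0r_neq0 q0') s0)).
rewrite (_ : (fun z => _) = fun z => Gam (v - z) s * (Pk i (rsnoc (z, q)) - Pk i (rsnoc (z, q')))); last first.
  by apply/funext => z; rewrite mulrBr.
rewrite [X in _ <= X * _]mulrAC; apply: conv_rhod_le => //.
  by apply: measurable_funB; exact: measurable_Pk_rsnoc.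
by move=> z; exact: Pk_rsnoc_lip.
Qed.

Lemma measurable_kt dd (X : measurableType dd) i (fv : X -> V) (fq fs : X -> R) :
  measurable_fun setT fv -> measurable_fun setT fq -> measurable_fun setT fs ->
  measurable_fun setT (fun p => kt i (fv p) (fq p) (fs p)).
Proof.
move=> mv mq ms.
have mF : measurable_fun setT (fun p : X * V =>
    Gam (fv p.1 - p.2) (fs p.1) * Pk i (rsnoc (p.2, fq p.1))).
  apply: measurable_funM.
    apply: measurable_Gam; last exact: (measurableT_comp ms measurable_fst).
    move=> k; apply: measurable_rV_coord_comp; apply: measurable_rV_sub => //.
    exact: (measurableT_comp mv measurable_fst).
  apply: (measurableT_comp (measurable_Pk i)).
  have h : measurable_fun [set: X * V] (fun p => (p.2, fq p.1) : V * measurableTypeR R).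
    apply/measurable_fun_pairP; split; first exact: measurable_snd.
    exact: (measurableT_comp mq measurable_fst).
  exact: (measurableT_comp (@measurable_rsnoc R d) h).
by have h := measurable_Rint2 mud mF; exact: h.
Qed.

(** Fubini and [Gam_semigroup]: a further tangential Gaussian only adds its time. This is what
    evaluates the integral over [Sigma] in [W]. *)
Lemma kt_semigroup i w y q t s : q != 0 -> 0 < t -> 0 < s ->
  intg mud (fun x => kt i (w - x) q t * Gam (x - y) s) /\
  \int[mud]_x (kt i (w - x) q t * Gam (x - y) s) = kt i (w - y) q (t + s).
Proof.
move=> q0 t0 s0; have qp : 0 < `|q| by rewrite normr_gt0.
pose F (p : V * V) := Gam (p.1 - y) s * (Gam (w - p.1 - p.2) t * Pk i (rsnoc (p.2, q))).
have [g1 g1E] := @intg_Gam_Rint R d _ t0; have [g2 g2E] := @intg_Gam_Rint R d _ s0.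
pose A := (1 + `|q|^-1) ^+ d * cM t ^+ d.
have inner x := intg_kt i (w - x) q0 t0.
have mgy : measurable_fun setT (fun x : V => Gam (x - y) s).
  apply: measurable_Gam => // k; apply: measurable_rV_coord_comp.
  by apply: measurable_rV_sub => //; exact: measurable_cst.
have iy : intg mud (fun x => Gam (x - y) s) by exact: (intg_shift (- y) g2).
have mF : measurable_fun setT F.
  apply: measurable_funM; first exact: (measurableT_comp mgy measurable_fst).
  apply: measurable_funM; last exact: (measurableT_comp (measurable_Pk_rsnoc i q) measurable_snd).
  apply: measurable_Gam => // k; apply: measurable_rV_coord_comp.
  apply: measurable_rV_sub => //.
  exact: (measurableT_comp (measurable_csub w) measurable_fst).
have Fi : intg (mud \x mud)%E F.
  apply: (intg_prod mF (intgZ A iy)) => [x|x]; first exact: (intgZ (Gam (x - y) s) (inner x)).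
  have [_ h] := intg_conv_rhod (w - x) (measurable_Pk_rsnoc i q)
    (fun z => Pk_rhod i z qp (lexx _)) t0 (lexx t).
  rewrite (_ : \int[mud]_z _ = Gam (x - y) s * \int[mud]_z `|Gam (w - x - z) t * Pk i (rsnoc (z, q))|).
    rewrite [leRHS]mulrC ler_wpM2l ?Gam_ge0// (le_trans h)//.
    by rewrite -/A ler_piMr ?rhod_le1// mulr_ge0 ?exprn_ge0 ?addr_ge0 ?(ltW (cM_gt0 _)).
  rewrite -(RintZ _ (intg_norm (inner x))); apply: eq_Rintegral => z _.
  by rewrite /F/= normrM [`|Gam (x - y) s|]ger0_norm ?Gam_ge0.
have E1 x : kt i (w - x) q t * Gam (x - y) s = \int[mud]_z F (x, z).
  by rewrite mulrC /kt -(RintZ _ (inner x)).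
split; first by rewrite (_ : (fun x => _) = fun x => \int[mud]_z F (x, z)); [exact: intg_Rint2|apply/funext].
under eq_Rintegral do rewrite E1.
rewrite (Rint_swap Fi) /kt; apply: eq_Rintegral => z _; rewrite /F/=.
have -> : w - y - z = w - z - y by rewrite addrAC.
rewrite -(Gam_semigroup (w - z) y t0 s0).
have si : intg mud (fun x => Gam (w - z - x) t * Gam (x - y) s).
  apply: (intg_le _ (intgZ ((Num.sqrt (4 * pi * t))^-1 ^+ d) iy)) => [|x].
    apply: measurable_funM => //; apply: measurable_Gam => // k.
    by apply: measurable_rV_coord_comp; exact: measurable_csub.
  rewrite ger0_norm ?mulr_ge0 ?Gam_ge0// ler_wpM2r ?Gam_ge0//.
  have prodE (r : R) : r ^+ d = \prod_(k < d) r by rewrite prodr_const card_ord.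
  rewrite prodE /Gam; apply: ler_prod => k _.
  by rewrite gk_ge0 gk_le.
rewrite -(RintZr _ si); apply: eq_Rintegral => x _.
have -> : w - x - z = w - z - x by rewrite addrAC.
by move: (Gam _ _) (Gam _ _) (Pk _ _) => a b c; ring.
Qed.

(** Against the constant part of [qn] the Gaussian has mass 1; against the singular part it is
    replaced by its maximum, of order [1 / sqrt s]. *)
Lemma gk_rho_qn r s T : 0 < s -> s <= T ->
  intg mu (fun u => gk (r - u) s * (rho u * @qn R d u)) /\
  \int[mu]_u (gk (r - u) s * (rho u * @qn R d u)) <=
    cM T * (Num.sqrt T + \int[mu]_u hs (@alpha R d) u) * (Num.sqrt s)^-1 * rho r.
Proof.
move=> s0 sT; have s20 : 0 < 2 * s by rewrite mulr_gt0.
have hi := @intg_hs R _ (@alpha01 R d); set H := \int[mu]_u hs _ u.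
have H0 : 0 <= H by apply: Rintegral_ge0 => u _; exact: hs_ge0.
have ss : 0 < Num.sqrt s by rewrite sqrtr_gt0.
have gi := intg_gk_sub r s20; have gE := Rint_gk_sub r s20.
pose D u := cM s * rho r * (gk (r - u) (2 * s) + (Num.sqrt s)^-1 * hs (@alpha R d) u).
have Di : intg mu D by apply: intgZ; apply: intgD => //; exact: intgZ.
have dom u : gk (r - u) s * (rho u * @qn R d u) <= D u.
  have g0 := gk_ge0 (r - u) (2 * s); have q0 := @qn_ge0 R d u; have h0 := hs_ge0 (@alpha R d) u.
  have c0 := cM_gt0 s.
  have hg : gk (r - u) s * rho u <= cM s * rho r * gk (r - u) (2 * s).
    have h1 : gk (r - u) s <= cM s * (rho (r - u) ^+ 3 * gk (r - u) (2 * s)).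
      apply: (le_trans _ (sg_gk_rho _ s0)).
      by rewrite ler_peMl ?gk_ge0// exprn_ege1// sg_ge1.
    apply: (le_trans (ler_wpM2r (rho_ge0 u) h1)).
    have h2 : rho (r - u) ^+ 3 * rho u <= rho r.
      have e : u = r - (r - u) by rewrite subKr.
      rewrite [in rho u]e; apply: (le_trans (ler_wpM2l _ (rho_sub _ _))).
        by rewrite exprn_ge0 ?rho_ge0.
      rewrite mulrCA ler_piMr ?rho_ge0// exprSr -mulrA [rho _ * (1 + _)]mulVf ?mulr1.
        by rewrite exprn_ile1 ?rho_ge0 ?rho_le1.
      by rewrite gt_eqF// ltr_wpDr.
    have -> : cM s * (rho (r - u) ^+ 3 * gk (r - u) (2 * s)) * rho u =
      cM s * ((rho (r - u) ^+ 3 * rho u) * gk (r - u) (2 * s)).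
      by move: (rho (r - u)) (gk _ _) (cM s) (rho u) => a b c e; ring.
    by rewrite -[leRHS]mulrA ler_wpM2l ?(ltW c0)// ler_wpM2r.
  rewrite mulrA; apply: (le_trans (ler_wpM2r q0 hg)).
  rewrite /D -[leLHS]mulrA; apply: ler_wpM2l; first by rewrite mulr_ge0 ?rho_ge0 ?(ltW c0).
  have -> : gk (r - u) (2 * s) * @qn R d u = gk (r - u) (2 * s) + gk (r - u) (2 * s) * hs (@alpha R d) u.
    by rewrite /qn mulrDr mulr1.
  apply: lerD => //; apply: ler_wpM2r => //.
  apply: (le_trans (gk_le _ _)); rewrite lef_pV2 ?posrE ?sqrtr_gt0//; last first.
    by rewrite !mulr_gt0// pi_gt0.
  apply: ler_wsqrtr; have := @pi_ge2 R; move: (pi : R) => p p2.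
  have : 2 * s <= p * s by rewrite ler_wpM2r// ltW.
  by move: s0; clear; lra.
have mf : measurable_fun [set: measurableTypeR R] (fun u => gk (r - u) s * (rho u * @qn R d u)).
  apply: measurable_funM; last first.
    apply: measurable_funM; first exact: measurable_rho.
    by apply: measurable_funD => //; exact: (intg_meas hi).
  by apply: measurable_gk => //; exact: measurable_funB.
have ii : intg mu (fun u => gk (r - u) s * (rho u * @qn R d u)).
  apply: (intg_le mf Di) => u; rewrite ger0_norm//.
  by rewrite !mulr_ge0 ?gk_ge0 ?rho_ge0 ?qn_ge0.
split=> //; apply: (le_trans (Rint_le ii Di dom)).
have ghi : intg mu (fun u => gk (r - u) (2 * s) + (Num.sqrt s)^-1 * hs (@alpha R d) u).
  by apply: intgD => //; exact: intgZ.
rewrite /D (RintZ _ ghi) (RintD gi (intgZ _ hi)) (RintZ _ hi) gE -/H.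
have sq1 : 1 <= Num.sqrt T * (Num.sqrt s)^-1.
  by rewrite ler_pdivlMr// mul1r; exact: ler_wsqrtr.
have -> : cM T * (Num.sqrt T + H) * (Num.sqrt s)^-1 * rho r =
  cM T * rho r * (Num.sqrt T * (Num.sqrt s)^-1 + (Num.sqrt s)^-1 * H).
  by move: (cM T) (rho r) (Num.sqrt T) (Num.sqrt s)^-1 => a b c e; ring.
apply: ler_pM; rewrite ?mulr_ge0 ?rho_ge0 ?(ltW (cM_gt0 _)) ?addr_ge0 ?mulr_ge0 ?invr_ge0 ?sqrtr_ge0//.
  by rewrite ler_wpM2r ?rho_ge0// cM_le.
by rewrite lerD2r.
Qed.

Definition cK T : R := 2 ^+ d * (cM T * (Num.sqrt T + \int[mu]_u hs (@alpha R d) u)) ^+ d.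

(** In contrast to [kt_rhod] this bound reaches down to [q = 0], with the integrable singularity
    [|q|^(-alpha)]. The price [s^(-d/2)] is affordable where it meets a Gaussian away from its
    peak. *)
Lemma kt_qn i v q s T : q != 0 -> 0 < s -> s <= T ->
  `|kt i v q s| <= cK T * (Num.sqrt s)^-1 ^+ d * rhod v * @qn R d q.
Proof.
move=> q0 s0 sT; have gi (k : 'I_d) := (@gk_rho_qn (v ord0 k) s T s0 sT).1.
pose D z := 2 ^+ d * @qn R d q * \prod_k (gk (v ord0 k - z ord0 k) s * (rho (z ord0 k) * @qn R d (z ord0 k))).
have Di : intg mud D by apply: intgZ; exact: (intg_prodf gi).
have ae : {ae mud, forall z, `|Gam (v - z) s * Pk i (rsnoc (z, q))| <= D z}.
  apply: aeS (ae_coord_neq (0 : V)) => z z0.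
  rewrite normrM ger0_norm ?Gam_ge0//.
  have h : nrmd (rsnoc (z, q)) <= 2 ^+ d * (\prod_k (rho (z ord0 k) * @qn R d (z ord0 k)) * @qn R d q).
    have := @nrmd_le_qf R d (rsnoc (z, q)).
    rewrite (prod_rsnoc (@qf R d)).
    have E (k : 'I_d) r : @qf R d (lift ord_max k) r = rho r * @qn R d r.
      by rewrite /qf eq_sym (negbTE (neq_lift _ _)).
    have -> : @qf R d ord_max q = @qn R d q by rewrite /qf eqxx.
    have -> : \prod_k @qf R d (lift ord_max k) (z ord0 k) = \prod_k (rho (z ord0 k) * @qn R d (z ord0 k)).
      by apply: eq_bigr => k _; exact: E.
    apply=> k; rewrite mxE; case: unliftP => [k' _|_//].
    by have := z0 k'; rewrite mxE.
  apply: (le_trans (ler_wpM2l (Gam_ge0 _ _) (le_trans (Pk_le _ _) h))).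
  set X := \prod_k (rho _ * _).
  have -> : D z = 2 ^+ d * @qn R d q * (Gam (v - z) s * X).
    rewrite /D /Gam /X -big_split/=; congr (_ * _); apply: eq_bigr => k _.
    by rewrite !mxE.
  rewrite le_eqVlt; apply/orP; left; apply/eqP.
  by move: (Gam _ _) X (qn q) => a X c; ring.
have ii := intg_kt i v q0 s0.
apply: (le_trans (le_normr_Rintegral measurableT ii)).
apply: (le_trans (Rint_le_ae (intg_norm ii) Di ae)).
rewrite /D (RintZ _ (intg_prodf gi)).
have f0 (k : 'I_d) u : 0 <= gk (v ord0 k - u) s * (rho u * @qn R d u).
  by rewrite !mulr_ge0 ?gk_ge0 ?rho_ge0 ?qn_ge0.
have h := @Rint_prodf_le R d (fun (k : 'I_d) u => gk (v ord0 k - u) s * (rho u * @qn R d u)) _ gi f0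
  (fun k : 'I_d => (gk_rho_qn (v ord0 k) s0 sT).2).
apply: (le_trans (ler_wpM2l _ h)); first by rewrite mulr_ge0 ?exprn_ge0 ?qn_ge0.
rewrite big_split/= prodr_const card_ord exprMn -/(rhod v) /cK.
rewrite le_eqVlt; apply/orP; left; apply/eqP.
by move: (qn q) (rhod v) (_^-1 ^+ d) ((_ * _) ^+ d) (2 ^+ d) => a b c e f; ring.
Qed.

End tangential_kernel.

(** * Time estimates and moving limits of integration for the one-dimensional kernel *)

Lemma aeS2 d (T : measurableType d) (R : realType) (m : {measure set T -> \bar R})
  (P Q S : T -> Prop) : (forall x, P x -> Q x -> S x) ->
  {ae m, forall x, P x} -> {ae m, forall x, Q x} -> {ae m, forall x, S x}.
Proof. by move=> PQ; apply: filterS2. Qed.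

Section heat_moments.
Context {R : realType}.
Local Notation mu := (@lebesgue_measure R).
Implicit Types (r s t p q x h T A B : R) (M N : nat).

(** Open ends keep out the end points, where the closed forms of the kernels fail. *)
Definition oo x p : R := \1_(`]0, x[%classic : set R) p.

Lemma ooE x p : oo x p = (0 < p < x)%R%:R.
Proof.
rewrite /oo /indic; have [h|/negP h] := boolP (0 < p < x); first by rewrite mem_set//= in_itv.
by rewrite memNset//= in_itv.
Qed.

Lemma oo_ge0 x p : 0 <= oo x p.
Proof. by rewrite ooE. Qed.

Lemma oo_le1 x p : oo x p <= 1.
Proof. by rewrite ooE; case: (_ && _). Qed.

Lemma oo_cases x p : oo x p = 0 \/ (oo x p = 1 /\ 0 < p < x).
Proof. by rewrite ooE; case: (boolP (0 < p < x)) => _; [right|left]. Qed.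

Lemma measurable_oo x : measurable_fun [set: measurableTypeR R] (oo x).
Proof. exact: measurable_indic. Qed.

Lemma intg_oo x : 0 < x -> intg mu (oo x) /\ \int[mu]_p oo x p = x.
Proof.
move=> x0; split; first exact: integrable_indic_itv.
have E : mu (`]0, x[%classic : set R) = x%:E.
  by rewrite lebesgue_measure_itv/= lte_fin x0 -EFinB subr0.
by rewrite /Rintegral /oo integral_indic// setIT [X in fine X]E.
Qed.

Lemma gk_le_sqrt r t : 0 < t -> gk r (2 * t) <= (Num.sqrt t)^-1.
Proof.
move=> t0; apply: (le_trans (gk_le _ _)).
have t20 : 0 < 4 * pi * (2 * t) by rewrite !mulr_gt0// pi_gt0.
rewrite lef_pV2 ?posrE ?sqrtr_gt0//; apply: ler_wsqrtr.
have := @pi_ge2 R; move: (pi : R) => P p2.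
have : 2 * t <= P * t by rewrite ler_wpM2r// ltW.
by move: t0; clear; lra.
Qed.

Lemma sqrt_sg r t : 0 < t -> Num.sqrt t * sg r t = Num.sqrt t + `|r|.
Proof.
by move=> t0; rewrite /sg mulrDr mulr1 mulrCA mulfV ?mulr1// gt_eqF// sqrtr_gt0.
Qed.

(* Away from the origin the Gaussian beats every power of [1 / sqrt t]. *)
Lemma gk_far M N r t h : 0 < h -> h <= `|r| -> 0 < t ->
  sg r t ^+ M * gk r t <=
    Kn (M + N) * h^-1 ^+ N * Num.sqrt t ^+ N * (Num.sqrt t)^-1.
Proof.
move=> h0 hr t0; have u0 : 0 < Num.sqrt t by rewrite sqrtr_gt0.
have x1 : 1 <= Num.sqrt t * sg r t * h^-1.
  rewrite sqrt_sg// ler_pdivlMr// mul1r (le_trans hr)// lerDr ltW//.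
have g0 := gk_ge0 r t; have s0 := sg_gt0 r t.
apply: (@le_trans _ _ (sg r t ^+ M * gk r t * (Num.sqrt t * sg r t * h^-1) ^+ N)).
  by rewrite ler_peMr ?exprn_ege1// mulr_ge0// exprn_ge0// ltW.
rewrite !exprMn.
have -> : sg r t ^+ M * gk r t * (Num.sqrt t ^+ N * sg r t ^+ N * h^-1 ^+ N) =
   h^-1 ^+ N * Num.sqrt t ^+ N * (gk r t * (sg r t ^+ M * sg r t ^+ N)).
  by move: (_ ^+ M) (gk _ _) (sg _ _ ^+ N) (_^-1 ^+ N) (Num.sqrt t ^+ N) => a b c e f; ring.
rewrite -exprD.
have c0 : 0 <= h^-1 ^+ N * Num.sqrt t ^+ N by rewrite mulr_ge0 ?exprn_ge0 ?invr_ge0 ?sqrtr_ge0 ?(ltW h0).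
apply: (le_trans (ler_wpM2l c0 (gk_sg _ _ t0))).
have k0 : 0 <= Kn (M + N) :> R by exact: ltW (Kn_gt0 _).
have := ler_wpM2l (mulr_ge0 k0 c0) (gk_le_sqrt r t0).
by move: (Kn _) (gk _ _) (_^-1 ^+ N) (Num.sqrt t ^+ N) (Num.sqrt t)^-1 => a b c e f; lra.
Qed.

Lemma gk2_far N r t h : 0 < h -> h <= `|r| -> 0 < t ->
  `|gk2 r t| * (Num.sqrt t)^-1 ^+ N <= Kn N.+4 * h^-1 ^+ N.+2 * (Num.sqrt t)^-1.
Proof.
move=> h0 hr t0; have u0 : 0 < Num.sqrt t by rewrite sqrtr_gt0.
have := gk_far 2 N.+2 h0 hr t0; rewrite add2n => F.
have uN : 0 <= (Num.sqrt t)^-1 ^+ N by rewrite exprn_ge0// invr_ge0 ltW.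
apply: (le_trans (ler_wpM2r uN (gk2_sg r t0))).
have tE : t^-1 = (Num.sqrt t)^-1 ^+ 2 by rewrite exprVn sqr_sqrtr// ltW.
rewrite tE -[leLHS]mulrA; apply: (le_trans (ler_wpM2l _ (ler_wpM2r uN F))).
  by rewrite exprn_ge0// invr_ge0 ltW.
rewrite le_eqVlt; apply/orP; left; apply/eqP.
have e : (Num.sqrt t)^-1 ^+ 2 * (Num.sqrt t ^+ N.+2 * (Num.sqrt t)^-1 ^+ N) = 1.
  by rewrite mulrCA -exprD addnC addn2 -exprMn mulfV ?expr1n// gt_eqF.
rewrite -[RHS]mul1r -e.
by move: (Kn _) (Num.sqrt t ^+ N.+2) ((Num.sqrt t)^-1 ^+ N) (h^-1 ^+ N.+2) (Num.sqrt t)^-1 => a b c f g; ring.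
Qed.

Lemma gk1_far N r t h : 0 < h -> h <= `|r| -> 0 < t ->
  `|gk1 r t| * (Num.sqrt t)^-1 ^+ N <= Kn N.+2 * h^-1 ^+ N.+1 * (Num.sqrt t)^-1.
Proof.
move=> h0 hr t0; have u0 : 0 < Num.sqrt t by rewrite sqrtr_gt0.
have := gk_far 1 N.+1 h0 hr t0; rewrite add1n expr1 => F.
have uN : 0 <= (Num.sqrt t)^-1 ^+ N by rewrite exprn_ge0// invr_ge0 ltW.
apply: (le_trans (ler_wpM2r uN (gk1_sg r t0))).
rewrite -[leLHS]mulrA; apply: (le_trans (ler_wpM2l _ (ler_wpM2r uN F))).
  by rewrite invr_ge0 ltW.
rewrite le_eqVlt; apply/orP; left; apply/eqP.
have e : (Num.sqrt t)^-1 * (Num.sqrt t ^+ N.+1 * (Num.sqrt t)^-1 ^+ N) = 1.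
  by rewrite mulrCA -exprS -exprMn mulfV ?expr1n// gt_eqF.
rewrite -[RHS]mul1r -e.
by move: (Kn _) (Num.sqrt t ^+ N.+1) ((Num.sqrt t)^-1 ^+ N) (h^-1 ^+ N.+1) (Num.sqrt t)^-1 => a b c f g; ring.
Qed.

Lemma gk_far0 r t h : 0 < h -> h <= `|r| -> 0 < t -> gk r t <= Kn 1 * h^-1.
Proof.
move=> h0 hr t0; have u0 : 0 < Num.sqrt t by rewrite sqrtr_gt0.
have := gk_far 0 1 h0 hr t0; rewrite expr0 mul1r !expr1 add0n => /le_trans; apply.
by rewrite mulfK// gt_eqF.
Qed.

(** [|r| <= sqrt t * sg r t]: a first-order zero at the origin improves [1 / t] to [1 / sqrt t]. *)
Lemma gk2_moment r t T : 0 < t -> t <= T ->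
  `|gk2 r t| * `|r| <= cM T * (Num.sqrt t)^-1 * gk r (2 * t).
Proof.
move=> t0 tT; have u0 : 0 < Num.sqrt t by rewrite sqrtr_gt0.
have ui0 : 0 <= (Num.sqrt t)^-1 by rewrite invr_ge0 ltW.
have s0 := sg_gt0 r t; have g0 := gk_ge0 r t; have g20 := gk_ge0 r (2 * t).
have r_le : `|r| <= Num.sqrt t * sg r t by rewrite sqrt_sg// lerDr ltW.
apply: (@le_trans _ _ (t^-1 * (sg r t ^+ 2 * gk r t) * (Num.sqrt t * sg r t))).
  by apply: ler_pM => //; exact: gk2_sg.
have tE : t^-1 = (Num.sqrt t)^-1 * (Num.sqrt t)^-1 by rewrite -expr2 exprVn sqr_sqrtr// ltW.
have -> : t^-1 * (sg r t ^+ 2 * gk r t) * (Num.sqrt t * sg r t) =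
   ((Num.sqrt t)^-1 * Num.sqrt t) * (Num.sqrt t)^-1 * (sg r t ^+ 3 * gk r t).
  by rewrite tE; move: (gk _ _) (sg _ _) (Num.sqrt t) (Num.sqrt t)^-1 => a b c e; ring.
rewrite mulVf ?gt_eqF// mul1r [leRHS]mulrAC [leRHS]mulrC; apply: ler_wpM2l => //.
apply: (le_trans (sg_gk_rho _ t0)).
apply: ler_pM; rewrite ?(ltW (cM_gt0 _)) ?cM_le ?mulr_ge0 ?exprn_ge0 ?rho_ge0//.
by rewrite ler_piMl// exprn_ile1 ?rho_ge0 ?rho_le1.
Qed.

Definition g2b t : R := t^-1 * (Kn 2 * (Num.sqrt t)^-1).
Definition g1b t : R := (Num.sqrt t)^-1 * (Kn 1 * (Num.sqrt t)^-1).

Lemma gk2_le r t : 0 < t -> `|gk2 r t| <= g2b t.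
Proof.
move=> t0; apply: (le_trans (gk2_sg r t0)); rewrite /g2b ler_wpM2l ?invr_ge0 ?(ltW t0)//.
rewrite mulrC (le_trans (gk_sg _ _ t0))// ler_wpM2l ?gk_le_sqrt//.
exact: ltW (Kn_gt0 _).
Qed.

Lemma gk1_le r t : 0 < t -> `|gk1 r t| <= g1b t.
Proof.
move=> t0; apply: (le_trans (gk1_sg r t0)); rewrite /g1b ler_wpM2l ?invr_ge0 ?sqrtr_ge0//.
have := gk_sg 1 r t0; rewrite expr1 mulrC => /le_trans; apply.
by rewrite ler_wpM2l ?gk_le_sqrt// ltW// Kn_gt0.
Qed.

Lemma measurable_gk1 dd (X : measurableType dd) (f h : X -> R) :
  measurable_fun setT f -> measurable_fun setT h ->
  measurable_fun setT (fun y => gk1 (f y) (h y)).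
Proof.
move=> mf mh; apply: measurable_funM; last exact: measurable_gk.
apply: measurableT_comp => //; apply: measurable_funM => //; apply: measurable_fun_inv; exact: measurable_funM.
Qed.

Lemma measurable_gk2 dd (X : measurableType dd) (f h : X -> R) :
  measurable_fun setT f -> measurable_fun setT h ->
  measurable_fun setT (fun y => gk2 (f y) (h y)).
Proof.
move=> mf mh; apply: measurable_funM; last exact: measurable_gk.
apply: measurable_funB; last by apply: measurable_fun_inv; exact: measurable_funM.
apply: measurable_funM; first exact: measurable_funX.
by apply: measurable_fun_inv; apply: measurable_funM => //; exact: measurable_funX.
Qed.

Lemma is_derive_cont (f f' : R -> R) : (forall x, is_derive x (1 : R) f (f' x)) -> continuous f.
Proof.
move=> df x; have [dd _] := df x.
exact: (differentiable_continuous ((derivable1_diffP _ _).1 dd)).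
Qed.

Lemma Rint_oo_FTC (F f : R -> R) h : 0 < h -> (forall p, is_derive p (1 : R) F (f p)) ->
  continuous f -> intg mu (fun p => oo h p * f p) /\ \int[mu]_p (oo h p * f p) = F h - F 0.
Proof.
move=> h0 dF cf; have cF := is_derive_cont dF.
have cf' : {within `[0, h], continuous f} by exact: continuous_subspaceT.
have cF' : derivable_oo_LRcontinuous F 0 h.
  split; [by move=> x _; have [] := dF x| |].
    by apply: cvg_at_right_filter; exact: cF.
  by apply: cvg_at_left_filter; exact: cF.
have FE : {in `]0, h[, F^`()%classic =1 f}.
  by move=> x _; rewrite derive1E; have := dF x => ?; exact: derive_val.
have E := continuous_FTC2 h0 cf' cF' FE.
have i1 : mu.-integrable `[0, h]%classic (EFin \o f).
  by apply: continuous_compact_integrable => //; exact: segment_compact.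
have m1 : measurable (`[0, h]%classic : set R) by [].
have i2 := (intg_restr mu f m1).1 i1.
have ae : {ae mu, forall p, \1_(`[0, h]%classic : set R) p * f p = oo h p * f p}.
  apply: aeS2 (@ae_neq R h) (ae_neq (0 : R)) => p p1 p2.
  rewrite ooE /indic (_ : (p \in _) = (0 < p < h))//; apply/idP/idP.
    by move=> /set_mem/=; rewrite in_itv/= !lt_neqAle eq_sym p2 p1.
  by move=> /andP[q1 q2]; apply: mem_set; rewrite /= in_itv/= !ltW.
have mo : measurable_fun [set: measurableTypeR R] (fun p => oo h p * f p).
  apply: measurable_funM; first exact: measurable_oo.
  exact: continuous_measurable_fun.
have i3 : intg mu (fun p => oo h p * f p).
  by apply: (intg_le_ae mo (intg_norm i2)); apply: aeS ae => p ->.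
split=> //; rewrite -(eq_Rint_ae (intg_meas i2) (intg_meas i3) ae) -Rint_restr /Rintegral E/=.
by [].
Qed.

Lemma gk_cont t : continuous (gk ^~ t : R -> R).
Proof. by apply: is_derive_cont => x; exact: is_derive_gk. Qed.

Lemma gk1_cont t : continuous (gk1 ^~ t : R -> R).
Proof. by apply: is_derive_cont => x; exact: is_derive_gk1. Qed.

Lemma gk2_cont t : continuous (gk2 ^~ t : R -> R).
Proof.
move=> x; rewrite /gk2; apply: cvgM; last exact: gk_cont.
by apply: cvgB; [apply: cvgM; [exact: exprn_continuous|exact: cvg_cst]|exact: cvg_cst].
Qed.

Lemma gk1_0 t : gk1 0 t = 0 :> R.
Proof. by rewrite /gk1 mul0r oppr0 mul0r. Qed.

(** Because [gk1 0 t = 0], the signed mass of [gk2] on [(0, h)] stays small as [t] tends to 0,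
    although its absolute mass is of order [1 / t]. [Dker] rests on this cancellation. *)
Lemma Rint_oo_gk2 h t : 0 < h ->
  intg mu (fun p => oo h p * gk2 p t) /\ \int[mu]_p (oo h p * gk2 p t) = gk1 h t.
Proof.
move=> h0; have [i ->] := @Rint_oo_FTC (gk1 ^~ t) (gk2 ^~ t) h h0
  (fun p => is_derive_gk1 p t) (@gk2_cont t).
by rewrite gk1_0 subr0.
Qed.

Lemma Rint_oo_gk1 h b t : 0 < h ->
  intg mu (fun p => oo h p * gk1 (p + b) t) /\
  \int[mu]_p (oo h p * gk1 (p + b) t) = gk (h + b) t - gk b t.
Proof.
move=> h0; have dF p : is_derive p (1 : R) (fun p => gk (p + b) t) (gk1 (p + b) t).
  have d1 : is_derive p (1 : R) (fun p : R => p + b) 1.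
    by apply: is_derive_eq; rewrite addr0.
  by apply: (is_derive_eq (@is_derive1_comp R (gk ^~ t) _ _ _ _ (is_derive_gk _ _) d1)); rewrite mulr1.
have cf : continuous (fun p => gk1 (p + b) t).
  move=> p; apply: (@continuous_comp _ _ _ (fun p : R => p + b) (gk1 ^~ t)); last exact: gk1_cont.
  by apply: cvgD; [exact: cvg_id|exact: cvg_cst].
by have [i ->] := Rint_oo_FTC h0 dF cf; rewrite add0r.
Qed.

(** Differentiation of [hitting_identity] in the first distance, under the integral sign: for
    distances at least [p / 2] the far bounds make the integrand bounded on [(0, t)], so a multiple
    of [oo t] dominates. *)
Lemma hitting2 p b t : 0 < p -> 0 < b -> 0 < t ->
  intg mu (fun s => oo t s * (-2 * gk2 p (t - s) * gk b s)) /\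
  \int[mu]_s (oo t s * (-2 * gk2 p (t - s) * gk b s)) = gk1 (p + b) t.
Proof.
move=> p0 b0 t0; pose F (a s : R) := oo t s * (-2 * gk1 a (t - s) * gk b s).
pose h := p / 2; have h0 : 0 < h by rewrite divr_gt0.
pose c : R := 2 * (Kn 5 * h^-1 ^+ 3) * (Kn 1 * b^-1).
have Ks N : 0 <= Kn N :> R by exact: ltW (Kn_gt0 _).
have c0 : 0 <= c by rewrite !mulr_ge0 ?exprn_ge0 ?invr_ge0 ?(ltW h0) ?(ltW b0).
have dom a s : h <= a -> `|oo t s * (-2 * gk2 a (t - s) * gk b s)| <= c * oo t s.
  move=> ha; have [->|[-> /andP[s0 st]]] := oo_cases t s; first by rewrite mul0r normr0 mulr0.
  rewrite mul1r mulr1 normrM normrM normrN (ger0_norm (gk_ge0 _ _)) [`|2|]ger0_norm//.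
  have ts0 : 0 < t - s by rewrite subr_gt0.
  have ha' : h <= `|a| by rewrite ger0_norm// (le_trans (ltW h0)).
  have hb : b <= `|b| by rewrite ger0_norm// ltW.
  have u0 : 0 < (Num.sqrt (t - s))^-1 by rewrite invr_gt0 sqrtr_gt0.
  have := gk2_far 1 h0 ha' ts0; rewrite expr1 ler_pM2r// => g2.
  apply: ler_pM; [exact: mulr_ge0|exact: gk_ge0|by rewrite ler_wpM2l|exact: gk_far0].
have dd a s : is_derive a (1 : R) (fun a => F a s) (oo t s * (-2 * gk2 a (t - s) * gk b s)).
  rewrite (_ : (fun a => F a s) = fun a => (oo t s * -2 * gk b s) * gk1 a (t - s)); last first.
    by apply/funext => r; rewrite /F; move: (gk _ _) (gk1 _ _) (oo _ _) => A B C; ring.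
  apply: (is_derive_eq (is_deriveZ _ (is_derive_gk1 a (t - s)))); rewrite /GRing.scale/=.
  by move: (gk _ _) (gk2 _ _) (oo _ _) => A B C; ring.
have pE a s : partial1of2 F a s = oo t s * (-2 * gk2 a (t - s) * gk b s).
  by rewrite partial1of2E; have := dd a s => ?; exact: derive_val.
have oi := (intg_oo t0).1.
have I0 : (`]h, 2 * p[%classic : set R) p by rewrite /= in_itv/= /h; lra.
have mo : measurable_fun [set: measurableTypeR R] (fun s => oo t s * (-2 * gk2 p (t - s) * gk b s)).
  apply: measurable_funM; first exact: measurable_oo.
  apply: measurable_funM; last exact: measurable_gk.
  by apply: measurable_funM => //; apply: measurable_gk2 => //; exact: measurable_funB.
have ii : intg mu (fun s => oo t s * (-2 * gk2 p (t - s) * gk b s)).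
  by apply: (intg_le mo (intgZ c oi)) => s; apply: dom; rewrite /h; lra.
split=> //.
have := @cvg_differentiation_under_integral R _ _ mu F setT measurableT p h (2 * p) I0.
move=> /(_ _ _ (fun s => c * oo t s)) H.
have : h^-1 *: (\int[mu]_s F (h + p) s - \int[mu]_s F p s) @[h --> 0^'] -->
    \int[mu]_s partial1of2 F p s.
  apply: H.
  - move=> a; rewrite /= in_itv/= => /andP[ha _].
    by have [] := @hitting_identity R a b t (lt_trans h0 ha) b0 t0.
  - by move=> a s _ _; have [] := dd a s.
  - by move=> s; rewrite mulr_ge0 ?oo_ge0.
  - exact: (intgZ c oi).
  - by move=> a s; rewrite /= in_itv/= => /andP[ha _] _; rewrite pE dom// ltW.
have -> : \int[mu]_s partial1of2 F p s = \int[mu]_s (oo t s * (-2 * gk2 p (t - s) * gk b s)).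
  by apply: eq_Rintegral => s _; exact: pE.
move=> c1.
have c2 : h^-1 *: (\int[mu]_s F (h + p) s - \int[mu]_s F p s) @[h --> 0^'] --> gk1 (p + b) t.
  have dG : is_derive p (1 : R) (fun p => gk (p + b) t) (gk1 (p + b) t).
    have d1 : is_derive p (1 : R) (fun p : R => p + b) 1.
      by apply: is_derive_eq; rewrite addr0.
    by apply: (is_derive_eq (@is_derive1_comp R (gk ^~ t) _ _ _ _ (is_derive_gk _ _) d1)); rewrite mulr1.
  have [D1 <-] := dG; apply: cvg_trans D1; apply: near_eq_cvg.
  have hn : \forall r \near (0 : R)^', `|r| < h by exact: dnbhs0_lt.
  near=> r; have rh : `|r| < h by near: r.
  have rp : 0 < r + p by move: rh; rewrite ltr_norml /h; lra.
  rewrite /= [\int[mu]_s F p s](hitting_identity p0 b0 t0).2.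
  rewrite [\int[mu]_s F (r + p) s](hitting_identity rp b0 t0).2.
  by rewrite /GRing.scale/= mulr1.
exact: (cvg_unique _ c1 c2).
Unshelve. all: by end_near. Qed.

(** Cutting [gk1] off on the negative half-line keeps it Lipschitz, as [gk1 0 t = 0]. An integral
    with moving upper limit thereby becomes a convolution that can be differentiated. *)
Definition gp r t : R := if 0 < r then gk1 r t else 0.
Definition gp' r t : R := if 0 < r then gk2 r t else 0.

Lemma gp_lip a b t : 0 < t -> `|gp a t - gp b t| <= g2b t * `|a - b|.
Proof.
move=> t0; have E r : gp r t = gk1 (Num.max r 0) t.
  by rewrite /gp; case: ltP => // _; rewrite gk1_0.
have c0 : 0 <= g2b t by exact: le_trans (normr_ge0 _) (gk2_le 0 t0).
have lip (u v : R) : u <= v -> `|gk1 v t - gk1 u t| <= g2b t * `|v - u|.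
  move=> uv; have cc : {within `[u, v], continuous (gk1 ^~ t)} by apply: continuous_subspaceT; exact: gk1_cont.
  have [c _ ->] := MVT_segment uv (fun x _ => is_derive_gk1 x t) cc.
  by rewrite normrM ler_wpM2r// gk2_le.
have lip' (u v : R) : `|gk1 u t - gk1 v t| <= g2b t * `|u - v|.
  by have [/lip|/ltW/lip//] := leP u v; rewrite distrC (distrC v).
rewrite !E; apply: (le_trans (lip' _ _)); apply: ler_wpM2l => //.
case: (leP a 0) => ha; case: (leP b 0) => hb; rewrite ?subrr ?normr0 ?normr_ge0//.
  by rewrite !ler0_norm; lra.
by rewrite !ger0_norm; lra.
Qed.

Lemma gp_le a t : 0 < t -> `|gp a t| <= g1b t.
Proof.
move=> t0; rewrite /gp; case: ifP => _; first exact: gk1_le.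
by rewrite normr0 (le_trans (normr_ge0 _) (gk1_le 0 t0)).
Qed.

Lemma measurable_gp t : measurable_fun [set: measurableTypeR R] (gp ^~ t).
Proof.
apply: measurable_fun_if => //; first exact: measurable_fun_ltr.
by apply: measurable_funTS; exact: measurable_gk1.
Qed.

Lemma measurable_gp' t : measurable_fun [set: measurableTypeR R] (gp' ^~ t).
Proof.
apply: measurable_fun_if => //; first exact: measurable_fun_ltr.
by apply: measurable_funTS; exact: measurable_gk2.
Qed.

Lemma is_derive_gp r t : r != 0 -> is_derive r (1 : R) (gp ^~ t) (gp' r t).
Proof.
move=> r0; have [rp|rn] := ltP 0 r.
  have -> : gp' r t = gk2 r t by rewrite /gp' rp.
  apply: (@near_eq_is_derive R R R (gk1 ^~ t)); last exact: is_derive_gk1.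
  near=> s; have s0 : 0 < s by near: s; exact: lt_nbhsr.
  by rewrite /gp s0.
have -> : gp' r t = 0 by rewrite /gp' ltNge rn.
have rn' : r < 0 by rewrite lt_neqAle r0.
apply: (@near_eq_is_derive R R R (cst (0 : R))).
near=> s; have s0 : s < 0 by near: s; exact: lt_nbhsl.
by rewrite /gp ltNge (ltW s0).
Unshelve. all: by end_near. Qed.

(** The difference quotients of [gp] are bounded by its Lipschitz constant [g2b t] and converge off
    the single point [q = r], so integrability of [k] is enough for dominated convergence. *)
Lemma is_derive_gp_conv (k : R -> R) r t : 0 < t -> intg mu k ->
  is_derive r (1 : R) (fun r => \int[mu]_q (gp (r - q) t * k q))
    (\int[mu]_q (gp' (r - q) t * k q)).
Proof.
move=> t0 ki; pose f r := \int[mu]_q (gp (r - q) t * k q).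
have mk := intg_meas ki.
have ms x (g : R -> R) : measurable_fun [set: measurableTypeR R] g ->
    measurable_fun [set: measurableTypeR R] (fun q => g (x - q)).
  by move=> mg; apply: (measurableT_comp mg); exact: measurable_funB.
have fi x : intg mu (fun q => gp (x - q) t * k q).
  apply: (intg_le _ (intgZ (g1b t) (intg_norm ki))) => [|q].
    by apply: measurable_funM => //; exact: (ms x _ (measurable_gp t)).
  by rewrite normrM ler_wpM2r// gp_le.
have cv : h^-1 *: ((f \o shift r) (h *: (1 : R)) - f r) @[h --> (0 : R)^'] -->
    \int[mu]_q (gp' (r - q) t * k q).
  apply/cvgr_dnbhsP => u [u0 uc].
  pose g_ m q := (u m)^-1 * (gp (u m + r - q) t * k q - gp (r - q) t * k q).
  have gE m : (u m)^-1 *: ((f \o shift r) (u m *: 1) - f r) = \int[mu]_q g_ m q.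
    rewrite /g_ (RintZ _ (intgB (fi _) (fi _))) (RintB (fi _) (fi _)).
    by rewrite /f /GRing.scale/= mulr1.
  under eq_fun do rewrite gE.
  have mg_ m : measurable_fun [set: measurableTypeR R] (g_ m).
    by apply: (intg_meas (m := mu)); apply: intgZ; exact: intgB.
  have mlim : measurable_fun [set: measurableTypeR R] (fun q => gp' (r - q) t * k q).
    by apply: measurable_funM => //; exact: (ms r _ (measurable_gp' t)).
  have bd : {ae mu, forall q, forall m, `|g_ m q| <= g2b t * `|k q|}.
    apply: aeW => q m; rewrite /g_ -mulrBl !normrM mulrA ler_wpM2r// normfV.
    rewrite ler_pdivrMl ?normr_gt0// mulrC (le_trans (gp_lip _ _ t0))//.
    by rewrite (_ : u m + r - q - (r - q) = u m)//; ring.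
  have lim : {ae mu, forall q, g_ ^~ q @ \oo --> gp' (r - q) t * k q}.
    have := @ae_neq R r; apply: aeS => q qr.
    have rq : r - q != 0 by rewrite subr_eq0 eq_sym.
    have [D1 D2] := is_derive_gp t rq.
    have D3 : h^-1 *: ((gp^~ t \o shift (r - q)) (h *: (1 : R)) - gp (r - q) t) @[h --> (0 : R)^'] --> gp' (r - q) t.
      by rewrite -D2.
    have /cvgr_dnbhsP/(_ u (conj u0 uc)) D4 := D3.
    rewrite (_ : g_ ^~ q = fun m => ((u m)^-1 *: ((gp^~ t \o shift (r - q)) (u m *: (1 : R)) - gp (r - q) t)) * k q).
      by apply: cvgMr_tmp.
    by apply/funext => m; rewrite /g_ /GRing.scale/= mulr1 -mulrBl mulrA addrA.
  by have [_] := Rint_dct mg_ mlim lim (intgZ (g2b t) (intg_norm ki)) bd.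
have dd : derivable f r 1 by apply/cvg_ex; eexists; exact: cv.
apply: (DeriveDef dd); exact: (cvg_lim _ cv).
Qed.

End heat_moments.

Section modification.
Context {dd : measure_display} {X : measurableType dd} {R : realType}.
Variable m : {measure set X -> \bar R}.

(** Serves to alter an integrand at one point, such as an end point where a closed form breaks down.
    Measurability of [f] is concluded, not assumed: it is known for the closed form [g] only. *)
Lemma Rint_mod1 (f g : X -> R) (a : X) :
  measurable [set a] -> {ae m, forall x, x <> a} -> measurable_fun setT g ->
  (forall x, x <> a -> f x = g x) ->
  measurable_fun setT f /\ \int[m]_x f x = \int[m]_x g x.
Proof.
move=> ma aea mg fg; have mf : measurable_fun setT f.
  rewrite (_ : f = fun x => g x + \1_[set a] x * (f a - g a)).
    apply: measurable_funD => //; apply: measurable_funM; last exact: measurable_cst.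
    exact: measurable_indic.
  apply/funext => x; rewrite /indic; have [/set_mem/= ->|xa] := boolP (x \in [set a]).
    by rewrite mul1r addrC subrK.
  by rewrite mul0r addr0 fg// => xE; move/negP: xa; apply; apply: mem_set.
split=> //; apply: eq_Rint_ae => //; exact: aeS aea.
Qed.

End modification.

(** * A closed form of the kernel [Ktilde] *)

Section boundary_kernel.
Context {R : realType} {d : nat}.
Local Notation mu := (@lebesgue_measure R).
Local Notation Rn := 'rV[R]_d.+1.
Local Notation V := 'rV[R]_d.
Local Notation mud := (lebesgue_rV R d).
Local Notation mun := (lebesgue_rV R d.+1).
Implicit Types (v w : V) (z x y : Rn) (i j k : 'I_d.+1) (t s T p q r h : R).

Let H0 : R := \int[mu]_u hs (@alpha R d) u.

Let H00 : 0 <= H0.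
Proof. by apply: Rintegral_ge0 => r _; exact: hs_ge0. Qed.

Lemma Rint_oo_sub (f : R -> R) r : measurable_fun [set: measurableTypeR R] f ->
  \int[mu]_p (oo r p * f (r - p)) = \int[mu]_p (oo r p * f p).
Proof.
move=> mf; rewrite -(@Rint1_sub R r (fun p => oo r p * f p)).
  apply: eq_Rintegral => p _; congr (_ * _); rewrite !ooE; congr (nat_of_bool _)%:R.
  by apply/idP/idP => /andP[h1 h2]; apply/andP; split; lra.
by apply: measurable_funM => //; exact: measurable_oo.
Qed.

(* The subtraction of [k r] near [p = 0] tames the singularity [gk2 p t],
   which is only of order [1 / t] in [L^1]. *)
Definition Dker (k : R -> R) r t p : R :=
  oo r p * (gk2 p t * (k (r - p) - oo (r / 2) p * k r)).

(** The constant of [gk2_far] for [N = d] and [h = r / 2]. *)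
Definition cF r : R := Kn d.+4 * (r / 2)^-1 ^+ d.+2.

Lemma cF_ge0 r : 0 <= r -> 0 <= cF r.
Proof. by move=> r0; rewrite mulr_ge0 ?exprn_ge0 ?invr_ge0 ?divr_ge0// ltW// Kn_gt0. Qed.

Lemma measurable_Dker (k : R -> R) r t : measurable_fun [set: measurableTypeR R] k ->
  measurable_fun [set: measurableTypeR R] (Dker k r t).
Proof.
move=> mk; apply: measurable_funM; first exact: measurable_oo.
apply: measurable_funM; first exact: measurable_gk2.
apply: measurable_funB.
  by apply: (measurableT_comp mk); exact: measurable_funB.
by apply: measurable_funM => //; exact: measurable_oo.
Qed.

Section Dker_bound.
Variables (k : R -> R) (r t T A B : R).
Hypotheses (r0 : 0 < r) (t0 : 0 < t) (tT : t <= T) (A0 : 0 <= A) (B0 : 0 <= B)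
  (mk : measurable_fun [set: measurableTypeR R] k)
  (kA : forall p, 0 < p < r / 2 -> `|k (r - p) - k r| <= A * p)
  (kB : forall p, r / 2 <= p < r -> `|k (r - p)| <= B * (Num.sqrt t)^-1 ^+ d * @qn R d (r - p)).

Let u0 : 0 < (Num.sqrt t)^-1. Proof. by rewrite invr_gt0 sqrtr_gt0. Qed.

(** For [p < r / 2] the increment of [k] is at most [A * p], and [gk2_moment] applies. For
    [p >= r / 2] nothing is subtracted, and [gk2], away from its peak, absorbs the [t^(-d/2)]
    allowed by [kB]. Either way [1 / sqrt t] remains. *)
Lemma Dker_le : intg mu (Dker k r t) /\
  \int[mu]_p `|Dker k r t p| <= (A * cM T + B * cF r * (r + H0)) * (Num.sqrt t)^-1.
Proof.
have t20 : 0 < 2 * t by rewrite mulr_gt0.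
have c0 := cF_ge0 (ltW r0); have cM0 : 0 <= cM T by exact: ltW (cM_gt0 _).
pose D p := A * cM T * (Num.sqrt t)^-1 * gk p (2 * t) +
  B * cF r * (Num.sqrt t)^-1 * (oo r p + hs (@alpha R d) (r - p)).
have hi := @intg_hs R _ (@alpha01 R d).
have i1 := intg_gk t20; have [i2 e2] := intg_oo r0; have i3 := intg1_sub r hi.
have i23 := intgD i2 i3.
have Di : intg mu D by apply: intgD; exact: intgZ.
have r20 : 0 < r / 2 by rewrite divr_gt0.
have D1 p : 0 <= A * cM T * (Num.sqrt t)^-1 * gk p (2 * t).
  by do 2! [apply: mulr_ge0; rewrite ?gk_ge0 ?(ltW u0)//]; exact: mulr_ge0.
have D2 p : 0 <= B * cF r * (Num.sqrt t)^-1 * (oo r p + hs (@alpha R d) (r - p)).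
  apply: mulr_ge0; last by rewrite addr_ge0 ?oo_ge0 ?hs_ge0.
  by apply: mulr_ge0; [exact: mulr_ge0|exact: ltW].
have dom p : `|Dker k r t p| <= D p.
  rewrite /Dker; have [->|[op /andP[p0 pr]]] := oo_cases r p.
    by rewrite mul0r normr0 addr_ge0.
  rewrite op mul1r normrM; have [ph|ph] := ltP p (r / 2).
    apply: (le_trans _ (_ : A * cM T * (Num.sqrt t)^-1 * gk p (2 * t) <= _)); last by rewrite lerDl.
    rewrite (_ : oo (r / 2) p = 1) ?mul1r; last by rewrite ooE p0 ph.
    have hk : `|k (r - p) - k r| <= A * `|p|.
      by rewrite [`|p|]ger0_norm ?(ltW p0)// kA// p0.
    apply: (le_trans (ler_wpM2l (normr_ge0 _) hk)).
    by rewrite mulrCA -[A * cM T * _]mulrA -[leRHS]mulrA ler_wpM2l// gk2_moment.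
  apply: (le_trans _ (_ : B * cF r * (Num.sqrt t)^-1 * (oo r p + hs (@alpha R d) (r - p)) <= _)).
    rewrite (_ : oo (r / 2) p = 0) ?mul0r ?subr0; last by rewrite ooE p0/= ltNge ph.
    have hk := kB (introT andP (conj ph pr)).
    apply: (le_trans (ler_wpM2l (normr_ge0 _) hk)).
    have pp : r / 2 <= `|p| by rewrite ger0_norm// ltW.
    have := gk2_far d r20 pp t0; rewrite -/(cF r) op -/(qn (r - p)) => g2.
    have q0 := @qn_ge0 R d (r - p).
    have := ler_wpM2l (mulr_ge0 B0 q0) g2.
    by move: (`|gk2 _ _|) ((Num.sqrt t)^-1 ^+ d) (qn _) (cF r) (Num.sqrt t)^-1 => a b c e f; lra.
  by rewrite lerDr.
have ii : intg mu (Dker k r t) by apply: (intg_le _ Di dom); exact: measurable_Dker.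
split=> //; apply: (le_trans (Rint_le (intg_norm ii) Di dom)).
rewrite /D (RintD (intgZ _ i1) (intgZ _ i23)) (RintZ _ i1) (RintZ _ i23) (RintD i2 i3).
rewrite Rint_gk// e2 (Rint1_sub r (intg_meas hi)) -/H0 mulr1.
by rewrite le_eqVlt; apply/orP; left; apply/eqP; ring.
Qed.

(** After the substitution [p = r - q] the subtracted term is added back; its integral is explicit
    by [Rint_oo_gk2]. *)
Lemma Dker_E :
  \int[mu]_q (oo r q * (gk2 (r - q) t * k q)) =
  \int[mu]_p Dker k r t p + gk1 (r / 2) t * k r.
Proof.
have [iD _] := Dker_le; have r20 : 0 < r / 2 by rewrite divr_gt0.
have [i2 e2] := Rint_oo_gk2 t r20.
rewrite -e2 -(RintZr (k r) i2) -(RintD iD (intgZr (k r) i2)).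
rewrite -(@Rint_oo_sub (fun q => gk2 (r - q) t * k q)); last first.
  by apply: measurable_funM => //; apply: measurable_gk2 => //; exact: measurable_funB.
apply: eq_Rintegral => p _; rewrite /Dker subKr.
have [e0|[e1 _]] := oo_cases r p; last by rewrite e1; ring.
rewrite e0 (_ : oo (r / 2) p = 0); first by ring.
move: e0; rewrite !ooE; case: (boolP (0 < p < r)) => [_ /eqP|/negP h _].
  by rewrite oner_eq0.
case: (boolP (0 < p < r / 2)) => // /andP[h1 h2]; exfalso; apply: h.
by rewrite h1/= (lt_trans h2)// ltr_pdivrMr// ltr_pMr// ltr1n.
Qed.

End Dker_bound.

Definition cA r T : R := 2 * d.+2%:R * (1 + (r / 2)^-1) ^+ d.+1 * cM T ^+ d.

Lemma cA_ge0 r T : 0 < r -> 0 <= cA r T.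
Proof.
move=> r0; rewrite !mulr_ge0// exprn_ge0 ?(ltW (cM_gt0 _))//.
by rewrite addr_ge0// invr_ge0 divr_ge0// ltW.
Qed.

Lemma cK_ge0 T : 0 <= @cK R d T.
Proof.
by rewrite mulr_ge0 ?exprn_ge0// mulr_ge0 ?(ltW (cM_gt0 _))// addr_ge0 ?sqrtr_ge0.
Qed.

Lemma measurable_ktq i v s : measurable_fun [set: measurableTypeR R] (fun q => kt i v q s).
Proof. by apply: measurable_kt => //; exact: measurable_cst. Qed.

Lemma kt_sub_le i v r s T : 0 < r -> 0 < s -> s <= T ->
  forall p, 0 < p < r / 2 -> `|kt i v (r - p) s - kt i v r s| <= cA r T * rhod v * p.
Proof.
move=> r0 s0 sT p /andP[p0 pr]; have h0 : 0 < r / 2 by rewrite divr_gt0.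
have h1 : r / 2 <= r - p by lra.
have h2 : r / 2 <= r by lra.
apply: (le_trans (kt_lip i v h0 h1 h2 s0 sT)).
have -> : r - p - r = - p by ring.
by rewrite normrN (gtr0_norm p0) /cA [leRHS]mulrAC.
Qed.

Definition cD r T : R := cA r T * cM T + @cK R d T * cF r * (r + H0).

Lemma cD_ge0 r T : 0 < r -> 0 <= cD r T.
Proof.
move=> r0; have cM0 : 0 <= cM T by exact: ltW (cM_gt0 _).
apply: addr_ge0; first by apply: mulr_ge0 => //; exact: cA_ge0.
apply: mulr_ge0; last by rewrite addr_ge0 ?(ltW r0).
by apply: mulr_ge0; [exact: cK_ge0|exact: cF_ge0 (ltW r0)].
Qed.

(** Two times occur because in [flux_E] the normal kernel runs at the remaining time while the
    tangential semigroup has already reached the full one. *)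
Lemma Dker_kt i v r t s T : 0 < r -> 0 < t -> t <= s -> s <= T ->
  intg mu (Dker (fun q => kt i v q s) r t) /\
  \int[mu]_p `|Dker (fun q => kt i v q s) r t p| <= cD r T * (Num.sqrt t)^-1 * rhod v.
Proof.
move=> r0 t0 ts sT; have s0 : 0 < s by exact: lt_le_trans ts.
have [|||||i1 b1] := @Dker_le (fun q => kt i v q s) r t T (cA r T * rhod v) (@cK R d T * rhod v)
   r0 t0 (le_trans ts sT).
- by rewrite mulr_ge0 ?rhod_ge0 ?cA_ge0.
- by rewrite mulr_ge0 ?rhod_ge0 ?cK_ge0.
- exact: measurable_ktq.
- exact: kt_sub_le.
- move=> p /andP[p1 p2]; have p0 : r - p != 0 by rewrite gt_eqF// subr_gt0.
  apply: (le_trans (kt_qn i v p0 s0 sT)); apply: ler_wpM2r; first exact: qn_ge0.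
  rewrite [leRHS]mulrAC; apply: ler_wpM2r; first exact: rhod_ge0.
  apply: ler_wpM2l; first exact: cK_ge0.
  apply: lerXn2r; rewrite ?nnegrE ?invr_ge0 ?sqrtr_ge0//.
  by rewrite lef_pV2 ?posrE ?sqrtr_gt0//; exact: ler_wsqrtr.
split=> //; apply: (le_trans b1); rewrite le_eqVlt; apply/orP; left; apply/eqP.
by rewrite /cD; move: (rhod v) (cA _ _) (cM T) (cK T) (cF r) (Num.sqrt t)^-1 => a b c e f g; ring.
Qed.

(** The derivative in [r] of the convolution of [gk1] and [kt] over [(0, r)], arranged so that its
    bound is integrable in time. *)
Definition DD i v r t : R :=
  \int[mu]_p Dker (fun q => kt i v q t) r t p + gk1 (r / 2) t * kt i v r t.

Definition cDD r T : R :=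
  cD r T + Kn 2 * (r / 2)^-1 * ((1 + (r / 2)^-1) ^+ d * cM T ^+ d).

Lemma cDD_ge0 r T : 0 < r -> 0 <= cDD r T.
Proof.
move=> r0; have h0 : 0 <= (r / 2)^-1 by rewrite invr_ge0 divr_ge0 ?(ltW r0).
rewrite addr_ge0 ?cD_ge0// !mulr_ge0 ?exprn_ge0 ?(ltW (cM_gt0 _)) ?(ltW (Kn_gt0 _))//.
exact: addr_ge0.
Qed.

Lemma DD_le i v r t T : 0 < r -> 0 < t -> t <= T ->
  `|DD i v r t| <= cDD r T * (Num.sqrt t)^-1 * rhod v.
Proof.
move=> r0 t0 tT; have [i1 b1] := Dker_kt i v r0 t0 (lexx t) tT.
have h0 : 0 < r / 2 by rewrite divr_gt0.
have hh : r / 2 <= `|r / 2| by exact: ler_norm.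
have hr : r / 2 <= `|r| by rewrite (ger0_norm (ltW r0)); lra.
apply: (le_trans (ler_normD _ _)).
have g1 := gk1_far 0 h0 hh t0; rewrite expr0 mulr1 expr1 in g1.
have k1 := kt_rhod i v h0 hr t0 tT.
have b2 := le_trans (le_normr_Rintegral measurableT i1) b1.
have := lerD b2 (ler_pM (normr_ge0 _) (normr_ge0 _) g1 k1); rewrite -normrM.
move=> /le_trans; apply; rewrite /cDD le_eqVlt; apply/orP; left; apply/eqP.
by move: (cD _ _) (Num.sqrt t)^-1 (rhod v) (Kn 2) (r / 2)^-1 (_ ^+ d) (_ ^+ d) => a b c e f g h; ring.
Qed.

Lemma intg_oo_qn r : 0 < r -> intg mu (fun q => oo r q * @qn R d q).
Proof.
move=> r0; have hi := @intg_hs R _ (@alpha01 R d).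
apply: (intg_le _ (intgD (intg_oo r0).1 hi)) => [|q].
  apply: measurable_funM; first exact: measurable_oo.
  by apply: measurable_funD => //; exact: (intg_meas hi).
rewrite ger0_norm ?mulr_ge0 ?oo_ge0 ?qn_ge0// /qn mulrDr mulr1 lerD2l.
by rewrite ler_piMl ?hs_ge0 ?oo_le1.
Qed.

Lemma intg_oo_kt i v r t : 0 < r -> 0 < t -> intg mu (fun q => oo r q * kt i v q t).
Proof.
move=> r0 t0; pose c := @cK R d t * (Num.sqrt t)^-1 ^+ d * rhod v.
apply: (intg_le _ (intgZ c (intg_oo_qn r0))) => [|q].
  by apply: measurable_funM; [exact: measurable_oo|exact: measurable_ktq].
have [->|[-> /andP[q0 _]]] := oo_cases r q; first by rewrite !mul0r normr0 mulr0.
by rewrite !mul1r kt_qn// gt_eqF.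
Qed.

Lemma is_derive_boundary i v r t : 0 < r -> 0 < t ->
  is_derive r (1 : R) (fun r => \int[mu]_p (oo r p * (gk1 p t * kt i v (r - p) t))) (DD i v r t).
Proof.
move=> r0 t0; have r1 : 0 < r + 1 by rewrite addr_gt0.
(* The moving limit is carried by [gp]; the fixed cut at [r + 1] makes [k] integrable and
   independent of the point near [r] at which the function is evaluated. *)
pose k q := oo (r + 1) q * kt i v q t.
have ki : intg mu k by exact: intg_oo_kt.
have mkt := measurable_ktq i v t.
have E (x : R) : 0 < x < r + 1 ->
    \int[mu]_p (oo x p * (gk1 p t * kt i v (x - p) t)) = \int[mu]_q (gp (x - q) t * k q).
  move=> /andP[x0 xr].
  transitivity (\int[mu]_q (oo x q * (gk1 (x - q) t * kt i v q t))).
    rewrite -(@Rint_oo_sub (fun q => gk1 (x - q) t * kt i v q t)); last first.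
      by apply: measurable_funM => //; apply: measurable_gk1 => //; exact: measurable_funB.
    by apply: eq_Rintegral => p _; rewrite subKr.
  apply: eq_Rintegral => q _; rewrite /gp /k subr_gt0 !ooE.
  have [qx|qx] := ltP q x; last by rewrite andbF !mul0r.
  rewrite (lt_trans qx xr) !andbT; case: (0 < q); last by rewrite !mul0r mulr0.
  by rewrite !mul1r.
have -> : DD i v r t = \int[mu]_q (gp' (r - q) t * k q).
  have s0 : 0 < t by [].
  have [B1 B2] : 0 <= cA r t * rhod v /\ 0 <= @cK R d t * rhod v.
    by split; apply: mulr_ge0; rewrite ?rhod_ge0 ?cA_ge0 ?cK_ge0.
  rewrite /DD -(@Dker_E (fun q => kt i v q t) r t t (cA r t * rhod v) (@cK R d t * rhod v))//.
  - apply: eq_Rintegral => q _; rewrite /gp' /k subr_gt0 !ooE.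
    have [qx|qx] := ltP q r; last by rewrite andbF !mul0r.
    rewrite (_ : q < r + 1) ?andbT; last by rewrite (lt_trans qx)// ltrDl.
    by case: (0 < q); rewrite ?mul0r ?mulr0// !mul1r.
  - exact: kt_sub_le.
  - move=> p /andP[p1 p2]; have p0 : r - p != 0 by rewrite gt_eqF// subr_gt0.
    by rewrite (le_trans (kt_qn i v p0 t0 (lexx t)))// [X in X * _ <= _]mulrAC.
apply: (@near_eq_is_derive R R R (fun x : R => \int[mu]_q (gp (x - q) t * k q))); last first.
  exact: is_derive_gp_conv.
near=> x; have x0 : 0 < x by near: x; exact: lt_nbhsr.
have xr : x < r + 1 by near: x; apply: lt_nbhsl; rewrite ltrDl.
by rewrite E// x0.
Unshelve. all: by end_near. Qed.

Lemma rsnoc_subE x v q : x - rsnoc (v, q) = rsnoc (tang x - v, height x - q).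
Proof.
apply/rowP => k; rewrite !mxE; case: unliftP => [k' ->|->].
  by rewrite !mxE.
by rewrite /height.
Qed.

Lemma Gam1_last x t : Gam1 ord_max x t = gk1 (height x) t * Gam (tang x) t.
Proof.
have E : Gam x t = Gam (tang x) t * gk (height x) t by rewrite -Gam_rsnoc rsnoc_tang.
by rewrite /Gam1 E /gk1 /height [Gam _ t * _]mulrC mulrA.
Qed.

Lemma tang_rsnocE v q : tang (rsnoc (v, q)) = v :> V.
Proof. exact: tang_rsnoc. Qed.

Lemma height_rsnocE v q : height (rsnoc (v, q)) = q :> R.
Proof. exact: height_rsnoc. Qed.

Lemma Rint_kt i v q t : q != 0 -> 0 < t ->
  \int[mud]_w (Gam w t * Pk i (rsnoc (v - w, q))) = kt i v q t.
Proof.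
move=> q0 t0; rewrite /kt -(@Rint_sub _ _ v (fun w => Gam (v - w) t * Pk i (rsnoc (w, q)))).
  by apply: eq_Rintegral => w _; rewrite subKr.
exact: (intg_meas (intg_kt i v q0 t0)).
Qed.

Lemma intg_kt' i v q t : q != 0 -> 0 < t ->
  intg mud (fun w => Gam w t * Pk i (rsnoc (v - w, q))).
Proof.
move=> q0 t0; have := intg_sub v (intg_kt i v q0 t0); congr (intg _ _).
by apply/funext => w; rewrite subKr.
Qed.

Lemma measurable_set1R r : measurable ([set r] : set (measurableTypeR R)).
Proof. exact: measurable_set1. Qed.

Lemma ae_neqP r : {ae mu, forall s, s <> r}.
Proof. by apply: aeS (@ae_neq R r) => s /eqP. Qed.

Hypothesis d1 : (1 <= d)%N.

(** The integral over [Sigma] in [Ktilde] is a [kt], since [pd n_ heat] factorizes; the remaining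
    one is a convolution on [(0, x_n)], whose derivative is given by [is_derive_boundary]. *)
Lemma Ktilde_E i x t : 0 < height x -> 0 < t ->
  Ktilde i x t = -2 * kron i ord_max * (gk1 (height x) t * Gam (tang x) t) +
    4 * @cE R d * DD i (tang x) (height x) t.
Proof.
move=> x0 t0; rewrite /Ktilde pd_heat// Gam1_last.
have mkt := measurable_ktq i (tang x) t.
set f := (fun w : Rn => _).
suff df : is_derive x (ed ord_max) f (- @cE R d * DD i (tang x) (height x) t).
  have -> : pd ord_max f x = - @cE R d * DD i (tang x) (height x) t by exact: derive_val.
  by move: (DD _ _ _ _) (gk1 _ _) (kron _ _) => a b c; ring.
apply/is_derive_lineP.
have hE r : height (r *: ed ord_max + x) = r + height x.
  by rewrite /height lineE eqxx mul1r.
have tE r : tang (r *: ed ord_max + x) = tang x.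
  apply/rowP => k; rewrite [LHS]mxE lineE mxE eq_sym (negbTE (neq_lift _ _)).
  by rewrite mul0r add0r.
pose a r := \int[mu]_p (oo r p * (gk1 p t * kt i (tang x) (r - p) t)).
have fE r : 0 < r + height x -> f (r *: ed ord_max + x) = - @cE R d * a (r + height x).
  set R0 := r + height x => R0p.
  rewrite /f hE -/R0 Rint_restr.
  pose g zn := oo R0 zn * (- @cE R d * (gk1 zn t * kt i (tang x) (R0 - zn) t)).
  have mk' : measurable_fun [set: measurableTypeR R] (fun zn => gk1 zn t * kt i (tang x) (R0 - zn) t).
    apply: measurable_funM; first exact: measurable_gk1.
    by apply: (measurableT_comp mkt); exact: measurable_funB.
  have mg : measurable_fun [set: measurableTypeR R] g.
    apply: measurable_funM; first exact: measurable_oo.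
    by apply: measurable_funM => //; exact: measurable_cst.
  have ga : \int[mu]_zn g zn = - @cE R d * a R0.
    rewrite /a -RintZ.
      by apply: eq_Rintegral => zn _; rewrite /g mulrCA.
    apply: (intg_le _ (intgZ (g1b t) (intg_norm (intg1_sub R0 (intg_oo_kt i (tang x) R0p t0))))) => [|p].
      by apply: measurable_funM => //; exact: measurable_oo.
    rewrite mulrCA normrM; apply: ler_pM => //; first exact: gk1_le.
    rewrite le_eqVlt; apply/orP; left; apply/eqP; congr (`|_ * _|).
    rewrite !ooE; congr (nat_of_bool _)%:R.
    by apply/idP/idP => /andP[h1 h2]; apply/andP; split; lra.
  rewrite -ga; pose F zn := \int[mud]_z' (pd ord_max (heat^~ t) (rsnoc (z', zn)) *
     pd i E (r *: ed ord_max + x - rsnoc (z', zn))).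
  have FE zn : zn < R0 -> F zn = - @cE R d * (gk1 zn t * kt i (tang x) (R0 - zn) t).
    move=> zR; have q0 : R0 - zn != 0 by rewrite gt_eqF// subr_gt0.
    rewrite -(Rint_kt i (tang x) q0 t0) -(RintZ _ (intg_kt' i (tang x) q0 t0)).
    rewrite -(RintZ _ (intgZ (gk1 zn t) (intg_kt' i (tang x) q0 t0))).
    apply: eq_Rintegral => z' _.
    rewrite pd_heat// Gam1_last tang_rsnocE height_rsnocE rsnoc_subE hE tE -/R0.
    rewrite pd_E//; last exact: rsnoc_enorm_gt0.
    by move: (gk1 _ _) (Gam _ _) (Pk _ _) => A B C; ring.
  (* The integrand is corrected at both ends: at [zn = R0] the gradient of [E] is taken at height 0
     and is left unevaluated, at [zn = 0] the closed interval is replaced by the open one. *)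
  pose f1 zn := if zn == R0 then 0 else \1_(`[0, R0]%classic : set R) zn * F zn.
  have f1E zn : zn <> 0 -> f1 zn = g zn.
    move=> z0; rewrite /f1 /g ooE; case: eqP => [->|zR]; first by rewrite ltxx andbF mul0r.
    rewrite /indic; have [/set_mem/=|zn0] := boolP (zn \in _).
      rewrite in_itv/= => /andP[h1 h2].
      have zR' : zn < R0 by rewrite lt_neqAle h2 andbT; apply/eqP.
      have zp : 0 < zn by rewrite lt_neqAle h1 andbT eq_sym; apply/eqP.
      by rewrite zR' zp/= !mul1r FE.
    case: (boolP (0 < zn < R0)) => [/andP[h1 h2]|_]; last by rewrite !mul0r.
    by move/negP: zn0; case; apply: mem_set; rewrite /= in_itv/= !ltW.
  have [mf1 f1I] := Rint_mod1 (measurable_set1R 0) (ae_neqP 0) mg f1E.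
  have f1' zn : zn <> R0 -> \1_(`[0, R0]%classic : set R) zn * F zn = f1 zn.
    by rewrite /f1; case: eqP.
  have [_ fI] := @Rint_mod1 _ _ _ mu (fun zn => \1_(`[0, R0]%classic : set R) zn * F zn) f1 R0
    (measurable_set1R R0) (ae_neqP R0) mf1 f1'.
  by rewrite -f1I -fI.
apply: (@near_eq_is_derive R R R (fun r => - @cE R d * a (r + height x))).
  near=> r; have rx : 0 < r + height x.
    rewrite -ltrBlDr sub0r; near: r; apply: lt_nbhsr; by rewrite oppr_lt0.
  by rewrite fE.
have d2 : is_derive (0 : R) (1 : R) (fun r : R => r + height x) 1.
  by apply: is_derive_eq; rewrite addr0.
have d3 : is_derive (0 + height x) (1 : R) a (DD i (tang x) (height x) t).
  by rewrite add0r; exact: is_derive_boundary.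
have d4 := @is_derive1_comp R a (fun r : R => r + height x) _ _ _ d3 d2.
by apply: (is_derive_eq (is_deriveZ (- @cE R d) d4)); rewrite /GRing.scale/= mulr1.
Unshelve. all: by end_near. Qed.

End boundary_kernel.

(** * The flux through the boundary *)

Section flux.
Context {R : realType} {d : nat}.
Hypothesis d1 : (1 <= d)%N.
Local Notation mu := (@lebesgue_measure R).
Local Notation Rn := 'rV[R]_d.+1.
Local Notation V := 'rV[R]_d.
Local Notation mud := (lebesgue_rV R d).
Local Notation mun := (lebesgue_rV R d.+1).
Implicit Types (v w xi : V) (i j k : 'I_d.+1) (t s T p q r h : R).

Lemma measurable_DD dd (X : measurableType dd) i r (fv : X -> V) (ft : X -> R) :
  measurable_fun setT fv -> measurable_fun setT ft ->
  measurable_fun setT (fun a => DD i (fv a) r (ft a)).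
Proof.
move=> mv mt; apply: measurable_funD; last first.
  apply: measurable_funM; first by apply: measurable_gk1 => //; exact: measurable_cst.
  by apply: measurable_kt => //; exact: measurable_cst.
pose F (a : X * measurableTypeR R) := Dker (fun q => kt i (fv a.1) q (ft a.1)) r (ft a.1) a.2.
have mF : measurable_fun setT F.
  have m2 : measurable_fun [set: X * measurableTypeR R] (fun a => a.2 : R) by exact: measurable_snd.
  have mv1 : measurable_fun [set: X * measurableTypeR R] (fun a => fv a.1) by exact: (measurableT_comp mv measurable_fst).
  have mt1 : measurable_fun [set: X * measurableTypeR R] (fun a => ft a.1) by exact: (measurableT_comp mt measurable_fst).
  apply: measurable_funM; first exact: (measurableT_comp (measurable_oo r) m2).
  apply: measurable_funM; first exact: measurable_gk2.
  apply: measurable_funB; first by apply: measurable_kt => //; exact: measurable_funB.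
  apply: measurable_funM; first exact: (measurableT_comp (measurable_oo _) m2).
  by apply: measurable_kt => //; exact: measurable_cst.
by have h := measurable_Rint2 mu mF; exact: h.
Qed.

(** The Gaussian in [xi] advances only the tangential time inside [kt]; the normal kernels [gk1] and
    [gk2] stay at time [t]. The result is therefore not a value of [DD]. *)
Lemma DD_semigroup i w v r t s : 0 < r -> 0 < t -> 0 < s ->
  intg mud (fun xi => DD i (w - xi) r t * Gam (xi - v) s) /\
  \int[mud]_xi (DD i (w - xi) r t * Gam (xi - v) s) =
  \int[mu]_p Dker (fun q => kt i (w - v) q (t + s)) r t p + gk1 (r / 2) t * kt i (w - v) r (t + s).
Proof.
move=> r0 t0 s0; have [g2 _] := @intg_Gam_Rint R d _ s0.
have mgy : measurable_fun setT (fun xi : V => Gam (xi - v) s).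
  apply: measurable_Gam => // k; apply: measurable_rV_coord_comp.
  by apply: measurable_rV_sub => //; exact: measurable_cst.
have iy : intg mud (fun xi => Gam (xi - v) s) by exact: (intg_shift (- v) g2).
pose F (a : V * measurableTypeR R) := Dker (fun q => kt i (w - a.1) q t) r t a.2 * Gam (a.1 - v) s.
have mF : measurable_fun setT F.
  have m2 : measurable_fun [set: V * measurableTypeR R] (fun a => a.2 : R) by exact: measurable_snd.
  have mw : measurable_fun [set: V * measurableTypeR R] (fun a => w - a.1) by exact: (measurableT_comp (measurable_csub w) measurable_fst).
  apply: measurable_funM; last exact: (measurableT_comp mgy measurable_fst).
  apply: measurable_funM; first exact: (measurableT_comp (measurable_oo r) m2).
  apply: measurable_funM; first exact: measurable_gk2.
  apply: measurable_funB; first by apply: measurable_kt => //; exact: measurable_funB.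
  apply: measurable_funM; first exact: (measurableT_comp (measurable_oo _) m2).
  by apply: measurable_kt => //; exact: measurable_cst.
have Dk xi := Dker_kt i (w - xi) r0 t0 (lexx t) (lexx t).
have Fi : intg (mud \x mu)%E F.
  apply: (intg_prod mF (intgZ (cD (d := d) r t * (Num.sqrt t)^-1) iy)) => xi.
    exact: (intgZr (Gam (xi - v) s) (Dk xi).1).
  have [ii ib] := Dk xi.
  rewrite (_ : \int[mu]_p `|F (xi, p)| =
      (\int[mu]_p `|Dker (fun q => kt i (w - xi) q t) r t p|) * Gam (xi - v) s).
    rewrite ler_wpM2r ?Gam_ge0// (le_trans ib)// ler_piMr ?rhod_le1//.
    by rewrite mulr_ge0 ?cD_ge0// invr_ge0 sqrtr_ge0.
  rewrite -(RintZr _ (intg_norm ii)); apply: eq_Rintegral => p _.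
  by rewrite /F/= normrM [`|Gam _ _|]ger0_norm ?Gam_ge0.
have i1 := intg_Rint2 Fi.
have E1 xi : \int[mu]_p F (xi, p) = \int[mu]_p Dker (fun q => kt i (w - xi) q t) r t p * Gam (xi - v) s.
  by rewrite -(RintZr (Gam (xi - v) s) (Dk xi).1).
have rn0 : r != 0 by rewrite gt_eqF.
have [k1 k2] := kt_semigroup i w v rn0 t0 s0.
have DE : (fun xi => DD i (w - xi) r t * Gam (xi - v) s) =
    fun xi => \int[mu]_p F (xi, p) + gk1 (r / 2) t * (kt i (w - xi) r t * Gam (xi - v) s).
  by apply/funext => xi; rewrite E1 /DD mulrDl mulrA.
rewrite DE; split; first by apply: intgD => //; exact: intgZ.
rewrite (RintD i1 (intgZ _ k1)) (RintZ _ k1) k2; congr (_ + _).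
rewrite (Rint_swap Fi); apply: eq_Rintegral => p _; rewrite /F/= /Dker.
have [e0|[e1 /andP[p0 pr]]] := oo_cases r p.
  rewrite e0 mul0r; under eq_Rintegral do rewrite mul0r mul0r.
  by rewrite Rintegral_cst// mul0r.
have q0 : r - p != 0 by rewrite gt_eqF// subr_gt0.
have [k3 k4] := kt_semigroup i w v q0 t0 s0.
rewrite e1 mul1r -k4 -k2.
rewrite -(RintZ _ k1) -(RintB k3 (intgZ _ k1)) -(RintZ _ (intgB k3 (intgZ _ k1))).
apply: eq_Rintegral => xi _.
by move: (kt _ _ _ _) (kt _ _ _ _) (Gam _ _) (gk2 _ _) (oo _ _) => a b c e f; ring.
Qed.

Lemma intg_Gam_Gam w v t s : 0 < t -> 0 < s -> intg mud (fun xi => Gam (w - xi) t * Gam (xi - v) s).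
Proof.
move=> t0 s0; have [g2 _] := @intg_Gam_Rint R d _ s0.
have iy : intg mud (fun xi => Gam (xi - v) s) by exact: (intg_shift (- v) g2).
apply: (intg_le _ (intgZ ((Num.sqrt (4 * pi * t))^-1 ^+ d) iy)) => [|xi].
  apply: measurable_funM; last exact: (intg_meas iy).
  by apply: measurable_Gam => // k; apply: measurable_rV_coord_comp; exact: measurable_csub.
rewrite ger0_norm ?mulr_ge0 ?Gam_ge0// ler_wpM2r ?Gam_ge0//.
have prodE (c : R) : c ^+ d = \prod_(k < d) c by rewrite prodr_const card_ord.
by rewrite prodE /Gam; apply: ler_prod => k _; rewrite gk_ge0 gk_le.
Qed.

Lemma intg_isqrt t : 0 < t -> intg mu (fun s => oo t s * (Num.sqrt s)^-1).
Proof.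
move=> t0; have h2 : 0 <= (2^-1 : R) < 1 by apply/andP; split; lra.
apply: (intg_le _ (intgD (intg_oo t0).1 (intg_hs h2))) => [|s].
  apply: measurable_funM; first exact: measurable_oo.
  by apply: measurable_fun_inv; exact: measurable_fun_sqrt.
have hs0 := hs_ge0 (2^-1 : R) s.
have [->|[-> /andP[s0 st]]] := oo_cases t s; first by rewrite mul0r normr0 add0r.
rewrite mul1r ger0_norm ?invr_ge0 ?sqrtr_ge0//; have [s1|s1] := ltP s 1.
  rewrite /hs /indic mem_set/=; last by rewrite in_itv/=; lra.
  by rewrite mul1r gtr0_norm// powRN powR12_sqrt ?(ltW s0)// lerDr.
apply: (@le_trans _ _ 1); last by rewrite lerDl.
rewrite invf_le1 ?sqrtr_gt0// -sqrtr1; exact: ler_wsqrtr.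
Qed.

Lemma intg_isqrt_sub t : 0 < t -> intg mu (fun s => oo t s * (Num.sqrt (t - s))^-1).
Proof.
move=> t0; have := intg1_sub t (intg_isqrt t0); congr (intg _ _); apply/funext => s.
congr (_ * _); rewrite !ooE; congr (nat_of_bool _)%:R.
by apply/idP/idP => /andP[h1 h2]; apply/andP; split; lra.
Qed.

(** One of [s] and [t - s] is at least [t / 2], which bounds one of the two factors by a
    constant. *)
Lemma intg_isqrt2 t : 0 < t ->
  intg mu (fun s => oo t s * ((Num.sqrt (t - s))^-1 * (Num.sqrt s)^-1)).
Proof.
move=> t0; pose c : R := (Num.sqrt (t / 2))^-1.
have t2 : 0 < t / 2 by rewrite divr_gt0.
have c0 : 0 <= c by rewrite invr_ge0 sqrtr_ge0.
apply: (intg_le _ (intgZ c (intgD (intg_isqrt_sub t0) (intg_isqrt t0)))) => [|s].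
  apply: measurable_funM; first exact: measurable_oo.
  by apply: measurable_funM; apply: measurable_fun_inv; apply: measurable_fun_sqrt => //; exact: measurable_funB.
have [->|[-> /andP[s0 st]]] := oo_cases t s; first by rewrite !mul0r normr0 addr0 mulr0.
rewrite !mul1r; have a0 : 0 <= (Num.sqrt (t - s))^-1 by rewrite invr_ge0 sqrtr_ge0.
have b0 : 0 <= (Num.sqrt s)^-1 by rewrite invr_ge0 sqrtr_ge0.
rewrite ger0_norm ?mulr_ge0//; have [h|h] := leP (t / 2) s.
  have bc : (Num.sqrt s)^-1 <= c by rewrite lef_pV2 ?posrE ?sqrtr_gt0//; exact: ler_wsqrtr.
  have := ler_wpM2l a0 bc; have := mulr_ge0 c0 b0; rewrite mulrDr; lra.
have ac : (Num.sqrt (t - s))^-1 <= c.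
  rewrite lef_pV2 ?posrE ?sqrtr_gt0//; last by rewrite subr_gt0.
  by apply: ler_wsqrtr; lra.
have := ler_wpM2r b0 ac; have := mulr_ge0 c0 a0; rewrite mulrDr; lra.
Qed.

Variables (x : Rn) (i : 'I_d.+1).
Hypothesis x0 : 0 < height x.

(** A jointly measurable substitute for [Ktilde] on [Sigma], equal to it at positive times. *)
Definition KT xi t : R :=
  -2 * kron i ord_max * (gk1 (height x) t * Gam (tang x - xi) t) +
    4 * @cE R d * DD i (tang x - xi) (height x) t.

Lemma Ktilde_Sigma xi t : 0 < t -> Ktilde i (x - on_Sigma xi) t = KT xi t.
Proof.
move=> t0; have h : 0 < height (rsnoc (tang x - xi, height x)) by rewrite height_rsnocE.
by rewrite /on_Sigma rsnoc_subE subr0 (Ktilde_E d1 i h t0) height_rsnocE tang_rsnocE /KT.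
Qed.

Lemma measurable_KT dd (X : measurableType dd) (fv : X -> V) (ft : X -> R) :
  measurable_fun setT fv -> measurable_fun setT ft ->
  measurable_fun setT (fun a => KT (fv a) (ft a)).
Proof.
move=> mv mt.
have mw : measurable_fun setT (fun a => tang x - fv a) by exact: (measurableT_comp (measurable_csub _) mv).
apply: measurable_funD; apply: measurable_funM => //; last exact: measurable_DD.
apply: measurable_funM; first by apply: measurable_gk1 => //; exact: measurable_cst.
by apply: measurable_Gam => // k; exact: measurable_rV_coord_comp.
Qed.

Definition cKT T : R := 2 * (Kn d.+2 * (height x)^-1 ^+ d.+1 * cM T ^+ d) +
  4 * `|@cE R d| * cDD (d := d) (height x) T.

Lemma cKT_ge0 T : 0 <= cKT T.
Proof.
apply: addr_ge0; apply: mulr_ge0 => //; last exact: cDD_ge0.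
  rewrite mulr_ge0 ?exprn_ge0 ?(ltW (cM_gt0 _))// mulr_ge0 ?(ltW (Kn_gt0 _))//.
  by rewrite exprn_ge0// invr_ge0 ltW.
Qed.

Lemma wt_rhod v : wt v <= rhod v.
Proof.
apply: ler_prod => k _; rewrite exprn_ge0 ?rho_ge0//= exprS.
by rewrite ler_piMr ?rho_ge0// exprn_ile1 ?rho_ge0 ?rho_le1.
Qed.

(** At a fixed positive height [gk1] beats the [t^(-d/2)] of the tangential Gaussian, and [DD_le]
    bounds the other part. One weight [rhod] of tangential decay is left for the integral over
    [Sigma]. *)
Lemma KT_le xi t T : 0 < t -> t <= T ->
  `|KT xi t| <= cKT T * (Num.sqrt t)^-1 * rhod (tang x - xi).
Proof.
move=> t0 tT; have u0 : 0 <= (Num.sqrt t)^-1 by rewrite invr_ge0 sqrtr_ge0.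
set v := tang x - xi; have r0 := rhod_ge0 v.
have G : Gam v t <= cM T ^+ d * rhod v * (Num.sqrt t)^-1 ^+ d.
  apply: (le_trans (Gam_wt v t0)); rewrite -mulrA; apply: ler_pM.
  - by rewrite exprn_ge0 ?(ltW (cM_gt0 _)).
  - by rewrite mulr_ge0 ?Gam_ge0 ?(ltW (wt_gt0 _)).
  - by apply: lerXn2r; rewrite ?nnegrE ?(ltW (cM_gt0 _)) ?cM_le.
  apply: ler_pM; [exact: ltW (wt_gt0 _)|exact: Gam_ge0|exact: wt_rhod|].
  have prodE (c : R) : c ^+ d = \prod_(k < d) c by rewrite prodr_const card_ord.
  by rewrite prodE /Gam; apply: ler_prod => k _; rewrite gk_ge0 gk_le_sqrt.
have hx : height x <= `|height x| by exact: ler_norm.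
have g1 := gk1_far d x0 hx t0.
have g2 := DD_le i v x0 t0 tT.
have kr : `|kron i (@ord_max d)| <= 1 :> R by rewrite /kron; case: eqP => _; rewrite ?normr1 ?normr0.
apply: (le_trans (ler_normD _ _)); rewrite (normrM (-2 * kron i ord_max)) (normrM (-2)) (normrM (gk1 (height x) t)) (normrM (4 * @cE R d)) (normrM 4) (normrN 2) (ger0_norm (Gam_ge0 _ _)).
rewrite (ger0_norm (ler0n R 2)) (ger0_norm (ler0n R 4)).
have A : `|gk1 (height x) t| * Gam v t <=
    Kn d.+2 * (height x)^-1 ^+ d.+1 * (Num.sqrt t)^-1 * (cM T ^+ d * rhod v).
  apply: (le_trans (ler_wpM2l (normr_ge0 _) G)).
  have c0 : 0 <= cM T ^+ d * rhod v by rewrite mulr_ge0// exprn_ge0 ?(ltW (cM_gt0 _)).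
  have := ler_wpM2r c0 g1; rewrite mulrAC -mulrA.
  by rewrite [_ * (_ * (_^-1 ^+ d))]mulrA -[X in _ <= X -> _]mulrA mulrA.
have A' : 2 * `|kron i (@ord_max d)| * (`|gk1 (height x) t| * Gam v t) <=
    2 * (Kn d.+2 * (height x)^-1 ^+ d.+1 * (Num.sqrt t)^-1 * (cM T ^+ d * rhod v)).
  rewrite -mulrA ler_wpM2l//; apply: (le_trans _ A).
  by rewrite ler_piMl// mulr_ge0 ?Gam_ge0.
have B := ler_wpM2l (mulr_ge0 (ler0n R 4) (normr_ge0 (@cE R d))) g2.
apply: (le_trans (lerD A' B)); rewrite le_eqVlt; apply/orP; left; apply/eqP; rewrite /cKT.
by move: (Kn _) (_ ^+ d.+1) (cM T ^+ d) (rhod v) (Num.sqrt t)^-1 (cDD _ _) (`|cE|) => a b c e f g h; ring.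
Qed.

Variables (y : Rn) (t : R).
Hypotheses (y0 : 0 < height y) (t0 : 0 < t).

Let v0 : V := tang x - tang y.
Let k0 q : R := kt i v0 q t.

(** What the integral of [Dker] becomes after integration in time; [hconv1_Qflux] identifies it with
    the normal derivative of the convolution of the Gaussian with the truncated [Pk i]. *)
Definition Qflux : R := \int[mu]_p (oo (height x) p * (gk1 (p + height y) t * k0 (height x - p))).

Lemma Gam_Sigma xi s : Gam (on_Sigma xi - y) s = Gam (xi - tang y) s * gk (height y) s.
Proof.
rewrite /on_Sigma; have -> : rsnoc (xi, 0) - y = rsnoc (xi - tang y, - height y).
  apply/rowP => k; rewrite !mxE; case: unliftP => [k' ->|->]; first by rewrite !mxE.
  by rewrite /height sub0r.
by rewrite Gam_rsnoc gkN.
Qed.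

(** The tangential times [t - s] and [s] add up to [t], so that [s] survives only in one-dimensional
    normal kernels, to which the first-passage identities apply. *)
Lemma KT_Gam s : 0 < s < t ->
  intg mud (fun xi => KT xi (t - s) * Gam (on_Sigma xi - y) s) /\
  \int[mud]_xi (KT xi (t - s) * Gam (on_Sigma xi - y) s) =
  gk (height y) s * (-2 * kron i ord_max * (gk1 (height x) (t - s) * Gam v0 t) +
    4 * @cE R d * (\int[mu]_p Dker k0 (height x) (t - s) p +
      gk1 (height x / 2) (t - s) * k0 (height x))).
Proof.
move=> /andP[s0 st]; have ts0 : 0 < t - s by rewrite subr_gt0.
have [i1 e1] := DD_semigroup i (tang x) (tang y) x0 ts0 s0; rewrite subrK in e1.
have i2 := intg_Gam_Gam (tang x) (tang y) ts0 s0.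
have e2 := Gam_semigroup (tang x) (tang y) ts0 s0; rewrite subrK in e2.
set c1 := -2 * kron i ord_max * gk1 (height x) (t - s) * gk (height y) s.
set c2 := 4 * @cE R d * gk (height y) s.
have E : (fun xi => KT xi (t - s) * Gam (on_Sigma xi - y) s) = fun xi =>
    c1 * (Gam (tang x - xi) (t - s) * Gam (xi - tang y) s) +
    c2 * (DD i (tang x - xi) (height x) (t - s) * Gam (xi - tang y) s).
  apply/funext => xi; rewrite Gam_Sigma /KT /c1 /c2.
  by move: (Gam _ _) (Gam _ _) (DD _ _ _ _) (gk _ _) (gk1 _ _) (kron _ _) (@cE R d) => a b c e f g l; ring.
rewrite E; split; first by apply: intgD; exact: intgZ.
rewrite (RintD (intgZ c1 i2) (intgZ c2 i1)) (RintZ _ i2) (RintZ _ i1) e1 e2 /c1 /c2 -/v0.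
move: (\int[mu]_p _) (Gam v0 t) (gk (height y) s) (gk1 _ _) (gk1 _ _) (kron _ _) => a b c e f g.
by rewrite /k0 /v0; move: (kt _ _ _ _) (@cE R d) => h l; ring.
Qed.

(** [hitting_identity] is used at the distances [x_n] and [x_n / 2], and [hitting2] under the
    integral of [Dker]. The terms at distance [x_n / 2], artefacts of the subtraction in [Dker],
    cancel. *)
Lemma flux_E :
  \int[mu]_s (oo t s * \int[mud]_xi (KT xi (t - s) * Gam (on_Sigma xi - y) s)) =
  kron i ord_max * (Gam v0 t * gk (height x + height y) t) -
  2 * @cE R d * (Qflux + k0 (height x) * gk (height y) t).
Proof.
set hx := height x; set hy := height y; have hx0 : 0 < hx := x0; have hy0 : 0 < hy := y0.
have h0 : 0 < hx / 2 by rewrite divr_gt0.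
have mk0 : measurable_fun [set: measurableTypeR R] k0 by exact: measurable_ktq.
pose G p := oo hx p * (k0 (hx - p) - oo (hx / 2) p * k0 hx).
have mG : measurable_fun [set: measurableTypeR R] G.
  apply: measurable_funM; first exact: measurable_oo.
  apply: measurable_funB; first by apply: (measurableT_comp mk0); exact: measurable_funB.
  exact: (measurable_funM (measurable_oo _) (measurable_cst _)).
pose F (a : measurableTypeR R * measurableTypeR R) := oo t a.1 * gk hy a.1 * Dker k0 hx (t - a.1) a.2.
have m1 : measurable_fun [set: measurableTypeR R * measurableTypeR R] (fun a => a.1 : R) by exact: measurable_fst.
have m2 : measurable_fun [set: measurableTypeR R * measurableTypeR R] (fun a => a.2 : R) by exact: measurable_snd.
have mF : measurable_fun setT F.
  apply: measurable_funM.
    apply: measurable_funM; first exact: (measurableT_comp (measurable_oo t) m1).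
    by apply: measurable_gk => //; exact: measurable_cst.
  rewrite (_ : (fun a => _) = fun a : measurableTypeR R * measurableTypeR R => gk2 a.2 (t - a.1) * G a.2).
    apply: measurable_funM; last exact: (measurableT_comp mG m2).
    by apply: measurable_gk2 => //; exact: measurable_funB.
  by apply/funext => a; rewrite /Dker /G mulrCA.
have Dk s : 0 < s < t -> intg mu (Dker k0 hx (t - s)) /\ \int[mu]_p `|Dker k0 hx (t - s) p| <= cD (d := d) hx t * (Num.sqrt (t - s))^-1 * rhod v0.
  move=> /andP[s0 st]; apply: Dker_kt => //; first by rewrite subr_gt0.
  by rewrite lerBlDr lerDl ltW.
(* As [y] lies off [Sigma], [gk hy s] is bounded in [s] by [Kn 1 * hy^-1]; only [1 / sqrt (t - s)]
   from [Dker] remains. *)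
pose cb := Kn 1 * hy^-1 * (cD (d := d) hx t * rhod v0).
have Fi : intg (mu \x mu)%E F.
  apply: (intg_prod mF (intgZ cb (intg_isqrt_sub t0))) => s; rewrite /F/=.
    have [->|[-> s01]] := oo_cases t s; first by rewrite !mul0r; under eq_fun do rewrite mul0r; exact: intg0.
    by apply: intgZ; have [] := Dk s s01.
  have [->|[-> s01]] := oo_cases t s.
    under eq_Rintegral do rewrite mul0r mul0r normr0.
    by rewrite Rintegral_cst// !mul0r mulr0.
  have [iD bD] := Dk s s01; rewrite mul1r mul1r.
  rewrite (_ : \int[mu]_p _ = gk hy s * \int[mu]_p `|Dker k0 hx (t - s) p|); last first.
    rewrite -(RintZ _ (intg_norm iD)); apply: eq_Rintegral => p _.
    by rewrite normrM [`|gk _ _|]ger0_norm ?gk_ge0.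
  have s0 : 0 < s by case/andP: s01.
  have gh : gk hy s <= Kn 1 * hy^-1 by apply: gk_far0 => //; exact: ler_norm.
  have D0 : 0 <= \int[mu]_p `|Dker k0 hx (t - s) p| by apply: Rintegral_ge0.
  apply: (le_trans (ler_pM (gk_ge0 _ _) D0 gh bD)); rewrite /cb.
  rewrite le_eqVlt; apply/orP; left; apply/eqP.
  by move: (rhod v0) (cD _ _) (Num.sqrt _)^-1 (Kn 1) => a b c e; ring.
have [ha1 hb1] := hitting_identity x0 y0 t0.
have [ha2 hb2] := hitting_identity h0 y0 t0.
pose c1 : R := kron i ord_max * Gam v0 t; pose c2 : R := -2 * @cE R d * k0 hx.
have E s : oo t s * \int[mud]_xi (KT xi (t - s) * Gam (on_Sigma xi - y) s) =
    c1 * (oo t s * (-2 * gk1 hx (t - s) * gk hy s)) +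
    c2 * (oo t s * (-2 * gk1 (hx / 2) (t - s) * gk hy s)) +
    4 * @cE R d * \int[mu]_p F (s, p).
  have [e0|[e1 s01]] := oo_cases t s.
    rewrite e0 !mul0r !mulr0 !add0r.
    rewrite (_ : \int[mu]_p F (s, p) = 0) ?mulr0//.
    under eq_Rintegral do rewrite /F/= e0 mul0r mul0r.
    by rewrite Rintegral_cst// mul0r.
  rewrite (KT_Gam s01).2 e1 !mul1r.
  have -> : \int[mu]_p F (s, p) = gk hy s * \int[mu]_p Dker k0 hx (t - s) p.
    rewrite -(RintZ _ (Dk s s01).1); apply: eq_Rintegral => p _.
    by rewrite /F/= e1 mul1r.
  rewrite /c1 /c2 -/hx -/hy; move: (\int[mu]_p _) (Gam v0 t) (gk hy s) (gk1 _ _) (gk1 _ _) (kron _ _) (k0 hx) (@cE R d) => a b c e f g h l.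
  by ring.
under eq_Rintegral do rewrite E.
have i3 := intg_Rint2 Fi.
rewrite (RintD (intgD (intgZ c1 ha1) (intgZ c2 ha2)) (intgZ _ i3)).
rewrite (RintD (intgZ c1 ha1) (intgZ c2 ha2)) (RintZ _ ha1) (RintZ _ ha2) (RintZ _ i3).
rewrite hb1 hb2 (Rint_swap Fi).
have E2 p : \int[mu]_s F (s, p) = -2^-1 * (G p * gk1 (p + hy) t).
  have [e0|[e1 /andP[p0 px]]] := oo_cases hx p.
    rewrite /G e0 !mul0r mulr0; under eq_Rintegral do rewrite /F/= /Dker e0 mul0r mulr0.
    by rewrite Rintegral_cst// mul0r.
  have [ih eh] := hitting2 p0 y0 t0; rewrite -eh mulrA -(RintZ _ ih).
  apply: eq_Rintegral => s _; rewrite /F /Dker /G/= e1.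
  by move: (gk2 _ _) (gk _ _) (oo t s) (oo _ p) (k0 _) (k0 _) => a b c e f g; field.
under eq_Rintegral do rewrite E2.
have kb p : oo hx p * `|k0 (hx - p)| <= @cK R d t * (Num.sqrt t)^-1 ^+ d * rhod v0 * (oo hx (hx - p) * @qn R d (hx - p)).
  have [->|[-> /andP[p0 px]]] := oo_cases hx p.
    rewrite mul0r; apply: mulr_ge0; last by rewrite mulr_ge0 ?oo_ge0 ?qn_ge0.
    apply: mulr_ge0; last exact: rhod_ge0.
    by apply: mulr_ge0; [exact: cK_ge0|rewrite exprn_ge0 ?invr_ge0 ?sqrtr_ge0].
  rewrite mul1r (_ : oo hx _ = 1) ?mul1r; last by rewrite ooE subr_gt0 px/= ltrBlDr ltrDl p0.
  by apply: kt_qn => //; rewrite gt_eqF// subr_gt0.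
have iQ : intg mu (fun p => oo hx p * (gk1 (p + hy) t * k0 (hx - p))).
  have iq := intg1_sub hx (intg_oo_qn (d := d) x0).
  apply: (intg_le _ (intgZ (g1b t * (@cK R d t * (Num.sqrt t)^-1 ^+ d * rhod v0)) iq)) => [|p].
    apply: measurable_funM; first exact: measurable_oo.
    apply: measurable_funM; first by apply: measurable_gk1 => //; exact: measurable_funD.
    by apply: (measurableT_comp mk0); exact: measurable_funB.
  rewrite (mulrCA (oo hx p)) (normrM (gk1 (p + hy) t)) (normrM (oo hx p)) (ger0_norm (oo_ge0 hx p)) -[leRHS]mulrA.
  by apply: ler_pM => //; [rewrite mulr_ge0 ?oo_ge0|exact: gk1_le].
have [ir er] := Rint_oo_gk1 hy t h0.
have EG p : G p * gk1 (p + hy) t = oo hx p * (gk1 (p + hy) t * k0 (hx - p)) -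
    k0 hx * (oo (hx / 2) p * gk1 (p + hy) t).
  rewrite /G; have [e0|[e1 _]] := oo_cases hx p; last by rewrite e1; ring.
  rewrite e0 (_ : oo (hx / 2) p = 0); first by ring.
  move: e0; rewrite !ooE; case: (boolP (0 < p < hx)) => [_ /eqP|/negP h _].
    by rewrite oner_eq0.
  case: (boolP (0 < p < hx / 2)) => // /andP[h1 h2]; exfalso; apply: h.
  by rewrite h1/= (lt_trans h2)//; lra.
have -> : \int[mu]_p (-2^-1 * (G p * gk1 (p + hy) t)) =
    -2^-1 * (Qflux - k0 hx * (gk (hx / 2 + hy) t - gk hy t)).
  rewrite -er -(RintZ _ ir) /Qflux -(RintB iQ (intgZ _ ir)) -(RintZ _ (intgB iQ (intgZ _ ir))).
  by apply: eq_Rintegral => p _; rewrite EG.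
rewrite /c1 /c2 -/hx -/hy; move: Qflux (Gam v0 t) (gk _ _) (gk _ _) (gk _ _) (kron _ _) (k0 hx) (@cE R d) => a b c e f g h l.
by field.
Qed.

End flux.

(** * Fubini for the boundary potential *)

Section integral_of_parameter.
Context {dd ee : measure_display} {P : measurableType dd} {Y : measurableType ee} {R : realType}.
Variables (nu : {sigma_finite_measure set P -> \bar R}) (mu : {sigma_finite_measure set Y -> \bar R}).

Lemma Rint_param (H : P -> Y -> R) (b : P -> R) :
  measurable_fun [set: P * Y] (fun a => H a.1 a.2) -> intg nu b ->
  (forall p, intg mu (H p)) -> (forall p, \int[mu]_y `|H p y| <= b p) ->
  [/\ intg mu (fun y => \int[nu]_p H p y),
      intg nu (fun p => \int[mu]_y H p y),
      \int[mu]_y (\int[nu]_p H p y) = \int[nu]_p (\int[mu]_y H p y) &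
      \int[mu]_y `|\int[nu]_p H p y| <= \int[nu]_p b p].
Proof.
move=> mH ib iH bH; have i := intg_prod mH ib iH bH.
have i1 := intg_Rint1 i; have i2 := intg_Rint2 i; split=> //.
  by rewrite (Rint_swap i).
have ia := intg_norm i; have ia1 := intg_Rint1 ia; have ia2 := intg_Rint2 ia.
apply: (@le_trans _ _ (\int[mu]_y \int[nu]_p `|H p y|)).
  apply: (Rint_le_ae (intg_norm i1) ia1); apply: aeS (ae_intg2 i) => y iy.
  exact: (le_normr_Rintegral measurableT iy).
rewrite -(Rint_swap ia); exact: (Rint_le ia2 ib bH).
Qed.

(** Covers non-integrable [f] as well: the extended integral is then infinite and read as 0, and the
    same happens to [f y * c] unless [c = 0]. *)
Lemma Rint_mulr (f : Y -> R) (c : R) : measurable_fun setT f ->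
  \int[mu]_y (f y * c) = (\int[mu]_y f y) * c.
Proof.
move=> mf; have [->|c0] := eqVneq c 0.
  under eq_Rintegral do rewrite mulr0.
  by rewrite Rintegral_cst// mul0r mulr0.
have fin g : measurable_fun setT g -> ~~ intg mu g -> \int[mu]_y g y = 0.
  move=> mg; rewrite /intg => /negP ng; rewrite /Rintegral.
  have mEg : measurable_fun setT (EFin \o g) by exact/measurable_EFinP.
  have [h|] := boolP ((\int[mu]_y (EFin \o g) y)%E \is a fin_num).
    by exfalso; apply: ng; apply/integrableP; split=> //; rewrite (integral_fin_num_abs mu measurableT mg).
  by rewrite fin_numE negb_and !negbK => /orP[] /eqP ->.
have [i|ni] := boolP (intg mu f); first exact: RintZr.
rewrite [in RHS]fin// mul0r fin//; first by apply: measurable_funM => //; exact: measurable_cst.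
apply: contra ni => i; have := intgZr c^-1 i; congr (intg _ _); apply/funext => y.
by rewrite mulfK.
Qed.

End integral_of_parameter.

Section flux_integral.
Context {R : realType} {d : nat}.
Hypothesis d1 : (1 <= d)%N.
Local Notation mu := (@lebesgue_measure R).
Local Notation Rn := 'rV[R]_d.+1.
Local Notation V := 'rV[R]_d.
Local Notation mud := (lebesgue_rV R d).
Local Notation mun := (lebesgue_rV R d.+1).
Implicit Types (p y : Rn) (xi : V) (i j k : 'I_d.+1) (s r h : R).

(** Peetre's inequality removes the shift, and two copies of [rho] in each coordinate are
    integrable. This is the only source of decay for the integrals over [Sigma]. *)
Lemma intg_rhod2 (a : V) : intg mud (fun xi => rhod (a - xi) * rhod xi).
Proof.
have i2 : intg mud (fun xi => \prod_k rho (xi ord0 k) ^+ 2).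
  by apply: (@intg_prodf _ _ (fun _ r => rho r ^+ 2)) => k; exact: intg_rho2.
apply: (intg_le _ (intgZ (\prod_k (1 + `|a ord0 k|)) i2)) => [|xi].
  apply: measurable_funM; last exact: measurable_rhod.
  exact: (measurableT_comp (@measurable_rhod R d) (measurable_csub a)).
rewrite ger0_norm ?mulr_ge0 ?rhod_ge0//.
have -> : rhod (a - xi) = rhod (xi - a).
  by apply: eq_bigr => k _; rewrite !mxE /rho distrC.
apply: (le_trans (ler_wpM2r (rhod_ge0 _) (rhod_sub _ _))).
have -> : \prod_k rho (xi ord0 k) ^+ 2 = rhod xi * rhod xi.
  by rewrite -big_split/=; apply: eq_bigr => k _; rewrite expr2.
rewrite le_eqVlt; apply/orP; left; apply/eqP.
by move: (rhod xi) (\prod_k _) => b c; ring.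
Qed.

Variables (x : Rn) (i : 'I_d.+1) (t : R).
Hypotheses (x0 : 0 < height x) (t0 : 0 < t).

(** [W] with an arbitrary kernel [S] in the place of the Oseen row, so that one Fubini argument
    serves both the full row and the Gaussian alone. *)
Definition WX (S : Rn -> R -> R) y : R :=
  - 2 * \int[mu]_s (oo t s * \int[mud]_xi (KT x i xi (t - s) * S (on_Sigma xi - y) s)) +
  4 * - @cE R d * \int[mud]_xi (Pk i (x - on_Sigma xi) * S (on_Sigma xi - y) t).

Definition WY (g : V -> R -> R) : R :=
  - 2 * \int[mu]_s (oo t s * \int[mud]_xi (KT x i xi (t - s) * g xi s)) +
  4 * - @cE R d * \int[mud]_xi (Pk i (x - on_Sigma xi) * g xi t).

Lemma tang_on_Sigma xi : tang (on_Sigma xi : Rn) = xi.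
Proof. exact: tang_rsnocE. Qed.

Lemma Pk_Sigma_le xi : `|Pk i (x - on_Sigma xi)| <=
  (1 + (height x)^-1) ^+ d * rhod (tang x - xi).
Proof. by rewrite /on_Sigma rsnoc_subE subr0 Pk_rhod//; exact: ler_norm. Qed.

Lemma measurable_on_Sigma : measurable_fun [set: V] (fun xi => on_Sigma xi : Rn).
Proof. exact: measurable_rsnoc2. Qed.

Section one_component.
Variables (S : Rn -> R -> R) (vj : Rn -> R) (cc : R).
Hypotheses (mS : measurable_fun [set: Rn * measurableTypeR R] (fun a => S a.1 a.2))
  (mv : measurable_fun setT vj)
  (Sv : forall p s, 0 < s -> s <= t -> intg mun (fun y => S (p - y) s * vj y) /\
     \int[mun]_y `|S (p - y) s * vj y| <= cc * (Num.sqrt s)^-1 * rhod (tang p)).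

Let g xi s : R := \int[mun]_y (S (on_Sigma xi - y) s * vj y).

Let rr : R := \int[mud]_xi (rhod (tang x - xi) * rhod xi).

Let mS3 dd (X : measurableType dd) (fx : X -> V) (fs : X -> R) (fy : X -> Rn) :
  measurable_fun setT fx -> measurable_fun setT fs -> measurable_fun setT fy ->
  measurable_fun setT (fun a => S (on_Sigma (fx a) - fy a) (fs a)).
Proof.
move=> mx ms my.
have h : measurable_fun setT (fun a => (on_Sigma (fx a) - fy a, fs a) : Rn * measurableTypeR R).
  apply/measurable_fun_pairP; split => //; apply: measurable_rV_sub => //.
  exact: (measurableT_comp measurable_on_Sigma mx).
exact: (measurableT_comp mS h).
Qed.

(** Fubini between [y] and [xi] at a fixed time, with [K] standing for either boundary kernel of
    [WX]; the weights of [K] and [S] combine to the integrable product of [intg_rhod2]. *)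
Let step (K : V -> R) (s kk : R) : 0 < s -> s <= t -> 0 <= kk -> measurable_fun setT K ->
  (forall xi, `|K xi| <= kk * rhod (tang x - xi)) ->
  [/\ intg mun (fun y => \int[mud]_xi (K xi * (S (on_Sigma xi - y) s * vj y))),
      intg mud (fun xi => K xi * g xi s),
      \int[mun]_y (\int[mud]_xi (K xi * (S (on_Sigma xi - y) s * vj y))) =
        \int[mud]_xi (K xi * g xi s) &
      \int[mun]_y `|\int[mud]_xi (K xi * (S (on_Sigma xi - y) s * vj y))| <=
        kk * (cc * (Num.sqrt s)^-1) * rr].
Proof.
move=> s0 st kk0 mK KK.
pose H xi y := K xi * (S (on_Sigma xi - y) s * vj y).
have mH : measurable_fun [set: V * Rn] (fun a => H a.1 a.2).
  apply: measurable_funM; first exact: (measurableT_comp mK measurable_fst).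
  apply: measurable_funM; last exact: (measurableT_comp mv measurable_snd).
  by apply: mS3; [exact: measurable_fst|exact: measurable_cst|exact: measurable_snd].
have ib := intgZ (kk * (cc * (Num.sqrt s)^-1)) (intg_rhod2 (tang x)).
have iH xi : intg mun (H xi) by exact: (intgZ (K xi) (Sv (on_Sigma xi) s0 st).1).
have bH xi : \int[mun]_y `|H xi y| <= kk * (cc * (Num.sqrt s)^-1) * (rhod (tang x - xi) * rhod xi).
  have [ii bb] := Sv (on_Sigma xi) s0 st; rewrite tang_on_Sigma in bb.
  rewrite (_ : \int[mun]_y _ = `|K xi| * \int[mun]_y `|S (on_Sigma xi - y) s * vj y|); last first.
    by rewrite -(RintZ _ (intg_norm ii)); apply: eq_Rintegral => y _; rewrite normrM.
  have I0 : 0 <= \int[mun]_y `|S (on_Sigma xi - y) s * vj y| by apply: Rintegral_ge0.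
  apply: (le_trans (ler_pM (normr_ge0 _) I0 (KK xi) bb)).
  rewrite le_eqVlt; apply/orP; left; apply/eqP.
  by move: (rhod _) (rhod _) (Num.sqrt s)^-1 => a b c; ring.
have [a1 a2 a3 a4] := Rint_param mH ib iH bH.
have E xi : \int[mun]_y H xi y = K xi * g xi s by rewrite /H (RintZ _ (Sv (on_Sigma xi) s0 st).1).
split=> //.
- by move: a2; congr (intg _ _); apply/funext => xi; exact: E.
- by rewrite a3; apply: eq_Rintegral => xi _; exact: E.
- by apply: (le_trans a4); rewrite (RintZ _ (intg_rhod2 _)).
Qed.

(** In time the majorant is the product of [1 / sqrt (t - s)] from [KT] and [1 / sqrt s] from [S],
    integrable by [intg_isqrt2]. *)
Lemma WX_Fubini :
  [/\ measurable_fun setT (WX S),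
   intg mun (fun y => WX S y * vj y),
   \int[mun]_y (WX S y * vj y) = WY g,
   (forall s, 0 < s < t -> intg mud (fun xi => KT x i xi (t - s) * g xi s)) &
   intg mu (fun s => oo t s * \int[mud]_xi (KT x i xi (t - s) * g xi s)) /\
   intg mud (fun xi => Pk i (x - on_Sigma xi) * g xi t)].
Proof.
have mPk : measurable_fun [set: V] (fun xi => Pk i (x - on_Sigma xi) : R).
  apply: (measurableT_comp (measurable_Pk i)).
  exact: (measurableT_comp (measurable_csub x) measurable_on_Sigma).
have mKT s : measurable_fun [set: V] (fun xi => KT x i xi (t - s)).
  by apply: measurable_KT => //; exact: measurable_cst.
have h0 : 0 <= (1 + (height x)^-1) ^+ d :> R by rewrite exprn_ge0// addr_ge0// invr_ge0 ltW.
have [b1 b2 b3 _] := step t0 (lexx t) h0 mPk Pk_Sigma_le.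
pose kk s : R := cKT x t * (Num.sqrt (t - s))^-1.
have kk0 s : 0 <= kk s by rewrite /kk mulr_ge0 ?cKT_ge0// invr_ge0 sqrtr_ge0.
have kkle s : 0 < s < t -> forall xi, `|KT x i xi (t - s)| <= kk s * rhod (tang x - xi).
  move=> /andP[s0 st] xi; apply: KT_le => //; first by rewrite subr_gt0.
  by rewrite lerBlDr lerDl ltW.
have st s (s01 : 0 < s < t) := step (proj1 (andP s01)) (ltW (proj2 (andP s01))) (kk0 s) (mKT s) (kkle s s01).
pose HH s y := oo t s * \int[mud]_xi (KT x i xi (t - s) * (S (on_Sigma xi - y) s * vj y)).
have m21 : measurable_fun [set: (measurableTypeR R * Rn) * V] (fun a => a.1.1 : R).
  exact: (measurableT_comp measurable_fst measurable_fst).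
have m22 : measurable_fun [set: (measurableTypeR R * Rn) * V] (fun a => a.1.2 : Rn).
  exact: (measurableT_comp measurable_snd measurable_fst).
have m23 : measurable_fun [set: (measurableTypeR R * Rn) * V] (fun a => a.2 : V).
  exact: measurable_snd.
have mts : measurable_fun [set: (measurableTypeR R * Rn) * V] (fun a => t - a.1.1 : R).
  exact: (measurable_funB (measurable_cst t) m21).
have mKT3 := measurable_KT x i m23 mts.
have mS33 := mS3 m23 m21 m22.
have moo : measurable_fun [set: measurableTypeR R * Rn] (fun a => oo t a.1).
  exact: (measurableT_comp (measurable_oo t) measurable_fst).
have mHH : measurable_fun [set: measurableTypeR R * Rn] (fun a => HH a.1 a.2).
  apply: (measurable_funM moo).
  have := measurable_Rint2 mud (measurable_funM mKT3 (measurable_funM mS33 (measurableT_comp mv m22))).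
  exact.
have mA : measurable_fun [set: measurableTypeR R * Rn]
    (fun a => oo t a.1 * \int[mud]_xi (KT x i xi (t - a.1) * S (on_Sigma xi - a.2) a.1)).
  by apply: (measurable_funM moo); have := measurable_Rint2 mud (measurable_funM mKT3 mS33); exact.
have ib := intgZ (cKT x t * cc * rr) (intg_isqrt2 t0).
have iH s : intg mun (HH s).
  rewrite /HH; have [->|[-> s01]] := oo_cases t s; first by under eq_fun do rewrite mul0r; exact: intg0.
  by apply: intgZ; have [] := st s s01.
have bH s : \int[mun]_y `|HH s y| <= cKT x t * cc * rr * (oo t s * ((Num.sqrt (t - s))^-1 * (Num.sqrt s)^-1)).
  rewrite /HH; have [->|[-> s01]] := oo_cases t s.
    under eq_Rintegral do rewrite mul0r normr0.
    by rewrite Rintegral_cst// !mul0r mulr0.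
  have [_ _ _ h] := st s s01; under eq_Rintegral do rewrite mul1r.
  apply: (le_trans h); rewrite mul1r le_eqVlt; apply/orP; left; apply/eqP.
  by rewrite /kk; move: (cKT x t) rr (Num.sqrt _)^-1 (Num.sqrt s)^-1 => a c e f; ring.
have [c1 c2 c3 _] := Rint_param mHH ib iH bH.
have HE s : \int[mun]_y HH s y = oo t s * \int[mud]_xi (KT x i xi (t - s) * g xi s).
  rewrite /HH; have [->|[-> s01]] := oo_cases t s.
    by under eq_Rintegral do rewrite mul0r; rewrite Rintegral_cst// !mul0r.
  have [_ _ h2 _] := st s s01; rewrite mul1r -h2; apply: eq_Rintegral => y _; exact: mul1r.
have mxi s y : measurable_fun [set: V] (fun xi => KT x i xi (t - s) * S (on_Sigma xi - y) s).
  apply: measurable_funM => //; apply: mS3; [exact: measurable_id|exact: measurable_cst|exact: measurable_cst].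
have mxi2 y : measurable_fun [set: V] (fun xi => Pk i (x - on_Sigma xi) * S (on_Sigma xi - y) t).
  apply: measurable_funM => //; apply: mS3; [exact: measurable_id|exact: measurable_cst|exact: measurable_cst].
(* [vj y] enters both integrals through [Rint_mulr], because at a fixed [y] nothing is known about
   integrability in [xi] and [s]. *)
have WE y : WX S y * vj y = -2 * \int[mu]_s HH s y +
    4 * - @cE R d * \int[mud]_xi (Pk i (x - on_Sigma xi) * (S (on_Sigma xi - y) t * vj y)).
  rewrite /WX mulrDl -!mulrA; congr (_ * _ + _ * (_ * _)).
    have mAy : measurable_fun [set: measurableTypeR R]
        (fun s => oo t s * \int[mud]_xi (KT x i xi (t - s) * S (on_Sigma xi - y) s)).
      have mp : measurable_fun [set: measurableTypeR R] (fun s => (s, y) : measurableTypeR R * Rn).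
        by apply/measurable_fun_pairP; split; [exact: measurable_id|exact: measurable_cst].
      exact: (measurableT_comp mA mp).
    rewrite -(Rint_mulr mu (vj y) mAy); apply: eq_Rintegral => s _.
    rewrite -[LHS]mulrA -(Rint_mulr mud (vj y) (mxi s y)); congr (_ * _).
    by apply: eq_Rintegral => xi _; rewrite -[LHS]mulrA.
  rewrite -(Rint_mulr mud (vj y) (mxi2 y)).
  by apply: eq_Rintegral => xi _; rewrite -[LHS]mulrA.
have WEf : (fun y => WX S y * vj y) = fun y => -2 * \int[mu]_s HH s y +
    4 * - @cE R d * \int[mud]_xi (Pk i (x - on_Sigma xi) * (S (on_Sigma xi - y) t * vj y)).
  by apply/funext => y; exact: WE.
split.
- apply: measurable_funD; apply: measurable_funM => //.
    have msw : measurable_fun [set: Rn * measurableTypeR R] (fun a => (a.2, a.1) : measurableTypeR R * Rn).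
      by apply/measurable_fun_pairP; split; [exact: measurable_snd|exact: measurable_fst].
    by have := measurable_Rint2 mu (measurableT_comp mA msw); exact.
  have mm : measurable_fun [set: Rn * V] (fun a => Pk i (x - on_Sigma a.2) * S (on_Sigma a.2 - a.1) t).
    apply: measurable_funM; first exact: (measurableT_comp mPk measurable_snd).
    by apply: mS3; [exact: measurable_snd|exact: measurable_cst|exact: measurable_fst].
  by have := measurable_Rint2 mud mm; exact.
- by rewrite WEf; apply: intgD; exact: intgZ.
- rewrite WEf (RintD (intgZ _ c1) (intgZ _ b1)) (RintZ _ c1) (RintZ _ b1) /WY b3 c3.
  by congr (_ * _ + _); apply: eq_Rintegral => s _; exact: HE.
- by move=> s s01; have [] := st s s01.
- by split=> //; move: c2; congr (intg _ _); apply/funext => s; exact: HE.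
Qed.

End one_component.
End flux_integral.

(** * The three kernels *)

Section kernels.
Context {R : realType} {d : nat}.
Hypothesis d1 : (1 <= d)%N.
Local Notation mu := (@lebesgue_measure R).
Local Notation Rn := 'rV[R]_d.+1.
Local Notation V := 'rV[R]_d.
Local Notation mud := (lebesgue_rV R d).
Local Notation mun := (lebesgue_rV R d.+1).
Implicit Types (x y z w : Rn) (i j k : 'I_d.+1) (t a p r : R).

Definition trunc a i z : R := (0 <= height z <= a)%R%:R * Pk i z.

Lemma measurable_height : measurable_fun setT (fun z : Rn => height z).
Proof. exact: measurable_coordE. Qed.

Lemma measurable_trunc a i : measurable_fun setT (trunc a i).
Proof.
apply: measurable_funM; last exact: measurable_Pk.
rewrite (_ : (fun z => _) = fun z : Rn => \1_(`[0, a]%classic : set (measurableTypeR R)) (height z)).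
  apply: (measurableT_comp _ measurable_height); exact: measurable_indic.
apply/funext => z; rewrite /indic; have [h|/negP h] := boolP (0 <= height z <= a).
  by rewrite mem_set//= in_itv/=.
by rewrite memNset//= in_itv/=.
Qed.

Lemma trunc_le a i z : `|trunc a i z| <= nrmd z.
Proof.
rewrite /trunc normrM; apply: (le_trans _ (Pk_le i z)); rewrite ler_piMl//.
by case: (_ && _); rewrite ?normr1 ?normr0.
Qed.

Lemma wclass_trunc a i : wclass (trunc a i).
Proof.
apply: (@wclass_le _ _ _ 1) => //; first exact: measurable_trunc.
move=> z _; apply: (le_trans (trunc_le a i z)); have n0 := nrmd_ge0 z.
have S0 : 0 <= \sum_k `|z ord0 k| by apply: sumr_ge0.
by rewrite mul1r; have := mulr_ge0 S0 n0; move: (nrmd z) (\sum_k _) n0 S0 => n s n0 s0 h; lra.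
Qed.

Lemma height_sub_star x y : height (x - star y) = height x + height y.
Proof. by rewrite /height !mxE eqxx opprK. Qed.

Lemma tang_sub_star x y : tang (x - star y) = tang x - tang y.
Proof.
apply/rowP => k; by rewrite !mxE eq_sym (negbTE (neq_lift _ _)).
Qed.

(** Slicing by height: the Gaussian derivative splits into [gk1] of the normal variable and a
    tangential Gaussian, whose integral against a slice of [Pk i] is [kt]. *)
Lemma hconv1_Qflux i x y t : 0 < height x -> 0 < height y -> 0 < t ->
  hconv1 ord_max (trunc (height x) i) t (x - star y) = Qflux x i y t.
Proof.
move=> x0 y0 t0; have [C hC] := @Gam_bounds R d t t0.
set w := x - star y; set hx := height x.
have mG1 : measurable_fun setT (Gam1 ord_max ^~ t : Rn -> R) by exact: measurable_Gam1t.
pose f z := Gam1 ord_max (w - z) t * trunc hx i z.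
have fi : intg mun f.
  apply: (@intg_conv R d.+1 (Gam1 ord_max ^~ t) C mG1) (wclass_trunc hx i) => u.
  by have [_ h _] := hC u; exact: h.
have mf := intg_meas fi.
have fi2 := (intg_rsnoc mf).1 fi.
rewrite /hconv1 (Rint_rsnoc fi) (Rint_prod21 fi2).
pose g q := gk1 (hx + height y - q) t * kt i (tang x - tang y) q t.
have mg : measurable_fun [set: measurableTypeR R] g.
  apply: measurable_funM; last exact: measurable_ktq.
  by apply: measurable_gk1; [exact: (measurable_funB (measurable_cst _) (@measurable_id _ _ _))|exact: measurable_cst].
have -> : Qflux x i y t = \int[mu]_q (oo hx q * g q).
  rewrite -(Rint_oo_sub hx mg) /Qflux; apply: eq_Rintegral => p _; rewrite /g -/hx.
  by congr (_ * (gk1 _ _ * _)); ring.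
apply: eq_Rint_ae.
- exact: (intg_meas (intg_Rint1 fi2)).
- exact: (measurable_funM (measurable_oo _) mg).
apply: aeS2 (ae_neq (0 : R)) (@ae_neq R hx) => q q0 qx.
have [oq|/negP oq] := boolP (0 < q < hx).
  rewrite ooE oq mul1r /g /kt -(RintZ _ (intg_kt i (tang x - tang y) q0 t0)).
  apply: eq_Rintegral => v _; rewrite /f /= Gam1_last /trunc height_rsnocE.
  rewrite rsnoc_subE height_rsnocE tang_rsnocE /w height_sub_star tang_sub_star -/hx.
  have -> : 0 <= q <= hx by case/andP: oq => h1 h2; rewrite !ltW.
  by rewrite mul1r mulrA.
rewrite ooE (negbTE (introN idP oq)) mul0r.
under eq_Rintegral do rewrite /f /trunc height_rsnocE.
have -> : 0 <= q <= hx = false.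
  by apply/negP => /andP[h1 h2]; apply: oq; rewrite !lt_neqAle h1 h2 eq_sym q0 qx.
under eq_Rintegral do rewrite mul0r mulr0.
by rewrite Rintegral_cst// mul0r.
Qed.

(** The same slices, reached from the iterated integral in [C_]; the integrand is evaluated at
    positive heights only, and the two end points are altered as null sets. *)
Lemma C_E i x y t : 0 < height x -> 0 < height y -> 0 < t ->
  C_ i x y t = - @cE R d * hconv1 ord_max (trunc (height x) i) t (x - star y).
Proof.
move=> x0 y0 t0; rewrite hconv1_Qflux// /C_ Rint_restr; set hx := height x.
pose g q := gk1 (hx + height y - q) t * kt i (tang x - tang y) q t.
have mg : measurable_fun [set: measurableTypeR R] g.
  apply: measurable_funM; last exact: measurable_ktq.
  by apply: measurable_gk1; [exact: (measurable_funB (measurable_cst _) (@measurable_id _ _ _))|exact: measurable_cst].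
have mog := measurable_funM (measurable_oo hx) mg.
have -> : Qflux x i y t = \int[mu]_q (oo hx q * g q).
  rewrite -(Rint_oo_sub hx mg) /Qflux; apply: eq_Rintegral => p _; rewrite /g -/hx.
  by congr (_ * (gk1 _ _ * _)); ring.
rewrite mulrC -(Rint_mulr mu (- @cE R d) mog).
pose F zn := \int[mud]_z' (pd ord_max (heat^~ t) (x - star y - rsnoc (z', zn)) * pd i E (rsnoc (z', zn))).
pose G q := oo hx q * g q * - @cE R d.
have mG : measurable_fun [set: measurableTypeR R] G by exact: (measurable_funM mog (measurable_cst _)).
have FE zn : 0 < zn -> F zn = g zn * - @cE R d.
  move=> z0; have q0 : zn != 0 by rewrite gt_eqF.
  rewrite /g /kt -(RintZ _ (intg_kt i (tang x - tang y) q0 t0)).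
  rewrite -(RintZr _ (intgZ _ (intg_kt i (tang x - tang y) q0 t0))).
  apply: eq_Rintegral => v _.
  rewrite pd_heat// Gam1_last rsnoc_subE height_rsnocE tang_rsnocE height_sub_star tang_sub_star -/hx.
  rewrite pd_E//; last exact: rsnoc_enorm_gt0.
  by move: (gk1 _ _) (Gam _ _) (Pk _ _) (@cE R d) => A B C c; ring.
pose f1 zn := if zn == hx then 0 else \1_(`[0, hx]%classic : set R) zn * F zn.
have f1E zn : zn <> 0 -> f1 zn = G zn.
  move=> z0; rewrite /f1 /G ooE; case: eqP => [->|zR]; first by rewrite ltxx andbF !mul0r.
  rewrite /indic; have [/set_mem/=|zn0] := boolP (zn \in _).
    rewrite in_itv/= => /andP[h1 h2].
    have zR' : zn < hx by rewrite lt_neqAle h2 andbT; apply/eqP.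
    have zp : 0 < zn by rewrite lt_neqAle h1 andbT eq_sym; apply/eqP.
    by rewrite zR' zp/= !mul1r FE.
  case: (boolP (0 < zn < hx)) => [/andP[h1 h2]|_]; last by rewrite !mul0r.
  by move/negP: zn0; case; apply: mem_set; rewrite /= in_itv/= !ltW.
have [mf1 f1I] := Rint_mod1 (measurable_set1R 0) (ae_neqP 0) mG f1E.
have f1' zn : zn <> hx -> \1_(`[0, hx]%classic : set R) zn * F zn = f1 zn.
  by rewrite /f1; case: eqP.
have [_ fI] := @Rint_mod1 _ _ _ mu (fun zn => \1_(`[0, hx]%classic : set R) zn * F zn) f1 hx
  (measurable_set1R hx) (ae_neqP hx) mf1 f1'.
by rewrite -f1I -fI.
Qed.

Lemma measurable_set1_rV w : measurable ([set w] : set Rn).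
Proof.
rewrite (_ : [set w] = \bigcap_(k in [set: 'I_d.+1]) [set z : Rn | z ord0 k = w ord0 k]).
  apply: fin_bigcap_measurable => [|k _]; first exact: finite_finset.
  have := @measurable_rV_coord _ (measurableTypeR R) d.+1 k measurableT _ (measurable_set1R (w ord0 k)).
  by rewrite setTI.
apply/seteqP; split=> [z -> k _//|z h]; apply/rowP => k; exact: h.
Qed.

Lemma ae_neq_rV w : {ae mun, forall z : Rn, z <> w}.
Proof. by apply: aeS (ae_coord_neq w) => z h zw; have := h ord0; rewrite zw eqxx. Qed.

Lemma pd_shift i (f : Rn -> R) z w : pd i (fun v => f (v - z)) w = pd i f (w - z).
Proof.
rewrite /pd /derive; congr (lim (_ @ 0^')); apply/funext => h /=.
by rewrite addrA.
Qed.

(** The reflection [z |-> w - z] maps the slab [0 <= z_n <= w_n] onto itself and moves the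
    singularity of [E] from [w] to the origin. *)
Lemma breve_potential i y t w : 0 < t ->
  \int[mun]_(z in [set z | 0 <= height z <= height w])
        (pd i (fun v => E (v - z)) w * heat (z - star y) t) =
  - @cE R d * hconv (trunc (height w) i) t (w - star y).
Proof.
move=> t0; rewrite Rint_restr.
pose F z := Gam (w - z - star y) t * trunc (height w) i z.
have mF : measurable_fun setT F.
  apply: measurable_funM; last exact: measurable_trunc.
  apply: (measurableT_comp (measurable_Gamt t)).
  by apply: measurable_rV_sub; [exact: measurable_csub|exact: measurable_cst].
have mF' : measurable_fun setT (fun z => F (w - z)) by exact: (measurableT_comp mF (measurable_csub w)).
have -> : hconv (trunc (height w) i) t (w - star y) = \int[mun]_z F (w - z).
  rewrite (Rint_sub w mF) /hconv; apply: eq_Rintegral => z _; rewrite /F.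
  by congr (Gam _ _ * _); rewrite addrAC.
rewrite mulrC -(Rint_mulr mun (- @cE R d) mF').
have mg : measurable_fun setT (fun z => F (w - z) * - @cE R d).
  exact: (measurable_funM mF' (measurable_cst _)).
have h := @Rint_mod1 _ _ _ mun (fun z => \1_[set z | 0 <= height z <= height w] z *
    (pd i (fun v => E (v - z)) w * heat (z - star y) t)) _ w (measurable_set1_rV w) (ae_neq_rV w) mg.
apply: (h _).2 => z zw; rewrite /F /trunc subKr pd_shift heatE//.
have hE : height (w - z) = height w - height z by rewrite /height !mxE.
rewrite hE subr_ge0 gerBl andbC /indic.
have [c|/negP c] := boolP (0 <= height z <= height w); last by rewrite memNset// !mul0r mulr0 mul0r.
rewrite mem_set// !mul1r pd_E//; last first.
  rewrite /enorm sqrtr_gt0 lt_neqAle sumr_ge0 ?andbT; last by move=> k _; exact: sqr_ge0.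
  rewrite eq_sym psumr_neq0; last by move=> k _; exact: sqr_ge0.
  have /existsP[k hk] : [exists k, z ord0 k != w ord0 k].
    rewrite -negb_forall; apply/negP => /forallP h'; apply: zw; apply/rowP => k.
    by apply/eqP; exact: h'.
  apply/hasP; exists k; first exact: mem_index_enum.
  by rewrite /= exprn_even_gt0//= !mxE subr_eq0 eq_sym.
by move: (Gam _ _) (Pk _ _) (@cE R d) => A B C; ring.
Qed.

(** A tangential direction does not move the slab, so that only the Gaussian is differentiated. *)
Lemma pd_breve i j x y t : j != ord_max -> 0 < t ->
  pd j (fun w => \int[mun]_(z in [set z | 0 <= height z <= height w])
        (pd i (fun v => E (v - z)) w * heat (z - star y) t)) x =
  - @cE R d * hconv1 j (trunc (height x) i) t (x - star y).
Proof.
move=> jn t0; set f := (fun w : Rn => _).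
suff df : is_derive x (ed j) f (- @cE R d * hconv1 j (trunc (height x) i) t (x - star y)).
  exact: derive_val.
apply/is_derive_lineP.
have -> : (fun h : R => f (h *: ed j + x)) =
    fun h : R => - @cE R d * hconv (trunc (height x) i) t (h *: ed j + (x - star y)).
  apply/funext => h; rewrite /f breve_potential// addrA; congr (_ * hconv (trunc _ _) _ _).
  by rewrite /height lineE eq_sym (negbTE jn) mul0r add0r.
have d2 : is_derive (0 : R) (1 : R) (fun h : R => hconv (trunc (height x) i) t (h *: ed j + (x - star y)))
   (hconv1 j (trunc (height x) i) t (x - star y)).
  by apply/is_derive_lineP; apply: is_derive_hconv => //; exact: wclass_trunc.
exact: (is_deriveZ (- @cE R d) d2).
Qed.

End kernels.

(** * Summation over the components of the field *)

Section kernel_identities.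
Context {R : realType} {d : nat}.
Hypothesis d1 : (1 <= d)%N.
Local Notation mu := (@lebesgue_measure R).
Local Notation Rn := 'rV[R]_d.+1.
Local Notation V := 'rV[R]_d.
Local Notation mud := (lebesgue_rV R d).
Local Notation mun := (lebesgue_rV R d.+1).
Local Notation n_ := (@ord_max d).
Implicit Types (p y z : Rn) (i j k : 'I_d.+1) (s : R).

Lemma sum_kron i (a : 'I_d.+1 -> R) : \sum_j kron i j * a j = a i.
Proof.
rewrite (bigD1_ord i)//= big1 => [|k _]; first by rewrite /kron eqxx mul1r addr0.
by rewrite /kron (negbTE (neq_lift _ _)) mul0r.
Qed.

Lemma sum_kronr i (a : 'I_d.+1 -> R) : \sum_j kron j i * a j = a i.
Proof. by rewrite -[RHS](sum_kron i); apply: eq_bigr => j _; rewrite /kron eq_sym. Qed.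

Lemma cube_rhod M y : 0 <= M -> cube M y <= (1 + M) ^+ d.+1 * rhod y.
Proof.
move=> M0; have [[-> _]|[-> yM]] := cube_cases M y.
  by rewrite mulr_ge0 ?rhod_ge0 ?exprn_ge0 ?addr_ge0.
have prodE (c : R) : c ^+ d.+1 = \prod_(k < d.+1) c by rewrite prodr_const card_ord.
rewrite prodE /rhod -big_split/= -[leLHS](@big1 _ 1 *%R _ (index_enum 'I_d.+1) xpredT (fun=> 1))//.
apply: ler_prod => k _; rewrite ler01/= /rho ler_pdivlMr ?ltr_wpDr// mul1r.
by rewrite lerD2l.
Qed.

Lemma rhod_le_tang p : rhod p <= rhod (tang p).
Proof.
rewrite rhod_tang /rhod (bigD1_ord n_)//= ler_piMl ?rho_le1//.
by apply: prodr_ge0 => k _; exact: rho_ge0.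
Qed.

Section point.
Variables (v w : 'I_d.+1 -> Rn -> R) (B M : R).
Hypothesis vs : solenoidal v w B M.
Hypothesis v_upper : forall j y, ~~ (0 < height y) -> v j y = 0.
Variables (x : Rn) (i : 'I_d.+1) (t : R).
Hypotheses (x0 : 0 < height x) (t0 : 0 < t).

Let B0 : 0 <= B. Proof. by have [? _ _] := vs. Qed.
Let M0 : 0 <= M. Proof. by have [_ ? _] := vs. Qed.
Let mv j : measurable_fun setT (v j). Proof. by have [_ _ [h _ _ _ _]] := vs; exact: h. Qed.
Let vB j y : `|v j y| <= B * cube M y. Proof. by have [_ _ [_ _ h _ _]] := vs; exact: h. Qed.

(** The last row of the Oseen tensor in jointly measurable form; it agrees with [oseen] at positive
    times. *)
Let S j p s : R := kron n_ j * Gam p s + hconv2 n_ j E s p.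

Let mG : measurable_fun [set: Rn * measurableTypeR R] (fun a => Gam a.1 a.2 : R).
Proof.
apply: measurable_Gam => [k|]; last exact: measurable_snd.
apply: measurable_rV_coord_comp; exact: measurable_fst.
Qed.

Let mS j : measurable_fun [set: Rn * measurableTypeR R] (fun a => S j a.1 a.2).
Proof.
apply: measurable_funD; first exact: (measurable_funM (measurable_cst _) mG).
exact: (measurable_hconv2 _ _ measurable_E).
Qed.

Let cG : R := B * (1 + M) ^+ d.+1 * cM t ^+ d.+1 * Num.sqrt t.

Let Gv j p s : 0 < s -> s <= t -> intg mun (fun y => Gam (p - y) s * v j y) /\
  \int[mun]_y `|Gam (p - y) s * v j y| <= cG * (Num.sqrt s)^-1 * rhod (tang p).
Proof.
move=> s0 st; have hv y : `|v j y| <= B * (1 + M) ^+ d.+1 * rhod y.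
  by rewrite (le_trans (vB j y))// -mulrA ler_wpM2l// cube_rhod.
have [ii bb] := intg_conv_rhod p (mv j) hv s0 st; split=> //.
apply: (le_trans bb).
(* The Gaussian part has no singularity at [s = 0]; its bound is weakened to the shape that the
   nonlocal part imposes. *)
have sq1 : 1 <= Num.sqrt t * (Num.sqrt s)^-1.
  by rewrite ler_pdivlMr ?sqrtr_gt0// mul1r; exact: ler_wsqrtr.
rewrite /cG -[X in _ <= X * _]mulrA; apply: ler_pM.
- by rewrite !mulr_ge0 ?exprn_ge0 ?addr_ge0 ?(ltW (cM_gt0 _)).
- exact: rhod_ge0.
- rewrite ler_peMr// mulr_ge0 ?exprn_ge0 ?(ltW (cM_gt0 _))//.
  by rewrite mulr_ge0 ?exprn_ge0 ?addr_ge0.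
- exact: rhod_le_tang.
Qed.

Let Hv j p s : 0 < s -> s <= t -> intg mun (fun y => hconv2 n_ j E s (p - y) * v j y) /\
  \int[mun]_y `|hconv2 n_ j E s (p - y) * v j y| <= B * cI (d := d) M t * (Num.sqrt s)^-1 * rhod (tang p).
Proof.
move=> s0 st; have [ii bb] := cube_heat_E d1 n_ j p M0 s0 st.
have mh := measurable_hconv2_sub n_ j s p.
have dom y : `|hconv2 n_ j E s (p - y) * v j y| <= B * `|cube M y * hconv2 n_ j E s (p - y)|.
  rewrite normrM [`|cube M y * _|]normrM (ger0_norm (cube_ge0 _ _)).
  rewrite mulrC mulrA; apply: ler_wpM2r => //.
have jj := intgZ B (intg_norm ii).
have i2 : intg mun (fun y => hconv2 n_ j E s (p - y) * v j y).
  by apply: (intg_le (measurable_funM mh (mv j)) jj dom).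
split=> //; apply: (le_trans (Rint_le (intg_norm i2) jj dom)).
have -> : B * cI (d := d) M t * (Num.sqrt s)^-1 * rhod (tang p) =
  B * (cI (d := d) M t * (Num.sqrt s)^-1 * rhod (tang p)).
  by move: (cI M t) (Num.sqrt s)^-1 (rhod _) => a b c; ring.
rewrite (RintZ _ (intg_norm ii)); apply: ler_wpM2l => //.
apply: le_trans bb; rewrite le_eqVlt; apply/orP; left; apply/eqP; apply: eq_Rintegral => y _.
by rewrite normrM (ger0_norm (cube_ge0 _ _)).
Qed.

Let Sv j p s : 0 < s -> s <= t -> intg mun (fun y => S j (p - y) s * v j y) /\
  \int[mun]_y `|S j (p - y) s * v j y| <= (cG + B * cI (d := d) M t) * (Num.sqrt s)^-1 * rhod (tang p).
Proof.
move=> s0 st; have [i1 b1] := Gv j p s0 st; have [i2 b2] := Hv j p s0 st.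
have E1 : (fun y => S j (p - y) s * v j y) = fun y =>
    kron n_ j * (Gam (p - y) s * v j y) + hconv2 n_ j E s (p - y) * v j y.
  by apply/funext => y; rewrite /S mulrDl mulrA.
have ii : intg mun (fun y => S j (p - y) s * v j y).
  by rewrite E1; apply: intgD => //; exact: intgZ.
split=> //; apply: (@le_trans _ _ (\int[mun]_y (`|Gam (p - y) s * v j y| + `|hconv2 n_ j E s (p - y) * v j y|))).
  apply: (Rint_le (intg_norm ii) (intgD (intg_norm i1) (intg_norm i2))) => y.
  rewrite /S mulrDl (le_trans (ler_normD _ _))// lerD2r -mulrA normrM.
  by rewrite ler_piMl// /kron; case: eqP => _; rewrite ?normr1 ?normr0.
rewrite (RintD (intg_norm i1) (intg_norm i2)); apply: (le_trans (lerD b1 b2)).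
by rewrite !mulrDl.
Qed.

Let gS j xi s : R := \int[mun]_y (S j (on_Sigma xi - y) s * v j y).
Let gG xi s : R := \int[mun]_y (Gam (on_Sigma xi - y) s * v n_ y).

(** The cancellation takes place at each boundary point and each time, before the integrations over
    [Sigma] and in time. *)
Let gsum xi s : 0 < s -> s <= t -> \sum_j gS j xi s = gG xi s.
Proof.
move=> s0 st; have [_ hs] := div_hconv2_sub vs n_ (on_Sigma xi) s0 (wclass_E d1).
have e j : gS j xi s = kron n_ j * \int[mun]_y (Gam (on_Sigma xi - y) s * v j y) +
    \int[mun]_y (hconv2 n_ j E s (on_Sigma xi - y) * v j y).
  have [i1 _] := Gv j (on_Sigma xi) s0 st; have [i2 _] := Hv j (on_Sigma xi) s0 st.
  rewrite -(RintZ _ i1) -(RintD (intgZ _ i1) i2); apply: eq_Rintegral => y _.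
  by rewrite /S mulrDl mulrA.
under eq_bigr do rewrite e.
by rewrite big_split/= hs addr0 (sum_kron n_ (fun j => \int[mun]_y (Gam (on_Sigma xi - y) s * v j y))).
Qed.

Lemma sum_WX : (forall j, intg mun (fun y => WX x i t (S j) y * v j y)) /\
  \sum_j \int[mun]_y (WX x i t (S j) y * v j y) = \int[mun]_y (WX x i t (@Gam R d.+1) y * v n_ y) /\
  intg mun (fun y => WX x i t (@Gam R d.+1) y * v n_ y).
Proof.
have FS j := @WX_Fubini R d x i t x0 t0 (S j) (v j) _ (mS j) (mv j) (Sv j).
have [_ iG EG _ _] := @WX_Fubini R d x i t x0 t0 (@Gam R d.+1) (v n_) _ mG (mv n_) (Gv n_).
split; first by move=> j; have [_ h _ _ _] := FS j.
split=> //; rewrite EG /WY.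
have -> : \sum_j \int[mun]_y (WX x i t (S j) y * v j y) = \sum_j
   (-2 * \int[mu]_s (oo t s * \int[mud]_xi (KT x i xi (t - s) * gS j xi s)) +
    4 * - @cE R d * \int[mud]_xi (Pk i (x - on_Sigma xi) * gS j xi t)).
  by apply: eq_bigr => j _; have [_ _ h _ _] := FS j.
rewrite big_split/= -!mulr_sumr; congr (_ * _ + _ * _).
  rewrite -Rint_sum => [|j _]; last by have [_ _ _ _ [h _]] := FS j.
  apply: eq_Rintegral => s _; rewrite -mulr_sumr.
  have [->|[-> s01]] := oo_cases t s; first by rewrite !mul0r.
  congr (_ * _); rewrite -Rint_sum => [|j _]; last by have [_ _ _ h _] := FS j; exact: h.
  apply: eq_Rintegral => xi _; rewrite -mulr_sumr -/(gG xi s) gsum//; first by case/andP: s01.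
  by apply: ltW; case/andP: s01.
rewrite -Rint_sum => [|j _]; last by have [_ _ _ _ [_ h]] := FS j.
by apply: eq_Rintegral => xi _; rewrite -mulr_sumr -/(gG xi t) gsum.
Qed.

(** The boundary term [k0 * gk] of [flux_E] is cancelled by the second integral of [WX], which the
    tangential convolution turns into the same product. *)
Lemma WX_Gam y : 0 < height y -> WX x i t (@Gam R d.+1) y =
  -2 * kron i n_ * Gam (x - star y) t + 4 * @cE R d * hconv1 n_ (trunc (height x) i) t (x - star y).
Proof.
move=> y0; rewrite /WX (flux_E i x0 y0 t0) hconv1_Qflux//.
have -> : \int[mud]_xi (Pk i (x - on_Sigma xi) * Gam (on_Sigma xi - y) t) =
    kt i (tang x - tang y) (height x) t * gk (height y) t.
  have hx0 : height x != 0 by rewrite gt_eqF.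
  have ii := intg_kt i (tang x - tang y) hx0 t0.
  rewrite /kt -(RintZr (gk (height y) t) ii).
  rewrite -(Rint_sub (tang x) (intg_meas (intgZr (gk (height y) t) ii))).
  apply: eq_Rintegral => xi _; rewrite Gam_Sigma /on_Sigma rsnoc_subE subr0.
  have -> : tang x - tang y - (tang x - xi) = xi - tang y.
    by apply/rowP => k; rewrite !mxE; ring.
  by move: (Pk _ _) (Gam _ _) (gk _ _) => a b c; ring.
have -> : Gam (x - star y) t = Gam (tang x - tang y) t * gk (height x + height y) t.
  by rewrite -{1}[x - star y]rsnoc_tang Gam_rsnoc tang_sub_star -/(height _) height_sub_star.
by move: (Qflux _ _ _ _) (kt _ _ _ _) (kron _ _) (Gam _ _) (gk _ _) (gk _ _) (@cE R d) => a b c e f g h; ring.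
Qed.

(** The closed forms of [oseen] and [Ktilde] hold for [0 < s < t]; the ends of the time interval are
    altered as null sets. *)
Lemma W_E j y : W i j x y t = WX x i t (S j) y.
Proof.
have SE z s : 0 < s -> oseen n_ j z s = S j z s.
  by move=> s0; rewrite /oseen heatE// heat_E_hconv.
rewrite /W /WX; congr (_ * _ + _).
  rewrite Rint_restr.
  pose F s := \int[mud]_xi (Ktilde i (x - on_Sigma xi) (t - s) * oseen n_ j (on_Sigma xi - y) s).
  pose G s := oo t s * \int[mud]_xi (KT x i xi (t - s) * S j (on_Sigma xi - y) s).
  have mGs : measurable_fun [set: measurableTypeR R] G.
    apply: (measurable_funM (measurable_oo t)).
    have m1 : measurable_fun [set: measurableTypeR R * V] (fun a => a.1 : R) by exact: measurable_fst.
    have m2 : measurable_fun [set: measurableTypeR R * V] (fun a => a.2 : V) by exact: measurable_snd.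
    have mSp : measurable_fun [set: measurableTypeR R * V] (fun a => (on_Sigma a.2 - y, a.1) : Rn * measurableTypeR R).
      apply/measurable_fun_pairP; split=> //; apply: measurable_rV_sub; last exact: measurable_cst.
      exact: (measurableT_comp measurable_on_Sigma m2).
    have mK := measurable_KT x i m2 (measurable_funB (measurable_cst t) m1).
    by have := measurable_Rint2 mud (measurable_funM mK (measurableT_comp (mS j) mSp)); exact.
  have FE s : 0 < s < t -> F s = \int[mud]_xi (KT x i xi (t - s) * S j (on_Sigma xi - y) s).
    move=> /andP[s0 st]; apply: eq_Rintegral => xi _; rewrite SE//.
    by rewrite (Ktilde_Sigma d1 i x0)// subr_gt0.
  pose f1 s := if s == t then 0 else \1_(`[0, t]%classic : set R) s * F s.
  have f1E s : s <> 0 -> f1 s = G s.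
    move=> z0; rewrite /f1 /G ooE; case: eqP => [->|zR]; first by rewrite ltxx andbF !mul0r.
    rewrite /indic; have [/set_mem/=|zn0] := boolP (s \in _).
      rewrite in_itv/= => /andP[h1 h2].
      have zR' : s < t by rewrite lt_neqAle h2 andbT; apply/eqP.
      have zp : 0 < s by rewrite lt_neqAle h1 andbT eq_sym; apply/eqP.
      by rewrite zR' zp/= !mul1r FE// zp.
    case: (boolP (0 < s < t)) => [/andP[h1 h2]|_]; last by rewrite !mul0r.
    by move/negP: zn0; case; apply: mem_set; rewrite /= in_itv/= !ltW.
  have [mf1 f1I] := Rint_mod1 (measurable_set1R 0) (ae_neqP 0) mGs f1E.
  have f1' s : s <> t -> \1_(`[0, t]%classic : set R) s * F s = f1 s.
    by rewrite /f1; case: eqP.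
  have [_ fI] := @Rint_mod1 _ _ _ mu (fun s => \1_(`[0, t]%classic : set R) s * F s) f1 t
    (measurable_set1R t) (ae_neqP t) mf1 f1'.
  by rewrite -f1I -fI.
rewrite -mulrA; congr (_ * _); rewrite mulrC.
have mP : measurable_fun [set: V] (fun xi => Pk i (x - on_Sigma xi) * S j (on_Sigma xi - y) t).
  apply: measurable_funM.
    apply: (measurableT_comp (measurable_Pk i)).
    exact: (measurableT_comp (measurable_csub x) measurable_on_Sigma).
  have mSp : measurable_fun [set: V] (fun xi => (on_Sigma xi - y, t) : Rn * measurableTypeR R).
    apply/measurable_fun_pairP; split; last exact: measurable_cst.
    by apply: measurable_rV_sub; [exact: measurable_on_Sigma|exact: measurable_cst].
  exact: (measurableT_comp (mS j) mSp).
rewrite -(Rint_mulr mud (- @cE R d) mP); apply: eq_Rintegral => xi _.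
rewrite SE// pd_E//; last by rewrite /on_Sigma rsnoc_subE subr0; apply: rsnoc_enorm_gt0; rewrite gt_eqF.
by move: (Pk _ _) (S _ _ _) (@cE R d) => a b c; ring.
Qed.

Let GI (q : Rn -> Rn) j : measurable_fun setT q -> intg mun (fun y => Gam (q y) t * v j y).
Proof.
move=> mq; have ci := intgZ B (@intg_cube R d M M0).
apply: (intg_le _ (intgZ ((Num.sqrt (4 * pi * t))^-1 ^+ d.+1) ci)) => [|y].
  by apply: (measurable_funM _ (mv j)); exact: (measurableT_comp (measurable_Gamt t) mq).
rewrite normrM (ger0_norm (Gam_ge0 _ _)); apply: ler_pM => //; first exact: Gam_ge0.
have prodE (c : R) : c ^+ d.+1 = \prod_(k < d.+1) c by rewrite prodr_const card_ord.
by rewrite prodE /Gam; apply: ler_prod => k _; rewrite gk_ge0 gk_le.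
Qed.

(** The local part shared by [breve_green] and [hat_green]. *)
Definition nice j y : R := kron i j * (Gam (x - y) t - Gam (x - star y) t).

Let mstar : measurable_fun setT (fun y : Rn => x - star y).
Proof. exact: (measurableT_comp (measurable_csub x) measurable_star). Qed.

Let h1 := div_hconv_star vs x t0 (wclass_trunc (height x) i).
Let J j : R := \int[mun]_y (hconv1 j (trunc (height x) i) t (x - star y) * v j y).
Let I1 := GI i (measurable_csub x).
Let I2 := GI i mstar.
Let a1 : R := \int[mun]_y (Gam (x - y) t * v i y).
Let a2 : R := \int[mun]_y (Gam (x - star y) t * v i y).

Let nice_int j : intg mun (fun y => nice j y * v j y) /\
  \int[mun]_y (nice j y * v j y) = kron i j * (a1 - a2).
Proof.
have [<-|ij] := eqVneq i j; last first.
  have e : (fun y => nice j y * v j y) = fun=> 0.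
    by apply/funext => y; rewrite /nice /kron (negbTE ij) !mul0r.
  by rewrite e Rintegral_cst// /kron (negbTE ij) !mul0r; split=> //; exact: intg0.
have e : (fun y => nice i y * v i y) = fun y => Gam (x - y) t * v i y - Gam (x - star y) t * v i y.
  by apply/funext => y; rewrite /nice /kron eqxx mul1r mulrBl.
by rewrite e /kron eqxx mul1r (RintB I1 I2); split=> //; exact: intgB.
Qed.

Lemma hat_sum : (forall j, intg mun (fun y => hat_green i j x y t * v j y)) /\
  \sum_j \int[mun]_y (hat_green i j x y t * v j y) = a1 - a2 + 4 * @cE R d * J n_.
Proof.
have e j : (fun y => hat_green i j x y t * v j y) = fun y => nice j y * v j y +
   4 * @cE R d * kron j n_ * (hconv1 n_ (trunc (height x) i) t (x - star y) * v j y).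
  (* The closed form of [C_] holds for [y] in the half-space; elsewhere the extended field
     vanishes. *)
  apply/funext => y; have [y0|y0] := boolP (0 < height y); last by rewrite v_upper// !mulr0 addr0.
  rewrite /hat_green !heatE// C_E// -/(nice j y) mulrDl; congr (_ + _).
  by move: (hconv1 _ _ _ _) (v _ _) (kron _ _) (@cE R d) => a b c f; ring.
have ii j : intg mun (fun y => 4 * @cE R d * kron j n_ * (hconv1 n_ (trunc (height x) i) t (x - star y) * v j y)).
  have [->|jn] := eqVneq j n_; first by apply: intgZ; have [h _] := h1; exact: h.
  rewrite (_ : (fun y => _) = fun=> 0); first exact: intg0.
  by apply/funext => y; rewrite /kron (negbTE jn) mulr0 mul0r.
split=> [j|]; first by rewrite e; apply: intgD => //; have [] := nice_int j.
have -> : \sum_j \int[mun]_y (hat_green i j x y t * v j y) =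
    \sum_j (kron i j * (a1 - a2) + kron j n_ * (4 * @cE R d * J j)).
  apply: eq_bigr => j _; rewrite e (RintD (nice_int j).1 (ii j)) (nice_int j).2; congr (_ + _).
  have [->|jn] := eqVneq j n_.
    by rewrite (RintZ _ (h1.1 n_)) /kron eqxx mulr1 mul1r.
  rewrite /kron (negbTE jn) mul0r (_ : (fun y => _) = fun=> 0); first by rewrite Rintegral_cst// mul0r.
  by apply/funext => y; rewrite mulr0 mul0r.
by rewrite big_split/= (sum_kron i (fun=> a1 - a2)) (sum_kronr n_ (fun j => 4 * @cE R d * J j)).
Qed.

Lemma breve_sum : (forall j, intg mun (fun y => breve_green i j x y t * v j y)) /\
  \sum_j \int[mun]_y (breve_green i j x y t * v j y) = a1 - a2 + 4 * @cE R d * J n_.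
Proof.
have e j : (fun y => breve_green i j x y t * v j y) = fun y => nice j y * v j y +
   4 * @cE R d * (1 - kron j n_) * (hconv1 j (trunc (height x) i) t (x - star y) * v j y).
  apply/funext => y; rewrite /breve_green !heatE// -/(nice j y) mulrDl; congr (_ + _).
  have [->|jn] := eqVneq j n_; first by rewrite /kron eqxx subrr !(mulr0, mul0r) oppr0 mul0r.
  rewrite (pd_breve d1 i x y jn t0).
  by move: (hconv1 _ _ _ _) (v _ _) (kron _ _) (@cE R d) => a b c f; ring.
have ii j := intgZ (4 * @cE R d * (1 - kron j n_)) (h1.1 j).
split=> [j|]; first by rewrite e; apply: intgD => //; have [] := nice_int j.
(* Here [1 - kron j n_] is split into [eps j + kron j n_]: the sum weighted by [eps] vanishes by
   [div_hconv_star], and the normal component is left. *)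
have -> : \sum_j \int[mun]_y (breve_green i j x y t * v j y) =
    \sum_j (kron i j * (a1 - a2) + (4 * @cE R d * (eps j * J j) + kron j n_ * (4 * @cE R d * J j))).
  apply: eq_bigr => j _; rewrite e (RintD (nice_int j).1 (ii j)) (nice_int j).2; congr (_ + _).
  by rewrite (RintZ _ (h1.1 j)) /eps -/(J j); move: (J j) (kron _ _) (@cE R d) => a b c; ring.
rewrite big_split/= (sum_kron i (fun=> a1 - a2)) big_split/= -mulr_sumr h1.2 mulr0 add0r.
by rewrite (sum_kronr n_ (fun j => 4 * @cE R d * J j)).
Qed.

Lemma green_sum : (forall j, intg mun (fun y => green i j x y t * v j y)) /\
  \sum_j \int[mun]_y (green i j x y t * v j y) = a1 - a2 + 4 * @cE R d * J n_.
Proof.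
have [iE1 sE1] := div_hconv2_sub vs i x t0 (wclass_E d1).
have [iE2 sE2] := div_hconv2_star vs i x t0 (wclass_E d1).
have [iW [sW iWG]] := sum_WX.
have iK j : intg mun (fun y => kron i j * (Gam (x - y) t * v j y - eps j * (Gam (x - star y) t * v j y))).
  apply: intgZ; apply: intgB; first exact: (GI j (measurable_csub x)).
  by apply: intgZ; exact: (GI j mstar).
have iH j : intg mun (fun y => hconv2 i j E t (x - y) * v j y - eps j * (hconv2 i j E t (x - star y) * v j y)).
  by apply: intgB => //; exact: intgZ.
have e j : (fun y => green i j x y t * v j y) = fun y =>
   kron i j * (Gam (x - y) t * v j y - eps j * (Gam (x - star y) t * v j y)) +
   (hconv2 i j E t (x - y) * v j y - eps j * (hconv2 i j E t (x - star y) * v j y)) +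
   WX x i t (S j) y * v j y.
  apply/funext => y; rewrite /green t0 W_E /oseen !heatE// !heat_E_hconv//.
  move: (hconv2 _ _ _ _ _) (hconv2 _ _ _ _ _) (v _ _) (kron _ _) (eps _) (WX _ _ _ _ _) (Gam _ _) (Gam _ _) => a b c f g h l m.
  by ring.
split=> [j|]; first by rewrite e; apply: intgD => //; exact: intgD.
have -> : \sum_j \int[mun]_y (green i j x y t * v j y) =
  \sum_j (kron i j * (\int[mun]_y (Gam (x - y) t * v j y) - eps j * \int[mun]_y (Gam (x - star y) t * v j y)) +
    (\int[mun]_y (hconv2 i j E t (x - y) * v j y) - eps j * \int[mun]_y (hconv2 i j E t (x - star y) * v j y)) +
    \int[mun]_y (WX x i t (S j) y * v j y)).
  apply: eq_bigr => j _; rewrite e (RintD (intgD (iK j) (iH j)) (iW j)) (RintD (iK j) (iH j)).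
  have g1 := GI j (measurable_csub x); have g2 := GI j mstar.
  rewrite (RintZ _ (intgB g1 (intgZ (eps j) g2))) (RintB g1 (intgZ (eps j) g2)) (RintZ _ g2).
  by rewrite (RintB (iE1 j) (intgZ (eps j) (iE2 j))) (RintZ _ (iE2 j)).
rewrite big_split/= big_split/= sW sumrB sE1 sE2 subr0 addr0.
rewrite (sum_kron i (fun j => \int[mun]_y (Gam (x - y) t * v j y) - eps j * \int[mun]_y (Gam (x - star y) t * v j y))).
rewrite -/a1 -/a2.
have -> : \int[mun]_y (WX x i t (@Gam R d.+1) y * v n_ y) = -2 * kron i n_ * a2 + 4 * @cE R d * J n_.
  have i2 : intg mun (fun y => -2 * kron i n_ * (Gam (x - star y) t * v n_ y)) by apply: intgZ; exact: (GI n_ mstar).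
  have -> : -2 * kron i n_ * a2 = \int[mun]_y (-2 * kron i n_ * (Gam (x - star y) t * v n_ y)).
    rewrite (RintZ _ (GI n_ mstar)) /a2; have [->//|ni] := eqVneq i n_.
    by rewrite /kron (negbTE ni) mulr0 !mul0r.
  rewrite /J -(RintZ _ (h1.1 n_)) -(RintD i2 (intgZ _ (h1.1 n_))).
  apply: eq_Rintegral => y _; have [y0|y0] := boolP (0 < height y); last by rewrite v_upper// !mulr0 addr0.
  by rewrite WX_Gam// mulrDl !mulrA.
(* [- eps i - 2 * kron i n_ = -1]: together with the contribution of [W], the reflected Gaussian has
   coefficient [-1] for every [i]. *)
by rewrite /eps; move: a1 a2 (J n_) (kron _ _) (@cE R d) => a b c f g; ring.
Qed.

End point.
End kernel_identities.

(** * Continuity *)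

Section sequential_continuity.
Context {R : realType} {d : nat}.
Local Notation mu := (@lebesgue_measure R).
Local Notation Rn := 'rV[R]_d.+1.
Local Notation mun := (lebesgue_rV R d.+1).
Local Notation n_ := (@ord_max d).
Implicit Types (y z : Rn) (i j k : 'I_d.+1).

(** Dominated convergence speaks of sequences; a failure of continuity at level [e] provides points
    of [D] at distance below [1 / (m + 1)] that form a contradicting one. *)
Lemma within_seq (D : set (Rn * R)) (f : Rn * R -> R) (p : Rn * R) :
  (forall u : nat -> Rn * R, (forall m, D (u m)) -> u m @[m --> \oo] --> p ->
     f (u m) @[m --> \oo] --> f p) ->
  f q @[q --> within D (nbhs p)] --> f p.
Proof.
move=> H; apply/cvgrPdist_lt => e e0; apply: contrapT => nA.
have ex (m : nat) : exists q, [/\ D q, ball p (m.+1%:R^-1 : R) q & e <= `|f p - f q|].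
  apply: contrapT => nq; apply: nA.
  have : \forall q \near p, D q -> `|f p - f q| < e.
    apply/nbhs_ballP; exists (m.+1%:R^-1 : R) => [|q pq Dq]; first by rewrite /= invr_gt0.
    by rewrite ltNge; apply/negP => h; apply: nq; exists q.
  exact.
have [u hu] := choice ex.
have uc : u m @[m --> \oo] --> p.
  apply/cvg_ballP => r r0; near=> m; have [_ b _] := hu m; apply: (le_ball _ b).
  by near: m; have := @near_infty_natSinv_lt R (PosNum r0); apply: filterS => m /ltW.
have uD m : D (u m) by have [] := hu m.
have /cvgrPdist_lt/(_ e e0) [N _ /(_ N (leqnn N))] := H u uD uc.
by have [_ _] := hu N; rewrite /= leNgt => /negP.
Unshelve. all: by end_near. Qed.

Lemma seq_bounded (f : nat -> R) (l : R) : f m @[m --> \oo] --> l ->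
  exists2 K, 0 < K & forall m, `|f m| <= K.
Proof.
move=> fl; have /pinfty_ex_gt0[K K0 hK] := cvg_seq_bounded (cvgP _ fl).
by exists K => // m; exact: hK.
Qed.

Lemma cvg_prod_seq (I : finType) (F : I -> nat -> R) (L : I -> R) :
  (forall l : I, F l m @[m --> \oo] --> L l) ->
  \prod_l F l m @[m --> \oo] --> \prod_l L l.
Proof.
move=> FL; elim: (index_enum I) => [|l s IH].
  by under eq_fun do rewrite big_nil; rewrite big_nil; exact: cvg_cst.
by under eq_fun do rewrite big_cons; rewrite big_cons; exact: cvgM.
Qed.

Variables (x_ : nat -> Rn) (t_ : nat -> R) (x : Rn) (t : R) (i : 'I_d.+1).
Hypotheses (x_cvg : forall k, x_ m ord0 k @[m --> \oo] --> x ord0 k)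
  (t_cvg : t_ m @[m --> \oo] --> t) (x_gt0 : forall m, 0 < height (x_ m))
  (t_gt0 : forall m, 0 < t_ m) (x0 : 0 < height x) (t0 : 0 < t).

Lemma cvg_Gam_seq (f : nat -> Rn) (l : Rn) : (forall k, f m ord0 k @[m --> \oo] --> l ord0 k) ->
  Gam (f m) (t_ m) @[m --> \oo] --> Gam l t.
Proof.
by move=> fl; apply: (@cvg_prod_seq _ (fun k m => gk (f m ord0 k) (t_ m))) => k; apply: cvg_gk.
Qed.

Lemma cvg_Gam1_seq (f : nat -> Rn) (l : Rn) j : (forall k, f m ord0 k @[m --> \oo] --> l ord0 k) ->
  Gam1 j (f m) (t_ m) @[m --> \oo] --> Gam1 j l t.
Proof.
move=> fl; apply: cvgM; last exact: cvg_Gam_seq.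
apply: cvgN; apply: cvgM; first exact: fl.
apply: cvgV; first by rewrite mulf_neq0// gt_eqF.
by apply: cvgMl_tmp.
Qed.

(** The slab moves with [x]; its indicator converges off the height [x_n], a null set of points
    [z]. *)
Lemma cvg_trunc z : height z != height x ->
  trunc (height (x_ m)) i z @[m --> \oo] --> trunc (height x) i z.
Proof.
move=> zx; apply: cvgMr_tmp; apply: cvg_near_cst.
have hc := @x_cvg n_; case/lt_total/orP: zx => zx.
  have hn : \forall m \near \oo, height z < height (x_ m) by exact: (cvgr_gt _ hc _ zx).
  near=> m; have hm : height z < height (x_ m) by near: m.
  by rewrite (ltW hm) (ltW zx).
have hn : \forall m \near \oo, height (x_ m) < height z by exact: (cvgr_lt _ hc _ zx).
near=> m; have hm : height (x_ m) < height z by near: m.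
by rewrite ![height z <= _]leNgt hm zx.
Unshelve. all: by end_near. Qed.

(** Supplies one majorant for the whole sequence; the lower bound on the times comes from the
    boundedness of their inverses. *)
Lemma seq_bounds : exists c T X : R, [/\ 0 < c, 0 <= X &
  forall m, [/\ c <= t_ m, t_ m <= T & forall k, `|x_ m ord0 k| <= X]].
Proof.
have tV : (t_ m)^-1 @[m --> \oo] --> t^-1 by apply: cvgV => //; rewrite gt_eqF.
have [K K0 hK] := seq_bounded tV; have [T T0 hT] := seq_bounded t_cvg.
have /choice[Xk hX] : forall k, exists X, 0 < X /\ forall m, `|x_ m ord0 k| <= X.
  by move=> k; have [X X0 h] := seq_bounded (@x_cvg k); exists X.
exists K^-1, T, (\sum_k Xk k); split; first by rewrite invr_gt0.
  by apply: sumr_ge0 => k _; have [/ltW] := hX k.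
move=> m; split=> [||k].
- rewrite -[t_ m]invrK lef_pV2 ?posrE ?invr_gt0//.
  by apply: le_trans (hK m); exact: ler_norm.
- by apply: le_trans (hT m); exact: ler_norm.
have [_ h] := hX k; apply: (le_trans (h m)); rewrite (bigD1_ord k)//= lerDl.
by apply: sumr_ge0 => l _; have [/ltW] := hX (lift k l).
Qed.

Variables (v w : 'I_d.+1 -> Rn -> R) (B M : R).
Hypothesis vs : solenoidal v w B M.

Lemma gk_le_lower (c s r : R) : 0 < c -> c <= s -> gk r s <= (Num.sqrt (4 * pi * c))^-1.
Proof.
move=> c0 cs; apply: (le_trans (gk_le _ _)).
have p0 : 0 < 4 * pi :> R by rewrite mulr_gt0// pi_gt0.
rewrite lef_pV2 ?posrE ?sqrtr_gt0 ?mulr_gt0 ?pi_gt0// ?(lt_le_trans c0)//.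
by apply: ler_wsqrtr; rewrite ler_wpM2l// ltW.
Qed.

Lemma Gam_le_lower (c s : R) z : 0 < c -> c <= s -> Gam z s <= (Num.sqrt (4 * pi * c))^-1 ^+ d.+1.
Proof.
move=> c0 cs; have prodE (r : R) : r ^+ d.+1 = \prod_(k < d.+1) r by rewrite prodr_const card_ord.
by rewrite prodE; apply: ler_prod => k _; rewrite gk_ge0 gk_le_lower.
Qed.

Lemma cvg_Rint_Gam (q : Rn -> Rn) : measurable_fun setT q ->
  \int[mun]_y (Gam (x_ m - q y) (t_ m) * v i y) @[m --> \oo] -->
  \int[mun]_y (Gam (x - q y) t * v i y).
Proof.
move=> mq; have [B0 M0 [mv _ vB _ _]] := vs.
have [c [T [X [c0 X0 hb]]]] := seq_bounds.
set g := (Num.sqrt (4 * pi * c))^-1 ^+ d.+1.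
have mm (a : Rn) s : measurable_fun setT (fun y => Gam (a - q y) s * v i y).
  apply: (measurable_funM _ (mv i)); apply: (measurableT_comp (measurable_Gamt s)).
  exact: (measurableT_comp (measurable_csub a) mq).
have bd : {ae mun, forall y, forall m, `|Gam (x_ m - q y) (t_ m) * v i y| <= g * (B * cube M y)}.
  apply: aeW => y m; rewrite normrM (ger0_norm (Gam_ge0 _ _)).
  by have [h _ _] := hb m; apply: ler_pM => //; [exact: Gam_ge0|exact: Gam_le_lower].
have lim : {ae mun, forall y, Gam (x_ m - q y) (t_ m) * v i y @[m --> \oo] --> Gam (x - q y) t * v i y}.
  apply: aeW => y; apply: cvgMr_tmp; apply: cvg_Gam_seq => k.
  under eq_fun do rewrite mxE; rewrite mxE.
  by apply: cvgD; [exact: x_cvg|exact: cvg_cst].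
by have [_] := Rint_dct (fun m => mm (x_ m) (t_ m)) (mm x t) lim (intgZ g (intgZ B (intg_cube M0))) bd.
Qed.

(** Dominated convergence twice: in [z] at fixed [y], where the kernels share a multiple of [wt],
    then in [y], where the growth [pw] is bounded on the support of the field. *)
Lemma cvg_Rint_hconv1 :
  \int[mun]_y (hconv1 n_ (trunc (height (x_ m)) i) (t_ m) (x_ m - star y) * v n_ y) @[m --> \oo] -->
  \int[mun]_y (hconv1 n_ (trunc (height x) i) t (x - star y) * v n_ y).
Proof.
have [B0 M0 [mv _ vB _ _]] := vs.
have [c [T [X [c0 X0 hb]]]] := seq_bounds.
have cT0 : 0 <= cM T ^+ d.+1 :> R by rewrite exprn_ge0// ltW// cM_gt0.
pose g := (Num.sqrt (4 * pi * c))^-1 ^+ d.+1.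
have g0 : 0 <= g by rewrite exprn_ge0// invr_ge0 sqrtr_ge0.
pose C1 := (Num.sqrt c)^-1 * cM T ^+ d.+1 * g.
have C10 : 0 <= C1 by rewrite !mulr_ge0// invr_ge0 sqrtr_ge0.
have G1 m z : `|Gam1 n_ z (t_ m)| <= C1 * wt z.
  have [h1 h2 _] := hb m; apply: (le_trans (Gam1_wt _ _ (t_gt0 m))).
  rewrite /C1 -[leRHS]mulrA; apply: ler_pM.
  - by rewrite mulr_ge0 ?invr_ge0 ?sqrtr_ge0// exprn_ge0// ltW// cM_gt0.
  - by rewrite mulr_ge0 ?Gam_ge0// ltW// wt_gt0.
  - apply: ler_pM; rewrite ?invr_ge0 ?sqrtr_ge0//.
    + by rewrite exprn_ge0// ltW// cM_gt0.
    + by rewrite lef_pV2 ?posrE ?sqrtr_gt0//; exact: ler_wsqrtr.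
    + by apply: lerXn2r; rewrite ?nnegrE ?(ltW (cM_gt0 _)) ?cM_le.
  rewrite mulrC ler_wpM2r ?(ltW (wt_gt0 _))// Gam_le_lower//.
  by rewrite (le_trans h1)// ler_peMl ?(ltW (t_gt0 m))// ler1n.
pose PX := ((1 + X) ^+ 3) ^+ d.+1.
have PX0 : 0 <= PX by rewrite !exprn_ge0// addr_ge0.
have pwX m y : pw (x_ m - star y) <= PX * pw y.
  apply: (le_trans (pw_sub _ _)); rewrite pw_star ler_wpM2r ?(ltW (pw_gt0 _))//.
  have prodE (r : R) : r ^+ d.+1 = \prod_(k < d.+1) r by rewrite prodr_const card_ord.
  rewrite /PX prodE /pw; apply: ler_prod => k _; rewrite exprn_ge0 ?addr_ge0//=.
  apply: lerXn2r; rewrite ?nnegrE ?addr_ge0// lerD2l.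
  by have [_ _ h] := hb m.
have nw : wclass (@nrmd R d : Rn -> R).
  apply: (@wclass_le _ _ _ 1) => //; first exact: measurable_nrmd.
  move=> z _; have n0 := nrmd_ge0 z; rewrite ger0_norm// mul1r.
  have S0 : 0 <= \sum_k `|z ord0 k| by apply: sumr_ge0.
  by have := mulr_ge0 S0 n0; move: (nrmd z) (\sum_k _) n0 S0 => n s n0 s0 h; lra.
pose N := \int[mun]_z (wt z * `|nrmd z|).
have N0 : 0 <= N by apply: Rintegral_ge0 => z _; rewrite mulr_ge0// ltW// wt_gt0.
have inner y : hconv1 n_ (trunc (height (x_ m)) i) (t_ m) (x_ m - star y) @[m --> \oo] -->
    hconv1 n_ (trunc (height x) i) t (x - star y).
  have mm (a b : Rn) s : measurable_fun setT (fun z => Gam1 n_ (a - star y - z) s * trunc (height b) i z).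
    apply: measurable_funM; last exact: measurable_trunc.
    exact: (measurableT_comp (measurable_Gam1t n_ s) (measurable_csub _)).
  have bd : {ae mun, forall z, forall m,
      `|Gam1 n_ (x_ m - star y - z) (t_ m) * trunc (height (x_ m)) i z| <= C1 * (PX * pw y) * (wt z * `|nrmd z|)}.
    apply: aeW => z m; rewrite normrM.
    have h1 : `|Gam1 n_ (x_ m - star y - z) (t_ m)| <= C1 * (PX * pw y) * wt z.
      apply: (le_trans (G1 _ _)); rewrite -mulrA ler_wpM2l//.
      by rewrite (le_trans (wt_sub _ _))// ler_wpM2r ?(ltW (wt_gt0 _))// pwX.
    rewrite mulrA; apply: ler_pM => //.
    by rewrite (le_trans (trunc_le _ _ _))// ler_norm.
  have lim : {ae mun, forall z, Gam1 n_ (x_ m - star y - z) (t_ m) * trunc (height (x_ m)) i z @[m --> \oo] -->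
      Gam1 n_ (x - star y - z) t * trunc (height x) i z}.
    apply: aeS (ae_coord_neq x) => z zx; apply: cvgM; last by apply: cvg_trunc; exact: zx.
    apply: cvg_Gam1_seq => k.
    have e (a : Rn) : (a - star y - z) ord0 k = a ord0 k - (star y ord0 k + z ord0 k).
      by rewrite mxE [(a - star y) _ _]mxE [(- z) _ _]mxE [(- star y) _ _]mxE opprD addrA.
    under eq_fun do rewrite e; rewrite e.
    by apply: cvgB; [exact: x_cvg|exact: cvg_cst].
  by have [_] := Rint_dct (fun m => mm (x_ m) (x_ m) (t_ m)) (mm x x t) lim (intgZ _ nw.2) bd.
have Jb m y : `|hconv1 n_ (trunc (height (x_ m)) i) (t_ m) (x_ m - star y)| <= C1 * N * PX * pw y.
  have mG1 : measurable_fun setT (Gam1 n_ ^~ (t_ m) : Rn -> R) by exact: measurable_Gam1t.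
  have tw := wclass_trunc (height (x_ m)) i.
  apply: (le_trans (conv_le mG1 (G1 m) _ tw)).
  have hN : \int[mun]_z (wt z * `|trunc (height (x_ m)) i z|) <= N.
    apply: (Rint_le tw.2 nw.2) => z; rewrite ler_wpM2l ?(ltW (wt_gt0 _))//.
    by rewrite (le_trans (trunc_le _ _ _))// ler_norm.
  have I0 : 0 <= \int[mun]_z (wt z * `|trunc (height (x_ m)) i z|).
    by apply: Rintegral_ge0 => z _; rewrite mulr_ge0// ltW// wt_gt0.
  have := ler_pM (ltW (pw_gt0 _)) I0 (pwX m y) hN => /(ler_wpM2l C10).
  rewrite mulrA => /le_trans; apply; rewrite le_eqVlt; apply/orP; left; apply/eqP.
  have e (a b c' f : R) : a * (b * f * c') = a * c' * b * f by ring.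
  exact: e.
have mJ (a : Rn) s : measurable_fun setT (fun y => hconv1 n_ (trunc (height a) i) s (a - star y) * v n_ y).
  apply: (measurable_funM _ (mv n_)).
  apply: (measurableT_comp (measurable_hconv1 n_ s (measurable_trunc (height a) i))).
  exact: (measurableT_comp (measurable_csub a) measurable_star).
pose D := C1 * N * PX * (M + 2) ^+ (3 * d.+1) * B.
have bd : {ae mun, forall y, forall m,
   `|hconv1 n_ (trunc (height (x_ m)) i) (t_ m) (x_ m - star y) * v n_ y| <= D * cube M y}.
  apply: aeW => y m; rewrite normrM.
  apply: (le_trans (ler_pM (normr_ge0 _) (normr_ge0 _) (Jb m y) (vB n_ y))).
  have z1 : `|0 : R| <= 1 by rewrite normr0.
  have := pw_line y n_ M0 z1; rewrite scale0r add0r => h.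
  have e1 (a p q : R) : a * p * (B * q) = a * B * (q * p) by ring.
  have e2 (a p q : R) : a * p * B * q = a * B * (q * p) by ring.
  rewrite /D (e1 (C1 * N * PX) (pw y) (cube M y)) (e2 (C1 * N * PX) ((M + 2) ^+ (3 * d.+1)) (cube M y)).
  exact: (ler_wpM2l (mulr_ge0 (mulr_ge0 (mulr_ge0 C10 N0) PX0) B0) h).
have lim : {ae mun, forall y, hconv1 n_ (trunc (height (x_ m)) i) (t_ m) (x_ m - star y) * v n_ y @[m --> \oo] -->
    hconv1 n_ (trunc (height x) i) t (x - star y) * v n_ y}.
  by apply: aeW => y; apply: cvgMr_tmp; exact: inner.
by have [_] := Rint_dct (fun m => mJ (x_ m) (t_ m)) (mJ x t) lim (intgZ D (intg_cube M0)) bd.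
Qed.

End sequential_continuity.

Unset Implicit Arguments.

(** The integrability claims rule out that the equalities hold merely between default values of the
    integral. Continuity is stated for [green]; on the set in question the equalities carry it over
    to the other two kernels. *)
Theorem theorem1p2 (R : realType) (d : nat) (hd : (2 <= d.+1)%N)
    (u0 : 'rV[R]_d.+1 -> 'rV[R]_d.+1)
    (u0_C1c : C1c_closed_upper u0)
    (u0_div : forall x, upper x -> divergence u0 x = 0)
    (u0_Sigma : forall x, height x = 0 -> height (u0 x) = 0)
    (i : 'I_d.+1) :
  (forall (x : 'rV[R]_d.+1) (t : R), upper x -> 0 < t ->
    [/\ kernel_integrable green u0 i x t,
        kernel_integrable breve_green u0 i x t &
        kernel_integrable hat_green u0 i x t] /\
    kernel_integral green u0 i x t = kernel_integral breve_green u0 i x t /\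
    kernel_integral breve_green u0 i x t = kernel_integral hat_green u0 i x t)
  /\ {within [set p : 'rV[R]_d.+1 * R | upper p.1 /\ 0 < p.2],
       continuous (fun p => kernel_integral green u0 i p.1 p.2)}.
Proof.
have d1 : (1 <= d)%N by [].
have [w [B [M vs]]] := solenoidal_extu u0_C1c u0_div u0_Sigma.
have v0 (j : 'I_d.+1) (y : 'rV[R]_d.+1) : ~~ (0 < height y) -> extu u0 j y = 0.
  by move=> y0; rewrite /extu indic_upper (negbTE y0) mul0r.
(* The domain [upper] is absorbed by the extension of the field by zero, to which the preceding
   identities apply. *)
have KE (K : @Defs.kernel R d) (j : 'I_d.+1) (x : 'rV[R]_d.+1) (t : R) : (fun y => \1_upper y * (K i j x y t * u0 y ord0 j)) =
    fun y => K i j x y t * extu u0 j y.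
  by apply/funext => y; rewrite /extu mulrCA.
have Kint (K : @Defs.kernel R d) (x : 'rV[R]_d.+1) (t : R) :
    (forall j, intg (lebesgue_rV R d.+1) (fun y => K i j x y t * extu u0 j y)) ->
    kernel_integrable K u0 i x t.
  move=> h j; have := h j; rewrite -KE => hj.
  exact: ((intg_restr (lebesgue_rV R d.+1) (fun y => K i j x y t * u0 y ord0 j) measurable_upper).2 hj).
have Ksum (K : @Defs.kernel R d) (x : 'rV[R]_d.+1) (t : R) : kernel_integral K u0 i x t =
    \sum_j \int[lebesgue_rV R d.+1]_y (K i j x y t * extu u0 j y).
  by apply: eq_bigr => j _; rewrite Rint_restr KE.
split=> [x t x0 t0|].
  have [g1 g2] := green_sum d1 vs v0 i x0 t0.
  have [b1 b2] := breve_sum d1 vs x i t0.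
  have [h1 h2] := hat_sum d1 vs v0 i x0 t0.
  split; first by split; apply: Kint.
  by rewrite !Ksum g2 b2 h2.
apply/subspace_continuousP => -[x t] [/= x0 t0].
apply: within_seq => u uD uc.
have x_cvg : (u m).1 @[m --> \oo] --> x by apply: (cvg_comp u fst uc); exact: cvg_fst.
have t_cvg : (u m).2 @[m --> \oo] --> t by apply: (cvg_comp u snd uc); exact: cvg_snd.
have xk_cvg k : (u m).1 ord0 k @[m --> \oo] --> x ord0 k.
  by apply: (cvg_comp _ (fun z : 'rV[R]_d.+1 => z ord0 k) x_cvg); exact: coord_continuous.
have ux m : 0 < height (u m).1 by have [] := uD m.
have ut m : 0 < (u m).2 by have [] := uD m.
rewrite /from_subspace/= Ksum (green_sum d1 vs v0 i x0 t0).2.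
have -> : (fun m => kernel_integral green u0 i (u m).1 (u m).2) = fun m =>
    \int[lebesgue_rV R d.+1]_y (Gam ((u m).1 - y) (u m).2 * extu u0 i y) -
    \int[lebesgue_rV R d.+1]_y (Gam ((u m).1 - star y) (u m).2 * extu u0 i y) +
    4 * @cE R d * \int[lebesgue_rV R d.+1]_y
      (hconv1 ord_max (trunc (height (u m).1) i) (u m).2 ((u m).1 - star y) * extu u0 ord_max y).
  by apply/funext => m; rewrite Ksum (green_sum d1 vs v0 i (ux m) (ut m)).2.
apply: cvgD; first apply: cvgB.
- have mid : measurable_fun setT (fun y : 'rV[R]_d.+1 => y) by exact: measurable_id.
  by have h := cvg_Rint_Gam xk_cvg t_cvg ut t0 vs mid; exact: h.
- by have h := cvg_Rint_Gam xk_cvg t_cvg ut t0 vs measurable_star; exact: h.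
- by apply: cvgMl_tmp; have h := cvg_Rint_hconv1 xk_cvg t_cvg ut t0 vs; exact: h.
Qed.
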